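(* Let $c(n)$, $n\ge 0$, be the Fourier coefficients of the modular invariant $j$. Put $$d(n)=1-\frac{3}{32\pi n^{1/2}}-\frac{15}{2048\pi^2n}-\frac{105}{65536\pi^3n^{3/2}}-\frac{4725}{8388608\pi^4n^2},$$ $$a(n)=\frac{e^{4\pi\sqrt n}}{\sqrt2\,n^{3/4}}\left(d(n)-\frac{2.21073\cdot10^{-5}}{n^{5/2}}\right),\qquad b(n)=\frac{e^{4\pi\sqrt n}}{\sqrt2\,n^{3/4}}\left(d(n)+\frac{2.21073\cdot10^{-5}}{n^{5/2}}\right).$$ Then for all integers $n\ge 6$, $a(n)\le c(n)\le b(n)$.
   Context: The modular invariant $j$ is defined for $\tau$ in the upper half-plane, with $q=e^{2\pi i\tau}$, by $$j(\tau)=\frac{\left(1+240\sum_{n\ge 1}\sigma_3(n)q^n\right)^3}{q\prod_{n\ge 1}(1-q^n)^{24}}=q^{-1}+\sum_{n\ge 0}c(n)q^n=q^{-1}+744+196884q+21493760q^2+\cdots,$$ where $\sigma_3(n)=\sum_{d\mid n}d^3$. This defines the integers $c(n)$, $n\ge 0$. The decimal constants in the statement are exact decimal numbers. *)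

(* Defs.v *)
From Stdlib Require Import Reals List ZArith.
From Coquelicot Require Import Coquelicot.
Open Scope R_scope.

(* The sum of the cubes of the divisors of [n], for [n >= 1]. *)
Definition sigma3 (n : nat) : nat :=
  list_sum (map (fun d => Nat.pow d 3)
                (filter (fun d => Nat.eqb (Nat.modulo n d) 0) (seq 1 n))).

Definition Cexp (z : C) : C := (exp (Re z) * cos (Im z), exp (Re z) * sin (Im z)).

(* Coquelicot has total limit operators for real sequences only. [CLim u] is
   the limit of [u] when [u] converges in [C], and is unspecified otherwise. *)
Definition CLim (u : nat -> C) : C :=
  (real (Lim_seq (fun n => Re (u n))), real (Lim_seq (fun n => Im (u n)))).

(* Indices start at 1: these are the sum and the product over n >= 1 of [f n]. *)
Definition CSum1 (f : nat -> C) : C :=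
  CLim (fun N => fold_right Cplus (RtoC 0) (map f (seq 1 N))).

Definition CProd1 (f : nat -> C) : C :=
  CLim (fun N => fold_right Cmult (RtoC 1) (map f (seq 1 N))).

Definition nome (tau : C) : C := Cexp (RtoC (2 * PI) * Ci * tau)%C.

(* Meaningful for [0 < Im tau], i.e. [0 < |nome tau| < 1], where the series and
   the product converge absolutely. *)
Definition j_invariant (tau : C) : C :=
  let q := nome tau in
  ((1 + 240 * CSum1 (fun n => RtoC (INR (sigma3 n)) * q ^ n)) ^ 3
   / (q * CProd1 (fun n => (1 - q ^ n) ^ 24)))%C.

(* j(tau) = q^(-1) + sum_(n >= 0) c(n) q^n on the whole upper half-plane; this
   determines [c] by uniqueness of Laurent coefficients in q. *)
Definition j_fourier_coefficients (c : nat -> Z) : Prop :=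
  forall tau : C, 0 < Im tau ->
    @is_series C_AbsRing C_NormedModule
      (fun n => RtoC (IZR (c n)) * nome tau ^ n)%C
      (j_invariant tau - / nome tau)%C.

Definition d (n : nat) : R :=
  1 - 3 / (32 * PI * sqrt (INR n))
    - 15 / (2048 * PI ^ 2 * INR n)
    - 105 / (65536 * PI ^ 3 * Rpower (INR n) (3 / 2))
    - 4725 / (8388608 * PI ^ 4 * INR n ^ 2).

Definition a (n : nat) : R :=
  exp (4 * PI * sqrt (INR n)) / (sqrt 2 * Rpower (INR n) (3 / 4))
  * (d n - 2.21073e-5 / Rpower (INR n) (5 / 2)).

Definition b (n : nat) : R :=
  exp (4 * PI * sqrt (INR n)) / (sqrt 2 * Rpower (INR n) (3 / 4))
  * (d n + 2.21073e-5 / Rpower (INR n) (5 / 2)).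

(* Main.v *)
Require Import Defs.
From Stdlib Require Import Reals ZArith Lra Lia Psatz List Machin.
From Coquelicot Require Import Coquelicot.
Open Scope R_scope.

(* Only the transformation [t -> -1/t] of [j] is needed, not the full circle method.
   The symmetric sums of [1 / (m t + n) ^ k] give [E4 (-1/t) = t^4 E4 t] and the quasi-modularity
   of [E2], which is the logarithmic derivative of the discriminant; hence [j (-1/t) = j t].

   The coefficients [c n] are nonnegative, so on the line [Im t = y] one has
   [|j t - e^(2 pi i / t)| <= sum_n c n e^(-2 pi n Im (-1/t))], a value on the imaginary axis that
   the same transformation bounds.  By Lipschitz's formula [e^(2 pi i / t)] is, up to a bounded
   error, the generating function of [beta n = 2 pi I_1 (4 pi sqrt n) / sqrt n].  Cauchy's estimate
   with [y = 1 / sqrt n] then gives [c n = beta n + O (e^(5/2 pi sqrt n))] with an explicit constant.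

   The expansion of [I_1] follows from a maximum principle for the equation satisfied by
   [sqrt x e^(-x) I_1 x], whose limit at infinity comes from the central binomial coefficients and
   Wallis's product.  This settles [n >= 64]; for smaller [n] the coefficients are computed from
   the defining product and compared with [a n] and [b n] in interval arithmetic. *)

(** * Sums, limits and absolutely convergent series of complex numbers *)

(** One transformation suffices because, for [Im t = y] and [|Re t| <= 1/2], only the cusp 0
    contributes a term as large as e^(2 pi / y). The rest is governed by [1 / Im (-1/t) = (x^2 +
    y^2) / y <= 1/(4y) + y]: with [y = 1 / sqrt n] this costs about e^(pi sqrt n / 2), and Cauchy's
    estimate adds a factor e^(2 pi sqrt n), which stays far below the e^(4 pi sqrt n) of the main
    term.

    No contour integral and no holomorphic derivative occurs. Identities between series come from
    comparing coefficients in a real shift [h], curves are differentiated in a real parameter, and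
    the law of the discriminant is obtained from finite products by a mean value inequality. The
    delicate point is weight 2: the lattice sum converges only conditionally, and exchanging the
    order of summation produces the extra term.

    The tolerance 2.21073e-5 is about 25 times the next coefficient of the expansion, which leaves
    room for two errors of 1e-5, one from the coefficients against [beta n] and one from the
    expansion of [I_1]. *)

Fixpoint rsum (f : nat -> R) (n : nat) : R :=
  match n with O => 0 | S k => rsum f k + f k end.

Fixpoint csum (f : nat -> C) (n : nat) : C :=
  match n with O => RtoC 0 | S k => (csum f k + f k)%C end.

Definition cvC (u : nat -> C) (l : C) : Prop :=
  is_lim_seq (fun n => Cmod (u n - l)%C) 0.

(* Meaningful when [asum f] holds. *)
Definition CS (f : nat -> C) : C :=
  (Series (fun n => Re (f n)), Series (fun n => Im (f n))).

Definition asum (f : nat -> C) : Prop := ex_series (fun n => Cmod (f n)).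

Lemma C_ext (z w : C) : Re z = Re w -> Im z = Im w -> z = w.
Proof. destruct z, w; simpl; intros; subst; reflexivity. Qed.

Lemma Im_le_Cmod (z : C) : Rabs (Im z) <= Cmod z.
Proof. eapply Rle_trans; [apply Rmax_r | apply (Rmax_Cmod z)]. Qed.

Lemma Cmod_le_Re_Im (z : C) : Cmod z <= Rabs (Re z) + Rabs (Im z).
Proof.
  unfold Cmod. rewrite <- (sqrt_Rsqr (Rabs (Re z) + Rabs (Im z))).
  - apply sqrt_le_1_alt. unfold Rsqr, Re, Im.
    pose proof (Rabs_pos (fst z)). pose proof (Rabs_pos (snd z)).
    rewrite <- (pow2_abs (fst z)), <- (pow2_abs (snd z)). nra.
  - pose proof (Rabs_pos (Re z)). pose proof (Rabs_pos (Im z)). lra.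
Qed.

Lemma Cmod_sq (z : C) : Cmod z ^ 2 = Re z ^ 2 + Im z ^ 2.
Proof. apply Cmod2_alt. Qed.

Lemma Cmod_minus_sym (z w : C) : Cmod (z - w) = Cmod (w - z).
Proof. rewrite <- Cmod_opp. f_equal. ring. Qed.

Lemma Cmod_triangle_inv (z w : C) : Cmod z - Cmod w <= Cmod (z - w).
Proof.
  pose proof (Cmod_triangle (z - w) w) as H.
  replace (z - w + w)%C with z in H by ring. lra.
Qed.

Lemma RtoC_neq (x : R) : x <> 0 -> RtoC x <> 0%C.
Proof. intros H E. apply H. now injection E. Qed.

Lemma Cmod_RtoC_pos (x : R) : 0 <= x -> Cmod (RtoC x) = x.
Proof. intros. rewrite Cmod_R. now apply Rabs_pos_eq. Qed.

Lemma Re_rsum (f : nat -> C) n : Re (csum f n) = rsum (fun k => Re (f k)) n.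
Proof. induction n; simpl; [reflexivity|]. rewrite <- IHn. reflexivity. Qed.

Lemma Im_rsum (f : nat -> C) n : Im (csum f n) = rsum (fun k => Im (f k)) n.
Proof. induction n; simpl; [reflexivity|]. rewrite <- IHn. reflexivity. Qed.

Lemma rsum_sum_n (f : nat -> R) n : rsum f (S n) = sum_n f n.
Proof.
  induction n; [simpl; rewrite sum_O; lra|].
  rewrite sum_Sn, <- IHn. reflexivity.
Qed.

Lemma rsum_ext (f g : nat -> R) n :
  (forall k, (k < n)%nat -> f k = g k) -> rsum f n = rsum g n.
Proof.
  induction n; intros H; [reflexivity|]. simpl. rewrite IHn, H; auto with arith.
Qed.

Lemma csum_ext (f g : nat -> C) n :
  (forall k, (k < n)%nat -> f k = g k) -> csum f n = csum g n.
Proof.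
  induction n; intros H; [reflexivity|]. simpl. rewrite IHn, H; auto with arith.
Qed.

Lemma rsum_le (f g : nat -> R) n :
  (forall k, (k < n)%nat -> f k <= g k) -> rsum f n <= rsum g n.
Proof.
  induction n; intros H; [simpl; lra|]. simpl.
  apply Rplus_le_compat; [apply IHn; auto with arith | apply H; lia].
Qed.

Lemma csum_plus (f g : nat -> C) n :
  csum (fun k => f k + g k)%C n = (csum f n + csum g n)%C.
Proof. induction n; simpl; [ring|]. rewrite IHn. ring. Qed.

Lemma csum_scal (c : C) (f : nat -> C) n :
  csum (fun k => c * f k)%C n = (c * csum f n)%C.
Proof. induction n; simpl; [ring|]. rewrite IHn. ring. Qed.

Lemma rsum_scal c (f : nat -> R) n : rsum (fun k => c * f k) n = c * rsum f n.
Proof. induction n; simpl; [ring|]. rewrite IHn. ring. Qed.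

Lemma csum_add (f : nat -> C) m n :
  csum f (m + n) = (csum f m + csum (fun k => f (m + k)%nat) n)%C.
Proof.
  induction n; simpl; [rewrite Nat.add_0_r; ring|].
  rewrite Nat.add_succ_r. simpl. rewrite IHn. ring.
Qed.

Lemma rsum_const c n : rsum (fun _ => c) n = INR n * c.
Proof. induction n; [simpl; ring|]. simpl rsum. rewrite IHn, S_INR. ring. Qed.

Lemma csum_mod (f : nat -> C) n : Cmod (csum f n) <= rsum (fun k => Cmod (f k)) n.
Proof.
  induction n; simpl; [rewrite Cmod_0; lra|].
  eapply Rle_trans; [apply Cmod_triangle|]. lra.
Qed.

Lemma is_lim_rsum (f : nat -> R) : ex_series f -> is_lim_seq (rsum f) (Series f).
Proof.
  intros H. apply is_lim_seq_incr_1.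
  apply is_lim_seq_ext with (sum_n f); [intros; now rewrite rsum_sum_n|].
  exact (Series_correct f H).
Qed.

Lemma ex_series_rsum (f : nat -> R) (l : R) :
  is_lim_seq (rsum f) l -> is_series f l.
Proof.
  intros H. apply is_lim_seq_incr_1 in H.
  apply is_lim_seq_ext with (v := sum_n f) in H; [exact H|].
  intros; now rewrite rsum_sum_n.
Qed.

Lemma rsum_le_Series (f : nat -> R) n :
  (forall k, 0 <= f k) -> ex_series f -> rsum f n <= Series f.
Proof.
  intros Hp H. apply (is_lim_seq_incr_compare (rsum f)); [now apply is_lim_rsum|].
  intros k. simpl. specialize (Hp k). lra.
Qed.

Lemma Series_nonneg (f : nat -> R) : (forall k, 0 <= f k) -> ex_series f -> 0 <= Series f.
Proof. intros Hp H. exact (rsum_le_Series f 0 Hp H). Qed.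

Lemma ex_series_bounded (f : nat -> R) (M : R) :
  (forall k, 0 <= f k) -> (forall n, rsum f n <= M) -> ex_series f.
Proof.
  intros Hp H. destruct (ex_finite_lim_seq_incr (rsum f) M) as [l Hl]; auto.
  - intros n; simpl; specialize (Hp n); lra.
  - exists l. now apply ex_series_rsum.
Qed.

Lemma ex_series_pos_le (f g : nat -> R) :
  (forall k, 0 <= f k <= g k) -> ex_series g -> ex_series f.
Proof.
  intros H Hg. apply (@ex_series_le R_AbsRing R_CompleteNormedModule) with g; auto.
  intros n. change (Rabs (f n) <= g n). rewrite Rabs_pos_eq; apply H.
Qed.

Lemma ex_series_tail (f : nat -> R) n :
  ex_series f -> ex_series (fun k => f (n + k)%nat).
Proof. intros; now apply ex_series_incr_n. Qed.

Lemma Series_split (f : nat -> R) n :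
  ex_series f -> Series f = rsum f n + Series (fun k => f (n + k)%nat).
Proof.
  intros H. destruct n; [simpl; rewrite Rplus_0_l; now apply Series_ext|].
  rewrite (Series_incr_n f (S n)) by (lia || auto). f_equal.
  rewrite rsum_sum_n, sum_n_Reals. reflexivity.
Qed.

Lemma Series_tail_lim (f : nat -> R) :
  ex_series f -> is_lim_seq (fun n => Series (fun k => f (n + k)%nat)) 0.
Proof.
  intros H. apply is_lim_seq_ext with (fun n => Series f - rsum f n).
  { intros n. rewrite (Series_split f n H). ring. }
  replace 0 with (Series f - Series f) by ring.
  apply is_lim_seq_minus'; [apply is_lim_seq_const | now apply is_lim_rsum].
Qed.

Lemma asum_le (f : nat -> C) (g : nat -> R) :
  (forall n, Cmod (f n) <= g n) -> ex_series g -> asum f.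
Proof.
  intros H Hg. apply ex_series_pos_le with g; auto.
  intros k; split; [apply Cmod_ge_0 | apply H].
Qed.

Lemma asum_Re f : asum f -> ex_series (fun n => Re (f n)).
Proof.
  intros H. apply (@ex_series_le R_AbsRing R_CompleteNormedModule) with (2 := H).
  intros; apply re_le_Cmod.
Qed.

Lemma asum_Im f : asum f -> ex_series (fun n => Im (f n)).
Proof.
  intros H. apply (@ex_series_le R_AbsRing R_CompleteNormedModule) with (2 := H).
  intros; apply Im_le_Cmod.
Qed.

Lemma asum_ext f g : (forall n, f n = g n) -> asum f -> asum g.
Proof. intros H. apply ex_series_ext. intros; now rewrite H. Qed.

Lemma asum_plus f g : asum f -> asum g -> asum (fun n => f n + g n)%C.
Proof.
  intros Hf Hg. apply asum_le with (fun n => Cmod (f n) + Cmod (g n)).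
  - intros; apply Cmod_triangle.
  - exact (ex_series_plus _ _ Hf Hg).
Qed.

Lemma asum_scal c f : asum f -> asum (fun n => c * f n)%C.
Proof.
  intros Hf. apply asum_le with (fun n => Cmod c * Cmod (f n)).
  - intros; rewrite Cmod_mult; lra.
  - exact (ex_series_scal_l (Cmod c) _ Hf).
Qed.

Lemma asum_S f : asum f <-> asum (fun n => f (S n)).
Proof. apply (ex_series_incr_1 (fun n => Cmod (f n))). Qed.

Lemma CS_ext f g : (forall n, f n = g n) -> CS f = CS g.
Proof. intros H. unfold CS. f_equal; apply Series_ext; intros; now rewrite H. Qed.

Lemma CS_plus f g : asum f -> asum g -> CS (fun n => f n + g n)%C = (CS f + CS g)%C.
Proof.
  intros Hf Hg. apply C_ext; simpl.
  - rewrite <- Series_plus; auto using asum_Re.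
  - rewrite <- Series_plus; auto using asum_Im.
Qed.

Lemma CS_scal c f : asum f -> CS (fun n => c * f n)%C = (c * CS f)%C.
Proof.
  intros Hf. apply C_ext; simpl.
  - rewrite <- !Series_scal_l, <- Series_minus.
    + reflexivity.
    + exact (ex_series_scal_l (fst c) _ (asum_Re _ Hf)).
    + exact (ex_series_scal_l (snd c) _ (asum_Im _ Hf)).
  - rewrite <- !Series_scal_l, <- Series_plus.
    + reflexivity.
    + exact (ex_series_scal_l (fst c) _ (asum_Im _ Hf)).
    + exact (ex_series_scal_l (snd c) _ (asum_Re _ Hf)).
Qed.

Lemma CS_minus f g : asum f -> asum g -> CS (fun n => f n - g n)%C = (CS f - CS g)%C.
Proof.
  intros Hf Hg.
  rewrite (CS_ext _ (fun n => f n + (-(1)) * g n)%C) by (intros; ring).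
  rewrite CS_plus, CS_scal; auto using asum_scal. ring.
Qed.

Lemma CS_split f n : asum f -> CS f = (csum f n + CS (fun k => f (n + k)%nat))%C.
Proof.
  intros Hf. apply C_ext.
  - change (Series (fun n => Re (f n)) = Re (csum f n) + Series (fun k => Re (f (n + k)%nat))).
    rewrite Re_rsum. apply (Series_split (fun n => Re (f n))), asum_Re, Hf.
  - change (Series (fun n => Im (f n)) = Im (csum f n) + Series (fun k => Im (f (n + k)%nat))).
    rewrite Im_rsum. apply (Series_split (fun n => Im (f n))), asum_Im, Hf.
Qed.

Lemma CS_S f : asum f -> CS f = (f O + CS (fun k => f (S k)))%C.
Proof. intros Hf. rewrite (CS_split f 1 Hf). simpl. ring. Qed.

Lemma cvC_components u l :
  is_lim_seq (fun n => Re (u n)) (Re l) -> is_lim_seq (fun n => Im (u n)) (Im l) ->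
  cvC u l.
Proof.
  intros H1 H2. unfold cvC.
  apply is_lim_seq_le_le with (fun _ => 0)
    (fun n => Rabs (Re (u n) - Re l) + Rabs (Im (u n) - Im l)).
  - intros n. split; [apply Cmod_ge_0|]. apply (Cmod_le_Re_Im (u n - l)%C).
  - apply is_lim_seq_const.
  - replace (Finite 0) with (Finite (Rabs (Re l - Re l) + Rabs (Im l - Im l))).
    + apply is_lim_seq_plus'; apply (is_lim_seq_abs _ (Finite _));
      apply is_lim_seq_minus'; auto; apply is_lim_seq_const.
    + f_equal. rewrite !Rminus_diag, Rabs_R0. lra.
Qed.

Lemma cvC_Re u l : cvC u l -> is_lim_seq (fun n => Re (u n)) (Re l).
Proof.
  intros H. apply is_lim_seq_spec. intros eps.
  apply is_lim_seq_spec in H. destruct (H eps) as [N HN]. exists N. intros n Hn.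
  specialize (HN n Hn). rewrite Rminus_0_r, Rabs_pos_eq in HN by apply Cmod_ge_0.
  eapply Rle_lt_trans; [|exact HN]. apply (re_le_Cmod (u n - l)%C).
Qed.

Lemma cvC_Im u l : cvC u l -> is_lim_seq (fun n => Im (u n)) (Im l).
Proof.
  intros H. apply is_lim_seq_spec. intros eps.
  apply is_lim_seq_spec in H. destruct (H eps) as [N HN]. exists N. intros n Hn.
  specialize (HN n Hn). rewrite Rminus_0_r, Rabs_pos_eq in HN by apply Cmod_ge_0.
  eapply Rle_lt_trans; [|exact HN]. apply (Im_le_Cmod (u n - l)%C).
Qed.

Lemma cvC_unique u l l' : cvC u l -> cvC u l' -> l = l'.
Proof.
  intros H H'. apply C_ext.
  - pose proof (is_lim_seq_unique _ _ (cvC_Re _ _ H)) as E.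
    rewrite (is_lim_seq_unique _ _ (cvC_Re _ _ H')) in E. now injection E.
  - pose proof (is_lim_seq_unique _ _ (cvC_Im _ _ H)) as E.
    rewrite (is_lim_seq_unique _ _ (cvC_Im _ _ H')) in E. now injection E.
Qed.

Lemma cvC_ext u v l : (forall n, u n = v n) -> cvC u l -> cvC v l.
Proof. intros E. apply is_lim_seq_ext. intros; now rewrite E. Qed.

Lemma cvC_const l : cvC (fun _ => l) l.
Proof.
  apply is_lim_seq_ext with (fun _ => 0); [|apply is_lim_seq_const].
  intros. replace (l - l)%C with (RtoC 0) by ring. now rewrite Cmod_0.
Qed.

Lemma cvC_plus u v l l' : cvC u l -> cvC v l' -> cvC (fun n => u n + v n)%C (l + l')%C.
Proof.
  intros H H'. apply cvC_components.
  - apply (is_lim_seq_plus' _ _ _ _ (cvC_Re _ _ H) (cvC_Re _ _ H')).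
  - apply (is_lim_seq_plus' _ _ _ _ (cvC_Im _ _ H) (cvC_Im _ _ H')).
Qed.

Lemma cvC_mult u v l l' : cvC u l -> cvC v l' -> cvC (fun n => u n * v n)%C (l * l')%C.
Proof.
  intros H H'. pose proof (cvC_Re _ _ H). pose proof (cvC_Re _ _ H').
  pose proof (cvC_Im _ _ H). pose proof (cvC_Im _ _ H').
  apply cvC_components.
  - apply (is_lim_seq_minus' (fun n => Re (u n) * Re (v n)) (fun n => Im (u n) * Im (v n)));
    apply is_lim_seq_mult'; auto.
  - apply (is_lim_seq_plus' (fun n => Re (u n) * Im (v n)) (fun n => Im (u n) * Re (v n)));
    apply is_lim_seq_mult'; auto.
Qed.

Lemma cvC_scal c u l : cvC u l -> cvC (fun n => c * u n)%C (c * l)%C.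
Proof. apply cvC_mult, cvC_const. Qed.

Lemma cvC_subseq u l phi : (forall n, (n <= phi n)%nat) -> cvC u l -> cvC (fun n => u (phi n)) l.
Proof.
  intros Hphi H. apply is_lim_seq_spec. intros eps.
  apply is_lim_seq_spec in H. destruct (H eps) as [N HN]. exists N. intros n Hn.
  apply HN. specialize (Hphi n). lia.
Qed.

Lemma cvC_le u l (e : nat -> R) :
  (forall n, Cmod (u n - l) <= e n) -> is_lim_seq e 0 -> cvC u l.
Proof.
  intros H He. apply is_lim_seq_le_le with (fun _ => 0) e; auto.
  - intros n; split; [apply Cmod_ge_0 | apply H].
  - apply is_lim_seq_const.
Qed.

Lemma cvC_mod_le u l (M : R) : (forall n, Cmod (u n) <= M) -> cvC u l -> Cmod l <= M.
Proof.
  intros HM H. apply Rnot_lt_le. intros Hl. apply is_lim_seq_spec in H.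
  assert (He : 0 < Cmod l - M) by lra.
  destruct (H (mkposreal _ He)) as [N HN]. specialize (HN N (le_n N)). simpl in HN.
  rewrite Rminus_0_r, Rabs_pos_eq, Cmod_minus_sym in HN by apply Cmod_ge_0.
  pose proof (Cmod_triangle_inv l (u N)). specialize (HM N). lra.
Qed.

Lemma CS_cv f : asum f -> cvC (csum f) (CS f).
Proof.
  intros H. apply cvC_components.
  - apply is_lim_seq_ext with (rsum (fun k => Re (f k))).
    + intros; now rewrite Re_rsum.
    + now apply is_lim_rsum, asum_Re.
  - apply is_lim_seq_ext with (rsum (fun k => Im (f k))).
    + intros; now rewrite Im_rsum.
    + now apply is_lim_rsum, asum_Im.
Qed.

Lemma CS_mod f : asum f -> Cmod (CS f) <= Series (fun n => Cmod (f n)).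
Proof.
  intros H. apply cvC_mod_le with (csum f); [|now apply CS_cv].
  intros n. eapply Rle_trans; [apply csum_mod|].
  apply rsum_le_Series; auto using Cmod_ge_0.
Qed.

Lemma CS_mod_le f (g : nat -> R) :
  (forall n, Cmod (f n) <= g n) -> ex_series g -> Cmod (CS f) <= Series g.
Proof.
  intros H Hg. eapply Rle_trans; [apply CS_mod; now apply asum_le with g|].
  apply Series_le; auto. split; [apply Cmod_ge_0 | apply H].
Qed.

(** Absolute convergence allows the sum to be identified along a subsequence of partial sums. The
    cotangent is treated with [phi n] a power of two, since only duplication is available there. *)
Lemma CS_unique f l phi :
  (forall n, (n <= phi n)%nat) -> asum f -> cvC (fun n => csum f (phi n)) l -> CS f = l.
Proof.
  intros Hphi Hf H. apply cvC_unique with (fun n => csum f (phi n)); auto.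
  apply cvC_subseq with (u := csum f); auto. now apply CS_cv.
Qed.

Lemma asum_csum (f : nat -> nat -> C) M :
  (forall m, asum (f m)) -> asum (fun n => csum (fun m => f m n) M).
Proof.
  intros H. induction M; simpl.
  - apply asum_le with (fun _ => 0); [intros; rewrite Cmod_0; lra|].
    exists 0. apply ex_series_rsum.
    apply is_lim_seq_ext with (fun _ => 0); [|apply is_lim_seq_const].
    intros n; rewrite rsum_const; ring.
  - now apply asum_plus.
Qed.

Lemma CS_0 : CS (fun _ => RtoC 0) = RtoC 0.
Proof.
  apply C_ext; simpl; apply is_series_unique, ex_series_rsum;
  (apply is_lim_seq_ext with (fun _ => 0); [|apply is_lim_seq_const]);
  intros n; rewrite rsum_const; ring.
Qed.

Lemma CS_csum (f : nat -> nat -> C) M :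
  (forall m, asum (f m)) ->
  CS (fun n => csum (fun m => f m n) M) = csum (fun m => CS (f m)) M.
Proof.
  intros H. induction M; simpl; [apply CS_0|].
  rewrite CS_plus, IHM; auto using asum_csum.
Qed.

(** A product majorant [u m * v n] makes everything explicit: finitely many rows may be exchanged
    with the sum over [n], and the remaining rows contribute at most the tail of [u] times the sum
    of [v]. Every exchange of summations below is set up to have such a majorant. *)
Lemma CS_fubini (f : nat -> nat -> C) (u v : nat -> R) :
  (forall m n, Cmod (f m n) <= u m * v n) ->
  (forall m, 0 <= u m) -> (forall n, 0 <= v n) -> ex_series u -> ex_series v ->
  CS (fun m => CS (fun n => f m n)) = CS (fun n => CS (fun m => f m n)).
Proof.
  intros Hf Hu0 Hv0 Hu Hv.
  assert (Ar : forall m, asum (f m)).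
  { intros m. apply asum_le with (fun n => u m * v n); auto.
    exact (ex_series_scal_l (u m) v Hv). }
  assert (Ac : forall n, asum (fun m => f m n)).
  { intros n. apply asum_le with (fun m => v n * u m).
    - intros; rewrite Rmult_comm; auto.
    - exact (ex_series_scal_l (v n) u Hu). }
  assert (Hrow : forall m, Cmod (CS (f m)) <= Series v * u m).
  { intros m. rewrite Rmult_comm, <- Series_scal_l.
    apply CS_mod_le; auto. exact (ex_series_scal_l (u m) v Hv). }
  assert (Arow : asum (fun m => CS (f m))).
  { apply asum_le with (1 := Hrow). exact (ex_series_scal_l (Series v) u Hu). }
  assert (Hcol : forall n, Cmod (CS (fun m => f m n)) <= Series u * v n).
  { intros n. rewrite Rmult_comm, <- Series_scal_l.
    apply CS_mod_le; [intros; rewrite Rmult_comm; auto|].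
    exact (ex_series_scal_l (v n) u Hu). }
  assert (Acol : asum (fun n => CS (fun m => f m n))).
  { apply asum_le with (1 := Hcol). exact (ex_series_scal_l (Series u) v Hv). }
  apply cvC_unique with (csum (fun m => CS (f m))).
  - now apply CS_cv.
  - apply cvC_le with (fun M => Series (fun k => u (M + k)%nat) * Series v).
    + intros M. rewrite <- CS_csum by auto.
      rewrite Cmod_minus_sym, <- CS_minus by auto using asum_csum.
      rewrite <- Series_scal_l. apply CS_mod_le.
      2:{ exact (ex_series_scal_l (Series (fun k => u (M + k)%nat)) v Hv). }
      intros n. rewrite (CS_split (fun m => f m n) M) by auto.
      match goal with |- Cmod ?x <= _ =>
        replace x with (CS (fun k => f (M + k)%nat n)) by ring end.
      rewrite Rmult_comm, <- Series_scal_l. apply CS_mod_le.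
      * intros; rewrite Rmult_comm; auto.
      * exact (ex_series_scal_l (v n) _ (ex_series_tail u M Hu)).
    + replace (Finite 0) with (Finite (0 * Series v)) by (f_equal; ring).
      apply is_lim_seq_mult'; [now apply Series_tail_lim | apply is_lim_seq_const].
Qed.

Lemma csum_RtoC (f : nat -> R) n : csum (fun k => RtoC (f k)) n = RtoC (rsum f n).
Proof. induction n; simpl; [reflexivity|]. now rewrite IHn, RtoC_plus. Qed.

Lemma CS_RtoC (f : nat -> R) : CS (fun n => RtoC (f n)) = RtoC (Series f).
Proof.
  apply C_ext; simpl; [reflexivity|].
  transitivity (Im (CS (fun _ => RtoC 0))); [reflexivity|]. now rewrite CS_0.
Qed.

(** * The complex exponential along curves *)

Lemma Cexp_0 : Cexp 0 = 1%C.
Proof. apply C_ext; simpl; rewrite exp_0, ?cos_0, ?sin_0; ring. Qed.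

Lemma Cexp_add z w : Cexp (z + w) = (Cexp z * Cexp w)%C.
Proof.
  apply C_ext; unfold Cexp; simpl; unfold Re, Im;
  rewrite exp_plus, ?cos_plus, ?sin_plus; ring.
Qed.

Lemma Cexp_mod z : Cmod (Cexp z) = exp (Re z).
Proof.
  unfold Cmod, Cexp. cbn [fst snd].
  replace ((exp (Re z) * cos (Im z)) ^ 2 + (exp (Re z) * sin (Im z)) ^ 2)
    with (exp (Re z) * exp (Re z)).
  - apply sqrt_square. left; apply exp_pos.
  - pose proof (sin2_cos2 (Im z)) as H. unfold Rsqr in H.
    replace (exp (Re z) * exp (Re z)) with (exp (Re z) * exp (Re z) * 1) by ring.
    rewrite <- H. ring.
Qed.

Lemma Cexp_neq_0 z : Cexp z <> 0%C.
Proof. apply Cmod_gt_0. rewrite Cexp_mod. apply exp_pos. Qed.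

Lemma Cexp_opp z : Cexp (- z) = (/ Cexp z)%C.
Proof.
  assert (H : (Cexp (-z) * Cexp z = 1)%C).
  { rewrite <- Cexp_add, <- Cexp_0. f_equal. ring. }
  transitivity ((Cexp (-z) * Cexp z) * / Cexp z)%C.
  - field. apply Cexp_neq_0.
  - rewrite H. ring.
Qed.

Lemma Cexp_pow z n : (Cexp z ^ n)%C = Cexp (RtoC (INR n) * z).
Proof.
  induction n.
  - simpl. replace (RtoC 0 * z)%C with (RtoC 0) by ring. now rewrite Cexp_0.
  - rewrite Cpow_S, IHn, <- Cexp_add, S_INR, RtoC_plus. f_equal. ring.
Qed.

Lemma Cexp_RtoC x : Cexp (RtoC x) = RtoC (exp x).
Proof. apply C_ext; simpl; rewrite ?cos_0, ?sin_0; ring. Qed.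

Lemma Cexp_period (m : Z) z : Cexp (z + 2 * PI * Ci * IZR m)%C = Cexp z.
Proof.
  rewrite Cexp_add.
  replace (Cexp (2 * PI * Ci * IZR m)) with (RtoC 1); [ring|].
  apply C_ext; simpl.
  - match goal with |- _ = exp ?x * cos ?y =>
      replace x with 0 by ring; replace y with (2 * IZR m * PI) by ring end.
    rewrite exp_0. destruct (Z_le_gt_dec 0 m) as [H|H].
    + rewrite <- (Z2Nat.id m H), <- INR_IZR_INZ.
      rewrite <- (Rplus_0_l (2 * _ * PI)), cos_period, cos_0. ring.
    + rewrite <- cos_neg.
      replace (- (2 * IZR m * PI)) with (0 + 2 * INR (Z.to_nat (- m)) * PI).
      * rewrite cos_period, cos_0. ring.
      * rewrite INR_IZR_INZ, Z2Nat.id, opp_IZR by lia. ring.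
  - match goal with |- _ = exp ?x * sin ?y =>
      replace x with 0 by ring; replace y with (2 * IZR m * PI) by ring end.
    rewrite exp_0. destruct (Z_le_gt_dec 0 m) as [H|H].
    + rewrite <- (Z2Nat.id m H), <- INR_IZR_INZ.
      rewrite <- (Rplus_0_l (2 * _ * PI)), sin_period, sin_0. ring.
    + replace (2 * IZR m * PI) with (- (0 + 2 * INR (Z.to_nat (- m)) * PI)).
      * rewrite sin_neg, sin_period, sin_0. ring.
      * rewrite INR_IZR_INZ, Z2Nat.id, opp_IZR by lia. ring.
Qed.

(* Complex-valued functions of a real variable are differentiated componentwise. *)
Definition dC (f : R -> C) (t : R) (l : C) : Prop :=
  is_derive (fun t => Re (f t)) t (Re l) /\ is_derive (fun t => Im (f t)) t (Im l).

Lemma dC_const c t : dC (fun _ => c) t 0.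
Proof. split; apply @is_derive_const. Qed.

Lemma dC_line a w t : dC (fun t => a + RtoC t * w)%C t w.
Proof. split; simpl; auto_derive; auto; unfold Re, Im; simpl; ring. Qed.

Lemma dC_plus f g t l m : dC f t l -> dC g t m -> dC (fun t => f t + g t)%C t (l + m)%C.
Proof.
  intros [H1 H2] [H3 H4]. split.
  - apply (is_derive_plus _ _ _ _ _ H1 H3).
  - apply (is_derive_plus _ _ _ _ _ H2 H4).
Qed.

Lemma is_derive_Rmult (f g : R -> R) t l m :
  is_derive f t l -> is_derive g t m -> is_derive (fun t => f t * g t) t (l * g t + f t * m).
Proof. intros H1 H2. apply (is_derive_mult f g t l m H1 H2). intros; apply Rmult_comm. Qed.

Lemma dC_ext f g t l : (forall s, f s = g s) -> dC f t l -> dC g t l.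
Proof.
  intros E [H1 H2]. split; (eapply is_derive_ext; [|eassumption]); intros; simpl; now rewrite E.
Qed.

Lemma dC_eq f g t l m : dC f t l -> (forall s, f s = g s) -> l = m -> dC g t m.
Proof. intros H E <-. now apply dC_ext with f. Qed.

Lemma is_derive_eq (f g : R -> R) t l m :
  is_derive f t l -> (forall s, f s = g s) -> l = m -> is_derive g t m.
Proof. intros H E <-. now apply is_derive_ext with f. Qed.

Lemma dC_mult f g t l m :
  dC f t l -> dC g t m -> dC (fun t => f t * g t)%C t (l * g t + f t * m)%C.
Proof.
  intros [H1 H2] [H3 H4]. split; eapply is_derive_eq.
  - apply (is_derive_minus _ _ _ _ _ (is_derive_Rmult _ _ _ _ _ H1 H3)
      (is_derive_Rmult _ _ _ _ _ H2 H4)).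
  - intros; reflexivity.
  - unfold minus, plus, opp, Re, Im. simpl. ring.
  - apply (is_derive_plus _ _ _ _ _ (is_derive_Rmult _ _ _ _ _ H1 H4)
      (is_derive_Rmult _ _ _ _ _ H2 H3)).
  - intros. unfold plus, Re, Im. simpl. ring.
  - unfold plus, Re, Im. simpl. ring.
Qed.

Lemma dC_scal c f t l : dC f t l -> dC (fun t => c * f t)%C t (c * l)%C.
Proof.
  intros H. replace (c * l)%C with (0 * f t + c * l)%C by ring.
  apply dC_mult; [apply dC_const | exact H].
Qed.

Lemma dC_inv f t l : dC f t l -> f t <> 0%C -> dC (fun t => / f t)%C t (- l / (f t * f t))%C.
Proof.
  intros [H1 H2] Hf.
  assert (Hn : Re (f t) ^ 2 + Im (f t) ^ 2 <> 0).
  { rewrite <- Cmod_sq. apply pow_nonzero. intros E. apply Hf. now apply Cmod_eq_0. }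
  set (n := fun t => Re (f t) ^ 2 + Im (f t) ^ 2).
  assert (Dn : is_derive n t (2 * Re (f t) * Re l + 2 * Im (f t) * Im l)).
  { eapply is_derive_eq.
    - apply (is_derive_plus _ _ _ _ _ (is_derive_Rmult _ _ _ _ _ H1 H1)
        (is_derive_Rmult _ _ _ _ _ H2 H2)).
    - intros s. unfold n, plus, Re, Im. simpl. ring.
    - unfold plus, Re, Im. simpl. ring. }
  pose proof (is_derive_inv n t _ Dn Hn) as Di.
  assert (E : (- l / (f t * f t))%C = 
    (- l * (Cconj (f t) * Cconj (f t)) * RtoC (/ (n t * n t)))%C).
  { assert (Hc : Cconj (f t) <> 0%C).
    { intros E. apply Hf, Cmod_eq_0. rewrite <- Cmod_conj, E. apply Cmod_0. }
    rewrite RtoC_inv by (apply Rmult_integral_contrapositive; auto).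
    unfold n. rewrite <- Cmod_sq, RtoC_mult, Cmod2_conj.
    field. auto. }
  rewrite E. split; eapply is_derive_eq.
  - apply (is_derive_Rmult _ _ _ _ _ H1 Di).
  - intros. unfold n, Re, Im. simpl. reflexivity.
  - unfold n, Re, Im in *. simpl in *. field. contradict Hn. rewrite <- Hn. ring.
  - apply (is_derive_Rmult _ _ _ _ _ (is_derive_opp _ _ _ H2) Di).
  - intros. unfold n, Re, Im. simpl. reflexivity.
  - unfold opp, n, Re, Im in *. simpl in *. field. contradict Hn. rewrite <- Hn. ring.
Qed.

Lemma dC_Cexp f t l : dC f t l -> dC (fun t => Cexp (f t)) t (l * Cexp (f t))%C.
Proof.
  intros [H1 H2].
  assert (De : is_derive (fun t => exp (Re (f t))) t (Re l * exp (Re (f t)))).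
  { apply (is_derive_comp exp (fun t => Re (f t)) t _ _ (is_derive_exp _) H1). }
  assert (Dc : is_derive (fun t => cos (Im (f t))) t (Im l * - sin (Im (f t)))).
  { apply (is_derive_comp cos (fun t => Im (f t)) t _ _ (is_derive_cos _) H2). }
  assert (Ds : is_derive (fun t => sin (Im (f t))) t (Im l * cos (Im (f t)))).
  { apply (is_derive_comp sin (fun t => Im (f t)) t _ _ (is_derive_sin _) H2). }
  split; eapply is_derive_eq.
  - apply (is_derive_Rmult _ _ _ _ _ De Dc).
  - reflexivity.
  - simpl. unfold Re, Im. ring.
  - apply (is_derive_Rmult _ _ _ _ _ De Ds).
  - reflexivity.
  - simpl. unfold Re, Im. ring.
Qed.

Lemma dC_pow f t l n :
  dC f t l -> dC (fun t => f t ^ S n)%C t (RtoC (INR (S n)) * f t ^ n * l)%C.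
Proof.
  intros H. induction n.
  - replace (RtoC (INR 1) * f t ^ 0 * l)%C with l by (simpl; unfold Re, Im; ring).
    destruct H as [H1 H2]. split; (eapply is_derive_ext; [|eassumption]);
    intros; now rewrite Cpow_1_r.
  - replace (RtoC (INR (S (S n))) * f t ^ S n * l)%C
      with (l * f t ^ S n + f t * (RtoC (INR (S n)) * f t ^ n * l))%C.
    + apply (dC_mult _ _ _ _ _ H IHn).
    + rewrite (S_INR (S n)), RtoC_plus, !Cpow_S. ring.
Qed.

Lemma mvt_nonincr (f f' : R -> R) :
  (forall t, 0 <= t <= 1 -> is_derive f t (f' t)) ->
  (forall t, 0 <= t <= 1 -> f' t <= 0) -> f 1 <= f 0.
Proof.
  intros Hd Hn.
  destruct (MVT_gen f 0 1 f') as [c [Hc E]].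
  - intros x Hx. rewrite Rmin_left, Rmax_right in Hx by lra. apply Hd; lra.
  - intros x Hx. rewrite Rmin_left, Rmax_right in Hx by lra.
    apply derivable_continuous_pt. exists (f' x). apply is_derive_Reals, Hd; lra.
  - rewrite Rmin_left, Rmax_right in Hc by lra. specialize (Hn c Hc). lra.
Qed.

(** There is no mean value point for complex values, so [f] is projected on the direction of
    [w = f 1 - f 0]: the real function Re(conj w f) - |w| g is nonincreasing on [0, 1], and its
    endpoint values give |w|^2 <= |w| (g 1 - g 0). *)
Lemma mean_value (f f' : R -> C) (g g' : R -> R) :
  (forall t, 0 <= t <= 1 -> dC f t (f' t)) ->
  (forall t, 0 <= t <= 1 -> is_derive g t (g' t)) ->
  (forall t, 0 <= t <= 1 -> Cmod (f' t) <= g' t) ->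
  Cmod (f 1 - f 0)%C <= g 1 - g 0.
Proof.
  intros Hf Hg Hle. set (w := (f 1 - f 0)%C).
  destruct (Req_dec (Cmod w) 0) as [H0|H0].
  - rewrite H0.
    pose proof (mvt_nonincr (fun t => - g t) (fun t => - g' t)) as H.
    enough (- g 1 <= - g 0) by lra. apply H.
    + intros t Ht. apply (is_derive_opp g t (g' t)), Hg, Ht.
    + intros t Ht. specialize (Hle t Ht). pose proof (Cmod_ge_0 (f' t)). lra.
  - assert (Hw : 0 < Cmod w) by (pose proof (Cmod_ge_0 w); lra).
    pose proof (mvt_nonincr
      (fun t => (Re w * Re (f t) + Im w * Im (f t)) - Cmod w * g t)
      (fun t => (Re w * Re (f' t) + Im w * Im (f' t)) - Cmod w * g' t)) as H.
    assert (H1 : (Re w * Re (f 1) + Im w * Im (f 1)) - Cmod w * g 1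
      <= (Re w * Re (f 0) + Im w * Im (f 0)) - Cmod w * g 0).
    { apply H.
      - intros t Ht. destruct (Hf t Ht) as [D1 D2].
        apply (is_derive_minus (fun t => Re w * Re (f t) + Im w * Im (f t))
          (fun t => Cmod w * g t)).
        + apply (is_derive_plus (fun t => Re w * Re (f t)) (fun t => Im w * Im (f t))).
          * apply (is_derive_scal (fun t => Re (f t)) t (Re w) _ D1).
          * apply (is_derive_scal (fun t => Im (f t)) t (Im w) _ D2).
        + apply (is_derive_scal g t (Cmod w) _ (Hg t Ht)).
      - intros t Ht. specialize (Hle t Ht).
        assert (E : Re w * Re (f' t) + Im w * Im (f' t) = Re (Cconj w * f' t)%C)
          by (simpl; unfold Re, Im; ring).
        rewrite E. pose proof (re_le_Cmod (Cconj w * f' t)%C) as H1.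
        rewrite Cmod_mult, Cmod_conj in H1.
        pose proof (Rle_abs (Re (Cconj w * f' t)%C)).
        assert (Cmod w * Cmod (f' t) <= Cmod w * g' t) by (apply Rmult_le_compat_l; lra).
        lra. }
    assert (E : Cmod w ^ 2 = (Re w * Re (f 1) + Im w * Im (f 1))
      - (Re w * Re (f 0) + Im w * Im (f 0))).
    { rewrite Cmod_sq. unfold w. simpl. unfold Re, Im. ring. }
    nra.
Qed.

Definition exp_term (z : C) (k : nat) : C := (z ^ k / RtoC (INR (fact k)))%C.

Lemma INR_fact_pos n : 0 < INR (fact n).
Proof. apply lt_0_INR, lt_O_fact. Qed.

Lemma Cmod_exp_term z k : Cmod (exp_term z k) = Cmod z ^ k / INR (fact k).
Proof.
  unfold exp_term. rewrite Cmod_div, Cmod_pow, Cmod_RtoC_pos; auto.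
  - left; apply INR_fact_pos.
  - apply RtoC_neq. apply Rgt_not_eq, INR_fact_pos.
Qed.

Lemma dC_exp_sum z n t :
  dC (fun t => csum (exp_term (RtoC t * z)) (S n)) t (z * csum (exp_term (RtoC t * z)) n)%C.
Proof.
  assert (Hl : dC (fun t => RtoC t * z)%C t z).
  { eapply dC_ext; [|apply (dC_line 0 z t)]. intros. simpl. ring. }
  induction n.
  - simpl csum.
    assert (H : dC (fun _ => (0 + exp_term (RtoC 0 * z) 0)%C) t 0) by apply dC_const.
    replace (z * 0)%C with (RtoC 0) by ring. exact H.
  - change (dC (fun t => csum (exp_term (RtoC t * z)) (S n) + exp_term (RtoC t * z) (S n))%C t
      (z * (csum (exp_term (RtoC t * z)) n + exp_term (RtoC t * z) n))%C).
    rewrite Cmult_plus_distr_l. apply dC_plus; auto.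
    eapply dC_eq; [apply (dC_scal (/ RtoC (INR (fact (S n)))) _ _ _ (dC_pow _ _ _ n Hl))| |].
    + intros s. unfold exp_term, Cdiv. apply Cmult_comm.
    + unfold exp_term. rewrite fact_simpl, mult_INR, RtoC_mult. field.
      split; apply RtoC_neq; [apply Rgt_not_eq, INR_fact_pos|].
      apply not_0_INR; lia.
Qed.

(** Along t -> t z the derivative of the remainder of one order is [z] times the remainder of the
    preceding order, so the induction hypothesis bounds it by the derivative of t^(n+1) K. *)
Lemma Cexp_taylor n : forall z,
  Cmod (Cexp z - csum (exp_term z) n)%C <= Cmod z ^ n / INR (fact n) * exp (Cmod z).
Proof.
  induction n; intros z.
  - simpl. replace (Cexp z - 0)%C with (Cexp z) by ring. rewrite Cexp_mod.
    pose proof (re_le_Cmod z). pose proof (Rle_abs (Re z)).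
    replace (1 / 1 * exp (Cmod z)) with (exp (Cmod z)) by field.
    destruct (Rle_lt_or_eq_dec (Re z) (Cmod z)) as [H1|H1]; [lra| |rewrite H1; lra].
    left; now apply exp_increasing.
  - set (K := Cmod z ^ S n / INR (fact (S n)) * exp (Cmod z)).
    assert (Hl : forall t, dC (fun t => RtoC t * z)%C t z).
    { intros t. eapply dC_ext; [|apply (dC_line 0 z t)]. intros. simpl. ring. }
    pose proof (mean_value
      (fun t => Cexp (RtoC t * z) + (-(1)) * csum (exp_term (RtoC t * z)) (S n))%C
      (fun t => z * (Cexp (RtoC t * z) - csum (exp_term (RtoC t * z)) n))%C
      (fun t => t ^ S n * K) (fun t => INR (S n) * t ^ n * K)) as H.
    assert (H' : Cmod (Cexp (RtoC 1 * z) + (-(1)) * csum (exp_term (RtoC 1 * z)) (S n)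
      - (Cexp (RtoC 0 * z) + (-(1)) * csum (exp_term (RtoC 0 * z)) (S n)))%C
      <= 1 ^ S n * K - 0 ^ S n * K).
    { apply H.
      - intros t Ht.
        replace (z * (Cexp (RtoC t * z) - csum (exp_term (RtoC t * z)) n))%C
          with (z * Cexp (RtoC t * z) + (-(1)) * (z * csum (exp_term (RtoC t * z)) n))%C by ring.
        apply dC_plus; [apply dC_Cexp, Hl | apply dC_scal, dC_exp_sum].
      - intros t Ht. auto_derive; auto. rewrite S_INR. simpl. destruct n; simpl; ring.
      - intros t Ht. rewrite Cmod_mult.
        assert (E : INR (S n) * t ^ n * K
          = Cmod z * ((t * Cmod z) ^ n / INR (fact n) * exp (Cmod z))).
        { unfold K. rewrite fact_simpl, mult_INR, Rpow_mult_distr. simpl pow. field.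
          split; [apply Rgt_not_eq, INR_fact_pos | apply not_0_INR; lia]. }
        rewrite E. apply Rmult_le_compat_l; [apply Cmod_ge_0|].
        eapply Rle_trans; [apply IHn|].
        rewrite Cmod_mult, Cmod_RtoC_pos by lra.
        apply Rmult_le_compat_l.
        + apply Rmult_le_pos; [apply pow_le, Rmult_le_pos; [lra | apply Cmod_ge_0]|].
          left; apply Rinv_0_lt_compat, INR_fact_pos.
        + pose proof (Cmod_ge_0 z).
          destruct (Rle_lt_or_eq_dec (t * Cmod z) (Cmod z)) as [H1|H1]; [nra| |rewrite H1; lra].
          left; now apply exp_increasing. }
    rewrite pow_ne_zero, pow1 in H' by lia.
    replace (1 * K - 0 * K) with K in H' by ring.
    refine (Rle_trans _ _ _ (Req_le _ _ _) H'). f_equal.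
    replace (RtoC 1 * z)%C with z by ring. replace (RtoC 0 * z)%C with (RtoC 0) by ring.
    rewrite Cexp_0.
    replace (csum (exp_term 0) (S n)) with (RtoC 1); [ring|].
    clear. induction n; [unfold exp_term; simpl; field|].
    simpl csum in IHn |- *. rewrite <- IHn. unfold exp_term. simpl. field.
    apply RtoC_neq. rewrite plus_INR, mult_INR.
    pose proof (INR_fact_pos n). pose proof (pos_INR n). apply Rgt_not_eq. nra.
Qed.

Lemma ex_series_exp x : ex_series (fun k => x ^ k / INR (fact k)).
Proof.
  exists (exp x). pose proof (is_exp_Reals x) as H. apply is_pseries_R in H.
  eapply is_series_ext; [|exact H]. intros. simpl. unfold Rdiv. ring.
Qed.

Lemma Series_exp x : Series (fun k => x ^ k / INR (fact k)) = exp x.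
Proof.
  apply is_series_unique. pose proof (is_exp_Reals x) as H. apply is_pseries_R in H.
  eapply is_series_ext; [|exact H]. intros. simpl. unfold Rdiv. ring.
Qed.

Lemma asum_exp z : asum (exp_term z).
Proof.
  apply asum_le with (fun k => Cmod z ^ k / INR (fact k)).
  - intros; rewrite Cmod_exp_term; lra.
  - apply ex_series_exp.
Qed.

Lemma CS_exp z : CS (exp_term z) = Cexp z.
Proof.
  apply cvC_unique with (csum (exp_term z)); [apply CS_cv, asum_exp|].
  apply cvC_le with (fun n => Cmod z ^ n / INR (fact n) * exp (Cmod z)).
  - intros n. rewrite Cmod_minus_sym. apply Cexp_taylor.
  - replace (Finite 0) with (Finite (0 * exp (Cmod z))) by (f_equal; ring).
    apply is_lim_seq_mult'; [|apply is_lim_seq_const].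
    exact (ex_series_lim_0 _ (ex_series_exp (Cmod z))).
Qed.

Lemma pow_le_exp x n : 0 <= x -> x ^ n / INR (fact n) <= exp x.
Proof.
  intros Hx.
  assert (Hp : forall k, 0 <= x ^ k / INR (fact k)).
  { intros k. apply Rmult_le_pos; [now apply pow_le|].
    left; apply Rinv_0_lt_compat, INR_fact_pos. }
  rewrite <- Series_exp.
  eapply Rle_trans; [|apply (rsum_le_Series _ (S n)); auto; apply ex_series_exp].
  simpl.
  assert (0 <= rsum (fun k => x ^ k / INR (fact k)) n); [|lra].
  clear -Hp. induction n; simpl; [lra|]. specialize (Hp n). lra.
Qed.

(** * The function [PI * cot (PI * a)] *)

Lemma Ci2 : (Ci * Ci = - (1))%C.
Proof. apply C_ext; simpl; ring. Qed.

Lemma Ci_neq_0 : Ci <> 0%C.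
Proof. intros E. injection E. lra. Qed.

Lemma PI_neq_0C : RtoC PI <> 0%C.
Proof. apply RtoC_neq. pose proof PI_RGT_0. lra. Qed.

Lemma two_pi_i_neq_0 : (RtoC (2 * PI) * Ci <> 0)%C.
Proof.
  apply Cmult_neq_0; [|apply Ci_neq_0]. apply RtoC_neq. pose proof PI_RGT_0. lra.
Qed.

Lemma Cmod_two_pi_i : Cmod (RtoC (2 * PI) * Ci)%C = 2 * PI.
Proof.
  rewrite Cmod_mult, Cmod_Ci, Cmod_RtoC_pos; [ring|]. pose proof PI_RGT_0. lra.
Qed.

Lemma nome_add a b : nome (a + b) = (nome a * nome b)%C.
Proof. unfold nome. rewrite <- Cexp_add. f_equal. ring. Qed.

Lemma nome_0 : nome 0 = 1%C.
Proof. unfold nome. rewrite Cmult_0_r. apply Cexp_0. Qed.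

Lemma nome_IZR m : nome (RtoC (IZR m)) = 1%C.
Proof.
  rewrite <- Cexp_0, <- (Cexp_period m 0). unfold nome. f_equal.
  rewrite RtoC_mult. ring.
Qed.

Lemma nome_shift a m : nome (a + RtoC (IZR m)) = nome a.
Proof. rewrite nome_add, nome_IZR. ring. Qed.

Lemma nome_neq_0 a : nome a <> 0%C.
Proof. apply Cexp_neq_0. Qed.

Lemma nome_opp a : nome (- a) = (/ nome a)%C.
Proof. unfold nome. rewrite <- Cexp_opp. f_equal. ring. Qed.

Lemma nome_mod a : Cmod (nome a) = exp (- (2 * PI * Im a)).
Proof. unfold nome. rewrite Cexp_mod. f_equal. simpl. unfold Re, Im. ring. Qed.

Lemma nome_pow a n : (nome a ^ n)%C = nome (RtoC (INR n) * a).
Proof. unfold nome. rewrite Cexp_pow. f_equal. ring. Qed.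

Lemma nome_half : nome (/ 2) = (- (1))%C.
Proof.
  unfold nome. apply C_ext; simpl.
  - match goal with |- exp ?x * cos ?y = _ => replace x with 0 by (simpl; field);
      replace y with PI by (simpl; field) end. rewrite exp_0, cos_PI. ring.
  - match goal with |- exp ?x * sin ?y = _ => replace x with 0 by (simpl; field);
      replace y with PI by (simpl; field) end. rewrite exp_0, sin_PI. ring.
Qed.

Lemma nome_lt_1 a : 0 < Im a -> Cmod (nome a) < 1.
Proof.
  intros H. rewrite nome_mod, <- exp_0. apply exp_increasing.
  pose proof PI_RGT_0. assert (0 < PI * Im a) by (apply Rmult_lt_0_compat; lra). lra.
Qed.

Lemma nome_neq_1 a : Im a <> 0 -> nome a <> 1%C.
Proof.
  intros H E. pose proof (nome_mod a) as H1. rewrite E, Cmod_1 in H1.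
  rewrite <- exp_0 in H1. apply exp_inv in H1. apply H.
  pose proof PI_RGT_0. nra.
Qed.

(* [PI * cot (PI * a)], junk where [nome a = 1], that is, at the integers. *)
Definition pi_cot (a : C) : C := (RtoC PI * Ci * (nome a + 1) / (nome a - 1))%C.

Lemma Cminus_neq_0 (a b : C) : a <> b -> (a - b <> 0)%C.
Proof. intros H E. apply H. replace a with (a - b + b)%C by ring. rewrite E. ring. Qed.

Lemma pi_cot_opp a : nome a <> 1%C -> pi_cot (- a) = (- pi_cot a)%C.
Proof.
  intros H. unfold pi_cot. rewrite nome_opp. pose proof (nome_neq_0 a).
  field. repeat split; auto using Cminus_neq_0.
Qed.

Lemma nome_halves a : nome a = (nome (a / 2) * nome (a / 2))%C
  /\ nome ((a + 1) / 2) = (- nome (a / 2))%C.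
Proof.
  split.
  - rewrite <- nome_add. f_equal. field. 
  - replace ((a + 1) / 2)%C with (a / 2 + / 2)%C by (field).
    rewrite nome_add, nome_half. ring.
Qed.

(** With p = [nome (a / 2)] one has [nome a] = p^2, and shifting the argument by 1/2 changes p to
    -p; the formula is then rational in p. Iterated, it writes the cotangent at [a] as an average
    over 2^k points, from which the partial fractions are read off. *)
Lemma pi_cot_duplication a : nome a <> 1%C ->
  pi_cot a = ((pi_cot (a / 2) + pi_cot ((a + 1) / 2)) / 2)%C.
Proof.
  intros H. destruct (nome_halves a) as [H1 H2]. unfold pi_cot. rewrite H2.
  rewrite H1 in *. set (p := nome (a / 2)) in *.
  assert (p <> 1)%C by (intros E; apply H; rewrite E; ring).
  assert (-p <> 1)%C.
  { intros E; apply H. replace (p * p)%C with (- p * - p)%C by ring. rewrite E; ring. }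
  field. repeat split; apply Cminus_neq_0; auto.
Qed.

Lemma csum_even_odd (f : nat -> C) n :
  csum f (2 * n) = (csum (fun j => f (2 * j)%nat) n + csum (fun j => f (2 * j + 1)%nat) n)%C.
Proof.
  induction n; [simpl; ring|].
  replace (2 * S n)%nat with (S (S (2 * n))) by lia.
  cbn [csum]. rewrite IHn. replace (S (2 * n)) with (2 * n + 1)%nat by lia. ring.
Qed.

Lemma RtoC_pow2_neq k : (RtoC (2 ^ k) <> 0)%C.
Proof. apply RtoC_neq. apply pow_nonzero. lra. Qed.

Lemma pi_cot_multiplication k : forall a, nome a <> 1%C ->
  pi_cot a = (csum (fun j => pi_cot ((a + RtoC (INR j)) / RtoC (2 ^ k))) (2 ^ k) / RtoC (2 ^ k))%C.
Proof.
  induction k; intros a H.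
  - simpl. replace ((a + 0) / 1)%C with a by field. field.
  - destruct (nome_halves a) as [H1 H2].
    rewrite pi_cot_duplication by auto.
    rewrite (IHk (a / 2)%C), (IHk ((a + 1) / 2)%C).
    + replace (2 ^ S k)%nat with (2 * 2 ^ k)%nat by reflexivity.
      rewrite csum_even_odd.
      assert (E : RtoC (2 ^ S k) = (2 * RtoC (2 ^ k))%C) by (simpl; apply RtoC_mult).
      rewrite E.
      rewrite (csum_ext (fun j => pi_cot ((a / 2 + RtoC (INR j)) / RtoC (2 ^ k)))
        (fun j => pi_cot ((a + RtoC (INR (2 * j))) / (2 * RtoC (2 ^ k))))).
      rewrite (csum_ext (fun j => pi_cot (((a + 1) / 2 + RtoC (INR j)) / RtoC (2 ^ k)))
        (fun j => pi_cot ((a + RtoC (INR (2 * j + 1))) / (2 * RtoC (2 ^ k))))).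
      * field. apply RtoC_pow2_neq.
      * intros j _. f_equal. rewrite plus_INR, mult_INR, RtoC_plus, RtoC_mult.
        change (RtoC (INR 2)) with (RtoC 2). change (RtoC (INR 1)) with (RtoC 1).
        field. apply RtoC_pow2_neq.
      * intros j _. f_equal. rewrite mult_INR, RtoC_mult.
        change (RtoC (INR 2)) with (RtoC 2). field. apply RtoC_pow2_neq.
    + intros E. apply H. rewrite H1.
      replace (nome (a/2) * nome (a/2))%C with (- nome (a/2) * - nome (a/2))%C by ring.
      rewrite <- H2, E. ring.
    + intros E. apply H. rewrite H1, E. ring.
Qed.

(* The quotients [(exp z - 1) / z] and [(exp z - 1 - z) / z ^ 2], as power series. *)
Definition expq1 (z : C) : C := CS (fun k => z ^ k / RtoC (INR (fact (k + 1))))%C.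
Definition expq2 (z : C) : C := CS (fun k => z ^ k / RtoC (INR (fact (k + 2))))%C.

Lemma fact_le_add k j : INR (fact k) <= INR (fact (k + j)).
Proof. apply le_INR, fact_le. lia. Qed.

Lemma RtoC_fact_neq n : (RtoC (INR (fact n)) <> 0)%C.
Proof. apply RtoC_neq, Rgt_not_eq, INR_fact_pos. Qed.

Lemma expq_term_mod z k j :
  Cmod (z ^ k / RtoC (INR (fact (k + j))))%C <= Cmod z ^ k / INR (fact k).
Proof.
  rewrite Cmod_div, Cmod_pow, Cmod_RtoC_pos; [|left; apply INR_fact_pos|apply RtoC_fact_neq].
  apply Rmult_le_compat_l; [apply pow_le, Cmod_ge_0|].
  apply Rinv_le_contravar; [apply INR_fact_pos | apply fact_le_add].
Qed.

Lemma expq_asum z j : asum (fun k => z ^ k / RtoC (INR (fact (k + j))))%C.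
Proof.
  apply asum_le with (fun k => Cmod z ^ k / INR (fact k)).
  - intros; apply expq_term_mod.
  - apply ex_series_exp.
Qed.

Lemma expq_mod z j : Cmod (CS (fun k => z ^ k / RtoC (INR (fact (k + j)))))%C <= exp (Cmod z).
Proof.
  rewrite <- Series_exp. apply CS_mod_le; [intros; apply expq_term_mod | apply ex_series_exp].
Qed.

Lemma Cexp_expq1 z : Cexp z = (1 + z * expq1 z)%C.
Proof.
  rewrite <- CS_exp, (CS_S _ (asum_exp z)). unfold expq1.
  rewrite <- CS_scal by apply expq_asum. f_equal.
  - unfold exp_term. simpl. field.
  - apply CS_ext. intros n. unfold exp_term. rewrite Nat.add_1_r.
    rewrite Cpow_S. unfold Cdiv. ring.
Qed.

Lemma expq1_expq2 z : expq1 z = (1 + z * expq2 z)%C.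
Proof.
  unfold expq1 at 1. rewrite (CS_S _ (expq_asum z 1)). unfold expq2.
  rewrite <- CS_scal by apply expq_asum. f_equal.
  - simpl. field.
  - apply CS_ext. intros n. replace (S n + 1)%nat with (n + 2)%nat by lia.
    rewrite Cpow_S. unfold Cdiv. ring.
Qed.

Lemma Cpow_lipschitz z w r n : Cmod z <= r -> Cmod w <= r ->
  Cmod (z ^ n - w ^ n)%C <= INR n * r ^ (n - 1) * Cmod (z - w).
Proof.
  intros Hz Hw. assert (Hr : 0 <= r) by (pose proof (Cmod_ge_0 z); lra).
  induction n.
  - simpl. replace (1 - 1)%C with (RtoC 0) by ring. rewrite Cmod_0. lra.
  - replace (z ^ S n - w ^ S n)%C with (z * (z ^ n - w ^ n) + (z - w) * w ^ n)%C
      by (rewrite !Cpow_S; ring).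
    eapply Rle_trans; [apply Cmod_triangle|]. rewrite !Cmod_mult, Cmod_pow.
    replace (S n - 1)%nat with n by lia.
    assert (H1 : Cmod z * Cmod (z ^ n - w ^ n) <= r * (INR n * r ^ (n - 1) * Cmod (z - w)))
      by (apply Rmult_le_compat; auto using Cmod_ge_0).
    assert (H2 : Cmod (z - w) * Cmod w ^ n <= Cmod (z - w) * r ^ n).
    { apply Rmult_le_compat_l; [apply Cmod_ge_0|]. apply pow_incr.
      split; [apply Cmod_ge_0 | auto]. }
    assert (H3 : r * (INR n * r ^ (n - 1) * Cmod (z - w)) = INR n * r ^ n * Cmod (z - w)).
    { destruct n; [simpl; ring|]. replace (S n - 1)%nat with n by lia. simpl pow. ring. }
    rewrite S_INR. lra.
Qed.

Lemma expq_lipschitz z w r j : (1 <= j)%nat -> Cmod z <= r -> Cmod w <= r ->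
  Cmod (CS (fun k => z ^ k / RtoC (INR (fact (k + j)))) -
        CS (fun k => w ^ k / RtoC (INR (fact (k + j)))))%C <= Cmod (z - w) * exp r.
Proof.
  intros Hj Hz Hw. rewrite <- CS_minus by apply expq_asum.
  rewrite CS_S.
  2:{ apply (asum_ext (fun k => z ^ k / RtoC (INR (fact (k + j)))
        + (-(1)) * (w ^ k / RtoC (INR (fact (k + j)))))%C); [intros; ring|].
      apply asum_plus; [|apply asum_scal]; apply expq_asum. }
  simpl Cpow. match goal with |- Cmod (?x + _) <= _ => replace x with (RtoC 0) by ring end.
  rewrite Cplus_0_l, <- Series_exp, <- Series_scal_l.
  apply CS_mod_le; [|exact (ex_series_scal_l (Cmod (z - w)) _ (ex_series_exp r))].
  intros k.
  replace (z * z ^ k / INR (fact (S k + j)) - w * w ^ k / INR (fact (S k + j)))%C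
    with ((z ^ S k - w ^ S k) / RtoC (INR (fact (S k + j))))%C
    by (rewrite !Cpow_S; unfold Cdiv; ring).
  rewrite Cmod_div, Cmod_RtoC_pos; [|left; apply INR_fact_pos|apply RtoC_fact_neq].
  pose proof (Cpow_lipschitz z w r (S k) Hz Hw) as H.
  replace (S k - 1)%nat with k in H by lia.
  assert (Hf : INR (S k) * INR (fact k) <= INR (fact (S k + j))).
  { rewrite <- mult_INR. apply le_INR. change (fact (S k) <= fact (S k + j))%nat.
    apply fact_le. lia. }
  pose proof (INR_fact_pos k). pose proof (INR_fact_pos (S k + j)).
  pose proof (Cmod_ge_0 z) as Hz0. assert (0 <= r ^ k) by (apply pow_le; lra).
  pose proof (Cmod_ge_0 (z - w)).
  apply Rle_trans with (INR (S k) * r ^ k * Cmod (z - w) / INR (fact (S k + j))).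
  - apply Rmult_le_compat_r; auto. left; now apply Rinv_0_lt_compat.
  - apply Rle_div_l; auto.
    replace (Cmod (z - w) * (r ^ k / INR (fact k)) * INR (fact (S k + j)))
      with (Cmod (z - w) * r ^ k * (INR (fact (S k + j)) / INR (fact k))) by (field; lra).
    replace (INR (S k) * r ^ k * Cmod (z - w)) with (Cmod (z - w) * r ^ k * INR (S k)) by ring.
    apply Rmult_le_compat_l; [now apply Rmult_le_pos|].
    apply Rle_div_r; auto.
Qed.

Lemma sin_lower t : 0 <= t <= 2 -> t / 3 <= sin t.
Proof.
  intros Ht. destruct (pre_sin_bound t 0) as [H _]; [lra|lra|].
  unfold sin_approx, sin_term in H. simpl in H.
  apply Rle_trans with (2 := H). nra.
Qed.

Lemma exp_minus_1_lower x : -4 <= x -> exp (-4) * Rabs x <= Rabs (exp x - 1).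
Proof.
  intros Hx. pose proof (exp_pos (-4)).
  assert (H4 : exp (-4) <= 1).
  { rewrite <- exp_0. destruct (Rle_lt_or_eq_dec (-4) 0); [lra| |lra].
    left; apply exp_increasing; lra. }
  destruct (Rle_lt_dec 0 x) as [H0|H0].
  - pose proof (exp_ineq1_le x). rewrite !Rabs_pos_eq by lra. nra.
  - assert (Hm : exp (-4) <= exp x).
    { destruct (Rle_lt_or_eq_dec (-4) x Hx) as [h|h]; [left; now apply exp_increasing|rewrite h; lra]. }
    pose proof (exp_ineq1_le (- x)) as H1. rewrite exp_Ropp in H1.
    pose proof (exp_pos x) as Hp.
    assert (H2 : exp x * (1 + - x) <= 1).
    { apply Rmult_le_reg_l with (/ exp x); [now apply Rinv_0_lt_compat|].
      rewrite <- Rmult_assoc, Rinv_l by lra. lra. }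
    rewrite (Rabs_left x), (Rabs_left1 (exp x - 1)) by nra. nra.
Qed.

Definition cexp : R := exp (-4) / 6.

Lemma cexp_pos : 0 < cexp.
Proof. unfold cexp. pose proof (exp_pos (-4)). lra. Qed.

(** The radius 4 is below 2 pi, so 0 is the only zero of e^z - 1 in the disk. With z = x + i y the
    square of the modulus is (e^x - 1)^2 + 4 e^x sin^2 (y/2); the first summand is at least e^(-8)
    x^2, the second at least e^(-4) y^2 / 9, and [cexp] squared is e^(-8) / 36. *)
Lemma Cexp_minus_1_lower z : Cmod z <= 4 -> cexp * Cmod z <= Cmod (Cexp z - 1).
Proof.
  intros Hz.
  assert (Hx : -4 <= Re z <= 4) by (pose proof (re_le_Cmod z) as H; apply Rabs_le_between; lra).
  assert (Hy : Rabs (Im z) <= 4) by (pose proof (Im_le_Cmod z); lra).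
  set (x := Re z) in *. set (y := Im z) in *.
  pose proof (exp_pos (-4)) as Hc.
  apply Rsqr_incr_0; [|apply Rmult_le_pos; [left; apply cexp_pos | apply Cmod_ge_0]|apply Cmod_ge_0].
  rewrite Rsqr_mult, !Rsqr_pow2, !Cmod_sq. fold x y.
  assert (E : Re (Cexp z - 1)%C ^ 2 + Im (Cexp z - 1)%C ^ 2
    = (exp x - 1) ^ 2 + 4 * exp x * sin (Rabs y / 2) ^ 2).
  { assert (Ey : cos y = 1 - 2 * sin (Rabs y / 2) ^ 2).
    { transitivity (cos (2 * (Rabs y / 2))).
      - replace (2 * (Rabs y / 2)) with (Rabs y) by field.
        unfold Rabs. destruct (Rcase_abs y); [now rewrite cos_neg | reflexivity].
      - rewrite cos_2a_sin. ring. }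
    pose proof (sin2_cos2 y) as Hs. unfold Rsqr in Hs.
    simpl. fold x y.
    transitivity (exp x * exp x * (sin y * sin y + cos y * cos y) - 2 * exp x * cos y + 1); [ring|].
    rewrite Hs, Ey. ring. }
  rewrite E.
  pose proof (exp_minus_1_lower x (proj1 Hx)) as H1.
  pose proof (Rabs_pos y).
  pose proof (sin_lower (Rabs y / 2)) as H2.
  assert (H2' : Rabs y / 2 / 3 <= sin (Rabs y / 2)) by (apply H2; lra). clear H2.
  assert (Hm : exp (-4) <= exp x).
  { destruct (Rle_lt_or_eq_dec (-4) x (proj1 Hx)) as [h|h]; [left; now apply exp_increasing|rewrite h; lra]. }
  assert (H4 : exp (-4) <= 1).
  { rewrite <- exp_0. left; apply exp_increasing; lra. }
  assert (A1 : exp (-4) ^ 2 * x ^ 2 <= (exp x - 1) ^ 2).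
  { rewrite <- (pow2_abs x), <- (pow2_abs (exp x - 1)), <- Rpow_mult_distr.
    apply pow_incr. split; [|exact H1]. apply Rmult_le_pos; [lra | apply Rabs_pos]. }
  assert (A2 : (Rabs y / 6) ^ 2 <= sin (Rabs y / 2) ^ 2) by (apply pow_incr; lra).
  assert (A3 : 4 * exp (-4) * (Rabs y / 6) ^ 2 <= 4 * exp x * sin (Rabs y / 2) ^ 2).
  { apply Rmult_le_compat; try lra. apply pow2_ge_0. }
  replace ((Rabs y / 6) ^ 2) with (y ^ 2 / 36) in A3 by (rewrite <- (pow2_abs y); field).
  unfold cexp. pose proof (pow2_ge_0 x). pose proof (pow2_ge_0 y).
  assert (exp (-4) ^ 2 <= exp (-4)) by nra.
  assert (exp (-4) ^ 2 * y ^ 2 <= exp (-4) * y ^ 2) by (apply Rmult_le_compat_r; lra).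
  assert (0 <= exp (-4) ^ 2 * x ^ 2) by (apply Rmult_le_pos; [apply pow2_ge_0 | lra]).
  assert (0 <= exp (-4) * y ^ 2) by (apply Rmult_le_pos; lra).
  replace ((exp (-4) / 6) ^ 2) with (exp (-4) ^ 2 / 36) by field. lra.
Qed.

(** This is 1/(e^z - 1) - 1/z, the regular part at 0 and a generating function of Bernoulli numbers,
    written so that it makes sense at 0. *)
Definition bern (z : C) : C := (- expq2 z / expq1 z)%C.

Lemma expq1_lower (z : C) : z <> 0%C -> Cmod z <= 4 -> cexp <= Cmod (expq1 z).
Proof.
  intros H0 Hz. pose proof (Cexp_minus_1_lower z Hz) as H.
  rewrite Cexp_expq1 in H.
  replace (1 + z * expq1 z - 1)%C with (z * expq1 z)%C in H by ring.
  rewrite Cmod_mult in H. apply Cmod_gt_0 in H0. nra.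
Qed.

Lemma Cmod_pos_neq (z : C) c : 0 < c -> c <= Cmod z -> z <> 0%C.
Proof. intros Hc H. apply Cmod_gt_0. lra. Qed.

Definition lip_bern : R := 2 * exp 4 * exp 4 / (cexp * cexp).

Lemma bern_lipschitz (z w : C) : z <> 0%C -> w <> 0%C -> Cmod z <= 4 -> Cmod w <= 4 ->
  Cmod (bern z - bern w) <= lip_bern * Cmod (z - w).
Proof.
  intros Hz0 Hw0 Hz Hw. pose proof cexp_pos as Hc.
  pose proof (expq1_lower z Hz0 Hz) as Lz. pose proof (expq1_lower w Hw0 Hw) as Lw.
  pose proof (Cmod_pos_neq _ _ Hc Lz) as Nz. pose proof (Cmod_pos_neq _ _ Hc Lw) as Nw.
  unfold bern.
  replace (- expq2 z / expq1 z - - expq2 w / expq1 w)%C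
    with ((expq2 z * (expq1 z - expq1 w) - expq1 z * (expq2 z - expq2 w))
          / (expq1 z * expq1 w))%C by (field; auto).
  rewrite Cmod_div by now apply Cmult_neq_0. rewrite Cmod_mult.
  assert (E4 : forall t, Cmod t <= 4 -> exp (Cmod t) <= exp 4).
  { intros t Ht. destruct (Rle_lt_or_eq_dec _ _ Ht) as [h|h];
    [left; now apply exp_increasing | rewrite h; lra]. }
  assert (B1 : Cmod (expq2 z) <= exp 4) by (eapply Rle_trans; [apply expq_mod | auto]).
  assert (B2 : Cmod (expq1 z) <= exp 4) by (eapply Rle_trans; [apply expq_mod | auto]).
  assert (B3 : Cmod (expq1 z - expq1 w) <= Cmod (z - w) * exp 4)
    by (apply expq_lipschitz; auto).
  assert (B4 : Cmod (expq2 z - expq2 w) <= Cmod (z - w) * exp 4)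
    by (apply expq_lipschitz; auto).
  assert (Bn : Cmod (expq2 z * (expq1 z - expq1 w) - expq1 z * (expq2 z - expq2 w))
    <= 2 * exp 4 * exp 4 * Cmod (z - w)).
  { unfold Cminus at 1. eapply Rle_trans; [apply Cmod_triangle|].
    rewrite Cmod_opp, !Cmod_mult.
    assert (Cmod (expq2 z) * Cmod (expq1 z - expq1 w) <= exp 4 * (Cmod (z - w) * exp 4))
      by (apply Rmult_le_compat; auto using Cmod_ge_0).
    assert (Cmod (expq1 z) * Cmod (expq2 z - expq2 w) <= exp 4 * (Cmod (z - w) * exp 4))
      by (apply Rmult_le_compat; auto using Cmod_ge_0).
    lra. }
  assert (Bd : cexp * cexp <= Cmod (expq1 z) * Cmod (expq1 w))
    by (apply Rmult_le_compat; lra).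
  unfold lip_bern.
  replace (2 * exp 4 * exp 4 / (cexp * cexp) * Cmod (z - w))
    with (2 * exp 4 * exp 4 * Cmod (z - w) * / (cexp * cexp))
    by (unfold Rdiv; ring).
  assert (0 < cexp * cexp) by now apply Rmult_lt_0_compat.
  apply Rmult_le_compat; auto using Cmod_ge_0.
  - left; apply Rinv_0_lt_compat; lra.
  - now apply Rinv_le_contravar.
Qed.

Lemma pi_cot_bern (w : C) : w <> 0%C -> 2 * PI * Cmod w <= 4 ->
  pi_cot w = (/ w + RtoC PI * Ci + RtoC (2 * PI) * Ci * bern (RtoC (2 * PI) * Ci * w))%C.
Proof.
  intros Hw H. set (z := (RtoC (2 * PI) * Ci * w)%C).
  assert (Hz : Cmod z <= 4) by (unfold z; rewrite Cmod_mult, Cmod_two_pi_i; lra).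
  assert (Hz0 : z <> 0%C) by (apply Cmult_neq_0; [apply two_pi_i_neq_0 | auto]).
  pose proof (expq1_lower z Hz0 Hz) as Lz.
  pose proof (Cmod_pos_neq _ _ cexp_pos Lz) as Nz.
  assert (E2 : expq2 z = ((expq1 z - 1) / z)%C) by (rewrite (expq1_expq2 z) at 1; field; auto).
  unfold pi_cot, bern, nome. fold z. rewrite E2, Cexp_expq1.
  assert (Ew : (/ w = RtoC (2 * PI) * Ci / z)%C).
  { unfold z. pose proof two_pi_i_neq_0 as Hk. set (k := (RtoC (2 * PI) * Ci)%C) in *.
    field. auto. }
  rewrite Ew.
  rewrite RtoC_mult. field. repeat split; auto.
  replace (1 + z * expq1 z - 1)%C with (z * expq1 z)%C by ring. now apply Cmult_neq_0.
Qed.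

(** * Partial fractions of the cotangent *)

(** Machin-type formula with the arctangents of 1/3 and 1/7. The thirteen decimals also serve as the
    enclosure of [PI] in the fixed-point computation at the end. *)
Lemma PI_bounds : 3.1415926535897 < PI < 3.1415926535898.
Proof.
  pose proof (PI_2_3_7_ineq 7) as [H1 H2].
  cbn [sum_f_R0 Nat.mul Nat.add] in *.
  unfold tg_alt, PI_2_3_7_tg, Ratan_seq in *.
  cbn [Nat.mul Nat.add pow] in *.
  simpl INR in *. split; lra.
Qed.

(* [delta] bounds the distance from [a] to the integers from below. *)
Definition far (a : C) (delta : R) : Prop :=
  0 < delta /\ forall m : Z, delta <= Cmod (a + RtoC (IZR m)).

Lemma far_pos a e n : far a e -> e <= Cmod (a + RtoC (INR n)).
Proof. intros [_ H]. rewrite INR_IZR_INZ. apply H. Qed.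

Lemma far_neg a e n : far a e -> e <= Cmod (a - RtoC (INR n)).
Proof.
  intros [_ H]. specialize (H (- Z.of_nat n)%Z).
  rewrite opp_IZR, RtoC_opp, <- INR_IZR_INZ in H. exact H.
Qed.

Lemma far_0 a e : far a e -> e <= Cmod a.
Proof. intros H. apply far_pos with (n := O) in H. simpl in H. now rewrite Cplus_0_r in H. Qed.

Lemma far_Im a : 0 < Im a -> far a (Im a).
Proof.
  intros H. split; auto. intros m.
  pose proof (Im_le_Cmod (a + RtoC (IZR m))) as H1. simpl in H1. rewrite Rplus_0_r in H1.
  pose proof (Rle_abs (Im a)). unfold Im in *. lra.
Qed.

(** If |a + m| >= e then |m| <= |a + m| + |a| <= (1 + |a|/e) |a + m|. This factor therefore turns
    the distance [e] from the integers into the decay 1/|m| of 1/(a + m). *)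
Definition Kfar (a : C) (e : R) : R := 1 + Cmod a / e.

Lemma Kfar_ge_1 a e : far a e -> 1 <= Kfar a e.
Proof.
  intros [He _]. unfold Kfar. pose proof (Cmod_ge_0 a).
  assert (0 <= Cmod a / e) by (apply Rmult_le_pos; [auto | left; now apply Rinv_0_lt_compat]). lra.
Qed.

Lemma far_mod_bound a e (x y : R) : 0 < e -> e <= x -> y <= x + Cmod a -> y <= Kfar a e * x.
Proof.
  intros He Hx Hy. unfold Kfar.
  assert (Cmod a <= Cmod a / e * x).
  { replace (Cmod a) with (Cmod a / e * e) at 1 by (field; lra).
    apply Rmult_le_compat_l; auto. apply Rmult_le_pos; [apply Cmod_ge_0 | left; now apply Rinv_0_lt_compat]. }
  lra.
Qed.

Lemma far_inv_pos a e i : far a e ->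
  Cmod (/ (a + RtoC (INR (S i))))%C <= Kfar a e / INR (S i).
Proof.
  intros H. pose proof (far_pos a e (S i) H) as H1. destruct H as [He _].
  assert (Hi : 0 < INR (S i)) by (apply lt_0_INR; lia).
  rewrite Cmod_inv by (apply Cmod_gt_0; lra).
  apply Rle_div_r; auto. rewrite Rmult_comm.
  apply Rle_div_l; [lra|].
  apply far_mod_bound; auto.
  pose proof (Cmod_triangle (a + RtoC (INR (S i))) (- a)) as H2.
  replace (a + RtoC (INR (S i)) + - a)%C with (RtoC (INR (S i))) in H2 by ring.
  rewrite Cmod_opp, Cmod_RtoC_pos in H2 by lra. lra.
Qed.

Lemma far_inv_neg a e i : far a e ->
  Cmod (/ (a - RtoC (INR (S i))))%C <= Kfar a e / INR (S i).
Proof.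
  intros H. pose proof (far_neg a e (S i) H) as H1. destruct H as [He _].
  assert (Hi : 0 < INR (S i)) by (apply lt_0_INR; lia).
  rewrite Cmod_inv by (apply Cmod_gt_0; lra).
  apply Rle_div_r; auto. rewrite Rmult_comm.
  apply Rle_div_l; [lra|].
  apply far_mod_bound; auto.
  pose proof (Cmod_triangle (a - (a - RtoC (INR (S i)))) (a - RtoC (INR (S i)))) as H2.
  pose proof (Cmod_triangle a (- (a - RtoC (INR (S i))))) as H3.
  replace (a + - (a - RtoC (INR (S i))))%C with (RtoC (INR (S i))) in H3 by ring.
  rewrite Cmod_opp, Cmod_RtoC_pos in H3 by lra. lra.
Qed.

Lemma ex_series_inv_sq : ex_series (fun i => / INR (S i) ^ 2).
Proof.
  apply ex_series_bounded with 2.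
  { intros k. left. apply Rinv_0_lt_compat, pow_lt, lt_0_INR. lia. }
  assert (H : forall n, rsum (fun i => / INR (S i) ^ 2) (S n) <= 2 - / INR (S n)).
  { induction n; [simpl; lra|]. cbn [rsum] in *.
    assert (H : / INR (S (S n)) ^ 2 <= / INR (S n) - / INR (S (S n))); [|lra].
    rewrite (S_INR (S n)).
    assert (0 < INR (S n)) by (apply lt_0_INR; lia). set (x := INR (S n)) in *.
    replace (/ x - / (x + 1)) with (/ (x * (x + 1))) by (field; lra).
    apply Rinv_le_contravar; nra. }
  intros [|n]; [simpl; lra|]. eapply Rle_trans; [apply H|].
  assert (0 < / INR (S n)) by (apply Rinv_0_lt_compat, lt_0_INR; lia). lra.
Qed.

Definition pair_inv (k : nat) (a : C) (i : nat) : C :=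
  (/ (a + RtoC (INR (S i))) ^ k + / (a - RtoC (INR (S i))) ^ k)%C.

(* For [k >= 1] and [a] not an integer, the sum of [1 / (a + m) ^ k] over all integers [m]. *)
Definition Sk (k : nat) (a : C) : C := (/ a ^ k + CS (pair_inv k a))%C.

Definition Kpair (a : C) (e : R) : R := (2 * Cmod a + 2 * e) * Kfar a e ^ 2.

Lemma inv_pow_mod (z : C) k : z <> 0%C -> Cmod (/ z ^ k)%C = (/ Cmod z) ^ k.
Proof. intros H. rewrite Cmod_inv by now apply Cpow_nz. rewrite Cmod_pow. now rewrite pow_inv. Qed.

Lemma inv_pow_bound (z : C) e K x k : 0 < e -> 0 < x -> e <= Cmod z ->
  Cmod (/ z)%C <= K / x -> Cmod (/ z ^ S (S k))%C <= e * (K ^ 2 / x ^ 2) * (/ e) ^ S k.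
Proof.
  intros He Hx Hz HK.
  assert (Hz0 : z <> 0%C) by (apply Cmod_gt_0; lra).
  rewrite Cmod_inv in HK by auto.
  rewrite inv_pow_mod by auto.
  assert (H0 : 0 < / Cmod z) by (apply Rinv_0_lt_compat; lra).
  replace ((/ Cmod z) ^ S (S k)) with ((/ Cmod z) ^ 2 * (/ Cmod z) ^ k) by (simpl; ring).
  replace (e * (K ^ 2 / x ^ 2) * (/ e) ^ S k) with ((K / x) ^ 2 * (/ e) ^ k)
    by (simpl; field; split; lra).
  apply Rmult_le_compat; try (apply pow_le; lra).
  - apply pow_incr; lra.
  - apply pow_incr. split; [lra|]. apply Rinv_le_contravar; lra.
Qed.

(** For [k = 0] the two terms combine to 2 a / (a^2 - m^2), which is where the part 2|a| of [Kpair]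
    comes from; for larger [k] each term alone decays like 1/m^2. The geometric dependence on [k] is
    what later gives convergence of the expansion in a shift [h]. *)
Lemma pair_inv_bound a e k i : far a e ->
  Cmod (pair_inv (S k) a i) <= Kpair a e * (/ e) ^ k * / INR (S i) ^ 2.
Proof.
  intros H. pose proof (far_inv_pos a e i H) as Hp. pose proof (far_inv_neg a e i H) as Hm.
  pose proof (far_pos a e (S i) H) as Lp. pose proof (far_neg a e (S i) H) as Lm.
  pose proof (Kfar_ge_1 a e H) as HK. destruct H as [He _].
  assert (Hx : 0 < INR (S i)) by (apply lt_0_INR; lia).
  unfold pair_inv, Kpair. set (x := INR (S i)) in *. set (K := Kfar a e) in *.
  assert (Np : (a + RtoC x <> 0)%C) by (apply Cmod_gt_0; lra).
  assert (Nm : (a - RtoC x <> 0)%C) by (apply Cmod_gt_0; lra).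
  assert (HKx : 0 < K / x) by (apply Rdiv_lt_0_compat; lra).
  assert (Hsq : 0 < K ^ 2 / x ^ 2) by (apply Rdiv_lt_0_compat; apply pow_lt; lra).
  pose proof (Cmod_ge_0 a) as Ha.
  destruct k.
  - rewrite !Cpow_1_r.
    replace (/ (a + RtoC x) + / (a - RtoC x))%C with (2 * a * (/ (a + RtoC x) * / (a - RtoC x)))%C
      by (field; auto).
    rewrite !Cmod_mult, Cmod_RtoC_pos by lra.
    apply Rle_trans with (2 * Cmod a * (K / x * (K / x))).
    + apply Rmult_le_compat_l; [lra|]. apply Rmult_le_compat; auto using Cmod_ge_0.
    + replace ((2 * Cmod a + 2 * e) * K ^ 2 * (/ e) ^ 0 * / x ^ 2)
        with (2 * Cmod a * (K / x * (K / x)) + 2 * e * (K ^ 2 / x ^ 2)) by (simpl; field; lra).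
      assert (0 < e * (K ^ 2 / x ^ 2)) by now apply Rmult_lt_0_compat. lra.
  - eapply Rle_trans; [apply Cmod_triangle|].
    pose proof (inv_pow_bound _ e K x k He Hx Lp Hp).
    pose proof (inv_pow_bound _ e K x k He Hx Lm Hm).
    replace ((2 * Cmod a + 2 * e) * K ^ 2 * (/ e) ^ S k * / x ^ 2)
      with (2 * Cmod a * (K ^ 2 / x ^ 2) * (/ e) ^ S k
        + 2 * (e * (K ^ 2 / x ^ 2) * (/ e) ^ S k)) by (simpl; field; lra).
    assert (0 <= 2 * Cmod a * (K ^ 2 / x ^ 2) * (/ e) ^ S k).
    { apply Rmult_le_pos; [apply Rmult_le_pos; lra|].
      apply pow_le. left; now apply Rinv_0_lt_compat. }
    lra.
Qed.

Lemma asum_pair_inv a e k : far a e -> asum (pair_inv (S k) a).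
Proof.
  intros H. apply asum_le with (fun i => Kpair a e * (/ e) ^ k * / INR (S i) ^ 2).
  - intros i. now apply pair_inv_bound.
  - exact (ex_series_scal_l (Kpair a e * (/ e) ^ k) _ ex_series_inv_sq).
Qed.

Lemma csum_S_l (f : nat -> C) n : csum f (S n) = (f O + csum (fun k => f (S k)) n)%C.
Proof. induction n; [simpl; ring|]. change (csum f (S (S n))) with (csum f (S n) + f (S n))%C.
  rewrite IHn. simpl. ring. Qed.

Lemma csum_rev (s : R -> C) n :
  csum (fun j => s (INR n - INR j)) n = csum (fun i => s (INR (S i))) n.
Proof.
  induction n; [reflexivity|]. rewrite csum_S_l.
  change (csum (fun i => s (INR (S i))) (S n)) with
    (csum (fun i => s (INR (S i))) n + s (INR (S n)))%C.
  rewrite <- IHn, Cplus_comm. f_equal.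
  - apply csum_ext. intros k _. f_equal. rewrite !S_INR. ring.
  - f_equal. change (INR 0) with 0. ring.
Qed.

(** The window of 2 M points runs from M down to -(M - 1): it contains M but not -M, hence the
    correction [- s (INR M)]. *)
Lemma csum_symmetric (s : R -> C) M : (forall x, s (- x) = s x) ->
  csum (fun j => s (INR M - INR j)) (2 * M)
  = (2 * csum (fun i => s (INR (S i))) M + s 0 - s (INR M))%C.
Proof.
  intros Hs. replace (2 * M)%nat with (M + M)%nat by lia.
  rewrite csum_add, csum_rev.
  rewrite (csum_ext (fun k => s (INR M - INR (M + k))) (fun k => s (INR k))).
  2:{ intros k _. rewrite <- Hs. f_equal. rewrite plus_INR. ring. }
  pose proof (csum_S_l (fun k => s (INR k)) M) as H.
  change (csum (fun k => s (INR k)) (S M)) with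
    (csum (fun k => s (INR k)) M + s (INR M))%C in H.

  replace (csum (fun k => s (INR k)) M)
    with (csum (fun k => s (INR k)) M + s (INR M) - s (INR M))%C by ring.
  rewrite H. change (INR 0) with 0. ring.
Qed.

Lemma csum_telescope_bound (f g : nat -> C) n B :
  (forall k, (k < n)%nat -> Cmod (f k - g k) <= B) ->
  Cmod (csum f n - csum g n) <= INR n * B.
Proof.
  intros H. rewrite <- rsum_const.
  replace (csum f n - csum g n)%C with (csum (fun k => f k - g k)%C n).
  - eapply Rle_trans; [apply csum_mod|]. now apply rsum_le.
  - clear. induction n; simpl; [ring|]. rewrite IHn. ring.
Qed.

Lemma nome_minus_INR a n : nome (a - RtoC (INR n)) = nome a.
Proof.
  replace (a - RtoC (INR n))%C with (a + RtoC (IZR (- Z.of_nat n)))%C.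
  - apply nome_shift.
  - rewrite opp_IZR, RtoC_opp, <- INR_IZR_INZ. reflexivity.
Qed.

Lemma pi_cot_centered a k : nome a <> 1%C ->
  pi_cot a = (csum (fun j => pi_cot ((a - RtoC (INR (2 ^ k)) + RtoC (INR j)) / RtoC (2 ^ S k)))
    (2 ^ S k) / RtoC (2 ^ S k))%C.
Proof.
  intros H. rewrite <- pi_cot_multiplication by now rewrite nome_minus_INR.
  unfold pi_cot. now rewrite nome_minus_INR.
Qed.

Lemma lip_bern_pos : 0 < lip_bern.
Proof.
  unfold lip_bern. pose proof cexp_pos. pose proof (exp_pos 4).
  apply Rdiv_lt_0_compat; [|now apply Rmult_lt_0_compat].
  repeat apply Rmult_lt_0_compat; lra.
Qed.

(** After the pole 1/u is removed the cotangent is Lipschitz near 0. The radius 5/8 satisfies 2 pi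
    (5/8) < 4, as [bern_lipschitz] requires, and 49 exceeds (2 pi)^2. *)
Lemma pi_cot_diff u v : u <> RtoC 0 -> v <> RtoC 0 -> Cmod u <= 5 / 8 -> Cmod v <= 5 / 8 ->
  Cmod (pi_cot u - pi_cot v - (/ u - / v)) <= 49 * lip_bern * Cmod (u - v).
Proof.
  intros Hu Hv Bu Bv. pose proof PI_bounds as HP.
  assert (Cu : 2 * PI * Cmod u <= 4) by (pose proof (Cmod_ge_0 u); nra).
  assert (Cv : 2 * PI * Cmod v <= 4) by (pose proof (Cmod_ge_0 v); nra).
  rewrite (pi_cot_bern u), (pi_cot_bern v) by auto.
  set (k := (RtoC (2 * PI) * Ci)%C).
  replace (/ u + PI * Ci + k * bern (k * u) - (/ v + PI * Ci + k * bern (k * v)) - (/ u - / v))%C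
    with (k * (bern (k * u) - bern (k * v)))%C by ring.
  assert (Ek : Cmod k = 2 * PI) by apply Cmod_two_pi_i.
  assert (Nk : k <> RtoC 0) by apply two_pi_i_neq_0.
  rewrite Cmod_mult.
  assert (H : Cmod (bern (k * u) - bern (k * v)) <= lip_bern * Cmod (k * u - k * v)).
  { apply bern_lipschitz; try (apply Cmult_neq_0; auto); rewrite Cmod_mult, Ek; lra. }
  replace (k * u - k * v)%C with (k * (u - v))%C in H by ring.
  rewrite Cmod_mult, Ek in H. rewrite Ek.
  assert (0 <= lip_bern * Cmod (u - v))
    by (apply Rmult_le_pos; [left; apply lip_bern_pos | apply Cmod_ge_0]).
  apply Rle_trans with (2 * PI * (2 * PI) * (lip_bern * Cmod (u - v))).
  - replace (2 * PI * (2 * PI) * (lip_bern * Cmod (u - v)))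
      with (2 * PI * (lip_bern * (2 * PI * Cmod (u - v)))) by ring.
    apply Rmult_le_compat_l; lra.
  - rewrite (Rmult_assoc 49). apply Rmult_le_compat_r; auto. nra.
Qed.

Lemma far_opp a e : far a e -> far (- a) e.
Proof.
  intros [He H]. split; auto. intros m. specialize (H (- m)%Z).
  rewrite <- Cmod_opp. replace (- (- a + RtoC (IZR m)))%C with (a + RtoC (IZR (- m)))%C; auto.
  rewrite opp_IZR, RtoC_opp. ring.
Qed.

Lemma far_centered a e M j : far a e -> (a - RtoC (INR M) + RtoC (INR j) <> 0)%C.
Proof.
  intros [He H]. specialize (H (Z.of_nat j - Z.of_nat M)%Z).
  rewrite minus_IZR, <- !INR_IZR_INZ, RtoC_minus in H.
  replace (a - RtoC (INR M) + RtoC (INR j))%C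
    with (a + (RtoC (INR j) - RtoC (INR M)))%C by ring.
  apply Cmod_gt_0. lra.
Qed.

Lemma pow2_INR k : INR (2 ^ k) = 2 ^ k.
Proof. rewrite pow_INR. reflexivity. Qed.

(** The multiplication formula is applied at [a] and at [-a], and the two are subtracted by oddness.
    The poles of the 2^(k+1) differences add up to the symmetric partial sum of the 1/(a + m); the
    regular parts enter only through differences at points 2|a| / 2^(k+1) apart, and the average of
    these is O(2^(-k)). *)
Lemma pi_cot_partial a e k : far a e -> nome a <> 1%C -> 4 * Cmod a <= 2 ^ k ->
  Cmod (csum (pair_inv 1 a) (2 ^ k) - (pi_cot a - / a))
  <= (49 * lip_bern * Cmod a + Kpair a e) / 2 ^ k.
Proof.
  intros Hf Hn Hk.
  assert (HM : 0 < 2 ^ k) by (apply pow_lt; lra).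
  assert (HM1 : 1 <= 2 ^ k) by (apply pow_R1_Rle; lra).
  assert (HN : (2 ^ S k = 2 * 2 ^ k)%nat) by reflexivity.
  assert (HNr : 2 ^ S k = 2 * 2 ^ k) by reflexivity.
  set (M := (2 ^ k)%nat) in *.
  assert (EM : INR M = 2 ^ k) by apply pow2_INR.
  pose proof (pi_cot_centered a k Hn) as E1.
  assert (Hn' : nome (- a) <> 1%C).
  { rewrite nome_opp. intros E. apply Hn. rewrite <- (Cinv_r (nome a)) by apply nome_neq_0.
    rewrite E. ring. }
  pose proof (pi_cot_centered (- a)%C k Hn') as E2.
  rewrite pi_cot_opp in E2 by auto. fold M in E1, E2.
  set (N := RtoC (2 ^ S k)) in *.
  assert (HNC : N <> RtoC 0) by apply RtoC_pow2_neq.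
  set (u := fun j => ((a - RtoC (INR M) + RtoC (INR j)) / N)%C) in *.
  set (v := fun j => ((- a - RtoC (INR M) + RtoC (INR j)) / N)%C) in *.
  change (fun j => pi_cot ((a - RtoC (INR M) + RtoC (INR j)) / N)) with (fun j => pi_cot (u j)) in E1.
  change (fun j => pi_cot ((- a - RtoC (INR M) + RtoC (INR j)) / N)) with (fun j => pi_cot (v j)) in E2.
  set (s := fun x : R => (/ (a + RtoC x) + / (a - RtoC x))%C).
  assert (Es : csum (fun j => s (INR M - INR j)) (2 * M)
    = (csum (fun j => / u j - / v j) (2 ^ S k) / N)%C).
  { rewrite HN. unfold Cdiv. rewrite Cmult_comm, <- csum_scal. apply csum_ext.
    intros j _. unfold s, u, v.
    pose proof (far_centered a e M j Hf) as F1.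
    pose proof (far_centered (- a) e M j (far_opp _ _ Hf)) as F2.
    replace (a + RtoC (INR M - INR j))%C with (- (- a - RtoC (INR M) + RtoC (INR j)))%C
      by (rewrite RtoC_minus; ring).
    replace (a - RtoC (INR M - INR j))%C with (a - RtoC (INR M) + RtoC (INR j))%C
      by (rewrite RtoC_minus; ring).
    set (A := (a - RtoC (INR M) + RtoC (INR j))%C) in *.
    set (B := (- a - RtoC (INR M) + RtoC (INR j))%C) in *.
    field. auto. }
  rewrite csum_symmetric in Es.
  2:{ intros x. unfold s. rewrite RtoC_opp.
      replace (a + - x)%C with (a - x)%C by ring. replace (a - - x)%C with (a + x)%C by ring. ring. }
  assert (Ep : csum (fun i => s (INR (S i))) M = csum (pair_inv 1 a) M).
  { apply csum_ext. intros i _. unfold s, pair_inv. now rewrite !Cpow_1_r. }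
  rewrite Ep in Es. clear Ep.
  assert (Es0 : s 0 = (2 * / a)%C).
  { unfold s. replace (a + 0)%C with a by ring. replace (a - 0)%C with a by ring. ring. }
  rewrite Es0 in Es. clear Es0.
  assert (HsM : Cmod (s (INR M)) <= Kpair a e / 2 ^ k).
  { assert (HMpos : (0 < M)%nat) by (apply INR_lt; simpl; lra).
    destruct M as [|M'] eqn:EM'; [lia|].
    pose proof (pair_inv_bound a e 0 M' Hf) as Hb. unfold pair_inv in Hb.
    rewrite !Cpow_1_r in Hb. unfold s. eapply Rle_trans; [apply Hb|].
    rewrite EM. simpl (_ ^ 0). rewrite Rmult_1_r.
    assert (HK : 0 <= Kpair a e).
    { unfold Kpair. destruct Hf as [He _]. pose proof (Cmod_ge_0 a).
      apply Rmult_le_pos; [lra | apply pow2_ge_0]. }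
    apply Rmult_le_compat_l; auto. apply Rinv_le_contravar; auto. nra. }
  assert (Hc : csum (fun j => pi_cot (u j)) (2 ^ S k) = (N * pi_cot a)%C)
    by (rewrite E1; field; auto).
  assert (Hc' : csum (fun j => pi_cot (v j)) (2 ^ S k) = (- (N * pi_cot a))%C)
    by (replace (- (N * pi_cot a))%C with (N * (- pi_cot a))%C by ring; rewrite E2; field; auto).
  assert (Hd : csum (fun j => / u j - / v j)%C (2 ^ S k) =
     (N * (2 * csum (pair_inv 1 a) M + 2 * / a - s (INR M)))%C)
    by (rewrite Es; field; auto).
  pose proof (csum_telescope_bound (fun j => pi_cot (u j) + (-(1)) * pi_cot (v j))%C
    (fun j => / u j - / v j)%C (2 ^ S k) (49 * lip_bern * (2 * Cmod a / 2 ^ S k))) as Hb.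
  assert (Hfe : 0 < e) by apply Hf.
  assert (Hmod : Cmod N = 2 ^ S k) by (apply Cmod_RtoC_pos; lra).
  (* The numerator is at most |a| + 2^k <= (5/4) 2^k and the denominator is 2^(k+1); this is what
     the hypothesis 4|a| <= 2^k is for. *)
  assert (Hjb : forall z (j : nat), Cmod z = Cmod a -> (j < 2 ^ S k)%nat ->
     Cmod ((z - RtoC (INR M) + RtoC (INR j)) / N) <= 5 / 8).
  { intros z j Hz Hj. rewrite Cmod_div, Hmod by auto. apply Rle_div_l; [lra|].
    replace (z - RtoC (INR M) + RtoC (INR j))%C with (z + RtoC (INR j - INR M))%C
      by (rewrite RtoC_minus; ring).
    eapply Rle_trans; [apply Cmod_triangle|]. rewrite Cmod_R, Hz, EM.
    apply lt_INR in Hj. rewrite HN, mult_INR, EM in Hj. simpl (INR 2) in Hj.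
    pose proof (pos_INR j).
    assert (Rabs (INR j - 2 ^ k) <= 2 ^ k) by (apply Rabs_le; lra). lra. }
  assert (Hb' : forall j, (j < 2 ^ S k)%nat ->
    Cmod (pi_cot (u j) + (-(1)) * pi_cot (v j) - (/ u j - / v j))
    <= 49 * lip_bern * (2 * Cmod a / 2 ^ S k)).
  { intros j Hj.
    replace (pi_cot (u j) + (-(1)) * pi_cot (v j) - (/ u j - / v j))%C
      with (pi_cot (u j) - pi_cot (v j) - (/ u j - / v j))%C by ring.
    replace (2 * Cmod a / 2 ^ S k) with (Cmod (u j - v j)).
    - apply pi_cot_diff.
      + unfold u, Cdiv. apply Cmult_neq_0; [now apply far_centered with e|].
        intros E. apply HNC. replace N with (N * N * / N)%C by (field; auto). rewrite E. ring.
      + unfold v, Cdiv. apply Cmult_neq_0; [now apply far_centered with e, far_opp|].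
        intros E. apply HNC. replace N with (N * N * / N)%C by (field; auto). rewrite E. ring.
      + apply Hjb; auto.
      + apply Hjb; auto. apply Cmod_opp.
    - replace (u j - v j)%C with (2 * a / N)%C by (unfold u, v; field; auto).
      rewrite Cmod_div, Hmod, Cmod_mult, Cmod_RtoC_pos by (auto; lra). reflexivity. }
  assert (Na : a <> RtoC 0) by (apply Cmod_gt_0; pose proof (far_0 a e Hf); lra).
  specialize (Hb Hb').
  rewrite csum_plus, csum_scal, Hc, Hc', Hd, pow2_INR in Hb.
  replace (N * pi_cot a + - (1) * - (N * pi_cot a)
       - N * (2 * csum (pair_inv 1 a) M + 2 * / a - s (INR M)))%C
    with (2 * N * ((pi_cot a - / a - csum (pair_inv 1 a) M) + / 2 * s (INR M)))%C in Hb by (field; auto).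
  rewrite Cmod_mult, Cmod_mult, Hmod, Cmod_RtoC_pos in Hb by lra.
  assert (Hb2 : Cmod (pi_cot a - / a - csum (pair_inv 1 a) M + / 2 * s (INR M))
    <= 49 * lip_bern * Cmod a / 2 ^ k).
  { apply Rmult_le_reg_l with (2 * 2 ^ S k); [lra|].
    eapply Rle_trans; [apply Hb|]. rewrite HNr.
    assert (0 <= lip_bern * Cmod a)
      by (apply Rmult_le_pos; [left; apply lip_bern_pos | apply Cmod_ge_0]).
    replace (2 * 2 ^ k * (49 * lip_bern * (2 * Cmod a / (2 * 2 ^ k))))
      with (98 * (lip_bern * Cmod a)) by (field; lra).
    replace (2 * (2 * 2 ^ k) * (49 * lip_bern * Cmod a / 2 ^ k))
      with (196 * (lip_bern * Cmod a)) by (field; lra). lra. }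
  rewrite Cmod_minus_sym.
  replace (pi_cot a - / a - csum (pair_inv 1 a) M)%C with
    ((pi_cot a - / a - csum (pair_inv 1 a) M + / 2 * s (INR M)) + - (/ 2 * s (INR M)))%C by ring.
  eapply Rle_trans; [apply Cmod_triangle|].
  assert (E2' : Cmod (/ RtoC 2) = / 2) by (rewrite <- RtoC_inv, Cmod_RtoC_pos by lra; reflexivity).
  rewrite Cmod_opp, (Cmod_mult (/ RtoC 2)), E2'.
  pose proof (Cmod_ge_0 (s (INR M))). rewrite Rdiv_plus_distr.
  apply Rplus_le_compat; [exact Hb2 | lra].
Qed.

Lemma is_lim_div_pow2 K j : is_lim_seq (fun n => K / 2 ^ (n + j)) 0.
Proof.
  apply is_lim_seq_ext with (fun n => K * / 2 ^ j * (/ 2) ^ n).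
  - intros n. rewrite pow_add, pow_inv. field. split; apply pow_nonzero; lra.
  - replace (Finite 0) with (Finite (K * / 2 ^ j * 0)) by (f_equal; ring).
    apply is_lim_seq_mult'; [apply is_lim_seq_const|].
    apply is_lim_seq_geom. rewrite Rabs_pos_eq; lra.
Qed.

Lemma pow2_ge n : INR n <= 2 ^ n.
Proof.
  induction n; [simpl; lra|]. rewrite S_INR. simpl.
  assert (1 <= 2 ^ n) by (apply pow_R1_Rle; lra). lra.
Qed.

Theorem pi_cot_series a e : far a e -> nome a <> 1%C -> pi_cot a = Sk 1 a.
Proof.
  intros Hf Hn. unfold Sk. rewrite Cpow_1_r.
  destruct (INR_unbounded (4 * Cmod a)) as [k0 Hk0].
  assert (E : CS (pair_inv 1 a) = (pi_cot a - / a)%C).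
  { apply CS_unique with (fun k => (2 ^ (k + k0))%nat).
    - intros n. apply INR_le. rewrite pow2_INR. eapply Rle_trans; [|apply pow2_ge].
      apply le_INR; lia.
    - now apply asum_pair_inv with e.
    - apply cvC_le with (fun k => (49 * lip_bern * Cmod a + Kpair a e) / 2 ^ (k + k0)).
      + intros k. apply pi_cot_partial; auto.
        pose proof (pow2_ge (k + k0)). assert (INR k0 <= INR (k + k0)) by (apply le_INR; lia). lra.
      + apply is_lim_div_pow2. }
  rewrite E. ring.
Qed.

(** * Lipschitz's formula *)

Lemma ex_series_geom_pos r : 0 <= r < 1 -> ex_series (fun n => r ^ n).
Proof. intros H. apply ex_series_geom. rewrite Rabs_pos_eq; lra. Qed.

Lemma asum_geom z : Cmod z < 1 -> asum (fun k => z ^ k)%C.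
Proof.
  intros H. apply asum_le with (fun k => Cmod z ^ k).
  - intros; rewrite Cmod_pow; lra.
  - apply ex_series_geom_pos. split; [apply Cmod_ge_0 | auto].
Qed.

Lemma Cmod_lt_1_neq z : Cmod z < 1 -> (1 - z <> 0)%C.
Proof.
  intros H. apply Cminus_neq_0. intros E. rewrite <- E, Cmod_1 in H. lra.
Qed.

Lemma CS_geom z : Cmod z < 1 -> CS (fun k => z ^ k)%C = (/ (1 - z))%C.
Proof.
  intros H. pose proof (asum_geom z H) as A. pose proof (Cmod_lt_1_neq z H).
  pose proof (CS_S _ A) as E.
  assert (E2 : CS (fun k => z ^ S k)%C = (z * CS (fun k => z ^ k))%C).
  { rewrite <- CS_scal by auto. apply CS_ext. intros; apply Cpow_S. }
  cbv beta in E; rewrite E2 in E. set (x := CS (fun k => z ^ k)%C) in *. simpl in E.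
  replace x with (x * (1 - z) / (1 - z))%C by (field; auto).
  replace (x * (1 - z))%C with (x - z * x)%C by ring.
  rewrite E at 1. field. auto.
Qed.

Lemma inv_expand (z : C) (h : R) : Rabs h < Cmod z ->
  (/ (z + RtoC h))%C = CS (fun k => RtoC (h ^ k) * ((-(1)) ^ k * / z ^ S k))%C
  /\ asum (fun k => RtoC (h ^ k) * ((-(1)) ^ k * / z ^ S k))%C.
Proof.
  intros H. pose proof (Rabs_pos h) as H0.
  assert (Hz : z <> RtoC 0) by (apply Cmod_gt_0; lra).
  assert (Hw : Cmod (- RtoC h / z) < 1).
  { rewrite Cmod_div, Cmod_opp, Cmod_R by auto. apply Rlt_div_l; lra. }
  assert (Ef : forall k, (/ z * (- RtoC h / z) ^ k)%C = (RtoC (h ^ k) * ((-(1)) ^ k * / z ^ S k))%C).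
  { intros k. unfold Cdiv. replace (- RtoC h * / z)%C with (-(1) * (RtoC h * / z))%C by ring.
    rewrite !Cpow_mult_l, RtoC_pow, Cpow_inv, Cpow_S by auto.
    field. split; auto. now apply Cpow_nz. }
  assert (A : asum (fun k => / z * (- RtoC h / z) ^ k)%C) by now apply asum_scal, asum_geom.
  split.
  - rewrite <- (CS_ext _ _ Ef), CS_scal, CS_geom by (auto using asum_geom).
    assert (Hzh : (z + RtoC h <> 0)%C).
    { intros E. apply (Cmod_lt_1_neq _ Hw).
      replace (1 - - RtoC h / z)%C with ((z + RtoC h) / z)%C by (field; auto).
      rewrite E. unfold Cdiv. ring. }
    assert (Hzh' : (z - - RtoC h <> 0)%C)
      by (replace (z - - RtoC h)%C with (z + RtoC h)%C by ring; auto).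
    field. auto.
  - apply asum_ext with (1 := Ef). exact A.
Qed.

Lemma pow_half_bound h e k : 0 < e -> Rabs h <= e / 2 -> Rabs h ^ k * (/ e) ^ k <= (/ 2) ^ k.
Proof.
  intros He Hh. rewrite <- Rpow_mult_distr. apply pow_incr. split.
  - apply Rmult_le_pos; [apply Rabs_pos | left; now apply Rinv_0_lt_compat].
  - apply (Rmult_le_reg_r e); auto. rewrite Rmult_assoc, Rinv_l by lra. lra.
Qed.

Lemma Cmod_m1_pow k : Cmod ((-(1)) ^ k)%C = 1.
Proof. rewrite Cmod_pow, Cmod_m1. apply pow1. Qed.

Lemma Kpair_pos a e : far a e -> 0 <= Kpair a e.
Proof.
  intros [He _]. unfold Kpair. pose proof (Cmod_ge_0 a).
  apply Rmult_le_pos; [lra | apply pow2_ge_0].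
Qed.

Lemma far_inv_0 a e : far a e -> Cmod (/ a)%C <= / e.
Proof.
  intros H. pose proof (far_0 a e H). destruct H as [He _].
  rewrite Cmod_inv by (apply Cmod_gt_0; lra). apply Rinv_le_contravar; auto.
Qed.

Lemma ex_series_half : ex_series (fun k => (/ 2) ^ k).
Proof. apply ex_series_geom_pos; lra. Qed.

Lemma Sk_mod a e k : far a e ->
  Cmod (Sk (S k) a) <= (/ e + Kpair a e * Series (fun i => / INR (S i) ^ 2)) * (/ e) ^ k.
Proof.
  intros H. unfold Sk. eapply Rle_trans; [apply Cmod_triangle|].
  pose proof (far_inv_0 a e H) as H0. pose proof (far_0 a e H) as H1.
  assert (He : 0 < e) by apply H.
  assert (Ha : a <> RtoC 0) by (apply Cmod_gt_0; lra).
  rewrite Rmult_plus_distr_r. apply Rplus_le_compat.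
  - rewrite inv_pow_mod by auto. change (/ e * (/ e) ^ k) with ((/ e) ^ S k).
    apply pow_incr. rewrite <- Cmod_inv by auto. split; [apply Cmod_ge_0 | auto].
  - rewrite Rmult_assoc, (Rmult_comm (Series _)), <- Rmult_assoc, <- Series_scal_l.
    apply CS_mod_le; [intros i; now apply pair_inv_bound|].
    exact (ex_series_scal_l _ _ ex_series_inv_sq).
Qed.

Lemma Sk_expand_asum a e h : far a e -> Rabs h <= e / 2 ->
  asum (fun k => RtoC (h ^ k) * ((-(1)) ^ k * Sk (S k) a))%C.
Proof.
  intros H Hh. assert (He : 0 < e) by apply H.
  set (B := / e + Kpair a e * Series (fun i => / INR (S i) ^ 2)).
  apply asum_le with (fun k => B * (/ 2) ^ k).
  - intros k. rewrite !Cmod_mult, Cmod_m1_pow, Cmod_R, <- RPow_abs, Rmult_1_l.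
    pose proof (Sk_mod a e k H) as HS. fold B in HS.
    assert (HB : 0 <= B).
    { unfold B. pose proof (Kpair_pos a e H). assert (0 < / e) by now apply Rinv_0_lt_compat.
      assert (0 <= Series (fun i => / INR (S i) ^ 2)).
      { apply Series_nonneg; [|apply ex_series_inv_sq].
        intros k'. left. apply Rinv_0_lt_compat, pow_lt, lt_0_INR. lia. }
      assert (0 <= Kpair a e * Series (fun i => / INR (S i) ^ 2)) by now apply Rmult_le_pos.
      lra. }
    pose proof (pow_half_bound h e k He Hh).
    pose proof (pow_le (Rabs h) k (Rabs_pos h)).
    apply Rle_trans with (Rabs h ^ k * (B * (/ e) ^ k)); [now apply Rmult_le_compat_l|].
    replace (Rabs h ^ k * (B * (/ e) ^ k)) with (B * (Rabs h ^ k * (/ e) ^ k)) by ring.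
    now apply Rmult_le_compat_l.
  - exact (ex_series_scal_l B _ ex_series_half).
Qed.

(** Each 1/(a + m + h) is a geometric series in [h] with ratio at most 1/2, and the exchange with
    the sum over [m] is dominated by 2^(-k) / m^2. Up to sign the sums [Sk (S k) a] are thus the
    Taylor coefficients of the cotangent at [a], obtained without differentiating. *)
Theorem Sk_expand a e h : far a e -> Rabs h <= e / 2 ->
  Sk 1 (a + RtoC h) = CS (fun k => RtoC (h ^ k) * ((-(1)) ^ k * Sk (S k) a))%C.
Proof.
  intros H Hh. assert (He : 0 < e) by apply H.
  pose proof (Kpair_pos a e H) as HK.
  set (f := fun i k => (RtoC (h ^ k) * ((-(1)) ^ k * pair_inv (S k) a i))%C).
  assert (Hf : forall i k, Cmod (f i k) <= / INR (S i) ^ 2 * (Kpair a e * (/ 2) ^ k)).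
  { intros i k. unfold f. rewrite !Cmod_mult, Cmod_m1_pow, Cmod_R, <- RPow_abs, Rmult_1_l.
    pose proof (pair_inv_bound a e k i H) as Hp.
    assert (Hi : 0 < / INR (S i) ^ 2) by (apply Rinv_0_lt_compat, pow_lt, lt_0_INR; lia).
    pose proof (pow_half_bound h e k He Hh).
    pose proof (pow_le (Rabs h) k (Rabs_pos h)).
    apply Rle_trans with (Rabs h ^ k * (Kpair a e * (/ e) ^ k * / INR (S i) ^ 2));
      [now apply Rmult_le_compat_l|].
    replace (Rabs h ^ k * (Kpair a e * (/ e) ^ k * / INR (S i) ^ 2))
      with (/ INR (S i) ^ 2 * (Kpair a e * (Rabs h ^ k * (/ e) ^ k))) by ring.
    apply Rmult_le_compat_l; [lra|]. now apply Rmult_le_compat_l. }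
  assert (Hfub : CS (fun i => CS (fun k => f i k)) = CS (fun k => CS (fun i => f i k))).
  { apply CS_fubini with (1 := Hf).
    - intros i. left. apply Rinv_0_lt_compat, pow_lt, lt_0_INR. lia.
    - intros k. apply Rmult_le_pos; auto. apply pow_le. lra.
    - apply ex_series_inv_sq.
    - exact (ex_series_scal_l (Kpair a e) _ ex_series_half). }
  assert (Hlt : forall z, e <= Cmod z -> Rabs h < Cmod z) by (intros; lra).
  assert (Hpair : forall i, pair_inv 1 (a + RtoC h) i = CS (fun k => f i k)).
  { intros i.
    destruct (inv_expand (a + RtoC (INR (S i))) h) as [E1 A1]; [apply Hlt, far_pos, H|].
    destruct (inv_expand (a - RtoC (INR (S i))) h) as [E2 A2]; [apply Hlt, far_neg, H|].
    unfold pair_inv. rewrite !Cpow_1_r.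
    replace (a + RtoC h + RtoC (INR (S i)))%C with (a + RtoC (INR (S i)) + RtoC h)%C by ring.
    replace (a + RtoC h - RtoC (INR (S i)))%C with (a - RtoC (INR (S i)) + RtoC h)%C by ring.
    rewrite E1, E2, <- CS_plus by auto. apply CS_ext. intros k. unfold f, pair_inv. ring. }
  destruct (inv_expand a h) as [E0 A0]; [apply Hlt, far_0, H|].
  unfold Sk at 1. rewrite Cpow_1_r, E0, (CS_ext _ _ Hpair), Hfub.
  assert (Hcol : forall k, CS (fun i => f i k)
    = (RtoC (h ^ k) * ((-(1)) ^ k * CS (pair_inv (S k) a)))%C).
  { intros k. unfold f. rewrite <- (CS_scal ((-(1)) ^ k)%C) by now apply asum_pair_inv with e.
    rewrite <- CS_scal by (apply asum_scal; now apply asum_pair_inv with e). reflexivity. }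
  rewrite (CS_ext _ _ Hcol), <- CS_plus; auto.
  - apply CS_ext. intros k. unfold Sk. ring.
  - apply (asum_ext (fun k => RtoC (h ^ k) * ((-(1)) ^ k * Sk (S k) a)
      + (-(1)) * (RtoC (h ^ k) * ((-(1)) ^ k * / a ^ S k)))%C).
    + intros k. unfold Sk. ring.
    + apply asum_plus; [now apply Sk_expand_asum with e | now apply asum_scal].
Qed.

Lemma CV_radius_geom_bound (a : nat -> R) r M : 0 < r ->
  (forall k, Rabs (a k) <= M / r ^ k) -> Rbar_lt 0 (CV_radius a).
Proof.
  intros Hr H. apply Rbar_lt_le_trans with r; [exact Hr|].
  apply (proj1 (CV_radius_bounded a)). exists M. intros n.
  rewrite Rabs_mult, (Rabs_pos_eq (r ^ n)) by (apply pow_le; lra).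
  pose proof (pow_lt r n Hr). specialize (H n).
  apply (Rmult_le_compat_r (r ^ n)) in H; [|lra].
  replace (M / r ^ n * r ^ n) with M in H by (field; lra). exact H.
Qed.

(** Real [h] suffice, because the real and imaginary parts of the coefficients then give two real
    power series, each with positive radius of convergence by the geometric bound. *)
Lemma Cpseries_unique (al be : nat -> C) r rho M : 0 < r -> 0 < rho ->
  (forall k, Cmod (al k) <= M / r ^ k) -> (forall k, Cmod (be k) <= M / r ^ k) ->
  (forall h, Rabs h < rho ->
     CS (fun k => RtoC (h ^ k) * al k)%C = CS (fun k => RtoC (h ^ k) * be k)%C) ->
  forall k, al k = be k.
Proof.
  intros Hr Hrho Ha Hb H k. apply C_ext.
  - apply (PSeries_ext_recip (fun k => Re (al k)) (fun k => Re (be k))).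
    + apply CV_radius_geom_bound with r M; auto.
      intros n; eapply Rle_trans; [apply re_le_Cmod | auto].
    + apply CV_radius_geom_bound with r M; auto.
      intros n; eapply Rle_trans; [apply re_le_Cmod | auto].
    + exists (mkposreal rho Hrho). intros h Hh.
      assert (Hh' : Rabs h < rho).
      { unfold ball in Hh; simpl in Hh; unfold AbsRing_ball, abs, minus, plus, opp in Hh.
        simpl in Hh. now rewrite Ropp_0, Rplus_0_r in Hh. }
      specialize (H h Hh'). unfold CS in H. injection H as H _.
      unfold PSeries. etransitivity; [|etransitivity; [exact H|]];
      apply Series_ext; intros n; unfold Re; simpl; ring.
  - apply (PSeries_ext_recip (fun k => Im (al k)) (fun k => Im (be k))).
    + apply CV_radius_geom_bound with r M; auto.
      intros n; eapply Rle_trans; [apply Im_le_Cmod | auto].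
    + apply CV_radius_geom_bound with r M; auto.
      intros n; eapply Rle_trans; [apply Im_le_Cmod | auto].
    + exists (mkposreal rho Hrho). intros h Hh.
      assert (Hh' : Rabs h < rho).
      { unfold ball in Hh; simpl in Hh; unfold AbsRing_ball, abs, minus, plus, opp in Hh.
        simpl in Hh. now rewrite Ropp_0, Rplus_0_r in Hh. }
      specialize (H h Hh'). unfold CS in H. injection H as _ H.
      unfold PSeries. etransitivity; [|etransitivity; [exact H|]];
      apply Series_ext; intros n; unfold Im; simpl; ring.
Qed.

Lemma asum_geom_S z : Cmod z < 1 -> asum (fun k => z ^ S k)%C.
Proof. intros H. now apply (proj1 (asum_S _)), asum_geom. Qed.

Lemma CS_geom_S z : Cmod z < 1 -> CS (fun k => z ^ S k)%C = (z / (1 - z))%C.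
Proof.
  intros H. transitivity (z * CS (fun k => z ^ k))%C.
  - rewrite <- CS_scal by now apply asum_geom. apply CS_ext. intros; apply Cpow_S.
  - rewrite CS_geom by auto. reflexivity.
Qed.

Lemma pi_cot_fourier t : 0 < Im t ->
  pi_cot t = (- (RtoC PI * Ci) - RtoC (2 * PI) * Ci * CS (fun n => nome t ^ S n))%C.
Proof.
  intros H. pose proof (nome_lt_1 t H) as Hq. rewrite CS_geom_S by auto.
  pose proof (Cmod_lt_1_neq _ Hq).
  assert (nome t - 1 <> 0)%C.
  { replace (nome t - 1)%C with (-(1 - nome t))%C by ring. intros E.
    apply H0. replace (1 - nome t)%C with (-(-(1 - nome t)))%C by ring. rewrite E. ring. }
  unfold pi_cot. rewrite RtoC_mult. field. auto.
Qed.

Definition pisum (k : nat) (q : C) : C := CS (fun n => RtoC (INR (S n) ^ k) * q ^ S n)%C.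

(** The power of |q| is split into two halves: one absorbs the polynomial factor by x^k / k! <= e^x
    at x = pi n Im t, the other remains and makes the sum over [n] converge. The factor (2 pi)^k /
    k! is the one that accompanies n^k in the expansions below. *)
Lemma pow_nome_bound t n k : 0 < Im t ->
  Cmod (RtoC (INR (S n) ^ k) * nome t ^ S n)%C * ((2 * PI) ^ k / INR (fact k))
  <= (2 / Im t) ^ k * exp (- (PI * Im t)) ^ S n.
Proof.
  intros H. set (y := Im t) in *. pose proof PI_RGT_0 as HP.
  assert (Hx : 0 <= INR (S n)) by apply pos_INR.
  rewrite Cmod_mult, Cmod_RtoC_pos by (now apply pow_le).
  rewrite Cmod_pow, nome_mod. fold y.
  pose proof (pow_le_exp (PI * y * INR (S n)) k) as Hb.
  assert (Hb' : (PI * y * INR (S n)) ^ k / INR (fact k) <= exp (PI * y * INR (S n))).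
  { apply Hb. apply Rmult_le_pos; auto. apply Rmult_le_pos; lra. }
  assert (E : exp (- (PI * y)) ^ S n = exp (- (2 * PI * y)) ^ S n * exp (PI * y * INR (S n))).
  { rewrite <- !Rpower_pow by apply exp_pos. unfold Rpower. rewrite !ln_exp, <- exp_plus.
    f_equal. ring. }
  rewrite E.
  replace (INR (S n) ^ k * exp (- (2 * PI * y)) ^ S n * ((2 * PI) ^ k / INR (fact k)))
    with (exp (- (2 * PI * y)) ^ S n * ((2 / y) ^ k * ((PI * y * INR (S n)) ^ k / INR (fact k)))).
  - replace ((2 / y) ^ k * (exp (- (2 * PI * y)) ^ S n * exp (PI * y * INR (S n))))
      with (exp (- (2 * PI * y)) ^ S n * ((2 / y) ^ k * exp (PI * y * INR (S n)))) by ring.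
    apply Rmult_le_compat_l; [apply pow_le; left; apply exp_pos|].
    apply Rmult_le_compat_l; auto. apply pow_le. left. apply Rdiv_lt_0_compat; lra.
  - replace ((2 / y) ^ k * ((PI * y * INR (S n)) ^ k / INR (fact k)))
      with (((2 / y) * (PI * y * INR (S n))) ^ k / INR (fact k))
      by (rewrite Rpow_mult_distr; field; apply Rgt_not_eq, INR_fact_pos).
    replace (2 / y * (PI * y * INR (S n))) with (INR (S n) * (2 * PI)) by (field; lra).
    rewrite Rpow_mult_distr. field. apply Rgt_not_eq, INR_fact_pos.
Qed.

Lemma exp_neg_PI_lt_1 y : 0 < y -> 0 <= exp (- (PI * y)) < 1.
Proof.
  intros H. split; [left; apply exp_pos|]. rewrite <- exp_0. apply exp_increasing.
  pose proof PI_RGT_0. assert (0 < PI * y) by now apply Rmult_lt_0_compat. lra.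
Qed.

Lemma ex_series_geom_S r : 0 <= r < 1 -> ex_series (fun n => r ^ S n).
Proof. intros H. now apply (ex_series_incr_1 (fun n => r ^ n)), ex_series_geom_pos. Qed.

Lemma asum_pisum t k : 0 < Im t -> asum (fun n => RtoC (INR (S n) ^ k) * nome t ^ S n)%C.
Proof.
  intros H. pose proof PI_RGT_0.
  assert (Hc : 0 < (2 * PI) ^ k / INR (fact k)).
  { apply Rdiv_lt_0_compat; [apply pow_lt; lra | apply INR_fact_pos]. }
  apply asum_le with (fun n => / ((2 * PI) ^ k / INR (fact k)) * (2 / Im t) ^ k
     * exp (- (PI * Im t)) ^ S n).
  - intros n. pose proof (pow_nome_bound t n k H) as Hb.
    apply Rmult_le_reg_r with (1 := Hc). eapply Rle_trans; [apply Hb|].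
    right. field. repeat split; try lra; try apply pow_nonzero; try lra.
    apply Rgt_not_eq, INR_fact_pos.
  - exact (ex_series_scal_l _ _ (ex_series_geom_S _ (exp_neg_PI_lt_1 _ H))).
Qed.

Lemma pisum_bound t k : 0 < Im t ->
  Cmod (pisum k (nome t)) * ((2 * PI) ^ k / INR (fact k))
  <= (2 / Im t) ^ k * Series (fun n => exp (- (PI * Im t)) ^ S n).
Proof.
  intros H. pose proof PI_RGT_0.
  assert (Hc : 0 < (2 * PI) ^ k / INR (fact k)).
  { apply Rdiv_lt_0_compat; [apply pow_lt; lra | apply INR_fact_pos]. }
  rewrite <- Series_scal_l. unfold pisum.
  eapply Rle_trans; [apply Rmult_le_compat_r; [lra|]; apply CS_mod; now apply asum_pisum|].
  rewrite <- Series_scal_r. apply Series_le.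
  - intros n. split; [|now apply pow_nome_bound].
    apply Rmult_le_pos; [apply Cmod_ge_0 | lra].
  - exact (ex_series_scal_l _ _ (ex_series_geom_S _ (exp_neg_PI_lt_1 _ H))).
Qed.

(** This is -(2 pi i)^(k+1) / k!: one factor from the Fourier series of the cotangent, the rest from
    expanding q^n under a shift of the argument. *)
Definition lip_coef (k : nat) : C := (- (RtoC (2 * PI) * Ci) * ((RtoC (2 * PI) * Ci) ^ k / RtoC (INR (fact k))))%C.

Lemma lip_coef_mod k : Cmod (lip_coef k) = 2 * PI * ((2 * PI) ^ k / INR (fact k)).
Proof.
  unfold lip_coef. rewrite Cmod_mult, Cmod_opp, Cmod_two_pi_i, Cmod_div by apply RtoC_fact_neq.
  rewrite Cmod_pow, Cmod_two_pi_i, Cmod_RtoC_pos; auto. left; apply INR_fact_pos.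
Qed.

Lemma nome_RtoC_term t h n :
  (nome (t + RtoC h) ^ S n)%C
  = CS (fun k => RtoC (h ^ k) * ((RtoC (2 * PI) * Ci) ^ k / RtoC (INR (fact k))
       * (RtoC (INR (S n) ^ k) * nome t ^ S n)))%C.
Proof.
  rewrite nome_add, Cpow_mult_l, (nome_pow (RtoC h)). unfold nome at 2.
  rewrite <- CS_exp, <- CS_scal by apply asum_exp. apply CS_ext. intros k.
  unfold exp_term. rewrite !Cpow_mult_l, !RtoC_pow. unfold Cdiv. ring.
Qed.

Lemma pi_cot_fourier_expand t h : 0 < Im t -> Rabs h <= Im t / 4 ->
  CS (fun n => nome (t + RtoC h) ^ S n)%C
  = CS (fun k => RtoC (h ^ k) * ((RtoC (2 * PI) * Ci) ^ k / RtoC (INR (fact k)) * pisum k (nome t)))%C.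
Proof.
  intros H Hh.
  rewrite (CS_ext _ _ (nome_RtoC_term t h)).
  rewrite (CS_fubini _ (fun n => exp (- (PI * Im t)) ^ S n) (fun k => (/ 2) ^ k)).
  - apply CS_ext. intros k. unfold pisum.
    rewrite <- !CS_scal; auto using asum_pisum. apply asum_scal; now apply asum_pisum.
  - intros n k.
    replace (RtoC (h ^ k) * ((RtoC (2 * PI) * Ci) ^ k / RtoC (INR (fact k)) *
       (RtoC (INR (S n) ^ k) * nome t ^ S n)))%C
      with (RtoC (h ^ k) * ((RtoC (2 * PI) * Ci) ^ k / RtoC (INR (fact k))) *
       (RtoC (INR (S n) ^ k) * nome t ^ S n))%C by ring.
    rewrite Cmod_mult, Cmod_mult, Cmod_div, Cmod_pow, Cmod_two_pi_i by apply RtoC_fact_neq.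
    rewrite (Cmod_RtoC_pos (INR (fact k))) by (left; apply INR_fact_pos).
    rewrite Cmod_R, <- RPow_abs.
    pose proof (pow_nome_bound t n k H) as Hb.
    set (X := Cmod (RtoC (INR (S n) ^ k) * nome t ^ S n)) in *.
    replace (Rabs h ^ k * ((2 * PI) ^ k / INR (fact k)) * X)
      with (Rabs h ^ k * (X * ((2 * PI) ^ k / INR (fact k)))) by ring.
    eapply Rle_trans; [apply Rmult_le_compat_l; [apply pow_le, Rabs_pos | apply Hb]|].
    rewrite <- Rmult_assoc, Rmult_comm. apply Rmult_le_compat_l; [apply pow_le; left; apply exp_pos|].
    rewrite <- Rpow_mult_distr. apply pow_incr. split.
    + apply Rmult_le_pos; [apply Rabs_pos|]. left; apply Rdiv_lt_0_compat; lra.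
    + apply (Rmult_le_reg_r (Im t)); auto.
      replace (Rabs h * (2 / Im t) * Im t) with (Rabs h * 2) by (field; lra). lra.
  - intros; apply pow_le; left; apply exp_pos.
  - intros; apply pow_le; lra.
  - now apply ex_series_geom_S, exp_neg_PI_lt_1.
  - apply ex_series_half.
Qed.

Lemma Sk_1 t : 0 < Im t -> Sk 1 t = pi_cot t.
Proof.
  intros H. symmetry. apply pi_cot_series with (Im t); [now apply far_Im|].
  apply nome_neq_1. lra.
Qed.

Lemma CS_single (c : C) : CS (fun k => if Nat.eqb k 0 then c else RtoC 0) = c
  /\ asum (fun k => if Nat.eqb k 0 then c else RtoC 0).
Proof.
  assert (A : asum (fun k => if Nat.eqb k 0 then c else RtoC 0)).
  { apply asum_S. simpl. apply asum_le with (fun _ => 0); [intros; rewrite Cmod_0; lra|].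
    exists 0. apply ex_series_rsum. apply is_lim_seq_ext with (fun _ => 0);
    [intros n; rewrite rsum_const; ring | apply is_lim_seq_const]. }
  split; auto. rewrite CS_S by auto. simpl. rewrite CS_0. ring.
Qed.

(** Both sides are the coefficient of h^k, up to (-1)^k, in the cotangent at t + h: once through
    partial fractions, once through its Fourier series. For k = 0 the Fourier side has the
    additional constant -pi i, carried here by [c0]. *)
Theorem lipschitz t k : 0 < Im t -> (1 <= k)%nat ->
  Sk (S k) t = ((-(1)) ^ k * lip_coef k * pisum k (nome t))%C.
Proof.
  intros H Hk. set (y := Im t) in *. pose proof PI_RGT_0 as HP.
  pose proof (far_Im t H) as Hfar. fold y in Hfar.
  set (al := fun k => ((-(1)) ^ k * Sk (S k) t)%C).
  set (c0 := (- (RtoC PI * Ci))%C).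
  set (be := fun k => ((if Nat.eqb k 0 then c0 else 0) + lip_coef k * pisum k (nome t))%C).
  set (M1 := / y + Kpair t y * Series (fun i => / INR (S i) ^ 2)).
  set (M2 := 2 * PI * Series (fun n => exp (- (PI * y)) ^ S n)).
  assert (Hgs : 0 <= Series (fun n => exp (- (PI * y)) ^ S n)).
  { apply Series_nonneg; [intros; apply pow_le; left; apply exp_pos|].
    now apply ex_series_geom_S, exp_neg_PI_lt_1. }
  assert (HM2 : 0 <= M2) by (apply Rmult_le_pos; lra).
  assert (HM1 : 0 <= M1).
  { unfold M1. pose proof (Kpair_pos t y Hfar). assert (0 < / y) by now apply Rinv_0_lt_compat.
    assert (0 <= Series (fun i => / INR (S i) ^ 2)).
    { apply Series_nonneg; [|apply ex_series_inv_sq].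
      intros k'. left. apply Rinv_0_lt_compat, pow_lt, lt_0_INR. lia. }
    assert (0 <= Kpair t y * Series (fun i => / INR (S i) ^ 2)) by now apply Rmult_le_pos.
    lra. }
  assert (Hlp : forall k, Cmod (lip_coef k * pisum k (nome t)) <= M2 * (2 / y) ^ k).
  { intros j. rewrite Cmod_mult, lip_coef_mod. pose proof (pisum_bound t j H) as Hb. fold y in Hb.
    unfold M2. apply (Rmult_le_compat_l (2 * PI)) in Hb; lra. }
  assert (E2y : forall k, 1 / (y / 2) ^ k = (2 / y) ^ k).
  { intros j. unfold Rdiv at 1. rewrite Rmult_1_l, <- pow_inv. f_equal. field. lra. }
  assert (Hc0 : Cmod c0 = PI).
  { unfold c0. rewrite Cmod_opp, Cmod_mult, Cmod_Ci, Cmod_RtoC_pos; lra. }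
  assert (E : forall k, al k = be k).
  { apply (Cpseries_unique al be (y / 2) (y / 4) (M1 + M2 + PI)); try lra.
    - intros j. unfold al. rewrite Cmod_mult, Cmod_m1_pow, Rmult_1_l.
      replace ((M1 + M2 + PI) / (y / 2) ^ j) with ((M1 + M2 + PI) * (2 / y) ^ j)
        by (rewrite <- E2y; unfold Rdiv; ring).
      eapply Rle_trans; [apply (Sk_mod t y j Hfar)|]. fold M1.
      assert ((/ y) ^ j <= (2 / y) ^ j).
      { apply pow_incr. assert (0 < / y) by now apply Rinv_0_lt_compat.
        unfold Rdiv. lra. }
      assert (0 <= (/ y) ^ j) by (apply pow_le; left; now apply Rinv_0_lt_compat).
      apply Rmult_le_compat; lra.
    - intros j. unfold be.
      replace ((M1 + M2 + PI) / (y / 2) ^ j) with ((M1 + M2 + PI) * (2 / y) ^ j)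
        by (rewrite <- E2y; unfold Rdiv; ring).
      eapply Rle_trans; [apply Cmod_triangle|]. pose proof (Hlp j) as Hj.
      assert (0 <= (2 / y) ^ j) by (apply pow_le; left; apply Rdiv_lt_0_compat; lra).
      assert (Hif : Cmod (if Nat.eqb j 0 then c0 else 0) <= PI * (2 / y) ^ j).
      { destruct j; simpl; [lra|]. rewrite Cmod_0. now apply Rmult_le_pos; [lra|]. }
      assert (0 <= M1 * (2 / y) ^ j) by now apply Rmult_le_pos.
      lra.
    - intros h Hh. unfold al. rewrite <- (Sk_expand t y h) by (auto; lra).
      assert (Him : Im (t + RtoC h) = y) by (simpl; fold (Im t); fold y; ring).
      rewrite Sk_1 by (rewrite Him; auto).
      rewrite pi_cot_fourier by (rewrite Him; auto).
      rewrite pi_cot_fourier_expand by (auto; fold y; lra).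
      fold c0. destruct (CS_single c0) as [Es As].
      rewrite <- Es at 1. unfold Cminus.
      replace (- (RtoC (2 * PI) * Ci * CS
        (fun k0 => RtoC (h ^ k0) * ((RtoC (2 * PI) * Ci) ^ k0 / RtoC (INR (fact k0)) * pisum k0 (nome t)))))%C
        with (- (RtoC (2 * PI) * Ci) * CS
        (fun k0 => RtoC (h ^ k0) * ((RtoC (2 * PI) * Ci) ^ k0 / RtoC (INR (fact k0)) * pisum k0 (nome t))))%C
        by ring.
      assert (A2 : asum (fun k0 => RtoC (h ^ k0) *
         ((RtoC (2 * PI) * Ci) ^ k0 / RtoC (INR (fact k0)) * pisum k0 (nome t)))%C).
      { apply asum_le with (fun k0 => Series (fun n => exp (- (PI * y)) ^ S n) * (/ 2) ^ k0).
        - intros j. pose proof (pisum_bound t j H) as Hb. fold y in Hb.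
          rewrite !Cmod_mult, Cmod_div, Cmod_pow, Cmod_two_pi_i by apply RtoC_fact_neq.
          rewrite (Cmod_RtoC_pos (INR (fact j))) by (left; apply INR_fact_pos).
          rewrite Cmod_R, <- RPow_abs.
          rewrite (Rmult_comm _ (Cmod (pisum j (nome t)))).
          eapply Rle_trans; [apply Rmult_le_compat_l; [apply pow_le, Rabs_pos | apply Hb]|].
          rewrite <- Rmult_assoc, Rmult_comm. apply Rmult_le_compat_l; auto.
          rewrite <- Rpow_mult_distr. apply pow_incr. split.
          + apply Rmult_le_pos; [apply Rabs_pos|]. left; apply Rdiv_lt_0_compat; lra.
          + apply (Rmult_le_reg_r y); auto.
            replace (Rabs h * (2 / y) * y) with (Rabs h * 2) by (field; lra). lra.
        - exact (ex_series_scal_l _ _ ex_series_half). }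
      rewrite <- CS_scal, <- CS_plus by (auto using asum_scal).
      apply CS_ext. intros j. unfold be, lip_coef. destruct j; simpl; ring. }
  specialize (E k). unfold al, be in E.
  destruct k; [lia|]. simpl Nat.eqb in E. cbv iota in E.
  rewrite Cplus_0_l in E. rewrite <- Cmult_assoc, <- E, Cmult_assoc, <- Cpow_mult_l.
  replace (- (1) * - (1))%C with (RtoC 1) by ring. rewrite Cpow_1_l. ring.
Qed.

(** * The values zeta(2) and zeta(4) *)

Definition zeta (k : nat) : R := Series (fun i => / INR (S i) ^ k).

Lemma ex_series_zeta k : (2 <= k)%nat -> ex_series (fun i => / INR (S i) ^ k).
Proof.
  intros Hk. apply ex_series_pos_le with (2 := ex_series_inv_sq).
  intros i. assert (1 <= INR (S i)) by (rewrite S_INR; pose proof (pos_INR i); lra).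
  split; [left; apply Rinv_0_lt_compat, pow_lt; lra|].
  apply Rinv_le_contravar; [apply pow_lt; lra|]. now apply Rle_pow.
Qed.

Lemma rsum_even_odd (f : nat -> R) n :
  rsum f (2 * n) = rsum (fun j => f (2 * j)%nat) n + rsum (fun j => f (2 * j + 1)%nat) n.
Proof.
  induction n; [simpl; ring|].
  replace (2 * S n)%nat with (S (S (2 * n))) by lia.
  cbn [rsum]. rewrite IHn. replace (S (2 * n)) with (2 * n + 1)%nat by lia. ring.
Qed.

Lemma ex_series_odd k : (2 <= k)%nat -> ex_series (fun i => / INR (2 * i + 1) ^ k).
Proof.
  intros Hk. apply ex_series_pos_le with (2 := ex_series_zeta k Hk).
  intros i. assert (0 < INR (S i)) by (apply lt_0_INR; lia).
  assert (INR (S i) <= INR (2 * i + 1)) by (apply le_INR; lia).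
  split; [left; apply Rinv_0_lt_compat, pow_lt; lra|].
  apply Rinv_le_contravar; [apply pow_lt; lra|]. apply pow_incr; lra.
Qed.

Lemma zeta_odd k : (2 <= k)%nat ->
  zeta k = Series (fun i => / INR (2 * i + 1) ^ k) + zeta k / 2 ^ k.
Proof.
  intros Hk. pose proof (ex_series_zeta k Hk) as Hz. pose proof (ex_series_odd k Hk) as Ho.
  pose proof (is_lim_rsum _ Hz) as H1. pose proof (is_lim_rsum _ Ho) as H2.
  fold (zeta k) in H1.
  apply (is_lim_seq_subseq _ _ (fun n => (2 * n)%nat)) in H1.
  2:{ apply eventually_subseq. intros; lia. }
  assert (H3 : is_lim_seq (fun n => rsum (fun i => / INR (2 * i + 1) ^ k) n
      + rsum (fun i => / INR (S i) ^ k) n / 2 ^ k)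
      (Series (fun i => / INR (2 * i + 1) ^ k) + zeta k / 2 ^ k)).
  { apply is_lim_seq_plus'; auto. apply (is_lim_seq_scal_r _ (/ 2 ^ k) (zeta k)).
    apply (is_lim_rsum _ Hz). }
  apply is_lim_seq_unique in H1. apply is_lim_seq_unique in H3.
  assert (E : forall n, rsum (fun i => / INR (2 * i + 1) ^ k) n
      + rsum (fun i => / INR (S i) ^ k) n / 2 ^ k = rsum (fun i => / INR (S i) ^ k) (2 * n)).
  { intros n. rewrite rsum_even_odd. f_equal.
    - apply rsum_ext. intros j _. do 3 f_equal. lia.
    - unfold Rdiv. rewrite Rmult_comm, <- rsum_scal. apply rsum_ext. intros j _.
      replace (S (2 * j + 1)) with (2 * S j)%nat by lia.
      rewrite mult_INR, Rpow_mult_distr. simpl (INR 2).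
      assert (0 < INR (S j)) by (apply lt_0_INR; lia).
      rewrite Rinv_mult. reflexivity. }
  rewrite (Lim_seq_ext _ _ E), H1 in H3. now injection H3.
Qed.

Lemma far_half : far (RtoC (/ 2)) (/ 2).
Proof.
  split; [lra|]. intros m. rewrite <- RtoC_plus, Cmod_R.
  destruct (Z_le_gt_dec 0 m) as [H|H].
  - apply IZR_le in H. rewrite Rabs_pos_eq; lra.
  - assert (H1 : (m <= -1)%Z) by lia. apply IZR_le in H1. rewrite Rabs_left1; lra.
Qed.

(** The point 1/2 is midway between poles. Its distances to the integers are the odd numbers over 2,
    each occurring twice, so even weights give the part of zeta over odd denominators. *)
Lemma Sk_half k : (1 <= k)%nat ->
  Sk (2 * k) (RtoC (/ 2)) = RtoC (2 * 2 ^ (2 * k) * Series (fun i => / INR (2 * i + 1) ^ (2 * k))).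
Proof.
  intros Hk. unfold Sk.
  assert (Ho : ex_series (fun i => / INR (2 * i + 1) ^ (2 * k))) by (apply ex_series_odd; lia).
  assert (E : forall i, pair_inv (2 * k) (RtoC (/ 2)) i
    = RtoC (2 ^ (2 * k) * / INR (2 * S i + 1) ^ (2 * k) + 2 ^ (2 * k) * / INR (2 * i + 1) ^ (2 * k))).
  { intros i. unfold pair_inv.
    rewrite <- RtoC_plus, <- RtoC_minus, <- !RtoC_pow.
    assert (H1 : 0 < INR (S i)) by (apply lt_0_INR; lia).
    pose proof (pos_INR i).
    assert (0 < INR (2 * S i + 1)) by (apply lt_0_INR; lia).
    assert (0 < INR (2 * i + 1)) by (apply lt_0_INR; lia).
    rewrite <- !RtoC_inv, <- RtoC_plus.
    - f_equal. f_equal.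
      + rewrite <- !pow_inv, <- Rpow_mult_distr. f_equal.
        rewrite plus_INR, mult_INR. simpl (INR 2). simpl (INR 1). field. lra.
      + rewrite !(pow_mult _ 2), <- !pow_inv, <- Rpow_mult_distr. f_equal.
        rewrite plus_INR, mult_INR, S_INR. simpl (INR 2). simpl (INR 1). field. lra.
    - apply pow_nonzero. rewrite S_INR. lra.
    - apply pow_nonzero. lra. }
  rewrite (CS_ext _ _ E), CS_RtoC, Series_plus, !Series_scal_l.
  2:{ apply (ex_series_scal_l (2 ^ (2 * k)) (fun i => / INR (2 * S i + 1) ^ (2 * k))).
      now apply (ex_series_incr_1 (fun i => / INR (2 * i + 1) ^ (2 * k))) in Ho. }
  2:{ exact (ex_series_scal_l (2 ^ (2 * k)) _ Ho). }
  rewrite (Series_incr_1 _ Ho). simpl (INR (2 * 0 + 1)). rewrite pow1.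
  rewrite <- RtoC_pow, <- RtoC_inv by (apply pow_nonzero; lra).
  rewrite <- RtoC_plus. f_equal. rewrite pow_inv, Rinv_inv, Rinv_1. ring.
Qed.

Lemma pi_cot_half h : cos (PI * h) <> 0 ->
  pi_cot (RtoC (/ 2) + RtoC h) = RtoC (- PI * (sin (PI * h) / cos (PI * h))).
Proof.
  intros Hc. unfold pi_cot. rewrite nome_add.
  assert (E2 : nome (RtoC (/ 2)) = (- (1))%C) by (rewrite RtoC_inv by lra; apply nome_half).
  rewrite E2.
  set (c := cos (PI * h)) in *. set (s := sin (PI * h)).
  assert (Hcs : c * c + s * s = 1).
  { pose proof (sin2_cos2 (PI * h)) as H. unfold Rsqr in H. fold c s in H. lra. }
  set (p := (c, s) : C).
  assert (Ep : nome (RtoC h) = (p * p)%C).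
  { unfold nome. replace (RtoC (2 * PI) * Ci * RtoC h)%C with ((0, 2 * (PI * h)) : C)
      by (apply C_ext; simpl; ring).
    unfold Cexp. cbn [Re Im fst snd]. rewrite exp_0, cos_2a, sin_2a. fold c s.
    apply C_ext; simpl; ring. }
  assert (E3 : (- (1) * (p * p) + 1 = - (2) * Ci * RtoC s * p)%C)
    by (apply C_ext; simpl; lra).
  assert (E4 : (- (1) * (p * p) - 1 = - (2) * RtoC c * p)%C)
    by (apply C_ext; simpl; lra).
  rewrite Ep, E3, E4.
  assert (Hp : p <> RtoC 0) by (intros E; injection E; intros; auto).
  assert (HcC : RtoC c <> RtoC 0) by now apply RtoC_neq.
  rewrite !RtoC_mult, RtoC_div by auto. rewrite RtoC_opp.
  replace (PI * Ci * (- (2) * Ci * s * p) / (- (2) * c * p))%C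
    with ((Ci * Ci) * PI * (s / c))%C by (field; auto).
  rewrite Ci2. ring.
Qed.

Lemma cos_near_0 h : Rabs h < / 4 -> cos (PI * h) <> 0.
Proof.
  intros Hh. apply Rabs_lt_between in Hh. pose proof PI_RGT_0.
  apply Rgt_not_eq, cos_gt_0; nra.
Qed.

(* Coefficients of [- PI tan (PI h)], found from its Riccati equation. *)
Lemma zeta_2_4 : zeta 2 = PI ^ 2 / 6 /\ zeta 4 = PI ^ 4 / 90.
Proof.
  set (t := fun k => Re ((-(1)) ^ k * Sk (S k) (RtoC (/ 2)))%C).
  set (B := / / 2 + Kpair (RtoC (/ 2)) (/ 2) * Series (fun i => / INR (S i) ^ 2)).
  assert (Ht : forall k, Rabs (t k) <= B / (/ 2) ^ k).
  { intros k. unfold t. eapply Rle_trans; [apply re_le_Cmod|].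
    rewrite Cmod_mult, Cmod_m1_pow, Rmult_1_l. unfold Rdiv. rewrite <- pow_inv.
    apply Sk_mod, far_half. }
  assert (Hcv : Rbar_lt 0 (CV_radius t)) by (apply CV_radius_geom_bound with (/ 2) B; auto; lra).
  assert (Hcv4 : forall h, Rabs h < / 4 -> Rbar_lt (Rabs h) (CV_radius t)).
  { intros h Hh. apply Rbar_lt_le_trans with (/ 2); [simpl; lra|].
    apply (proj1 (CV_radius_bounded t)). exists B. intros n.
    rewrite Rabs_mult, (Rabs_pos_eq ((/ 2) ^ n)) by (apply pow_le; lra).
    assert (0 < (/ 2) ^ n) by (apply pow_lt; lra). specialize (Ht n).
    apply (Rmult_le_compat_r ((/ 2) ^ n)) in Ht; [|lra].
    replace (B / (/ 2) ^ n * (/ 2) ^ n) with B in Ht by (field; lra). exact Ht. }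
  set (T := fun h => - PI * (sin (PI * h) / cos (PI * h))).
  assert (HT : forall h, Rabs h < / 4 -> PSeries t h = T h).
  { intros h Hh.
    assert (E : pi_cot (RtoC (/ 2) + RtoC h) = RtoC (T h)) by (apply pi_cot_half, cos_near_0; lra).
    assert (Hn1 : nome (RtoC (/ 2) + RtoC h) <> RtoC 1).
    { intros En. pose proof (cos_near_0 h ltac:(lra)) as Hc.
      rewrite nome_add, RtoC_inv, nome_half in En by lra.
      assert (Er : cos (2 * (PI * h)) = - 1).
      { assert (H1 : nome (RtoC h) = RtoC (-1)).
        { replace (nome (RtoC h)) with (- (- (1) * nome (RtoC h)))%C by ring. rewrite En.
          rewrite <- RtoC_opp. f_equal. }
        assert (H2 : Re (nome (RtoC h)) = -1) by now rewrite H1.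
        unfold nome, Cexp in H2. simpl in H2.
        match type of H2 with exp ?x * cos ?y = _ => replace x with 0 in H2 by ring;
          replace y with (2 * (PI * h)) in H2 by ring end.
        rewrite exp_0 in H2. lra. }
      rewrite cos_2a_cos in Er. apply Hc. nra. }
    assert (Hf : far (RtoC (/ 2) + RtoC h) (/ 4)).
    { split; [lra|]. intros m. pose proof (proj2 far_half m) as Hm.
      pose proof (Cmod_triangle (RtoC (/ 2) + RtoC h + RtoC (IZR m)) (- RtoC h)) as H1.
      replace (RtoC (/ 2) + RtoC h + RtoC (IZR m) + - RtoC h)%C
        with (RtoC (/ 2) + RtoC (IZR m))%C in H1 by ring.
      rewrite Cmod_opp, Cmod_R in H1. lra. }
    pose proof (Sk_expand (RtoC (/ 2)) (/ 2) h far_half ltac:(lra)) as H.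
    rewrite <- (pi_cot_series _ _ Hf Hn1), E in H.
    apply (f_equal Re) in H. rewrite re_RtoC in H. rewrite H. unfold CS. simpl.
    unfold PSeries. apply Series_ext. intros n. unfold t, Re. simpl. ring. }
  assert (Hloc : locally 0 (fun h => Rabs h < / 4)).
  { assert (H4 : 0 < / 4) by lra. exists (mkposreal _ H4). intros h Hh.
    unfold ball in Hh; simpl in Hh; unfold AbsRing_ball, abs, minus, plus, opp in Hh.
    simpl in Hh. now rewrite Ropp_0, Rplus_0_r in Hh. }
  assert (Hd : forall h, Rabs h < / 4 ->
     PSeries (PS_derive t) h = - PI ^ 2 - PSeries (PS_mult t t) h).
  { intros h Hh. rewrite PSeries_mult by auto. rewrite HT by auto.
    pose proof (is_derive_PSeries t h (Hcv4 h Hh)) as D1.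
    assert (D2 : is_derive T h (- PI ^ 2 - T h * T h)).
    { pose proof (cos_near_0 h Hh) as Hc. unfold T. auto_derive; auto.
      field. auto. }
    assert (D3 : is_derive (PSeries t) h (- PI ^ 2 - T h * T h)).
    { apply (is_derive_ext_loc T); [|exact D2].
      assert (Hp : 0 < / 4 - Rabs h) by lra. exists (mkposreal _ Hp). intros x Hx.
      unfold ball in Hx; simpl in Hx; unfold AbsRing_ball, abs, minus, plus, opp in Hx.
      simpl in Hx. symmetry. apply HT.
      pose proof (Rabs_triang (x + - h) h) as H1. replace (x + - h + h) with (x : R) in H1 by (simpl; lra). simpl in *. lra. }
    apply is_derive_unique in D1. apply is_derive_unique in D3. lra. }
  set (s := fun k => - PI ^ 2 * (if Nat.eqb k 0 then 1 else 0) - PS_mult t t k).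
  assert (Hs : forall k, PS_derive t k = s k).
  { assert (Hexm : forall h, Rabs h < / 4 -> ex_series (fun k => PS_mult t t k * h ^ k)).
    { intros h Hh. apply ex_pseries_R, ex_pseries_mult; auto. }
    assert (Hex0 : forall h, is_series (fun k => - PI ^ 2 * (if Nat.eqb k 0 then 1 else 0) * h ^ k) (- PI ^ 2)).
    { intros h. apply ex_series_rsum. apply is_lim_seq_incr_1.
      apply is_lim_seq_ext with (fun _ => - PI ^ 2); [|apply is_lim_seq_const].
      intros n. induction n; [simpl; ring|].
      change (rsum ?f (S (S n))) with (rsum f (S n) + f (S n)). rewrite <- IHn. simpl. ring. }
    assert (Hexs : forall h, Rabs h < / 4 ->
      is_series (fun k => s k * h ^ k) (- PI ^ 2 - PSeries (PS_mult t t) h)).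
    { intros h Hh. pose proof (is_series_minus _ _ _ _ (Hex0 h) (Series_correct _ (Hexm h Hh))) as H.
      eapply is_series_ext; [|exact H]. intros n. unfold s, plus, opp. simpl. ring. }
    intros k. apply PSeries_ext_recip.
    - now rewrite CV_radius_derive.
    (* The series with coefficients [s] converges for |h| < 1/4; a radius below 1/8 would keep its
       terms at 1/8 from tending to 0. *)
    - apply Rbar_lt_le_trans with (/ 8); [simpl; lra|]. apply Rbar_not_lt_le. intros Hlt.
      apply (CV_disk_outside s (/ 8)).
      + rewrite Rabs_pos_eq by lra. exact Hlt.
      + apply ex_series_lim_0. eexists. apply Hexs. rewrite Rabs_pos_eq; lra.
    - revert Hloc. apply filter_imp. intros h Hh. rewrite Hd by auto.
      symmetry. apply is_series_unique, Hexs, Hh. }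
  assert (T0 : t 0%nat = 0).
  { rewrite <- PSeries_0, HT by (rewrite Rabs_R0; lra). unfold T. rewrite Rmult_0_r, sin_0.
    unfold Rdiv. ring. }
  (* T' = -PI^2 - T^2 with t 0 = 0 gives t 1 = -PI^2, t 2 = 0 and 3 t 3 = -(t 1)^2. On the other
     hand -t 1 and -t 3 are the sums of weight 2 and 4 at 1/2. *)
  pose proof (Hs 0%nat) as S0. pose proof (Hs 1%nat) as S1. pose proof (Hs 2%nat) as S2.
  unfold s, PS_derive, PS_mult in S0, S1, S2. simpl in S0, S1, S2. rewrite T0 in *.
  assert (T1 : t 1%nat = - PI ^ 2) by (simpl; lra).
  assert (T3 : 3 * t 3%nat = - (PI ^ 2) ^ 2) by (rewrite T1 in S2; simpl in *; lra).
  assert (U1 : t 1%nat = - (2 * 2 ^ 2 * Series (fun i => / INR (2 * i + 1) ^ 2))).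
  { unfold t. pose proof (Sk_half 1 (le_n 1)) as H. simpl Nat.mul in H. rewrite H.
    simpl. unfold Re. simpl. ring. }
  assert (U3 : t 3%nat = - (2 * 2 ^ 4 * Series (fun i => / INR (2 * i + 1) ^ 4))).
  { unfold t. pose proof (Sk_half 2 ltac:(lia)) as H. simpl Nat.mul in H. rewrite H.
    simpl. unfold Re. simpl. ring. }
  pose proof (zeta_odd 2 (le_n 2)). pose proof (zeta_odd 4 ltac:(lia)).
  split; simpl in *; lra.
Qed.

(** * Eisenstein sums of weights 4 and 2 *)

Definition cS (m : nat) : C := RtoC (INR (S m)).

Lemma cS_neq m : cS m <> RtoC 0.
Proof. apply RtoC_neq, not_0_INR. lia. Qed.

Lemma INR_S_ge_1 m : 1 <= INR (S m).
Proof. rewrite S_INR. pose proof (pos_INR m). lra. Qed.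

Lemma Cmod_cS m : Cmod (cS m) = INR (S m).
Proof. apply Cmod_RtoC_pos. pose proof (INR_S_ge_1 m). lra. Qed.

Lemma Im_cS_mult m t : Im (cS m * t) = INR (S m) * Im t.
Proof. unfold cS. simpl. unfold Im. ring. Qed.

Lemma Im_cS_pos m t : 0 < Im t -> 0 < Im (cS m * t).
Proof.
  intros H. rewrite Im_cS_mult. apply Rmult_lt_0_compat; auto.
  pose proof (INR_S_ge_1 m). lra.
Qed.

(* [x] is real and stands for any integer. *)
Lemma lattice_Im_bound t m (x : R) : 0 < Im t ->
  INR (S m) * Im t <= Cmod (cS m * t + RtoC x).
Proof.
  intros H. pose proof (Im_le_Cmod (cS m * t + RtoC x)) as H1.
  pose proof (Rle_abs (Im (cS m * t + RtoC x))).
  assert (E : Im (cS m * t + RtoC x) = INR (S m) * Im t).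
  { rewrite <- Im_cS_mult. simpl. unfold Im. ring. }
  lra.
Qed.

Definition Klat (t : C) : R := 1 + (1 + Cmod t) / Im t.

(** The slack [+ 1] admits, besides x = n + 1, its neighbours n and n + 2 and their negatives, which
    occur when z is replaced by z - 1 or z + 1 in weight 2. *)
Lemma lattice_Re_bound t m (x : R) n : 0 < Im t -> INR (S n) <= Rabs x + 1 ->
  INR (S n) <= Klat t * Cmod (cS m * t + RtoC x).
Proof.
  intros H Hx. pose proof (lattice_Im_bound t m x H) as H1.
  pose proof (INR_S_ge_1 m) as Hm. set (y := Im t) in *.
  pose proof (Cmod_triangle (cS m * t + RtoC x) (- (cS m * t))) as H2.
  replace (cS m * t + RtoC x + - (cS m * t))%C with (RtoC x) in H2 by ring.
  rewrite Cmod_opp, Cmod_R, Cmod_mult, Cmod_cS in H2.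
  set (Z := Cmod (cS m * t + RtoC x)) in *.
  pose proof (Cmod_ge_0 t) as Ht.
  unfold Klat. fold y. rewrite Rmult_plus_distr_r, Rmult_1_l.
  assert (INR (S m) * (1 + Cmod t) <= (1 + Cmod t) / y * Z).
  { replace (INR (S m) * (1 + Cmod t)) with ((1 + Cmod t) / y * (INR (S m) * y)) by (field; lra).
    apply Rmult_le_compat_l; auto. left; apply Rdiv_lt_0_compat; lra. }
  lra.
Qed.

Lemma Klat_pos t : 0 < Im t -> 0 < Klat t.
Proof.
  intros H. unfold Klat. pose proof (Cmod_ge_0 t).
  assert (0 < (1 + Cmod t) / Im t) by (apply Rdiv_lt_0_compat; lra). lra.
Qed.

(* The product of two lattice points dominates [m * n] by combining both bounds. *)
Lemma lattice_mul_bound t m n (x x' : R) : 0 < Im t ->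
  INR (S n) <= Rabs x + 1 -> INR (S n) <= Rabs x' + 1 ->
  Im t / Klat t * (INR (S m) * INR (S n)) <= Cmod (cS m * t + RtoC x) * Cmod (cS m * t + RtoC x').
Proof.
  intros H Hx Hx'. pose proof (lattice_Im_bound t m x H) as H1.
  pose proof (lattice_Re_bound t m x' n H Hx') as H2. pose proof (Klat_pos t H) as HK.
  pose proof (INR_S_ge_1 m). pose proof (INR_S_ge_1 n).
  replace (Im t / Klat t * (INR (S m) * INR (S n)))
    with ((INR (S m) * Im t) * (INR (S n) / Klat t)) by (field; lra).
  apply Rmult_le_compat; auto.
  - apply Rmult_le_pos; lra.
  - apply Rmult_le_pos; [lra | left; now apply Rinv_0_lt_compat].
  - apply Rle_div_l; auto. rewrite Rmult_comm. exact H2.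
Qed.

Lemma lattice_neq t m (x : R) : 0 < Im t -> (cS m * t + RtoC x <> 0)%C.
Proof.
  intros H. pose proof (lattice_Im_bound t m x H). pose proof (INR_S_ge_1 m).
  apply Cmod_gt_0. assert (0 < INR (S m) * Im t) by (apply Rmult_lt_0_compat; lra). lra.
Qed.

Lemma inv4_bound (z1 z2 z3 z4 : C) c : 0 < c ->
  c <= Cmod z1 * Cmod z2 -> c <= Cmod z3 * Cmod z4 -> Cmod (/ (z1 * z2 * (z3 * z4)))%C <= / c ^ 2.
Proof.
  intros Hc H1 H2. rewrite <- Cmod_mult in H1. rewrite <- Cmod_mult in H2.
  assert (N1 : (z1 * z2 <> 0)%C) by (apply Cmod_gt_0; lra).
  assert (N2 : (z3 * z4 <> 0)%C) by (apply Cmod_gt_0; lra).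
  rewrite Cmod_inv by now apply Cmult_neq_0. rewrite Cmod_mult.
  apply Rinv_le_contravar; [now apply pow_lt|]. simpl. rewrite Rmult_1_r.
  apply Rmult_le_compat; lra.
Qed.

Definition Clat (t : C) : R := / (Im t / Klat t) ^ 2.

Lemma Clat_pos t : 0 < Im t -> 0 < Clat t.
Proof.
  intros H. apply Rinv_0_lt_compat, pow_lt, Rdiv_lt_0_compat; auto. now apply Klat_pos.
Qed.

Lemma Clat_split t m n : 0 < Im t ->
  / (Im t / Klat t * (INR (S m) * INR (S n))) ^ 2 = / INR (S m) ^ 2 * (Clat t * / INR (S n) ^ 2).
Proof.
  intros H. pose proof (Klat_pos t H). pose proof (INR_S_ge_1 m). pose proof (INR_S_ge_1 n).
  unfold Clat. rewrite !Rpow_mult_distr. field. repeat split; lra.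
Qed.

Lemma lat_const_pos t m n : 0 < Im t -> 0 < Im t / Klat t * (INR (S m) * INR (S n)).
Proof.
  intros H. pose proof (INR_S_ge_1 m). pose proof (INR_S_ge_1 n).
  apply Rmult_lt_0_compat; [apply Rdiv_lt_0_compat; auto; now apply Klat_pos|].
  apply Rmult_lt_0_compat; lra.
Qed.

Lemma Rabs_INR_S n : Rabs (INR (S n)) = INR (S n).
Proof. apply Rabs_pos_eq, pos_INR. Qed.

(** A fourth power of a lattice point is a product of two squares, each bounded below by a constant
    times m n. This yields the separated majorant 1/(m^2 n^2) that the exchange of summations asks
    for. *)
Lemma pair_4_bound t m n : 0 < Im t ->
  Cmod (pair_inv 4 (cS m * t) n) <= / INR (S m) ^ 2 * (2 * Clat t * / INR (S n) ^ 2).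
Proof.
  intros H. unfold pair_inv. pose proof (lat_const_pos t m n H) as Hc.
  assert (B : forall x, Rabs x = INR (S n) ->
    Cmod (/ (cS m * t + RtoC x) ^ 4) <= / INR (S m) ^ 2 * (Clat t * / INR (S n) ^ 2)).
  { intros x Hx. rewrite <- Clat_split by auto.
    replace ((cS m * t + RtoC x) ^ 4)%C with
      ((cS m * t + RtoC x) * (cS m * t + RtoC x) * ((cS m * t + RtoC x) * (cS m * t + RtoC x)))%C
      by ring.
    apply inv4_bound; auto; apply lattice_mul_bound; auto; lra. }
  eapply Rle_trans; [apply Cmod_triangle|].
  pose proof (B (INR (S n)) (Rabs_INR_S n)) as B1.
  assert (Hx : Rabs (- INR (S n)) = INR (S n)) by (rewrite Rabs_Ropp; apply Rabs_INR_S).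
  pose proof (B _ Hx) as B2. rewrite RtoC_opp in B2.
  replace (/ INR (S m) ^ 2 * (2 * Clat t * / INR (S n) ^ 2)) with
    (/ INR (S m) ^ 2 * (Clat t * / INR (S n) ^ 2) + / INR (S m) ^ 2 * (Clat t * / INR (S n) ^ 2)) by ring.
  apply Rplus_le_compat; auto.
Qed.

Lemma inv_sq_nonneg i : 0 <= / INR (S i) ^ 2.
Proof. left. apply Rinv_0_lt_compat, pow_lt. pose proof (INR_S_ge_1 i). lra. Qed.

Lemma asum_row (f : nat -> nat -> C) K : 0 <= K ->
  (forall m n, Cmod (f m n) <= / INR (S m) ^ 2 * (K * / INR (S n) ^ 2)) ->
  asum (fun m => CS (fun n => f m n)).
Proof.
  intros HK H. apply asum_le with (fun m => K * zeta 2 * / INR (S m) ^ 2).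
  - intros m.
    replace (K * zeta 2 * / INR (S m) ^ 2) with (/ INR (S m) ^ 2 * K * zeta 2) by ring.
    unfold zeta. rewrite <- !Series_scal_l. apply CS_mod_le.
    + intros n. eapply Rle_trans; [apply H|]. right; ring.
    + apply (ex_series_scal_l (/ INR (S m) ^ 2 * K) (fun i => / INR (S i) ^ 2)), ex_series_inv_sq.
  - exact (ex_series_scal_l (K * zeta 2) _ ex_series_inv_sq).
Qed.

Lemma fubini_lat (f : nat -> nat -> C) K : 0 <= K ->
  (forall m n, Cmod (f m n) <= / INR (S m) ^ 2 * (K * / INR (S n) ^ 2)) ->
  CS (fun m => CS (fun n => f m n)) = CS (fun n => CS (fun m => f m n)).
Proof.
  intros HK H. apply CS_fubini with (1 := H).
  - apply inv_sq_nonneg.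
  - intros n. apply Rmult_le_pos; auto. apply inv_sq_nonneg.
  - apply ex_series_inv_sq.
  - exact (ex_series_scal_l K _ ex_series_inv_sq).
Qed.

Lemma inv_cS_pow k m : (/ cS m ^ k)%C = RtoC (/ INR (S m) ^ k).
Proof.
  unfold cS. rewrite <- RtoC_pow, <- RtoC_inv; auto.
  apply pow_nonzero. pose proof (INR_S_ge_1 m). lra.
Qed.

Lemma Im_pos_neq t : 0 < Im t -> t <> RtoC 0.
Proof. intros H E. rewrite E in H. simpl in H. lra. Qed.

Lemma inv_cSt_pow k m t : t <> RtoC 0 -> (/ (cS m * t) ^ k = / t ^ k * RtoC (/ INR (S m) ^ k))%C.
Proof.
  intros Ht. rewrite <- inv_cS_pow, Cpow_mult_l. field. split; apply Cpow_nz; auto. apply cS_neq.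
Qed.

Lemma asum_inv_cS k : (2 <= k)%nat -> asum (fun m => RtoC (/ INR (S m) ^ k)).
Proof.
  intros Hk. apply asum_le with (2 := ex_series_zeta k Hk). intros m.
  rewrite Cmod_RtoC_pos; [lra|]. left. apply Rinv_0_lt_compat, pow_lt.
  pose proof (INR_S_ge_1 m). lra.
Qed.

Lemma CS_inv_cS k : CS (fun m => RtoC (/ INR (S m) ^ k)) = RtoC (zeta k).
Proof. apply (CS_RtoC (fun m => / INR (S m) ^ k)). Qed.

(* Sums over the lattice points [m * t + n] with [m >= 1]. *)
Definition Leis (k : nat) (t : C) : C := CS (fun m => Sk k (cS m * t)).

Definition Sinv (t : C) : C := (- / t)%C.

Lemma Im_Sinv t : 0 < Im t -> Im (Sinv t) = Im t / Cmod t ^ 2.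
Proof.
  intros H. rewrite Cmod_sq. unfold Sinv. simpl. unfold Re, Im in *. field.
  destruct t as [a b]; simpl in *. nra.
Qed.

Lemma Im_Sinv_pos t : 0 < Im t -> 0 < Im (Sinv t).
Proof.
  intros H. rewrite Im_Sinv by auto. apply Rdiv_lt_0_compat; auto.
  apply pow_lt, Cmod_gt_0, Im_pos_neq, H.
Qed.

(** Since m (-1/t) + n = (n t - m) / t, the transformation exchanges the roles of [m] and [n]; the
    even exponent hides the sign. *)
Lemma pair_inv_Sinv k t m n : 0 < Im t ->
  pair_inv (2 * k) (cS m * Sinv t) n = (t ^ (2 * k) * pair_inv (2 * k) (cS n * t) m)%C.
Proof.
  intros H. pose proof (Im_pos_neq t H) as Ht. unfold pair_inv. fold (cS m) (cS n).
  pose proof (lattice_neq t n (INR (S m)) H) as N1.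
  pose proof (lattice_neq t n (- INR (S m)) H) as N2. rewrite RtoC_opp in N2.
  fold (cS m) in N1, N2.
  replace (cS m * Sinv t + cS n)%C with ((cS n * t + - cS m) * / t)%C
    by (unfold Sinv; field; auto).
  replace (cS m * Sinv t - cS n)%C with (- (1) * (cS n * t + cS m) * / t)%C
    by (unfold Sinv; field; auto).
  replace (cS n * t - cS m)%C with (cS n * t + - cS m)%C by ring.
  rewrite !Cpow_mult_l, (Cpow_mult_r (- (1))), Cpow_inv by auto.
  replace ((- (1)) ^ 2)%C with (RtoC 1) by ring. rewrite Cpow_1_l.
  field. repeat split; apply Cpow_nz; auto.
Qed.

Lemma asum_Sk4 t : 0 < Im t -> asum (fun m => CS (pair_inv 4 (cS m * t)))
  /\ asum (fun m => / (cS m * t) ^ 4)%C.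
Proof.
  intros H. pose proof (Clat_pos t H). split.
  - apply (asum_row (fun m n => pair_inv 4 (cS m * t) n) (2 * Clat t)); [lra|].
    intros; now apply pair_4_bound.
  - apply (asum_ext (fun m => / t ^ 4 * RtoC (/ INR (S m) ^ 4))%C).
    + intros m. symmetry. apply inv_cSt_pow, Im_pos_neq, H.
    + apply asum_scal, asum_inv_cS. lia.
Qed.

Lemma Leis4_split t : 0 < Im t ->
  Leis 4 t = (/ t ^ 4 * RtoC (zeta 4) + CS (fun m => CS (pair_inv 4 (cS m * t))))%C.
Proof.
  intros H. destruct (asum_Sk4 t H) as [A1 A2]. unfold Leis, Sk.
  rewrite CS_plus by auto. f_equal.
  rewrite <- CS_inv_cS, <- CS_scal by (apply asum_inv_cS; lia).
  apply CS_ext. intros m. apply inv_cSt_pow, Im_pos_neq, H.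
Qed.

(** The points off both axes are permuted, which is the exchange of summations. The [zeta 4] on
    either side belongs to the axis m = 0; it trades places with the axis n = 0, which sits inside
    [Leis 4]. *)
Theorem Leis4_Sinv t : 0 < Im t ->
  (Leis 4 (Sinv t) + RtoC (zeta 4) = t ^ 4 * (Leis 4 t + RtoC (zeta 4)))%C.
Proof.
  intros H. pose proof (Im_Sinv_pos t H) as H'. pose proof (Im_pos_neq t H) as Ht.
  rewrite (Leis4_split t H), (Leis4_split _ H').
  assert (E : CS (fun m => CS (pair_inv 4 (cS m * Sinv t)))
    = (t ^ 4 * CS (fun m => CS (pair_inv 4 (cS m * t))))%C).
  { pose proof (Clat_pos t H).
    transitivity (t ^ 4 * CS (fun n => CS (fun m => pair_inv 4 (cS m * t) n)))%C.
    2:{ f_equal. symmetry. apply (fubini_lat (fun m n => pair_inv 4 (cS m * t) n) (2 * Clat t));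
        [lra | intros; now apply pair_4_bound]. }
    rewrite <- CS_scal.
    - apply CS_ext. intros m. rewrite <- CS_scal.
      + apply CS_ext. intros n. apply (pair_inv_Sinv 2 t m n H).
      + apply asum_le with (fun n => 2 * Clat t * / INR (S m) ^ 2 * / INR (S n) ^ 2).
        * intros n. eapply Rle_trans; [now apply pair_4_bound|]. right; ring.
        * exact (ex_series_scal_l (2 * Clat t * / INR (S m) ^ 2) _ ex_series_inv_sq).
    - apply (asum_row (fun n m => pair_inv 4 (cS m * t) n) (2 * Clat t)); [lra|].
      intros n m. eapply Rle_trans; [now apply pair_4_bound|]. right; ring. }
  rewrite E. unfold Sinv. replace ((- / t) ^ 4)%C with (/ t ^ 4)%C by (field; auto).
  field. auto.
Qed.

(** Subtracting 1/(z^2 - 1) leaves -1/(z^2 (z - 1)(z + 1)), of order z^(-4), so the double sum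
    converges absolutely and may be exchanged. The subtracted [tel] telescopes along both directions
    of the lattice, and its sums are known exactly. *)
Definition hdiff (z : C) : C := (/ z ^ 2 - / (z ^ 2 - 1))%C.
Definition hpair (z : C) (n : nat) : C := (hdiff (z + cS n) + hdiff (z - cS n))%C.
Definition tel (z : C) : C := (/ (z ^ 2 - 1))%C.
Definition telpair (z : C) (n : nat) : C := (tel (z + cS n) + tel (z - cS n))%C.

Lemma sq_minus_1_neq z : 0 < Im z -> (z ^ 2 - 1 <> 0)%C /\ (z - 1 <> 0)%C /\ (z + 1 <> 0)%C.
Proof.
  intros H.
  assert (H1 : (z - 1 <> 0)%C) by (apply Im_pos_neq; simpl; fold (Im z); lra).
  assert (H2 : (z + 1 <> 0)%C) by (apply Im_pos_neq; simpl; fold (Im z); lra).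
  split; auto. replace (z ^ 2 - 1)%C with ((z - 1) * (z + 1))%C by ring. now apply Cmult_neq_0.
Qed.

Lemma hdiff_prod z : 0 < Im z -> hdiff z = (- / (z * z * ((z - 1) * (z + 1))))%C.
Proof.
  intros H. destruct (sq_minus_1_neq z H) as [H1 [H2 H3]]. pose proof (Im_pos_neq z H).
  unfold hdiff. field. repeat split; auto.
Qed.

Lemma Im_lattice_pos t m x : 0 < Im t -> 0 < Im (cS m * t + RtoC x).
Proof.
  intros H. replace (Im (cS m * t + RtoC x)) with (Im (cS m * t)).
  - now apply Im_cS_pos.
  - simpl. unfold Im. ring.
Qed.

Lemma hdiff_bound t m n (x : R) : 0 < Im t -> INR (S n) <= Rabs (x - 1) + 1 ->
  INR (S n) <= Rabs (x + 1) + 1 -> INR (S n) <= Rabs x + 1 ->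
  Cmod (hdiff (cS m * t + RtoC x)) <= / INR (S m) ^ 2 * (Clat t * / INR (S n) ^ 2).
Proof.
  intros H Hx1 Hx2 Hx. rewrite hdiff_prod by now apply Im_lattice_pos.
  rewrite Cmod_opp, <- Clat_split by auto.
  replace (cS m * t + RtoC x - 1)%C with (cS m * t + RtoC (x - 1))%C
    by (rewrite RtoC_minus; ring).
  replace (cS m * t + RtoC x + 1)%C with (cS m * t + RtoC (x + 1))%C
    by (rewrite RtoC_plus; ring).
  apply inv4_bound; [now apply lat_const_pos| |]; apply lattice_mul_bound; auto.
Qed.

Lemma hpair_bound t m n : 0 < Im t ->
  Cmod (hpair (cS m * t) n) <= / INR (S m) ^ 2 * (2 * Clat t * / INR (S n) ^ 2).
Proof.
  intros H. unfold hpair. pose proof (INR_S_ge_1 n) as Hn.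
  eapply Rle_trans; [apply Cmod_triangle|].
  assert (B1 : Cmod (hdiff (cS m * t + cS n)) <= / INR (S m) ^ 2 * (Clat t * / INR (S n) ^ 2)).
  { apply hdiff_bound; auto; rewrite Rabs_pos_eq; lra. }
  assert (B2 : Cmod (hdiff (cS m * t - cS n)) <= / INR (S m) ^ 2 * (Clat t * / INR (S n) ^ 2)).
  { replace (cS m * t - cS n)%C with (cS m * t + RtoC (- INR (S n)))%C
      by (unfold cS; rewrite RtoC_opp; ring).
    apply hdiff_bound; auto; rewrite Rabs_left1; lra. }
  lra.
Qed.

Lemma hdiff_0_bound t m : 0 < Im t ->
  Cmod (hdiff (cS m * t)) <= / INR (S m) ^ 2 * (Clat t * / INR (S 0) ^ 2).
Proof.
  intros H. replace (cS m * t)%C with (cS m * t + RtoC 0)%C by ring.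
  apply hdiff_bound; auto; simpl INR; rewrite ?Rabs_R0; try lra;
  match goal with |- context [Rabs ?x] => pose proof (Rabs_pos x); lra end.
Qed.

Lemma asum_hpair t m : 0 < Im t -> asum (hpair (cS m * t)).
Proof.
  intros H. apply asum_le with (fun n => 2 * Clat t * / INR (S m) ^ 2 * / INR (S n) ^ 2).
  - intros n. eapply Rle_trans; [now apply hpair_bound|]. right; ring.
  - exact (ex_series_scal_l (2 * Clat t * / INR (S m) ^ 2) _ ex_series_inv_sq).
Qed.

Lemma tel_split z : 0 < Im z -> tel z = ((/ (z - 1) - / (z + 1)) / 2)%C.
Proof.
  intros H. destruct (sq_minus_1_neq z H) as [H1 [H2 H3]]. unfold tel.
  replace (z ^ 2 - 1)%C with ((z - 1) * (z + 1))%C by ring. field. auto.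
Qed.

Lemma Im_plus_real z x : Im (z + RtoC x) = Im z.
Proof. simpl. unfold Im. ring. Qed.

Lemma telpair_partial z n : 0 < Im z ->
  (tel z + csum (telpair z) n
   = (/ (z - cS n) + / (z - RtoC (INR n)) - / (z + RtoC (INR n)) - / (z + cS n)) / 2)%C.
Proof.
  intros H. pose proof (Im_plus_real z) as Him.
  induction n.
  - simpl csum. rewrite Cplus_0_r, tel_split by auto. unfold cS. simpl INR.
    replace (z - 0)%C with z by ring. replace (z + 0)%C with z by ring. unfold Cdiv. ring.
  - simpl csum. rewrite Cplus_assoc, IHn. unfold telpair.
    rewrite !tel_split.
    2:{ replace (z - cS n)%C with (z + RtoC (- INR (S n)))%C by (unfold cS; rewrite RtoC_opp; ring).
        now rewrite Him. }
    2:{ unfold cS. now rewrite Him. }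
    assert (E1 : (z + cS n - 1 = z + RtoC (INR n))%C) by (unfold cS; rewrite S_INR, RtoC_plus; ring).
    assert (E2 : (z + cS n + 1 = z + cS (S n))%C) by (unfold cS; rewrite (S_INR (S n)), RtoC_plus; ring).
    assert (E3 : (z - cS n - 1 = z - cS (S n))%C) by (unfold cS; rewrite (S_INR (S n)), RtoC_plus; ring).
    assert (E4 : (z - cS n + 1 = z - RtoC (INR n))%C) by (unfold cS; rewrite S_INR, RtoC_plus; ring).
    rewrite E1, E2, E3, E4. fold (cS n). unfold Cdiv. ring.
Qed.

Lemma is_lim_inv_INR K : is_lim_seq (fun n => K / INR (S n)) 0.
Proof.
  replace (Finite 0) with (Rbar_mult K (Rbar_inv p_infty)) by (simpl; f_equal; ring).
  apply is_lim_seq_scal_l. apply is_lim_seq_inv.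
  - apply (is_lim_seq_incr_1 INR), is_lim_seq_INR.
  - discriminate.
Qed.

Lemma cvC_inv_shift z e : far z e ->
  cvC (fun n => / (z + cS n))%C 0 /\ cvC (fun n => / (z - cS n))%C 0.
Proof.
  intros H. split; apply cvC_le with (fun n => Kfar z e / INR (S n)); try apply is_lim_inv_INR;
  intros n; unfold Cminus at 1; rewrite Copp_0, Cplus_0_r.
  - now apply far_inv_pos.
  - now apply far_inv_neg.
Qed.

Lemma cvC_shift u l : cvC u l <-> cvC (fun n => u (S n)) l.
Proof. apply (is_lim_seq_incr_1 (fun n => Cmod (u n - l))). Qed.

Lemma tel_sum z : 0 < Im z -> cvC (fun n => tel z + csum (telpair z) n)%C 0.
Proof.
  intros H. pose proof (far_Im z H) as Hf. destruct (cvC_inv_shift z _ Hf) as [L1 L2].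
  assert (L3 : cvC (fun n => / (z + RtoC (INR n)))%C 0) by (apply cvC_shift; exact L1).
  assert (L4 : cvC (fun n => / (z - RtoC (INR n)))%C 0) by (apply cvC_shift; exact L2).
  apply cvC_ext with (fun n => / 2 * ((/ (z - cS n) + / (z - RtoC (INR n))) +
     ((- (1)) * (/ (z + RtoC (INR n)) + / (z + cS n)))))%C.
  - intros n. rewrite telpair_partial by auto. unfold Cdiv. ring.
  - pose proof (cvC_scal (/ 2) _ _ (cvC_plus _ _ _ _ (cvC_plus _ _ _ _ L2 L4)
      (cvC_scal (- (1)) _ _ (cvC_plus _ _ _ _ L3 L1)))) as L.
    match type of L with cvC _ ?x => replace x with (RtoC 0) in L by ring end. exact L.
Qed.

(** Along a row the correction telescopes to 0, so the inner sum of weight 2 may be replaced by the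
    absolutely convergent one. *)
Lemma Sk2_hpair t m : 0 < Im t ->
  Sk 2 (cS m * t) = (hdiff (cS m * t) + CS (hpair (cS m * t)))%C.
Proof.
  intros H. pose proof (Im_cS_pos m t H) as Hz.
  pose proof (asum_hpair t m H) as Ah. set (z := (cS m * t)%C) in *.
  pose proof (asum_pair_inv z _ 1 (far_Im z Hz)) as Ap.
  unfold Sk.
  apply cvC_unique with (fun n => (/ z ^ 2 + csum (pair_inv 2 z) n))%C.
  - apply cvC_plus; [apply cvC_const | now apply CS_cv].
  - apply cvC_ext with (fun n => (hdiff z + csum (hpair z) n) + (tel z + csum (telpair z) n))%C.
    + intros n. rewrite <- (csum_ext (fun k => hpair z k + telpair z k)%C (pair_inv 2 z)).
      * rewrite csum_plus. unfold hdiff, tel. ring.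
      * intros k _. unfold hpair, telpair, hdiff, tel, pair_inv, cS. ring.
    + rewrite <- (Cplus_0_r (hdiff z + _)%C).
      apply cvC_plus; [apply cvC_plus; [apply cvC_const | now apply CS_cv] | now apply tel_sum].
Qed.

(* [cterm t n] is the principal value sum of [1 / (m t + n)] over [m <> 0]. *)
Definition cterm (t : C) (n m : nat) : C :=
  (/ (RtoC (INR n) + cS m * t) + / (RtoC (INR n) - cS m * t))%C.
Definition cpv (t : C) (n : nat) : C := CS (cterm t n).

Lemma cterm_0 t m : 0 < Im t -> cterm t 0 m = RtoC 0.
Proof.
  intros H. pose proof (Im_pos_neq _ (Im_cS_pos m t H)) as N.
  unfold cterm. simpl INR. set (z := (cS m * t)%C) in *.
  replace (0 + z)%C with z by ring. replace (0 - z)%C with (- z)%C by ring.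
  field. auto.
Qed.

Lemma cterm_S t n m : 0 < Im t -> cterm t (S n) m = (Sinv t * pair_inv 1 (cS n * Sinv t) m)%C.
Proof.
  intros H. pose proof (Im_pos_neq t H) as Ht. unfold cterm, pair_inv. fold (cS m) (cS n).
  rewrite !Cpow_1_r.
  pose proof (lattice_neq t m (INR (S n)) H) as N1.
  pose proof (lattice_neq t m (- INR (S n)) H) as N2. rewrite RtoC_opp in N2. fold (cS n) in N1, N2.
  replace (cS n * Sinv t + cS m)%C with ((cS m * t + - cS n) * / t)%C by (unfold Sinv; field; auto).
  replace (cS n * Sinv t - cS m)%C with (- (cS m * t + cS n) * / t)%C by (unfold Sinv; field; auto).
  replace (cS n + cS m * t)%C with (cS m * t + cS n)%C by ring.
  replace (cS n - cS m * t)%C with (- (cS m * t + - cS n))%C by ring.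
  unfold Sinv.
  set (A := (cS m * t + cS n)%C) in *. set (B := (cS m * t + - cS n)%C) in *.
  field. auto.
Qed.

Lemma asum_cterm t n : 0 < Im t -> asum (cterm t n).
Proof.
  intros H. destruct n.
  - apply asum_ext with (fun k : nat => if Nat.eqb k 0 then RtoC 0 else RtoC 0).
    + intros k. rewrite cterm_0 by auto. now destruct (Nat.eqb k 0).
    + apply CS_single.
  - apply (asum_ext (fun m => Sinv t * pair_inv 1 (cS n * Sinv t) m)%C).
    + intros m. symmetry. now apply cterm_S.
    + apply asum_scal. apply asum_pair_inv with (Im (cS n * Sinv t)).
      apply far_Im, Im_cS_pos, Im_Sinv_pos, H.
Qed.

Lemma cpv_0 t : 0 < Im t -> cpv t 0 = RtoC 0.
Proof. intros H. unfold cpv. rewrite (CS_ext _ (fun _ => RtoC 0)); [apply CS_0 | intros; now apply cterm_0]. Qed.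

(** Dividing numerator and denominator by [t] turns the column sum into the partial fractions of the
    cotangent at n (-1/t), without its term at 0. *)
Lemma cpv_S t n : 0 < Im t ->
  cpv t (S n) = (Sinv t * pi_cot (cS n * Sinv t) - / cS n)%C.
Proof.
  intros H. pose proof (Im_Sinv_pos t H) as H'. pose proof (Im_cS_pos n _ H') as Hw.
  unfold cpv. rewrite (CS_ext _ _ (fun m => cterm_S t n m H)).
  rewrite CS_scal by (apply asum_pair_inv with (1 := far_Im _ Hw)).
  rewrite <- Sk_1 by auto. unfold Sk. rewrite Cpow_1_r.
  field. split; [apply cS_neq | now apply Im_pos_neq].
Qed.

Lemma pi_cot_lim t : 0 < Im t -> cvC (fun n => pi_cot (cS n * t)) (- (RtoC PI * Ci))%C.
Proof.
  intros H. pose proof (nome_lt_1 t H) as Hq. set (r := Cmod (nome t)) in *.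
  assert (Hr : 0 <= r) by apply Cmod_ge_0.
  apply cvC_le with (fun n => 2 * PI / (1 - r) * r ^ S n).
  - intros n. pose proof (Im_cS_pos n t H) as Hw. rewrite pi_cot_fourier by auto.
    pose proof (nome_lt_1 _ Hw) as Hq'. rewrite CS_geom_S by auto.
    assert (E : nome (cS n * t) = (nome t ^ S n)%C) by (rewrite nome_pow; reflexivity).
    replace (- (PI * Ci) - (2 * PI)%R * Ci * (nome (cS n * t) / (1 - nome (cS n * t))) - - (PI * Ci))%C
      with (- ((2 * PI)%R * Ci * (nome (cS n * t) / (1 - nome (cS n * t)))))%C by ring.
    rewrite Cmod_opp, Cmod_mult, Cmod_two_pi_i, Cmod_div by now apply Cmod_lt_1_neq.
    assert (Er : Cmod (nome (cS n * t)) = r ^ S n) by (rewrite E, Cmod_pow; reflexivity).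
    assert (Hle : r ^ S n <= r).
    { apply Rle_trans with (r * 1); [|lra]. simpl. apply Rmult_le_compat_l; auto.
      rewrite <- (pow1 n). apply pow_incr. lra. }
    pose proof (Cmod_triangle_inv 1 (nome (cS n * t))) as Ht. rewrite Cmod_1 in Ht.
    rewrite Er in *. pose proof PI_RGT_0.
    assert (0 <= r ^ S n) by now apply pow_le.
    replace (2 * PI / (1 - r) * r ^ S n) with (2 * PI * (r ^ S n * / (1 - r))) by (unfold Rdiv; ring).
    apply Rmult_le_compat_l; [lra|]. apply Rmult_le_compat_l; auto.
    apply Rinv_le_contravar; lra.
  - replace (Finite 0) with (Finite (2 * PI / (1 - r) * 0)) by (f_equal; ring).
    apply is_lim_seq_mult'; [apply is_lim_seq_const|].
    apply (is_lim_seq_incr_1 (fun n => r ^ n)). apply is_lim_seq_geom. rewrite Rabs_pos_eq; lra.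
Qed.

(** In the upper half-plane the cotangent tends to -pi i as the imaginary part grows. That this
    limit is not 0 is the entire reason why weight 2 is only quasi-modular. *)
Lemma cpv_lim t : 0 < Im t -> cvC (cpv t) (- (RtoC PI * Ci * Sinv t))%C.
Proof.
  intros H. apply cvC_shift.
  apply cvC_ext with (fun n => Sinv t * pi_cot (cS n * Sinv t) + - (1) * / cS n)%C.
  - intros n. rewrite cpv_S by auto. ring.
  - replace (- (PI * Ci * Sinv t))%C with (Sinv t * (- (PI * Ci)) + - (1) * 0)%C by ring.
    apply cvC_plus; apply cvC_scal.
    + now apply pi_cot_lim, Im_Sinv_pos.
    + apply cvC_le with (fun n => 1 / INR (S n)); [|apply is_lim_inv_INR].
      intros n. unfold Cminus. rewrite Copp_0, Cplus_0_r, Cmod_inv, Cmod_cS by apply cS_neq. lra.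
Qed.

(** In this form the correction telescopes over columns, with step 2 in [n]. *)
Lemma telpair_cterm t n m : 0 < Im t ->
  telpair (cS m * t) n = (/ 2 * (cterm t n m - cterm t (S (S n)) m))%C.
Proof.
  intros H. unfold telpair.
  assert (H1 : 0 < Im (cS m * t + cS n)) by (apply Im_lattice_pos, H).
  assert (H2 : 0 < Im (cS m * t - cS n)).
  { replace (cS m * t - cS n)%C with (cS m * t + RtoC (- INR (S n)))%C
      by (unfold cS; rewrite RtoC_opp; ring). apply Im_lattice_pos, H. }
  rewrite !tel_split by auto. unfold cterm.
  assert (E1 : (cS m * t + cS n - 1 = RtoC (INR n) + cS m * t)%C)
    by (unfold cS; rewrite (S_INR n), RtoC_plus; ring).
  assert (E2 : (cS m * t + cS n + 1 = RtoC (INR (S (S n))) + cS m * t)%C)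
    by (unfold cS; rewrite (S_INR (S n)), RtoC_plus; ring).
  assert (E3 : (cS m * t - cS n - 1 = - (RtoC (INR (S (S n))) - cS m * t))%C)
    by (unfold cS; rewrite (S_INR (S n)), RtoC_plus; ring).
  assert (E4 : (cS m * t - cS n + 1 = - (RtoC (INR n) - cS m * t))%C)
    by (unfold cS; rewrite (S_INR n), RtoC_plus; ring).
  assert (N3 : (cS m * t - cS n - 1 <> 0)%C) by (apply sq_minus_1_neq, H2).
  assert (N4 : (cS m * t - cS n + 1 <> 0)%C) by (apply sq_minus_1_neq, H2).
  assert (N1 : (cS m * t + cS n - 1 <> 0)%C) by (apply sq_minus_1_neq, H1).
  assert (N2 : (cS m * t + cS n + 1 <> 0)%C) by (apply sq_minus_1_neq, H1).
  rewrite E1 in *. rewrite E2 in *. rewrite E3 in *. rewrite E4 in *.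
  assert (neg : forall w, (- w <> 0)%C -> w <> RtoC 0)
    by (intros w Hw E; apply Hw; rewrite E; ring).
  apply neg in N3. apply neg in N4.
  set (A := (RtoC (INR n) + cS m * t)%C) in *. set (B := (RtoC (INR (S (S n))) + cS m * t)%C) in *.
  set (D := (RtoC (INR (S (S n))) - cS m * t)%C) in *. set (F := (RtoC (INR n) - cS m * t)%C) in *.
  field. auto.
Qed.

Lemma asum_telpair_col t n : 0 < Im t -> asum (fun m => telpair (cS m * t) n).
Proof.
  intros H. apply (asum_ext (fun m => / 2 * (cterm t n m + - (1) * cterm t (S (S n)) m))%C).
  - intros m. rewrite telpair_cterm by auto. ring.
  - apply asum_scal, asum_plus; [|apply asum_scal]; now apply asum_cterm.
Qed.

Lemma CS_telpair_col t n : 0 < Im t ->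
  CS (fun m => telpair (cS m * t) n) = (/ 2 * (cpv t n - cpv t (S (S n))))%C.
Proof.
  intros H. rewrite (CS_ext _ _ (fun m => telpair_cterm t n m H)).
  assert (A : asum (fun m => cterm t n m - cterm t (S (S n)) m)%C).
  { apply (asum_ext (fun m => cterm t n m + - (1) * cterm t (S (S n)) m)%C); [intros; ring|].
    apply asum_plus; [|apply asum_scal]; now apply asum_cterm. }
  rewrite CS_scal by auto. f_equal. unfold cpv. rewrite <- CS_minus; auto using asum_cterm.
Qed.

Lemma csum_tel2 (u : nat -> C) n :
  csum (fun k => u k - u (S (S k)))%C n = (u 0%nat + u 1%nat - u n - u (S n))%C.
Proof. induction n; simpl; [ring|]. rewrite IHn. ring. Qed.

Lemma CS_hpair_col t n : 0 < Im t ->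
  CS (fun m => hpair (cS m * t) n)
  = (Sinv t ^ 2 * CS (pair_inv 2 (cS n * Sinv t)) - / 2 * (cpv t n - cpv t (S (S n))))%C
  /\ asum (pair_inv 2 (cS n * Sinv t)).
Proof.
  intros H. pose proof (Im_Sinv_pos t H) as H'. pose proof (Im_cS_pos n _ H') as Hw.
  pose proof (asum_pair_inv _ _ 1 (far_Im _ Hw)) as A. split; auto.
  rewrite <- CS_telpair_col, <- CS_scal, <- CS_minus by (auto using asum_scal, asum_telpair_col).
  apply CS_ext. intros m.
  assert (E : (Sinv t ^ 2 * pair_inv 2 (cS n * Sinv t) m)%C = pair_inv 2 (cS m * t) n).
  { pose proof (pair_inv_Sinv 1 t n m H) as E. change (2 * 1)%nat with 2%nat in E.
    rewrite E. unfold Sinv.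
    replace ((- / t) ^ 2)%C with (/ t ^ 2)%C by (field; now apply Im_pos_neq).
    field. now apply Im_pos_neq. }
  rewrite E. unfold hpair, telpair, hdiff, tel, pair_inv, cS. ring.
Qed.

Lemma asum_hpair_row t : 0 < Im t -> asum (fun m => CS (hpair (cS m * t))).
Proof.
  intros H. pose proof (Clat_pos t H).
  apply (asum_row (fun m n => hpair (cS m * t) n) (2 * Clat t)); [lra|].
  intros; now apply hpair_bound.
Qed.

Lemma asum_hpair_col t : 0 < Im t -> asum (fun n => CS (fun m => hpair (cS m * t) n)).
Proof.
  intros H. pose proof (Clat_pos t H).
  apply (asum_row (fun n m => hpair (cS m * t) n) (2 * Clat t)); [lra|].
  intros n m. eapply Rle_trans; [now apply hpair_bound|]. right; ring.
Qed.

Lemma asum_hdiff t : 0 < Im t -> asum (fun m => hdiff (cS m * t)).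
Proof.
  intros H. apply asum_le with (fun m => Clat t * / INR (S m) ^ 2).
  - intros m. eapply Rle_trans; [now apply hdiff_0_bound|]. right. simpl (INR 1). field.
    pose proof (INR_S_ge_1 m). lra.
  - exact (ex_series_scal_l (Clat t) _ ex_series_inv_sq).
Qed.

Lemma asum_Sk2 t : 0 < Im t -> asum (fun m => Sk 2 (cS m * t)).
Proof.
  intros H. apply (asum_ext (fun m => hdiff (cS m * t) + CS (hpair (cS m * t)))%C).
  - intros m. symmetry. now apply Sk2_hpair.
  - apply asum_plus; [now apply asum_hdiff | now apply asum_hpair_row].
Qed.

(** Summed by rows the correction vanishes; summed by columns it leaves the value of [cpv] at
    infinity. Since the corrected double sum is the same both ways, the discrepancy is the term -pi
    i (-1/t). *)
Theorem Leis2_Sinv t : 0 < Im t ->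
  (RtoC (zeta 2) + Leis 2 t
   = Sinv t ^ 2 * (RtoC (zeta 2) + Leis 2 (Sinv t)) - RtoC PI * Ci * Sinv t)%C.
Proof.
  intros H. pose proof (Im_Sinv_pos t H) as H'. pose proof (Im_pos_neq t H) as Ht.
  assert (Es : (Sinv t ^ 2 = / t ^ 2)%C) by (unfold Sinv; field; auto).
  assert (A2 : asum (fun m => / (cS m * t) ^ 2)%C).
  { apply (asum_ext (fun m => / t ^ 2 * RtoC (/ INR (S m) ^ 2))%C).
    - intros m. symmetry. now apply inv_cSt_pow.
    - now apply asum_scal, asum_inv_cS. }
  (* The axis n = 0 also receives the correction; the half of [cpv t 1] appearing here cancels the
     boundary term at n = 1 in [E3]. *)
  assert (E0 : CS (fun m => hdiff (cS m * t)) = (/ t ^ 2 * RtoC (zeta 2) + / 2 * cpv t 1)%C).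
  { unfold cpv. rewrite <- CS_inv_cS, <- (CS_scal (/ t ^ 2)) by now apply asum_inv_cS.
    rewrite <- CS_scal, <- CS_plus by auto using asum_cterm, asum_scal, asum_inv_cS.
    - apply CS_ext. intros m. unfold hdiff. rewrite inv_cSt_pow by auto.
      pose proof (Im_cS_pos m t H) as Hz. destruct (sq_minus_1_neq _ Hz) as [N1 [N2 N3]].
      unfold cterm. simpl (INR 1).
      replace ((cS m * t) ^ 2 - 1)%C with ((cS m * t - 1) * (cS m * t + 1))%C by ring.
      replace (1 - cS m * t)%C with (- (cS m * t - 1))%C by ring.
      replace (1 + cS m * t)%C with (cS m * t + 1)%C by ring.
      set (u := (cS m * t - 1)%C) in *. set (v := (cS m * t + 1)%C) in *.
      assert (Euv : (v - u = 2)%C) by (unfold u, v; ring).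
      replace (/ (u * v))%C with (/ 2 * ((v - u) * / (u * v)))%C by (rewrite Euv; field; auto).
      field. auto. }
  assert (E1 : Leis 2 t = (CS (fun m => hdiff (cS m * t)) + CS (fun m => CS (hpair (cS m * t))))%C).
  { unfold Leis. rewrite <- CS_plus by (auto using asum_hdiff, asum_hpair_row).
    apply CS_ext. intros m. now apply Sk2_hpair. }
  assert (E2 : CS (fun m => CS (hpair (cS m * t))) = CS (fun n => CS (fun m => hpair (cS m * t) n))).
  { pose proof (Clat_pos t H).
    apply (fubini_lat (fun m n => hpair (cS m * t) n) (2 * Clat t)); [lra|].
    intros; now apply hpair_bound. }
  assert (Ap : asum (fun n => CS (pair_inv 2 (cS n * Sinv t)))).
  { apply (asum_ext (fun n => Sk 2 (cS n * Sinv t) + - (1) * / (cS n * Sinv t) ^ 2)%C).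
    - intros n. unfold Sk. ring.
    - apply asum_plus; [now apply asum_Sk2 | apply asum_scal].
      apply (asum_ext (fun m => / Sinv t ^ 2 * RtoC (/ INR (S m) ^ 2))%C).
      + intros m. symmetry. apply inv_cSt_pow. now apply Im_pos_neq.
      + now apply asum_scal, asum_inv_cS. }
  assert (E3 : CS (fun n => CS (fun m => hpair (cS m * t) n))
    = (Sinv t ^ 2 * CS (fun n => CS (pair_inv 2 (cS n * Sinv t)))
       - / 2 * (cpv t 1 + 2 * (RtoC PI * Ci * Sinv t)))%C).
  { apply cvC_unique with (csum (fun n => CS (fun m => hpair (cS m * t) n))).
    - now apply CS_cv, asum_hpair_col.
    - apply cvC_ext with (fun N => Sinv t ^ 2 * csum (fun n => CS (pair_inv 2 (cS n * Sinv t))) N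
         + (- / 2) * ((cpv t 1 + - (1) * cpv t N) + - (1) * cpv t (S N)))%C.
      + intros N. rewrite (csum_ext (fun n => CS (fun m => hpair (cS m * t) n)) (fun n => Sinv t ^ 2 * CS (pair_inv 2 (cS n * Sinv t))
          + (- / 2) * (cpv t n - cpv t (S (S n))))%C).
        * rewrite csum_plus, !csum_scal, csum_tel2, cpv_0 by auto. ring.
        * intros k _. destruct (CS_hpair_col t k H) as [Ek _]. rewrite Ek. ring.
      + pose proof (cpv_lim t H) as L. pose proof (proj1 (cvC_shift _ _) L) as L'.
        pose proof (cvC_plus _ _ _ _ (cvC_scal (Sinv t ^ 2) _ _ (CS_cv _ Ap))
          (cvC_scal (- / 2) _ _ (cvC_plus _ _ _ _ (cvC_plus _ _ _ _ (cvC_const (cpv t 1))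
             (cvC_scal (- (1)) _ _ L)) (cvC_scal (- (1)) _ _ L')))) as LL.
        match type of LL with cvC _ ?x =>
          match goal with |- cvC _ ?y => replace y with x by ring end end.
        exact LL. }
  assert (E4 : Leis 2 (Sinv t) = (t ^ 2 * RtoC (zeta 2) + CS (fun n => CS (pair_inv 2 (cS n * Sinv t))))%C).
  { unfold Leis, Sk.
    assert (Ai : asum (fun n => / (cS n * Sinv t) ^ 2)%C).
    { apply (asum_ext (fun m => / Sinv t ^ 2 * RtoC (/ INR (S m) ^ 2))%C).
      - intros m. symmetry. apply inv_cSt_pow. now apply Im_pos_neq.
      - now apply asum_scal, asum_inv_cS. }
    rewrite CS_plus by auto. f_equal.
    rewrite <- CS_inv_cS, <- CS_scal by now apply asum_inv_cS.
    apply CS_ext. intros n. rewrite inv_cSt_pow by now apply Im_pos_neq.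
    f_equal. rewrite Es. field. auto. }
  rewrite E1, E0, E2, E3, E4, Es. field. auto.
Qed.

(** * The Eisenstein series [E4] and [E2] *)

Definition lam (k : nat) (q : C) (n : nat) : C :=
  (RtoC (INR (S n) ^ k) * (q ^ S n / (1 - q ^ S n)))%C.

Lemma pow_S_le_1 r n : 0 <= r < 1 -> r ^ S n <= r.
Proof.
  intros H. simpl. apply Rle_trans with (r * 1); [|lra]. apply Rmult_le_compat_l; [lra|].
  rewrite <- (pow1 n). apply pow_incr. lra.
Qed.

Lemma Cmod_pow_S_lt q n : Cmod q < 1 -> Cmod (q ^ S n)%C < 1.
Proof.
  intros H. rewrite Cmod_pow. pose proof (Cmod_ge_0 q).
  pose proof (pow_S_le_1 (Cmod q) n). lra.
Qed.

Lemma nome_half_mod t : Cmod (nome t) = exp (- (PI * Im t)) * exp (- (PI * Im t)).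
Proof. rewrite nome_mod, <- exp_plus. f_equal. ring. Qed.

Lemma exp_pow x n : exp x ^ n = exp (INR n * x).
Proof.
  induction n; [simpl; rewrite Rmult_0_l, exp_0; reflexivity|].
  rewrite S_INR. simpl. rewrite IHn, <- exp_plus. f_equal. ring.
Qed.

Lemma ex_series_pow_geom t k : 0 < Im t ->
  ex_series (fun n => INR (S n) ^ k * exp (- (PI * Im t)) ^ S n).
Proof.
  intros H.
  assert (H' : 0 < Im (t / 2)) by (unfold Cdiv; rewrite <- RtoC_inv by lra; simpl; unfold Im in *; lra).
  pose proof (asum_pisum (t / 2) k H') as A.
  eapply ex_series_ext; [|exact A]. intros n. cbv beta.
  rewrite Cmod_mult, Cmod_pow, nome_mod, Cmod_RtoC_pos by (apply pow_le, pos_INR).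
  do 3 f_equal. replace (Im (t / 2)) with (Im t / 2); [field|].
  unfold Cdiv; rewrite <- RtoC_inv by lra. simpl. unfold Im. lra.
Qed.

(** The double series of n^k q^(m n), summed first over [m] as a geometric series. *)
Lemma lambert t k : 0 < Im t ->
  CS (fun m => pisum k (nome (cS m * t))) = CS (lam k (nome t))
  /\ asum (fun m => pisum k (nome (cS m * t))).
Proof.
  intros H. set (rho := exp (- (PI * Im t))).
  assert (Hrho : 0 <= rho < 1) by now apply exp_neg_PI_lt_1.
  set (f := fun m n => (RtoC (INR (S n) ^ k) * nome (cS m * t) ^ S n)%C).
  assert (Hf : forall m n, Cmod (f m n) <= rho ^ S m * (INR (S n) ^ k * rho ^ S n)).
  { intros m n. unfold f.
    rewrite Cmod_mult, Cmod_pow, nome_mod, Cmod_RtoC_pos by (apply pow_le, pos_INR).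
    rewrite Im_cS_mult, exp_pow. unfold rho. rewrite !exp_pow.
    replace (exp (INR (S m) * - (PI * Im t)) * (INR (S n) ^ k * exp (INR (S n) * - (PI * Im t))))
      with (INR (S n) ^ k * exp ((INR (S m) + INR (S n)) * - (PI * Im t))).
    2:{ rewrite Rmult_plus_distr_r, exp_plus. ring. }
    apply Rmult_le_compat_l; [apply pow_le, pos_INR|].
    (* 2 m n >= m + n for m, n >= 1: the non-separated exponent is traded for a product of a
       function of [m] and a function of [n]. *)
    assert (Hle : INR (S n) * - (2 * PI * (INR (S m) * Im t)) <= (INR (S m) + INR (S n)) * - (PI * Im t)).
    { pose proof (INR_S_ge_1 m). pose proof (INR_S_ge_1 n).
      pose proof PI_RGT_0. assert (0 < PI * Im t) by now apply Rmult_lt_0_compat.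
      set (p := PI * Im t) in *.
      replace (INR (S n) * - (2 * PI * (INR (S m) * Im t))) with (- (2 * INR (S n) * INR (S m)) * p)
        by (unfold p; ring).
      replace ((INR (S m) + INR (S n)) * - p) with (- (INR (S m) + INR (S n)) * p) by ring.
      apply Rmult_le_compat_r; [lra|]. nra. }
    destruct Hle as [Hlt|Heq]; [left; now apply exp_increasing | rewrite Heq; lra]. }
  assert (Hs : ex_series (fun n => INR (S n) ^ k * rho ^ S n)) by now apply ex_series_pow_geom.
  assert (Hp : forall n, 0 <= INR (S n) ^ k * rho ^ S n).
  { intros n. apply Rmult_le_pos; apply pow_le; [apply pos_INR | lra]. }
  split.
  - change (CS (fun m => CS (fun n => f m n)) = CS (lam k (nome t))).
    rewrite (CS_fubini _ _ _ Hf); auto using ex_series_geom_S.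
    2:{ intros; apply pow_le; lra. }
    apply CS_ext. intros n. unfold f, lam.
    pose proof (Cmod_pow_S_lt (nome t) n (nome_lt_1 t H)) as Hq.
    assert (E : forall m, (nome (cS m * t) ^ S n = (nome t ^ S n) ^ S m)%C).
    { intros m. rewrite <- !Cpow_mult_r.
      replace (nome (cS m * t)) with (nome t ^ S m)%C by (rewrite nome_pow; reflexivity).
      rewrite <- Cpow_mult_r. f_equal. lia. }
    rewrite (CS_ext _ (fun m => RtoC (INR (S n) ^ k) * (nome t ^ S n) ^ S m)%C)
      by (intros; now rewrite E).
    rewrite CS_scal, CS_geom_S; auto using asum_geom_S.
  - apply asum_le with (fun m => Series (fun n => INR (S n) ^ k * rho ^ S n) * rho ^ S m).
    + intros m. rewrite Rmult_comm, <- Series_scal_l. apply CS_mod_le; [intros; apply Hf|].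
      exact (ex_series_scal_l (rho ^ S m) _ Hs).
    + exact (ex_series_scal_l _ _ (ex_series_geom_S _ Hrho)).
Qed.

Lemma Leis_lambert t k : 0 < Im t -> (1 <= k)%nat ->
  Leis (S k) t = ((-(1)) ^ k * lip_coef k * CS (lam k (nome t)))%C.
Proof.
  intros H Hk. destruct (lambert t k H) as [E A]. rewrite <- E, <- CS_scal by auto.
  apply CS_ext. intros m. apply lipschitz; auto. now apply Im_cS_pos.
Qed.

Lemma sigma3_rsum n :
  INR (sigma3 n) = rsum (fun d => if Nat.eqb (Nat.modulo n (S d)) 0 then INR (S d) ^ 3 else 0) n.
Proof.
  unfold sigma3.
  assert (G : forall k, INR (list_sum (map (fun d => Nat.pow d 3)
      (filter (fun d => Nat.eqb (Nat.modulo n d) 0) (seq 1 k))))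
    = rsum (fun d => if Nat.eqb (Nat.modulo n (S d)) 0 then INR (S d) ^ 3 else 0) k); [|apply G].
  induction k; [reflexivity|].
  rewrite seq_S, filter_app, map_app, list_sum_app, plus_INR, IHk.
  change (1 + k)%nat with (S k). cbn [rsum filter].
  destruct (Nat.eqb (Nat.modulo n (S k)) 0); [|reflexivity].
  cbn [map list_sum fold_right]. rewrite Nat.add_0_r, pow_INR. reflexivity.
Qed.

Definition divides_b (d n : nat) : bool := Nat.eqb (Nat.modulo n d) 0.

(** With d = D + 1, the sum F of q^n over the multiples n >= 0 of d satisfies F = 1 + q^d F, because
    divisibility by d is invariant under the shift by d. The term n = 0 is then removed. *)
Lemma CS_multiples q D : Cmod q < 1 ->
  CS (fun n => if divides_b (S D) (S n) then q ^ S n else 0)%C = (q ^ S D / (1 - q ^ S D))%C.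
Proof.
  intros Hq. set (d := S D). set (f := fun n => (if divides_b d n then q ^ n else 0)%C).
  assert (Hfm : forall n, Cmod (f n) <= Cmod q ^ n).
  { intros n. unfold f. destruct (divides_b d n); [rewrite Cmod_pow; lra|].
    rewrite Cmod_0. apply pow_le, Cmod_ge_0. }
  assert (A : asum f).
  { apply asum_le with (1 := Hfm). apply ex_series_geom_pos. split; [apply Cmod_ge_0 | auto]. }
  pose proof (CS_S f A) as E1. pose proof (CS_split f d A) as E2.
  assert (F0 : f 0%nat = RtoC 1).
  { unfold f, divides_b. rewrite Nat.Div0.mod_0_l. reflexivity. }
  assert (Hc : forall k, (k <= D)%nat -> csum f (S k) = RtoC 1).
  { induction k; intros Hk.
    - simpl csum. rewrite F0. ring.
    - change (csum f (S (S k))) with (csum f (S k) + f (S k))%C. rewrite IHk by lia.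
      unfold f, divides_b. rewrite Nat.mod_small by (unfold d; lia). simpl. ring. }
  unfold d in E2 at 1. rewrite Hc in E2 by lia.
  assert (Hs : CS (fun k => f (d + k)%nat) = (q ^ d * CS f)%C).
  { rewrite <- CS_scal by auto. apply CS_ext. intros n. unfold f, divides_b.
    replace (d + n)%nat with (n + 1 * d)%nat by lia. rewrite Nat.Div0.mod_add.
    destruct (Nat.eqb (Nat.modulo n d) 0); [|ring].
    rewrite Nat.mul_1_l, Nat.add_comm, Cpow_add_r. reflexivity. }
  rewrite Hs in E2.
  pose proof (Cmod_lt_1_neq _ (Cmod_pow_S_lt q D Hq)) as Hn. fold d in Hn |- *.
  change (CS (fun n => f (S n)) = (q ^ d / (1 - q ^ d))%C).
  assert (EY : CS f = (/ (1 - q ^ d))%C).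
  { set (Y := CS f) in *. replace Y with (Y * (1 - q ^ d) / (1 - q ^ d))%C by (field; auto).
    replace (Y * (1 - q ^ d))%C with (Y - q ^ d * Y)%C by ring. rewrite E2 at 1. field. auto. }
  rewrite F0 in E1.
  replace (CS (fun n => f (S n))) with (CS f - 1)%C by (rewrite E1; ring).
  rewrite EY. field. auto.
Qed.

(** Exchange of the sums over [n] and its divisors [d]. With |q| = rho^2 and d <= n, one factor
    rho^n is kept for [n] and the other is at most rho^d, which gives the separated majorant. *)
Lemma sigma3_lambert t : 0 < Im t ->
  CS (fun n => RtoC (INR (sigma3 (S n))) * nome t ^ S n)%C = CS (lam 3 (nome t))
  /\ asum (fun n => RtoC (INR (sigma3 (S n))) * nome t ^ S n)%C.
Proof.
  intros H. set (rho := exp (- (PI * Im t))).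
  assert (Hrho : 0 <= rho < 1) by now apply exp_neg_PI_lt_1.
  assert (Hrho0 : 0 < rho) by apply exp_pos.
  set (q := nome t). pose proof (nome_lt_1 t H) as Hq. fold q in Hq.
  assert (Hqr : Cmod q = rho * rho) by apply nome_half_mod.
  set (f := fun n d => (RtoC (INR (S d) ^ 3) * (if divides_b (S d) (S n) then q ^ S n else 0))%C).
  assert (Hf : forall n d, Cmod (f n d) <= rho ^ S n * (INR (S d) ^ 3 * rho ^ S d)).
  { intros n d. unfold f. rewrite Cmod_mult, Cmod_RtoC_pos by (apply pow_le, pos_INR).
    rewrite (Rmult_comm (rho ^ S n)), Rmult_assoc.
    apply Rmult_le_compat_l; [apply pow_le, pos_INR|].
    unfold divides_b. destruct (Nat.eqb (Nat.modulo (S n) (S d)) 0) eqn:E.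
    - assert (Hd : (S d <= S n)%nat).
      { apply Nat.eqb_eq in E. destruct (le_lt_dec (S d) (S n)) as [h|h]; auto.
        rewrite Nat.mod_small in E by auto. lia. }
      rewrite Cmod_pow, Hqr, Rpow_mult_distr.
      apply Rmult_le_compat_r; [apply pow_le; lra|].
      replace (S n) with (S d + (S n - S d))%nat by lia. rewrite pow_add.
      assert (0 <= rho ^ S d) by (apply pow_le; lra).
      assert (rho ^ (S n - S d) <= 1) by (rewrite <- (pow1 (S n - S d)); apply pow_incr; lra).
      assert (0 <= rho ^ (S n - S d)) by (apply pow_le; lra). nra.
    - rewrite Cmod_0. apply Rmult_le_pos; apply pow_le; lra. }
  assert (Hs : ex_series (fun n => INR (S n) ^ 3 * rho ^ S n)) by now apply ex_series_pow_geom.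
  assert (Hrow : forall n, CS (fun d => f n d) = (RtoC (INR (sigma3 (S n))) * q ^ S n)%C).
  { intros n.
    assert (A : asum (fun d => f n d)).
    { apply asum_le with (1 := Hf n). exact (ex_series_scal_l (rho ^ S n) _ Hs). }
    rewrite (CS_split _ (S n) A).
    rewrite (CS_ext (fun k => f n (S n + k)%nat) (fun _ => RtoC 0)).
    2:{ intros k. unfold f, divides_b. rewrite Nat.mod_small by lia. simpl. ring. }
    rewrite CS_0, Cplus_0_r, sigma3_rsum, <- csum_RtoC, Cmult_comm, <- csum_scal.
    apply csum_ext. intros k _. unfold f, divides_b.
    destruct (Nat.eqb (Nat.modulo (S n) (S k)) 0); ring. }
  split.
  - rewrite <- (CS_ext _ _ Hrow), (CS_fubini _ _ _ Hf); auto using ex_series_geom_S.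
    2:{ intros; apply pow_le; lra. }
    2:{ intros n. apply Rmult_le_pos; apply pow_le; [apply pos_INR | lra]. }
    apply CS_ext. intros d. unfold f, lam.
    rewrite <- (CS_multiples q d Hq). apply CS_scal.
    apply asum_le with (fun n => Cmod q ^ S n).
    + intros n. destruct (divides_b (S d) (S n)); [rewrite Cmod_pow; lra|].
      rewrite Cmod_0. apply pow_le, Cmod_ge_0.
    + apply ex_series_geom_S. split; [apply Cmod_ge_0 | auto].
  - apply (asum_ext _ _ Hrow).
    apply asum_le with (fun m => Series (fun n => INR (S n) ^ 3 * rho ^ S n) * rho ^ S m).
    + intros m. rewrite Rmult_comm, <- Series_scal_l. apply CS_mod_le; [intros; apply Hf|].
      exact (ex_series_scal_l (rho ^ S m) _ Hs).
    + exact (ex_series_scal_l _ _ (ex_series_geom_S _ Hrho)).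
Qed.

Definition E4 (t : C) : C := (1 + 240 * CS (fun n => RtoC (INR (sigma3 (S n))) * nome t ^ S n))%C.

Definition E2 (t : C) : C := (1 - 24 * CS (lam 1 (nome t)))%C.

Lemma zeta4_E4 t : 0 < Im t -> (RtoC (zeta 4) * E4 t = Leis 4 t + RtoC (zeta 4))%C.
Proof.
  intros H. unfold E4. rewrite (proj1 (sigma3_lambert t H)), (Leis_lambert t 3) by (auto; lia).
  rewrite (proj2 zeta_2_4). unfold lip_coef.
  replace ((- (1)) ^ 3 * (- ((2 * PI)%R * Ci) * (((2 * PI)%R * Ci) ^ 3 / INR (fact 3))))%C
    with (RtoC (PI ^ 4 / 90) * 240)%C; [ring|].
  change (fact 3) with 6%nat. simpl INR.
  replace (1 + 1 + 1 + 1 + 1 + 1) with 6 by ring.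
  rewrite RtoC_div, RtoC_pow, RtoC_mult by lra.
  replace ((- (1)) ^ 3 * (- (2 * PI * Ci) * ((2 * PI * Ci) ^ 3 / 6)))%C
    with (16 * PI ^ 4 * ((Ci * Ci) * (Ci * Ci)) / 6)%C by field.
  rewrite Ci2. field.
Qed.

Theorem E4_Sinv t : 0 < Im t -> E4 (Sinv t) = (t ^ 4 * E4 t)%C.
Proof.
  intros H. pose proof (Leis4_Sinv t H) as E. pose proof (Im_Sinv_pos t H) as H'.
  rewrite <- !zeta4_E4 in E by auto.
  assert (Hz : RtoC (zeta 4) <> RtoC 0).
  { apply RtoC_neq. rewrite (proj2 zeta_2_4). pose proof PI_RGT_0.
    apply Rgt_not_eq, Rdiv_lt_0_compat; [apply pow_lt|]; lra. }
  replace (E4 (Sinv t)) with (/ RtoC (zeta 4) * (RtoC (zeta 4) * E4 (Sinv t)))%C by (field; auto).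
  rewrite E. field. auto.
Qed.

Lemma zeta2_E2 t : 0 < Im t -> (RtoC (zeta 2) * E2 t = RtoC (zeta 2) + Leis 2 t)%C.
Proof.
  intros H. unfold E2. rewrite (Leis_lambert t 1) by (auto; lia).
  rewrite (proj1 zeta_2_4). unfold lip_coef.
  replace ((- (1)) ^ 1 * (- ((2 * PI)%R * Ci) * (((2 * PI)%R * Ci) ^ 1 / INR (fact 1))))%C
    with (- (RtoC (PI ^ 2 / 6) * 24))%C; [ring|].
  change (fact 1) with 1%nat. simpl INR.
  rewrite RtoC_div, RtoC_pow, RtoC_mult by lra.
  replace ((- (1)) ^ 1 * (- (2 * PI * Ci) * ((2 * PI * Ci) ^ 1 / 1)))%C
    with (4 * PI ^ 2 * (Ci * Ci))%C by field.
  rewrite Ci2. field.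
Qed.

Theorem E2_Sinv t : 0 < Im t ->
  (RtoC PI * (E2 t - Sinv t ^ 2 * E2 (Sinv t)) = - (6) * Ci * Sinv t)%C.
Proof.
  intros H. pose proof (Leis2_Sinv t H) as E. pose proof (Im_Sinv_pos t H) as H'.
  rewrite <- !zeta2_E2 in E by auto. rewrite (proj1 zeta_2_4) in E.
  rewrite RtoC_div, RtoC_pow in E by lra.
  pose proof PI_neq_0C.
  replace (PI * (E2 t - Sinv t ^ 2 * E2 (Sinv t)))%C with
    (6 / PI * (PI ^ 2 / 6 * E2 t - Sinv t ^ 2 * (PI ^ 2 / 6 * E2 (Sinv t))))%C by (field; auto).
  rewrite E. field. auto.
Qed.

(** * Invariance of [j] *)

Fixpoint Pn (q : C) (n : nat) : C :=
  match n with O => RtoC 1 | S k => (Pn q k * (1 - q ^ S k))%C end.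

Lemma geom_partial r n : 0 <= r < 1 -> rsum (fun k => r ^ S k) n <= / (1 - r).
Proof.
  intros H. apply Rle_trans with (Series (fun k => r ^ S k)).
  - apply rsum_le_Series; [intros; apply pow_le; lra | now apply ex_series_geom_S].
  - rewrite <- (Series_geom r) by (rewrite Rabs_pos_eq; lra).
    rewrite (Series_incr_1 (fun n => r ^ n)) by now apply ex_series_geom_pos. simpl. lra.
Qed.

Lemma exp_le x y : x <= y -> exp x <= exp y.
Proof. intros [H|H]; [left; now apply exp_increasing | rewrite H; lra]. Qed.

Lemma Pn_mod_le q r n : 0 <= r < 1 -> Cmod q <= r -> Cmod (Pn q n) <= exp (/ (1 - r)).
Proof.
  intros Hr Hq. apply Rle_trans with (exp (rsum (fun k => r ^ S k) n)).
  2:{ apply exp_le. now apply geom_partial. }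
  induction n; [simpl; rewrite Cmod_1, exp_0; lra|].
  cbn [Pn rsum]. rewrite Cmod_mult, exp_plus.
  apply Rmult_le_compat; auto using Cmod_ge_0.
  unfold Cminus. eapply Rle_trans; [apply Cmod_triangle|]. rewrite Cmod_1, Cmod_opp, Cmod_pow.
  assert (Cmod q ^ S n <= r ^ S n) by (apply pow_incr; split; [apply Cmod_ge_0 | auto]).
  pose proof (exp_ineq1_le (r ^ S n)). lra.
Qed.

(** Factor by factor, 1 + x <= e^(2x/(1-r)) (1 - x) for 0 <= x <= r. Bounding the ratio makes the
    estimate uniform in [n] without a lower bound for either product. *)
Lemma Pn_ratio q q' r n : 0 <= r < 1 -> Cmod q <= r -> Cmod q' <= r ->
  Cmod (Pn q' n) <= exp (2 / (1 - r) * / (1 - r)) * Cmod (Pn q n).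
Proof.
  intros Hr Hq Hq'.
  apply Rle_trans with (exp (2 / (1 - r) * rsum (fun k => r ^ S k) n) * Cmod (Pn q n)).
  2:{ apply Rmult_le_compat_r; [apply Cmod_ge_0|]. apply exp_le.
      apply Rmult_le_compat_l; [|now apply geom_partial].
      left; apply Rdiv_lt_0_compat; lra. }
  induction n; [simpl; rewrite Cmod_1, Rmult_0_r, exp_0; lra|].
  cbn [Pn rsum]. rewrite !Cmod_mult, Rmult_plus_distr_l, exp_plus.
  replace (exp (2 / (1 - r) * rsum (fun k => r ^ S k) n) * exp (2 / (1 - r) * r ^ S n) *
    (Cmod (Pn q n) * Cmod (1 - q ^ S n))) with
    ((exp (2 / (1 - r) * rsum (fun k => r ^ S k) n) * Cmod (Pn q n)) *
     (exp (2 / (1 - r) * r ^ S n) * Cmod (1 - q ^ S n))) by ring.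
  apply Rmult_le_compat; auto using Cmod_ge_0.
  assert (Hx : 0 <= r ^ S n <= r) by (split; [apply pow_le; lra | now apply pow_S_le_1]).
  assert (U : Cmod (1 - q' ^ S n) <= 1 + r ^ S n).
  { unfold Cminus. eapply Rle_trans; [apply Cmod_triangle|]. rewrite Cmod_1, Cmod_opp, Cmod_pow.
    assert (Cmod q' ^ S n <= r ^ S n) by (apply pow_incr; split; [apply Cmod_ge_0 | auto]). lra. }
  assert (L : 1 - r ^ S n <= Cmod (1 - q ^ S n)).
  { pose proof (Cmod_triangle_inv 1 (q ^ S n)) as H. rewrite Cmod_1, Cmod_pow in H.
    assert (Cmod q ^ S n <= r ^ S n) by (apply pow_incr; split; [apply Cmod_ge_0 | auto]). lra. }
  set (x := r ^ S n) in *.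
  assert (E : 1 + x <= exp (2 / (1 - r) * x) * (1 - x)).
  { apply Rle_trans with ((1 + 2 / (1 - r) * x) * (1 - x)).
    - assert (2 * x <= 2 / (1 - r) * x * (1 - x)); [|nra].
      assert (2 * x * (1 - r) <= 2 * x * (1 - x)) by nra.
      replace (2 * x) with (2 / (1 - r) * x * (1 - r)) at 1 by (field; lra).
      apply Rmult_le_compat_l; [|lra].
      apply Rmult_le_pos; [left; apply Rdiv_lt_0_compat|]; lra.
    - apply Rmult_le_compat_r; [lra|]. apply exp_ineq1_le. }
  pose proof (exp_pos (2 / (1 - r) * x)).
  apply Rle_trans with (1 := U). apply Rle_trans with (1 := E).
  apply Rmult_le_compat_l; lra.
Qed.

Lemma Pn_neq_0 q n : Cmod q < 1 -> Pn q n <> RtoC 0.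
Proof.
  intros H. induction n; simpl Pn; [apply RtoC_neq; lra|].
  apply Cmult_neq_0; auto. apply Cmod_lt_1_neq. now apply Cmod_pow_S_lt.
Qed.

Lemma Pn_csum q n : Pn q n = (1 + csum (fun k => - (Pn q k * q ^ S k)) n)%C.
Proof.
  induction n; [simpl; ring|]. cbn [Pn csum]. rewrite Cplus_assoc, <- IHn. ring.
Qed.

(** The infinite product, as the telescoping series of the differences of its partial products;
    these are O(|q|^(k+1)), so absolute convergence is immediate. *)
Definition Pinf (q : C) : C := (1 + CS (fun k => - (Pn q k * q ^ S k)))%C.

Lemma Pn_cv q : Cmod q < 1 -> cvC (Pn q) (Pinf q).
Proof.
  intros H. assert (Hr : 0 <= Cmod q < 1) by (split; [apply Cmod_ge_0 | auto]).
  apply cvC_ext with (fun n => 1 + csum (fun k => - (Pn q k * q ^ S k)) n)%C.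
  - intros n. symmetry. apply Pn_csum.
  - apply cvC_plus; [apply cvC_const|]. apply CS_cv.
    apply asum_le with (fun n => exp (/ (1 - Cmod q)) * Cmod q ^ S n).
    + intros n. rewrite Cmod_opp, Cmod_mult, Cmod_pow.
      apply Rmult_le_compat_r; [apply pow_le; lra|]. apply Pn_mod_le; lra.
    + exact (ex_series_scal_l _ _ (ex_series_geom_S _ Hr)).
Qed.

Lemma cvC_pow u l k : cvC u l -> cvC (fun n => u n ^ k)%C (l ^ k)%C.
Proof.
  intros H. induction k; simpl; [apply cvC_const|]. now apply cvC_mult.
Qed.

Definition DN (N : nat) (t : C) : C := (nome t * Pn (nome t) N ^ 24)%C.
Definition Disc (t : C) : C := (nome t * Pinf (nome t) ^ 24)%C.

Lemma DN_cv t : 0 < Im t -> cvC (fun N => DN N t) (Disc t).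
Proof. intros H. apply cvC_scal, cvC_pow, Pn_cv, nome_lt_1, H. Qed.

Definition E2N (N : nat) (t : C) : C := (1 - 24 * csum (lam 1 (nome t)) N)%C.

Lemma dC_nome g s g' : dC g s g' ->
  dC (fun s => nome (g s)) s (RtoC (2 * PI) * Ci * g' * nome (g s))%C.
Proof. intros H. apply (dC_Cexp (fun s => RtoC (2 * PI) * Ci * g s)%C). now apply dC_scal. Qed.

Lemma dC_Pn g s g' N : dC g s g' -> 0 < Im (g s) ->
  dC (fun s => Pn (nome (g s)) N) s
    (- (RtoC (2 * PI) * Ci * g' * csum (lam 1 (nome (g s))) N * Pn (nome (g s)) N))%C.
Proof.
  intros H Hp. pose proof (dC_nome _ _ _ H) as Hq. pose proof (nome_lt_1 _ Hp) as Hlt.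
  induction N.
  - simpl Pn. simpl csum. eapply dC_eq; [apply (dC_const 1)| reflexivity | ring].
  - cbn [Pn csum]. set (q := nome (g s)) in *.
    pose proof (Cmod_lt_1_neq _ (Cmod_pow_S_lt q N Hlt)) as Hn.
    eapply dC_eq.
    + apply dC_mult; [exact IHN|].
      apply (dC_plus (fun _ => RtoC 1)); [apply dC_const|].
      apply (dC_scal (- (1))). apply (dC_pow (fun s => nome (g s)) s (RtoC (2 * PI) * Ci * g' * q)%C N). exact Hq.
    + intros x. cbv beta. ring.
    + cbv beta. fold q. unfold lam. rewrite pow_1.
      replace (q ^ S N)%C with (q * q ^ N)%C by reflexivity. field.
      replace (q * q ^ N)%C with (q ^ S N)%C by reflexivity. auto.
Qed.

(** The logarithmic derivative of the truncated product is exactly 2 pi i times the truncated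
    Lambert series of [E2], so no limit has to be exchanged with a derivative. *)
Lemma dC_DN g s g' N : dC g s g' -> 0 < Im (g s) ->
  dC (fun s => DN N (g s)) s (RtoC (2 * PI) * Ci * g' * E2N N (g s) * DN N (g s))%C.
Proof.
  intros H Hp. unfold DN. eapply dC_eq.
  - apply dC_mult; [apply dC_nome; exact H|].
    eapply (dC_pow (fun s => Pn (nome (g s)) N) s _ 23). apply dC_Pn; [exact H | exact Hp].
  - reflexivity.
  - cbv beta. unfold E2N.
    replace (RtoC (INR 24)) with (RtoC 24) by (f_equal; simpl; ring).
    set (P := Pn (nome (g s)) N). rewrite (Cpow_S P 23). ring.
Qed.

Lemma dC_Sinv g s g' : dC g s g' -> g s <> RtoC 0 ->
  dC (fun s => Sinv (g s)) s (g' / (g s * g s))%C.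
Proof.
  intros H Hn. eapply dC_eq.
  - apply (dC_scal (- (1))), dC_inv; [exact H | exact Hn].
  - intros x. unfold Sinv. ring.
  - field. auto.
Qed.

Definition FN (N : nat) (t : C) : C := (DN N (Sinv t) * / (t ^ 12 * DN N t))%C.

Lemma DN_neq_0 N t : 0 < Im t -> DN N t <> RtoC 0.
Proof.
  intros H. apply Cmult_neq_0; [apply nome_neq_0|]. apply Cpow_nz, Pn_neq_0, nome_lt_1, H.
Qed.

Definition err (N : nat) (t : C) : C := (E2N N t - E2 t)%C.

(** The logarithmic derivative of [FN] combines [E2N] at both points with -12/t from the power of
    [t]. By [E2_Sinv] the same combination of the full [E2] vanishes, and only the truncation errors
    remain. *)
Lemma dC_FN g s g' N : dC g s g' -> 0 < Im (g s) ->
  dC (fun s => FN N (g s)) s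
    (FN N (g s) * (g' * (RtoC (2 * PI) * Ci *
       (Sinv (g s) ^ 2 * err N (Sinv (g s)) - err N (g s)))))%C.
Proof.
  intros H Hp. pose proof (Im_pos_neq _ Hp) as Hn. pose proof (Im_Sinv_pos _ Hp) as Hp'.
  pose proof (DN_neq_0 N _ Hp) as HD.
  assert (Hn12 : (g s ^ 12 <> 0)%C) by now apply Cpow_nz.
  unfold FN. eapply dC_eq.
  - apply dC_mult.
    + apply dC_DN; [apply dC_Sinv; [exact H | exact Hn] | exact Hp'].
    + apply (dC_inv (fun s => g s ^ 12 * DN N (g s))%C); [|now apply Cmult_neq_0].
      apply dC_mult; [eapply (dC_pow g s _ 11); exact H | apply dC_DN; [exact H | exact Hp]].
  - reflexivity.
  - cbv beta. pose proof (E2_Sinv (g s) Hp) as E. unfold err.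
    set (z := g s) in *. set (w := Sinv z) in *.
    assert (E' : (Sinv z ^ 2 * E2 w - E2 z = 6 * Ci * w / PI)%C).
    { fold w. replace (w ^ 2 * E2 w - E2 z)%C with (- (PI * (E2 z - w ^ 2 * E2 w)) / PI)%C
        by (field; apply PI_neq_0C).
      rewrite E. field. apply PI_neq_0C. }
    fold w in E'.
    replace (w ^ 2 * (E2N N w - E2 w) - (E2N N z - E2 z))%C
      with (w ^ 2 * E2N N w - E2N N z - (w ^ 2 * E2 w - E2 z))%C by ring.
    rewrite E'. 
    replace (RtoC (INR 12)) with (RtoC 12) by (f_equal; simpl; ring).
    set (A := DN N w). set (B := DN N z) in *. set (e := E2N N w). set (e' := E2N N z).
    replace (w ^ 2)%C with (/ z ^ 2)%C by (unfold w, Sinv; field; auto).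
    replace (RtoC (2 * PI) * Ci * (/ z ^ 2 * e - e' - 6 * Ci * w / PI))%C
      with (RtoC (2 * PI) * Ci * (/ z ^ 2 * e - e') - 12 / z)%C.
    2:{ rewrite RtoC_mult. unfold w, Sinv.
        replace (2 * PI * Ci * (/ z ^ 2 * e - e' - 6 * Ci * (- / z) / PI))%C
          with (2 * PI * Ci * (/ z ^ 2 * e - e') + 12 * (Ci * Ci) * / z)%C
          by (field; split; auto; apply PI_neq_0C).
        rewrite Ci2. unfold Cdiv. ring. }
    set (K := (RtoC (2 * PI) * Ci)%C).
    replace (z ^ 12)%C with (z * z ^ 11)%C in * by reflexivity.
    assert (Hz11 : (z ^ 11 <> 0)%C) by now apply Cpow_nz.
    set (Z := (z ^ 11)%C) in *. field. auto.
Qed.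

Lemma ex_series_n_geom r : 0 < r < 1 -> ex_series (fun n => INR (S n) * r ^ S n).
Proof.
  intros Hr.
  assert (Hln : ln r < 0) by (rewrite <- ln_1; apply ln_increasing; lra).
  set (t := (0, - ln r / PI) : C).
  pose proof PI_RGT_0.
  assert (Ht : 0 < Im t) by (simpl; apply Rdiv_lt_0_compat; lra).
  pose proof (ex_series_pow_geom t 1 Ht) as E.
  eapply ex_series_ext; [|exact E]. intros n. cbv beta. rewrite pow_1.
  do 2 f_equal. simpl. replace (- (PI * (- ln r / PI))) with (ln r) by (field; lra).
  apply exp_ln; lra.
Qed.

Lemma lam1_mod q r n : 0 < r < 1 -> Cmod q <= r ->
  Cmod (lam 1 q n) <= / (1 - r) * (INR (S n) * r ^ S n).
Proof.
  intros Hr Hq. unfold lam.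
  assert (Hq1 : Cmod q < 1) by lra.
  pose proof (Cmod_lt_1_neq _ (Cmod_pow_S_lt q n Hq1)) as Hn.
  rewrite Cmod_mult, pow_1, Cmod_RtoC_pos, Cmod_div, Cmod_pow by (auto; apply pos_INR).
  assert (B : Cmod q ^ S n <= r ^ S n) by (apply pow_incr; split; [apply Cmod_ge_0 | auto]).
  assert (L : 1 - r <= Cmod (1 - q ^ S n)).
  { pose proof (Cmod_triangle_inv 1 (q ^ S n)) as H. rewrite Cmod_1, Cmod_pow in H.
    pose proof (pow_S_le_1 r n). lra. }
  replace (/ (1 - r) * (INR (S n) * r ^ S n)) with (INR (S n) * (r ^ S n * / (1 - r))) by ring.
  apply Rmult_le_compat_l; [apply pos_INR|].
  apply Rmult_le_compat; auto.
  - apply pow_le, Cmod_ge_0.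
  - left; apply Rinv_0_lt_compat; lra.
  - apply Rinv_le_contravar; lra.
Qed.

Definition tailE (r : R) (N : nat) : R :=
  24 * (/ (1 - r) * Series (fun k => INR (S (N + k)) * r ^ S (N + k))).

Lemma err_bound N t r : 0 < r < 1 -> Cmod (nome t) <= r -> Cmod (err N t) <= tailE r N.
Proof.
  intros Hr Hq. pose proof (ex_series_n_geom r Hr) as Ex.
  assert (A : asum (lam 1 (nome t))).
  { apply asum_le with (fun n => / (1 - r) * (INR (S n) * r ^ S n)).
    - intros n. now apply lam1_mod.
    - exact (ex_series_scal_l (/ (1 - r)) _ Ex). }
  unfold err, E2N, E2. rewrite (CS_split _ N A).
  match goal with |- Cmod ?x <= _ =>
    replace x with (24 * CS (fun k => lam 1 (nome t) (N + k)%nat))%C by ring end.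
  rewrite Cmod_mult, Cmod_RtoC_pos by lra. unfold tailE.
  apply Rmult_le_compat_l; [lra|]. rewrite <- Series_scal_l.
  apply CS_mod_le; [intros k; now apply lam1_mod|].
  exact (ex_series_scal_l (/ (1 - r)) _ (ex_series_tail _ N Ex)).
Qed.

Lemma tailE_lim r : 0 < r < 1 -> is_lim_seq (tailE r) 0.
Proof.
  intros Hr. unfold tailE.
  replace (Finite 0) with (Finite (24 * (/ (1 - r) * 0))) by (f_equal; ring).
  apply is_lim_seq_mult'; [apply is_lim_seq_const|].
  apply is_lim_seq_mult'; [apply is_lim_seq_const|].
  apply (Series_tail_lim (fun n => INR (S n) * r ^ S n)). now apply ex_series_n_geom.
Qed.

(** The derivative of [FN] is [FN] times a small error, so a bound independent of [N] is required
    before anything can tend to 0. *)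
Lemma FN_bound N t r y M : 0 < r < 1 -> 0 < y -> y <= Cmod t -> 0 < Im t -> Im t <= M ->
  Cmod (nome t) <= r -> Cmod (nome (Sinv t)) <= r ->
  Cmod (FN N t) <= exp (2 / (1 - r) * / (1 - r)) ^ 24 * (exp (2 * PI * M) * / y ^ 12).
Proof.
  intros Hr Hy Hyt Hp HM Hq Hq'. unfold FN.
  pose proof (Im_pos_neq _ Hp) as Hn. pose proof (DN_neq_0 N t Hp) as HD.
  assert (Hq1 : Cmod (nome t) < 1) by lra.
  pose proof (Pn_neq_0 _ N Hq1) as HP.
  rewrite Cmod_mult, Cmod_inv by (apply Cmult_neq_0; auto; now apply Cpow_nz).
  rewrite Cmod_mult. unfold DN. rewrite !Cmod_mult, !Cmod_pow.
  pose proof (Pn_ratio (nome t) (nome (Sinv t)) r N ltac:(lra) Hq Hq') as Hrat.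
  set (A := Cmod (Pn (nome (Sinv t)) N)) in *. set (B := Cmod (Pn (nome t) N)) in *.
  set (X := exp (2 / (1 - r) * / (1 - r))) in *.
  assert (HB : 0 < B) by (apply Cmod_gt_0; auto).
  assert (HA : 0 <= A) by apply Cmod_ge_0.
  assert (HX : 0 < X) by apply exp_pos.
  assert (Ht : 0 < Cmod t) by lra.
  assert (Hnq : exp (- (2 * PI * M)) <= Cmod (nome t)).
  { rewrite nome_mod. apply exp_le. pose proof PI_RGT_0.
    assert (PI * Im t <= PI * M) by (apply Rmult_le_compat_l; lra). lra. }
  pose proof (exp_pos (- (2 * PI * M))) as Hep.
  assert (Hq'1 : 0 <= Cmod (nome (Sinv t)) <= 1) by (split; [apply Cmod_ge_0 | lra]).
  assert (A24 : A ^ 24 <= X ^ 24 * B ^ 24) by (rewrite <- Rpow_mult_distr; apply pow_incr; lra).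
  assert (HA24 : 0 <= A ^ 24) by now apply pow_le.
  assert (HB24 : 0 < B ^ 24) by now apply pow_lt.
  assert (HX24 : 0 < X ^ 24) by now apply pow_lt.
  assert (Hy12 : y ^ 12 <= Cmod t ^ 12) by (apply pow_incr; lra).
  assert (Hy12p : 0 < y ^ 12) by now apply pow_lt.
  assert (EM : exp (2 * PI * M) = / exp (- (2 * PI * M))) by (rewrite exp_Ropp, Rinv_inv; reflexivity).
  rewrite EM.
  apply Rle_trans with (X ^ 24 * B ^ 24 * / (y ^ 12 * (exp (- (2 * PI * M)) * B ^ 24))).
  - assert (U1 : Cmod (nome (Sinv t)) * A ^ 24 <= X ^ 24 * B ^ 24).
    { apply Rle_trans with (1 * A ^ 24); [apply Rmult_le_compat_r; lra | lra]. }
    assert (U2 : y ^ 12 * (exp (- (2 * PI * M)) * B ^ 24)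
      <= Cmod t ^ 12 * (Cmod (nome t) * B ^ 24)).
    { assert (0 < exp (- (2 * PI * M)) * B ^ 24) by now apply Rmult_lt_0_compat.
      apply Rmult_le_compat; try lra. apply Rmult_le_compat_r; lra. }
    assert (U3 : 0 < y ^ 12 * (exp (- (2 * PI * M)) * B ^ 24))
      by (apply Rmult_lt_0_compat; [auto | apply Rmult_lt_0_compat; auto]).
    apply Rmult_le_compat; auto.
    + apply Rmult_le_pos; lra.
    + left; apply Rinv_0_lt_compat; lra.
    + now apply Rinv_le_contravar.
  - right. field. repeat split; lra.
Qed.

Lemma Sinv_Ci : Sinv Ci = Ci.
Proof.
  unfold Sinv. replace (/ Ci)%C with (- Ci)%C; [ring|].
  replace (- Ci)%C with (- (Ci * Ci) * / Ci)%C by (field; apply Ci_neq_0). rewrite Ci2. ring.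
Qed.

(** Along the segment from i to [t] the derivative of [FN N] is at most a constant times
    [tailE r N]. At i, a fixed point of the transformation with i^12 = 1, [FN N] equals 1; hence it
    tends to 1 at [t]. *)
Theorem Disc_Sinv t : 0 < Im t -> Disc (Sinv t) = (t ^ 12 * Disc t)%C.
Proof.
  intros H. pose proof (Im_Sinv_pos t H) as H'.
  pose proof PI_RGT_0 as HPI.
  set (y0 := Rmin 1 (Im t)). assert (Hy0 : 0 < y0 <= 1).
  { unfold y0. split; [apply Rmin_glb_lt; lra | apply Rmin_l]. }
  assert (Hy0t : y0 <= Im t) by apply Rmin_r.
  set (M := 1 + Cmod t). pose proof (Cmod_ge_0 t) as Ht0.
  assert (HM : 1 <= M) by (unfold M; lra).
  (* On the segment Im w >= y0 and |w| <= M, so Im(-1/w) = Im w / |w|^2 >= y0 / M^2. This single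
     bound keeps the nome at both w and -1/w below [r]. *)
  set (del := y0 / M ^ 2).
  assert (HM2 : 1 <= M ^ 2) by (apply pow_R1_Rle; lra).
  assert (Hdel : 0 < del <= y0).
  { unfold del. split; [apply Rdiv_lt_0_compat; lra|].
    apply Rle_div_l; [lra|]. rewrite <- (Rmult_1_r y0) at 1. apply Rmult_le_compat_l; lra. }
  set (r := exp (- (2 * PI * del))).
  assert (Hr : 0 < r < 1).
  { unfold r. split; [apply exp_pos|]. rewrite <- exp_0. apply exp_increasing.
    assert (0 < PI * del) by (apply Rmult_lt_0_compat; lra). lra. }
  assert (Hnr : forall w, del <= Im w -> Cmod (nome w) <= r).
  { intros w Hw. rewrite nome_mod. apply exp_le.
    assert (PI * del <= PI * Im w) by (apply Rmult_le_compat_l; lra). lra. }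
  set (g := fun s : R => (Ci + RtoC s * (t - Ci))%C).
  assert (Hg : forall s, dC g s (t - Ci)%C) by (intros; apply dC_line).
  assert (Hgi : forall s, 0 <= s <= 1 -> y0 <= Im (g s)).
  { intros s Hs. unfold g. simpl. fold (Im t). unfold y0 in *.
    assert (Rmin 1 (Im t) <= 1) by apply Rmin_l.
    replace (1 + (s * (Im t + - (1)) + 0 * (fst t + - 0))) with ((1 - s) * 1 + s * Im t) by ring.
    nra. }
  assert (Hgm : forall s, 0 <= s <= 1 -> Cmod (g s) <= M).
  { intros s Hs. unfold g. replace (Ci + RtoC s * (t - Ci))%C with (RtoC (1 - s) * Ci + RtoC s * t)%C
      by (rewrite RtoC_minus; ring).
    eapply Rle_trans; [apply Cmod_triangle|]. rewrite !Cmod_mult, Cmod_Ci, !Cmod_RtoC_pos by lra.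
    unfold M. nra. }
  assert (Hgp : forall s, 0 <= s <= 1 -> 0 < Im (g s)) by (intros s Hs; specialize (Hgi s Hs); lra).
  assert (Hgc : forall s, 0 <= s <= 1 -> y0 <= Cmod (g s)).
  { intros s Hs. specialize (Hgi s Hs). pose proof (Im_le_Cmod (g s)).
    pose proof (Rle_abs (Im (g s))). lra. }
  assert (HgS : forall s, 0 <= s <= 1 -> del <= Im (Sinv (g s))).
  { intros s Hs. rewrite Im_Sinv by auto. unfold del.
    specialize (Hgi s Hs). specialize (Hgm s Hs). specialize (Hgc s Hs).
    assert (0 < Cmod (g s) ^ 2) by (apply pow_lt; lra).
    assert (Cmod (g s) ^ 2 <= M ^ 2) by (apply pow_incr; lra).
    apply Rmult_le_compat; try lra.
    - left; apply Rinv_0_lt_compat; lra.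
    - apply Rinv_le_contravar; lra. }
  set (B := exp (2 / (1 - r) * / (1 - r)) ^ 24 * (exp (2 * PI * M) * / y0 ^ 12)).
  assert (HB : 0 <= B).
  { unfold B. apply Rmult_le_pos; [apply pow_le; left; apply exp_pos|].
    apply Rmult_le_pos; [left; apply exp_pos|]. left; apply Rinv_0_lt_compat, pow_lt; lra. }
  set (L := Cmod (t - Ci)).
  set (K := B * (L * (2 * PI * (/ y0 ^ 2 + 1)))).
  assert (Hbound : forall N, Cmod (FN N t - 1) <= K * tailE r N).
  { intros N.
    pose proof (mean_value (fun s => FN N (g s))
      (fun s => FN N (g s) * ((t - Ci) * (RtoC (2 * PI) * Ci *
        (Sinv (g s) ^ 2 * err N (Sinv (g s)) - err N (g s)))))%C
      (fun s => s * (K * tailE r N)) (fun _ => K * tailE r N)) as Hm.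
    assert (Hm' : Cmod (FN N (g 1) - FN N (g 0)) <= 1 * (K * tailE r N) - 0 * (K * tailE r N)).
    { apply Hm.
      - intros s Hs. apply dC_FN; auto.
      - intros s Hs. auto_derive; auto. ring.
      - intros s Hs. rewrite !Cmod_mult, Cmod_Ci, Cmod_RtoC_pos by lra.
        assert (b1 : Cmod (FN N (g s)) <= B).
        { apply FN_bound; auto; try lra.
          - pose proof (Im_le_Cmod (g s)). pose proof (Rle_abs (Im (g s))).
            specialize (Hgm s Hs). lra.
          - apply Hnr. specialize (Hgi s Hs). lra. }
        assert (e1 : Cmod (err N (Sinv (g s))) <= tailE r N) by (apply err_bound; auto).
        assert (e2 : Cmod (err N (g s)) <= tailE r N).
        { apply err_bound; auto. apply Hnr. specialize (Hgi s Hs). lra. }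
        assert (e3 : Cmod (Sinv (g s) ^ 2) <= / y0 ^ 2).
        { unfold Sinv. replace ((- / g s) ^ 2)%C with (/ g s ^ 2)%C
            by (field; apply Im_pos_neq; auto).
          rewrite Cmod_inv by (apply Cpow_nz, Im_pos_neq; auto). rewrite Cmod_pow.
          apply Rinv_le_contravar; [apply pow_lt; lra|]. apply pow_incr.
          specialize (Hgc s Hs). lra. }
        assert (Ht : 0 <= tailE r N) by (pose proof (Cmod_ge_0 (err N (g s))); lra).
        assert (e4 : Cmod (Sinv (g s) ^ 2 * err N (Sinv (g s)) - err N (g s))
          <= (/ y0 ^ 2 + 1) * tailE r N).
        { unfold Cminus. eapply Rle_trans; [apply Cmod_triangle|]. rewrite Cmod_opp, Cmod_mult.
          assert (Cmod (Sinv (g s) ^ 2) * Cmod (err N (Sinv (g s))) <= / y0 ^ 2 * tailE r N)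
            by (apply Rmult_le_compat; auto using Cmod_ge_0). lra. }
        unfold K. fold L.
        replace (B * (L * (2 * PI * (/ y0 ^ 2 + 1))) * tailE r N)
          with (B * (L * (2 * PI * 1 * ((/ y0 ^ 2 + 1) * tailE r N)))) by ring.
        assert (HL : 0 <= L) by apply Cmod_ge_0.
        apply Rmult_le_compat; auto using Cmod_ge_0.
        + apply Rmult_le_pos; auto. apply Rmult_le_pos; [lra | apply Cmod_ge_0].
        + apply Rmult_le_compat_l; auto. apply Rmult_le_compat_l; lra. }
    assert (G1 : g 1 = t) by (unfold g; ring).
    assert (G0 : g 0 = Ci) by (unfold g; ring).
    rewrite G1, G0 in Hm'.
    assert (F0 : FN N Ci = RtoC 1).
    { unfold FN. rewrite Sinv_Ci.
      assert (Hc : 0 < Im Ci) by (simpl; lra).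
      pose proof (DN_neq_0 N Ci Hc).
      replace (Ci ^ 12)%C with ((Ci * Ci) * (Ci * Ci) * ((Ci * Ci) * (Ci * Ci)) * ((Ci * Ci) * (Ci * Ci)))%C
        by ring.
      rewrite Ci2. field. auto. }
    rewrite F0 in Hm'. lra. }
  assert (HF : cvC (fun N => FN N t) 1).
  { apply cvC_le with (1 := Hbound).
    replace (Finite 0) with (Finite (K * 0)) by (f_equal; ring).
    apply is_lim_seq_mult'; [apply is_lim_seq_const | now apply tailE_lim]. }
  apply cvC_unique with (fun N => DN N (Sinv t)); [now apply DN_cv|].
  apply cvC_ext with (fun N => FN N t * (t ^ 12 * DN N t))%C.
  - intros N. unfold FN. pose proof (DN_neq_0 N t H). pose proof (Im_pos_neq t H).
    assert (t ^ 12 <> 0)%C by now apply Cpow_nz. field. auto.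
  - replace (t ^ 12 * Disc t)%C with (1 * (t ^ 12 * Disc t))%C by ring.
    apply cvC_mult; auto. apply cvC_scal. now apply DN_cv.
Qed.

(** [CLim] always has a value; this is how its occurrences in [j_invariant] acquire their
    meaning. *)
Lemma CLim_cvC u l : cvC u l -> CLim u = l.
Proof.
  intros H. unfold CLim.
  rewrite (is_lim_seq_unique _ _ (cvC_Re _ _ H)), (is_lim_seq_unique _ _ (cvC_Im _ _ H)).
  apply C_ext; reflexivity.
Qed.

Lemma fold_Cplus (l : list C) (z : C) :
  fold_right Cplus z l = (fold_right Cplus (RtoC 0) l + z)%C.
Proof. induction l; simpl; [ring|]. rewrite IHl. ring. Qed.

Lemma fold_Cmult (l : list C) (z : C) :
  fold_right Cmult z l = (fold_right Cmult (RtoC 1) l * z)%C.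
Proof. induction l; simpl; [ring|]. rewrite IHl. ring. Qed.

Lemma CSum1_CS f : asum (fun n => f (S n)) -> CSum1 f = CS (fun n => f (S n)).
Proof.
  intros H. unfold CSum1. apply CLim_cvC.
  apply cvC_ext with (csum (fun n => f (S n))); [|now apply CS_cv].
  intros n. induction n; [reflexivity|].
  rewrite seq_S, map_app, fold_right_app. simpl. rewrite fold_Cplus, <- IHn. ring.
Qed.

Lemma CProd1_Pinf q : Cmod q < 1 -> CProd1 (fun n => (1 - q ^ n) ^ 24)%C = (Pinf q ^ 24)%C.
Proof.
  intros H. unfold CProd1. apply CLim_cvC.
  apply cvC_ext with (fun n => Pn q n ^ 24)%C; [|apply cvC_pow, Pn_cv, H].
  intros n. induction n; [simpl; ring|].
  rewrite seq_S, map_app, fold_right_app. cbn [map fold_right Nat.add].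
  rewrite fold_Cmult, <- IHn. cbn [Pn]. rewrite Cpow_mult_l. ring.
Qed.

Lemma j_E4_Disc t : 0 < Im t -> j_invariant t = (E4 t ^ 3 / Disc t)%C.
Proof.
  intros H. unfold j_invariant, Disc. rewrite CProd1_Pinf by now apply nome_lt_1.
  rewrite CSum1_CS by apply (sigma3_lambert t H). reflexivity.
Qed.

Theorem j_Sinv t : 0 < Im t -> j_invariant (Sinv t) = j_invariant t.
Proof.
  intros H. rewrite !j_E4_Disc by (auto; now apply Im_Sinv_pos).
  rewrite E4_Sinv, Disc_Sinv by auto.
  pose proof (Im_pos_neq t H).
  assert (H12 : (t ^ 12 <> 0)%C) by now apply Cpow_nz.
  replace ((t ^ 4 * E4 t) ^ 3)%C with (t ^ 12 * E4 t ^ 3)%C by ring.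
  (* Were [Disc t] zero, both quotients would be 0, because the inverse of 0 in [C] is 0. *)
  destruct (Ceq_dec (Disc t) 0) as [E|N].
  - rewrite E. unfold Cdiv. rewrite Cmult_0_r.
    assert (I0 : (/ RtoC 0 = RtoC 0)%C) by (apply C_ext; simpl; unfold Rdiv; rewrite ?Ropp_0; ring).
    rewrite I0. ring.
  - field. auto.
Qed.

(** * Nonnegativity of the coefficients *)

Lemma is_series_cvC (f : nat -> C) (l : C) :
  @is_series C_AbsRing C_NormedModule f l -> cvC (csum f) l.
Proof.
  intros H. apply cvC_shift. apply is_lim_seq_spec. intros eps.
  pose proof (proj1 (filterlim_locally_ball_norm (K := C_AbsRing) (U := C_NormedModule) _ _) H eps)
    as H1. clear H. rename H1 into H. destruct H as [N HN]. exists N. intros n Hn. specialize (HN n Hn).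
  unfold ball_norm in HN. change (Cmod (minus (sum_n f n) l) < eps) in HN.
  rewrite Rminus_0_r, Rabs_pos_eq by apply Cmod_ge_0.
  assert (E : sum_n f n = csum f (S n)).
  { clear. induction n.
    - rewrite sum_O. simpl. ring.
    - rewrite sum_Sn, IHn. reflexivity. }
  rewrite E in HN. exact HN.
Qed.

Definition imag (y : R) : C := (0, y).

Lemma nome_imag y : nome (imag y) = RtoC (exp (- (2 * PI * y))).
Proof.
  rewrite <- Cexp_RtoC. unfold nome. f_equal. apply C_ext; simpl; ring.
Qed.

Lemma nome_imag_surj q : 0 < q < 1 ->
  exists t, 0 < Im t /\ nome t = RtoC q.
Proof.
  intros Hq. pose proof PI_RGT_0. exists (imag (- ln q / (2 * PI))).
  assert (Hln : ln q < 0) by (rewrite <- ln_1; apply ln_increasing; lra).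
  split; [simpl; apply Rdiv_lt_0_compat; lra|].
  rewrite nome_imag. f_equal. replace (- (2 * PI * (- ln q / (2 * PI)))) with (ln q) by (field; lra).
  apply exp_ln; lra.
Qed.

Definition abs_cv (a : nat -> R) : Prop :=
  forall r, 0 < r < 1 -> ex_series (fun n => Rabs (a n) * r ^ n).

Definition PS (a : nat -> R) (q : R) : R := Series (fun n => a n * q ^ n).

Lemma abs_cv_ex a q : abs_cv a -> 0 < q < 1 -> ex_series (fun n => a n * q ^ n).
Proof.
  intros H Hq. apply ex_series_Rabs. eapply ex_series_ext; [|apply (H q Hq)].
  intros n. cbv beta. rewrite Rabs_mult, (Rabs_pos_eq (q ^ n)); auto. apply pow_le; lra.
Qed.

Section Coefficients.
Variable c : nat -> Z.
Hypothesis Hc : j_fourier_coefficients c.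

(** The series converges at the larger nome s = (1 + r)/2, so its terms there are eventually below 1
    and |c n| r^n is eventually below (r/s)^n. *)
Lemma coef_abs_cv : abs_cv (fun n => IZR (c n)).
Proof.
  intros r Hr. set (s := (1 + r) / 2).
  assert (Hs : r < s < 1) by (unfold s; lra).
  destruct (nome_imag_surj s ltac:(lra)) as [t [Ht Hn]].
  pose proof (is_series_cvC _ _ (Hc t Ht)) as Hcv. rewrite Hn in Hcv.
  set (f := fun n => (RtoC (IZR (c n)) * RtoC s ^ n)%C) in *.
  assert (H0 : cvC f 0).
  { apply cvC_ext with (fun n => csum f (S n) + - (1) * csum f n)%C.
    - intros n. simpl. ring.
    - replace (RtoC 0) with (j_invariant t - / s + - (1) * (j_invariant t - / s))%C by ring.
      apply cvC_plus; [now apply cvC_shift in Hcv | now apply cvC_scal]. }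
  apply is_lim_seq_spec in H0. destruct (H0 (mkposreal 1 Rlt_0_1)) as [N HN].
  simpl in HN.
  apply (ex_series_incr_n _ N).
  apply ex_series_pos_le with (fun k => (r / s) ^ (N + k)).
  - intros k. split; [apply Rmult_le_pos; [apply Rabs_pos | apply pow_le; lra]|].
    specialize (HN (N + k)%nat ltac:(lia)).
    rewrite Rminus_0_r, Rabs_pos_eq in HN by apply Cmod_ge_0.
    unfold f in HN. unfold Cminus in HN. rewrite Copp_0, Cplus_0_r, Cmod_mult, Cmod_pow in HN.
    rewrite Cmod_R, Cmod_RtoC_pos in HN by lra.
    unfold Rdiv. rewrite Rpow_mult_distr, pow_inv.
    assert (0 < s ^ (N + k)) by (apply pow_lt; lra).
    assert (0 < r ^ (N + k)) by (apply pow_lt; lra).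
    apply (Rmult_le_reg_r (s ^ (N + k))); auto.
    replace (r ^ (N + k) * / s ^ (N + k) * s ^ (N + k)) with (1 * r ^ (N + k)) by (field; lra).
    replace (Rabs (IZR (c (N + k)%nat)) * r ^ (N + k) * s ^ (N + k))
      with (Rabs (IZR (c (N + k)%nat)) * s ^ (N + k) * r ^ (N + k)) by ring.
    apply Rmult_le_compat_r; lra.
  - apply (ex_series_tail (fun k => (r / s) ^ k)). apply ex_series_geom_pos.
    split; [left; apply Rdiv_lt_0_compat; lra|]. apply Rlt_div_l; lra.
Qed.

Lemma coef_asum t : 0 < Im t -> asum (fun n => RtoC (IZR (c n)) * nome t ^ n)%C.
Proof.
  intros H. assert (Hq : 0 < Cmod (nome t) < 1).
  { split; [apply Cmod_gt_0, nome_neq_0 | now apply nome_lt_1]. }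
  eapply ex_series_ext; [|apply (coef_abs_cv _ Hq)].
  intros n. cbv beta. rewrite Cmod_mult, Cmod_pow, Cmod_R. reflexivity.
Qed.

Lemma j_coef t : 0 < Im t ->
  j_invariant t = (/ nome t + CS (fun n => RtoC (IZR (c n)) * nome t ^ n))%C.
Proof.
  intros H. pose proof (is_series_cvC _ _ (Hc t H)) as H1.
  pose proof (CS_cv _ (coef_asum t H)) as H2.
  rewrite (cvC_unique _ _ _ H2 H1). ring.
Qed.

(** The coefficients of q j: clearing the pole shifts every index by one, so [c n] is entry n +
    1. *)
Definition eZ (n : nat) : Z := match n with O => 1%Z | S k => c k end.

Lemma eZ_abs_cv : abs_cv (fun n => IZR (eZ n)).
Proof.
  intros r Hr. apply ex_series_incr_1. simpl.
  eapply ex_series_ext; [|exact (ex_series_scal_l r _ (coef_abs_cv r Hr))].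
  intros n. cbv beta. unfold scal. simpl. unfold mult. simpl. ring.
Qed.

Lemma eZ_PS t q : 0 < Im t -> 0 < q < 1 -> nome t = RtoC q ->
  RtoC (PS (fun n => IZR (eZ n)) q) = (RtoC q * j_invariant t)%C.
Proof.
  intros H Hq Hn. rewrite (j_coef t H), Hn.
  assert (HqC : RtoC q <> RtoC 0) by (apply RtoC_neq; lra).
  unfold PS. rewrite (Series_incr_1 _ (abs_cv_ex _ _ eZ_abs_cv Hq)).
  rewrite (CS_ext _ (fun n => RtoC (IZR (c n) * q ^ n))).
  2:{ intros n. now rewrite RtoC_mult, RtoC_pow. }
  rewrite CS_RtoC. simpl eZ. rewrite pow_O, RtoC_plus, Rmult_1_l.
  rewrite (Series_ext _ (fun n => q * (IZR (c n) * q ^ n))) by (intros; simpl; ring).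
  rewrite Series_scal_l, RtoC_mult. field. auto.
Qed.
End Coefficients.

Lemma abs_cv_shift a : abs_cv a -> abs_cv (fun n => a (S n)).
Proof.
  intros H r Hr. pose proof (H r Hr) as Hs. apply ex_series_incr_1 in Hs.
  eapply ex_series_ext; [|exact (ex_series_scal_l (/ r) _ Hs)].
  intros n. cbv beta. unfold scal. simpl. unfold mult. simpl. field. lra.
Qed.

Lemma PS_shift a q : abs_cv a -> 0 < q < 1 -> PS a q = a 0%nat + q * PS (fun n => a (S n)) q.
Proof.
  intros H Hq. unfold PS. rewrite (Series_incr_1 _ (abs_cv_ex _ _ H Hq)), <- Series_scal_l.
  rewrite pow_O, Rmult_1_r. f_equal. apply Series_ext. intros n. simpl. ring.
Qed.

Lemma PS_bound a q : abs_cv a -> 0 < q <= / 2 ->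
  Rabs (PS a q) <= Series (fun n => Rabs (a n) * (/ 2) ^ n).
Proof.
  intros H Hq. unfold PS.
  assert (E : forall n, Rabs (a n * q ^ n) = Rabs (a n) * q ^ n).
  { intros n. rewrite Rabs_mult, (Rabs_pos_eq (q ^ n)); auto. apply pow_le; lra. }
  eapply Rle_trans; [apply Series_Rabs|].
  - eapply ex_series_ext; [intros; symmetry; apply E|]. apply H. lra.
  - cbv beta. rewrite (Series_ext _ _ E). apply Series_le; [|apply H; lra].
    intros n. split.
    + apply Rmult_le_pos; [apply Rabs_pos | apply pow_le; lra].
    + apply Rmult_le_compat_l; [apply Rabs_pos|]. apply pow_incr. lra.
Qed.

Lemma small_zero (x K : R) : (forall q, 0 < q <= / 2 -> Rabs x <= K * q) -> x = 0.
Proof.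
  intros H. destruct (Req_dec x 0) as [|Hx]; auto. exfalso.
  pose proof (Rabs_pos_lt x Hx) as Hp.
  pose proof (H (/ 2) ltac:(lra)) as H1. assert (HK : 0 < K) by lra.
  set (q := Rmin (/ 2) (Rabs x / (2 * K))).
  assert (Hq : 0 < q).
  { unfold q. apply Rmin_glb_lt; [lra|]. apply Rdiv_lt_0_compat; lra. }
  pose proof (H q (conj Hq (Rmin_l _ _))) as H2.
  assert (H3 : K * q <= K * (Rabs x / (2 * K))) by (apply Rmult_le_compat_l; [lra | apply Rmin_r]).
  replace (K * (Rabs x / (2 * K))) with (Rabs x / 2) in H3 by (field; lra). lra.
Qed.

(** The constant term is bounded by a multiple of q, hence is 0; dividing by q lowers the order by
    one and the argument repeats. *)
Lemma PS_vanish (N : nat) : forall (g : nat -> R) (K : R), abs_cv g ->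
  (forall q, 0 < q <= / 2 -> Rabs (PS g q) <= K * q ^ S N) ->
  forall n, (n <= N)%nat -> g n = 0.
Proof.
  assert (Z0 : forall (g : nat -> R) (K : R) M, abs_cv g ->
     (forall q, 0 < q <= / 2 -> Rabs (PS g q) <= K * q ^ S M) -> g 0%nat = 0).
  { intros g K M Ha H.
    apply small_zero with (Rabs K + Series (fun n => Rabs (g (S n)) * (/ 2) ^ n)).
    intros q Hq. pose proof (PS_shift g q Ha ltac:(lra)) as E.
    pose proof (PS_bound _ q (abs_cv_shift g Ha) Hq) as B.
    specialize (H q Hq).
    replace (g 0%nat) with (PS g q + - (q * PS (fun n => g (S n)) q)) by lra.
    eapply Rle_trans; [apply Rabs_triang|]. rewrite Rabs_Ropp, Rabs_mult, (Rabs_pos_eq q) by lra.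
    assert (K * q ^ S M <= Rabs K * q).
    { apply Rle_trans with (Rabs K * q ^ S M).
      - apply Rmult_le_compat_r; [apply pow_le; lra | apply Rle_abs].
      - apply Rmult_le_compat_l; [apply Rabs_pos|]. apply pow_S_le_1. lra. }
    assert (q * Rabs (PS (fun n => g (S n)) q) <= q * Series (fun n => Rabs (g (S n)) * (/ 2) ^ n))
      by (apply Rmult_le_compat_l; lra).
    lra. }
  induction N; intros g K Ha H n Hn.
  - replace n with 0%nat by lia. now apply Z0 with K 0%nat.
  - pose proof (Z0 g K (S N) Ha H) as G0. destruct n; auto.
    apply (IHN (fun n => g (S n)) K); [now apply abs_cv_shift| |lia].
    intros q Hq. specialize (H q Hq). rewrite (PS_shift g q Ha) in H by lra.
    rewrite G0, Rplus_0_l, Rabs_mult, (Rabs_pos_eq q) in H by lra.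
    apply Rmult_le_reg_l with q; [lra|]. eapply Rle_trans; [apply H|]. right. simpl. ring.
Qed.

(** Multiplication by 1 - q^k on coefficient sequences. Working with integers keeps positivity and
    exact computation available. *)
Definition mulk (k : nat) (a : nat -> Z) (n : nat) : Z :=
  (a n - (if Nat.leb k n then a (n - k)%nat else 0))%Z.

Definition shiftk (k : nat) (a : nat -> R) (n : nat) : R :=
  if Nat.leb k n then a (n - k)%nat else 0.

(** [f] stands for the identity, which gives the value of the shifted series, and for [Rabs], which
    gives its absolute convergence. *)
Lemma shiftk_series k (a : nat -> R) q (f : R -> R) : f 0 = 0 ->
  ex_series (fun n => f (a n) * q ^ n) ->
  ex_series (fun n => f (shiftk k a n) * q ^ n) /\
  Series (fun n => f (shiftk k a n) * q ^ n) = q ^ k * Series (fun n => f (a n) * q ^ n).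
Proof.
  intros Hf H.
  assert (E : forall n, f (shiftk k a (k + n)) * q ^ (k + n) = q ^ k * (f (a n) * q ^ n)).
  { intros n. unfold shiftk. replace (Nat.leb k (k + n)) with true by (symmetry; apply Nat.leb_le; lia).
    replace (k + n - k)%nat with n by lia. rewrite pow_add. ring. }
  assert (Ex : ex_series (fun n => f (shiftk k a n) * q ^ n)).
  { apply (ex_series_incr_n _ k). eapply ex_series_ext; [intros; symmetry; apply E|].
    exact (ex_series_scal_l (q ^ k) _ H). }
  split; auto. rewrite (Series_split _ k Ex), (Series_ext _ _ E), Series_scal_l.
  rewrite (rsum_ext _ (fun _ => 0)), rsum_const; [ring|].
  intros j Hj. unfold shiftk. replace (Nat.leb k j) with false by (symmetry; apply Nat.leb_gt; lia).
  rewrite Hf. ring.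
Qed.

Lemma IZR_mulk k a n : IZR (mulk k a n) = IZR (a n) + - shiftk k (fun n => IZR (a n)) n.
Proof. unfold mulk, shiftk. rewrite minus_IZR. destruct (Nat.leb k n); simpl; lra. Qed.

Lemma mulk_abs_cv k a : abs_cv (fun n => IZR (a n)) -> abs_cv (fun n => IZR (mulk k a n)).
Proof.
  intros H r Hr.
  destruct (shiftk_series k (fun n => IZR (a n)) r Rabs Rabs_R0 (H r Hr)) as [E _].
  apply ex_series_pos_le with (2 := ex_series_plus _ _ (H r Hr) E).
  intros n. assert (0 <= r ^ n) by (apply pow_le; lra). split.
  - apply Rmult_le_pos; [apply Rabs_pos | auto].
  - unfold plus; simpl. rewrite IZR_mulk, <- Rmult_plus_distr_r.
    apply Rmult_le_compat_r; auto. eapply Rle_trans; [apply Rabs_triang|]. rewrite Rabs_Ropp. lra.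
Qed.

Lemma PS_mulk k a q : abs_cv (fun n => IZR (a n)) -> 0 < q < 1 ->
  PS (fun n => IZR (mulk k a n)) q = (1 - q ^ k) * PS (fun n => IZR (a n)) q.
Proof.
  intros H Hq. pose proof (abs_cv_ex _ _ H Hq) as Ex.
  destruct (shiftk_series k (fun n => IZR (a n)) q (fun x => x) eq_refl Ex) as [E1 E2].
  unfold PS. rewrite (Series_ext _ (fun n => IZR (a n) * q ^ n - shiftk k (fun n => IZR (a n)) n * q ^ n)).
  - rewrite Series_minus, E2 by auto. ring.
  - intros n. rewrite IZR_mulk. ring.
Qed.

Fixpoint mulks (k j : nat) (a : nat -> Z) : nat -> Z :=
  match j with O => a | S j' => mulk k (mulks k j' a) end.

(* The exponent [e] is kept abstract: with a literal, conversion would unfold [mulks]. *)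
Fixpoint mulall (e N : nat) (a : nat -> Z) : nat -> Z :=
  match N with O => a | S M => mulks (S M) e (mulall e M a) end.

Lemma mulks_abs_cv k j a : abs_cv (fun n => IZR (a n)) -> abs_cv (fun n => IZR (mulks k j a n)).
Proof. intros H. induction j; simpl; auto. now apply mulk_abs_cv. Qed.

Lemma mulall_abs_cv e N a : abs_cv (fun n => IZR (a n)) -> abs_cv (fun n => IZR (mulall e N a n)).
Proof. intros H. induction N; cbn [mulall]; auto. now apply mulks_abs_cv. Qed.

Lemma PS_mulks k j a q : abs_cv (fun n => IZR (a n)) -> 0 < q < 1 ->
  PS (fun n => IZR (mulks k j a n)) q = (1 - q ^ k) ^ j * PS (fun n => IZR (a n)) q.
Proof.
  intros H Hq. induction j; cbn [mulks]; [simpl; ring|].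
  rewrite PS_mulk, IHj by (auto using mulks_abs_cv). simpl. ring.
Qed.

Lemma PS_mulall e N a q : abs_cv (fun n => IZR (a n)) -> 0 < q < 1 ->
  RtoC (PS (fun n => IZR (mulall e N a n)) q) = (Pn (RtoC q) N ^ e * RtoC (PS (fun n => IZR (a n)) q))%C.
Proof.
  intros H Hq. induction N; cbn [mulall]; [simpl Pn; rewrite Cpow_1_l; ring|].
  rewrite PS_mulks by (auto using mulall_abs_cv).
  rewrite RtoC_mult, IHN, RtoC_pow, RtoC_minus, RtoC_pow. cbn [Pn]. rewrite Cpow_mult_l. ring.
Qed.

Fixpoint zsum (f : nat -> Z) (n : nat) : Z :=
  match n with O => 0%Z | S k => (zsum f k + f k)%Z end.

Definition conv (a b : nat -> Z) (n : nat) : Z := zsum (fun k => a k * b (n - k)%nat)%Z (S n).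

Lemma IZR_zsum f n : IZR (zsum f n) = rsum (fun k => IZR (f k)) n.
Proof. induction n; simpl; [reflexivity|]. now rewrite plus_IZR, IHn. Qed.

Lemma rsum_f_R0 f n : sum_f_R0 f n = rsum f (S n).
Proof. rewrite rsum_sum_n, sum_n_Reals. reflexivity. Qed.

Lemma IZR_conv_term a b q n :
  IZR (conv a b n) * q ^ n = sum_f_R0 (fun k => (IZR (a k) * q ^ k) * (IZR (b (n - k)%nat) * q ^ (n - k))) n.
Proof.
  rewrite rsum_f_R0. unfold conv. rewrite IZR_zsum, Rmult_comm, <- rsum_scal.
  apply rsum_ext. intros k Hk. rewrite mult_IZR.
  replace (q ^ n) with (q ^ k * q ^ (n - k)) by (rewrite <- pow_add; f_equal; lia). ring.
Qed.

Lemma conv_abs_cv a b : abs_cv (fun n => IZR (a n)) -> abs_cv (fun n => IZR (b n)) ->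
  abs_cv (fun n => IZR (conv a b n)).
Proof.
  intros Ha Hb r Hr.
  assert (Er : forall x n, Rabs (Rabs (IZR x) * r ^ n) = Rabs (IZR x) * r ^ n).
  { intros. apply Rabs_pos_eq, Rmult_le_pos; [apply Rabs_pos | apply pow_le; lra]. }
  pose proof (is_series_mult _ _ _ _ (Series_correct _ (Ha r Hr)) (Series_correct _ (Hb r Hr))) as M.
  assert (M1 : ex_series (fun n => sum_f_R0 (fun k => Rabs (IZR (a k)) * r ^ k *
     (Rabs (IZR (b (n - k)%nat)) * r ^ (n - k))) n)).
  { eexists. apply M.
    - eapply ex_series_ext; [intros; symmetry; apply Er | apply (Ha r Hr)].
    - eapply ex_series_ext; [intros; symmetry; apply Er | apply (Hb r Hr)]. }
  apply ex_series_pos_le with (2 := M1). intros n. split.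
  - apply Rmult_le_pos; [apply Rabs_pos | apply pow_le; lra].
  - rewrite <- (Rabs_pos_eq (r ^ n)) by (apply pow_le; lra).
    rewrite <- Rabs_mult, IZR_conv_term.
    eapply Rle_trans; [apply Rsum_abs|]. right. rewrite !rsum_f_R0. apply rsum_ext.
    intros k _. rewrite !Rabs_mult, !(Rabs_pos_eq (r ^ _)) by (apply pow_le; lra). reflexivity.
Qed.

Lemma PS_conv a b q : abs_cv (fun n => IZR (a n)) -> abs_cv (fun n => IZR (b n)) -> 0 < q < 1 ->
  PS (fun n => IZR (conv a b n)) q = PS (fun n => IZR (a n)) q * PS (fun n => IZR (b n)) q.
Proof.
  intros Ha Hb Hq. unfold PS. apply is_series_unique.
  assert (Er : forall x n, Rabs (IZR x * q ^ n) = Rabs (IZR x) * q ^ n).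
  { intros. rewrite Rabs_mult, (Rabs_pos_eq (q ^ n)); auto. apply pow_le; lra. }
  eapply is_series_ext; [intros n; symmetry; apply IZR_conv_term|].
  apply (is_series_mult (fun n => IZR (a n) * q ^ n) (fun n => IZR (b n) * q ^ n)).
  - apply Series_correct, abs_cv_ex; auto.
  - apply Series_correct, abs_cv_ex; auto.
  - eapply ex_series_ext; [intros; symmetry; apply Er | apply (Ha q Hq)].
  - eapply ex_series_ext; [intros; symmetry; apply Er | apply (Hb q Hq)].
Qed.

Definition E4Z (n : nat) : Z := match n with O => 1 | S _ => 240 * Z.of_nat (sigma3 n) end%Z.
Definition cubZ : nat -> Z := conv (conv E4Z E4Z) E4Z.

Lemma E4Z_abs_cv : abs_cv (fun n => IZR (E4Z n)).
Proof.
  intros r Hr. destruct (nome_imag_surj r Hr) as [t [Ht Hn]].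
  pose proof (proj2 (sigma3_lambert t Ht)) as A. rewrite Hn in A.
  apply ex_series_incr_1.
  eapply ex_series_ext; [|exact (ex_series_scal_l 240 _ A)].
  intros n. unfold scal. simpl scal. cbv beta.
  change (240 * Cmod (RtoC (INR (sigma3 (S n))) * RtoC r ^ S n)
     = Rabs (IZR (240 * Z.of_nat (sigma3 (S n)))) * r ^ S n).
  rewrite Cmod_mult, Cmod_pow, !Cmod_RtoC_pos by (try apply pos_INR; lra).
  rewrite mult_IZR, <- INR_IZR_INZ, Rabs_pos_eq; [ring|].
  apply Rmult_le_pos; [lra | apply pos_INR].
Qed.

Lemma PS_E4Z t q : 0 < Im t -> 0 < q < 1 -> nome t = RtoC q ->
  RtoC (PS (fun n => IZR (E4Z n)) q) = E4 t.
Proof.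
  intros Ht Hq Hn. unfold E4. rewrite Hn.
  rewrite (CS_ext _ (fun n => RtoC (INR (sigma3 (S n)) * q ^ S n))).
  2:{ intros n. now rewrite RtoC_mult, RtoC_pow. }
  unfold PS. rewrite CS_RtoC, (Series_incr_1 _ (abs_cv_ex _ _ E4Z_abs_cv Hq)).
  rewrite (Series_ext _ (fun n => 240 * (INR (sigma3 (S n)) * q ^ S n))).
  - rewrite Series_scal_l, RtoC_plus, !RtoC_mult. simpl E4Z. rewrite pow_O. ring.
  - intros n. change (E4Z (S n)) with (240 * Z.of_nat (sigma3 (S n)))%Z.
    rewrite mult_IZR, <- INR_IZR_INZ. ring.
Qed.

Lemma cubZ_abs_cv : abs_cv (fun n => IZR (cubZ n)).
Proof. apply conv_abs_cv; [apply conv_abs_cv|]; apply E4Z_abs_cv. Qed.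

Lemma Pinf_diff q N : 0 < q <= / 2 ->
  Cmod (Pn (RtoC q) N - Pinf (RtoC q)) <= exp 2 * 2 * q ^ S N.
Proof.
  intros Hq. assert (Hm : Cmod (RtoC q) = q) by (apply Cmod_RtoC_pos; lra).
  assert (Hb : forall k, Cmod (- (Pn (RtoC q) k * RtoC q ^ S k)) <= exp 2 * q ^ S k).
  { intros k. rewrite Cmod_opp, Cmod_mult, Cmod_pow, Hm.
    apply Rmult_le_compat_r; [apply pow_le; lra|].
    eapply Rle_trans; [apply (Pn_mod_le _ q); lra|]. apply exp_le.
    replace 2 with (/ / 2) by field. apply Rinv_le_contravar; lra. }
  assert (Hg : ex_series (fun k => q ^ S k)) by (apply ex_series_geom_S; lra).
  assert (A : asum (fun k => - (Pn (RtoC q) k * RtoC q ^ S k))%C).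
  { apply asum_le with (1 := Hb). exact (ex_series_scal_l (exp 2) _ Hg). }
  rewrite Cmod_minus_sym. unfold Pinf. rewrite (Pn_csum _ N), (CS_split _ N A).
  match goal with |- Cmod ?x <= _ =>
    replace x with (CS (fun k => - (Pn (RtoC q) (N + k) * RtoC q ^ S (N + k)))%C) by ring end.
  apply Rle_trans with (Series (fun k => exp 2 * q ^ S N * q ^ k)).
  - apply CS_mod_le.
    + intros k. eapply Rle_trans; [apply Hb|]. right.
      replace (S (N + k)) with (S N + k)%nat by lia. rewrite pow_add. ring.
    + exact (ex_series_scal_l (exp 2 * q ^ S N) _ (ex_series_geom_pos q ltac:(lra))).
  - rewrite Series_scal_l, Series_geom by (rewrite Rabs_pos_eq; lra).
    replace (exp 2 * 2 * q ^ S N) with (exp 2 * q ^ S N * 2) by ring.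
    apply Rmult_le_compat_l.
    + apply Rmult_le_pos; [left; apply exp_pos | apply pow_le; lra].
    + replace 2 with (/ / 2) by field. apply Rinv_le_contravar; lra.
Qed.

Lemma Pinf_mod q : 0 < q <= / 2 -> Cmod (Pinf (RtoC q)) <= exp 2.
Proof.
  intros Hq. assert (Hm : Cmod (RtoC q) = q) by (apply Cmod_RtoC_pos; lra).
  apply cvC_mod_le with (Pn (RtoC q)); [|apply Pn_cv; lra].
  intros n. eapply Rle_trans; [apply (Pn_mod_le _ q); lra|]. apply exp_le.
  replace 2 with (/ / 2) by field. apply Rinv_le_contravar; lra.
Qed.

(** The first truncation is 1, and its distance from the limit is at most 2 e^2 q <= 18/64. A small
    interval of q is enough, since coefficients are determined by the behaviour at 0. *)
Lemma Pinf_neq_0 q : 0 < q <= / 64 -> Pinf (RtoC q) <> RtoC 0.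
Proof.
  intros Hq. pose proof (Pinf_diff q 0 ltac:(lra)) as H. cbn [Pn] in H. simpl pow in H.
  pose proof (Cmod_triangle_inv 1 (Pinf (RtoC q))) as H1. rewrite Cmod_1 in H1.
  assert (exp 2 <= 9).
  { replace 2 with (1 + 1) by ring. rewrite exp_plus.
    pose proof exp_le_3. pose proof (exp_pos 1). nra. }
  apply Cmod_gt_0. nra.
Qed.

Section Determination.
Variable c : nat -> Z.
Hypothesis Hc : j_fourier_coefficients c.

(** The full product to the power 24 times q j is the cube of [E4]. Keeping only [N] factors changes
    the product by O(q^(N+1)), so the coefficients through index [N] are unaffected, and both
    computation and positivity become finite questions. *)
Lemma mulall_eZ N n : (n <= N)%nat -> mulall 24 N (eZ c) n = cubZ n.
Proof.
  intros Hn. pose proof (eZ_abs_cv c Hc) as He.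
  set (g := fun n => IZR (mulall 24 N (eZ c) n) + - IZR (cubZ n)).
  assert (Hg : abs_cv g).
  { intros r Hr.
    apply ex_series_pos_le with
      (2 := ex_series_plus _ _ (mulall_abs_cv 24 N _ He r Hr) (cubZ_abs_cv r Hr)).
    intros k. assert (0 <= r ^ k) by (apply pow_le; lra). split.
    - apply Rmult_le_pos; [apply Rabs_pos | auto].
    - unfold plus; simpl. rewrite <- Rmult_plus_distr_r. apply Rmult_le_compat_r; auto.
      unfold g. eapply Rle_trans; [apply Rabs_triang|]. rewrite Rabs_Ropp. lra. }
  set (B := Series (fun n => Rabs (IZR (eZ c n)) * (/ 2) ^ n)).
  set (K := B * (24 * exp 2 ^ 23 * (exp 2 * 2))).
  (* For q > 1/64 the required bound is trivial because (64 q)^(N+1) >= 1; [D] covers that range and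
     [K] covers q <= 1/64. *)
  set (D := 64 ^ S N * Series (fun n => Rabs (g n) * (/ 2) ^ n)).
  assert (HD : 0 <= Series (fun n => Rabs (g n) * (/ 2) ^ n)).
  { apply Series_nonneg; [|apply Hg; lra].
    intros k. apply Rmult_le_pos; [apply Rabs_pos | apply pow_le; lra]. }
  assert (HB : 0 <= B).
  { apply Series_nonneg; [|apply He; lra].
    intros k. apply Rmult_le_pos; [apply Rabs_pos | apply pow_le; lra]. }
  assert (HK : 0 <= K).
  { unfold K. pose proof (exp_pos 2). apply Rmult_le_pos; auto.
    apply Rmult_le_pos; [|lra]. apply Rmult_le_pos; [lra | apply pow_le; lra]. }
  assert (H64 : 0 < 64 ^ S N) by (apply pow_lt; lra).
  assert (G0 : g n = 0).
  { apply (PS_vanish N g (K + D) Hg); auto. intros q Hq.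
    assert (HqN : 0 < q ^ S N) by (apply pow_lt; lra).
    destruct (Rle_lt_dec q (/ 64)) as [Hs|Hs].
    - assert (HP : PS g q = PS (fun n => IZR (mulall 24 N (eZ c) n)) q - PS (fun n => IZR (cubZ n)) q).
      { unfold PS, g. rewrite <- Series_minus.
        - apply Series_ext. intros; ring.
        - apply (abs_cv_ex (fun n => IZR (mulall 24 N (eZ c) n))); [now apply mulall_abs_cv | lra].
        - apply (abs_cv_ex (fun n => IZR (cubZ n))); [apply cubZ_abs_cv | lra]. }
      rewrite HP, <- Cmod_R, RtoC_minus, PS_mulall by (auto; lra).
      destruct (nome_imag_surj q ltac:(lra)) as [t [Ht Hn']].
      assert (HqC : RtoC q <> RtoC 0) by (apply RtoC_neq; lra).
      pose proof (Pinf_neq_0 q ltac:(lra)) as HP0.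
      assert (EP : RtoC (PS (fun n => IZR (cubZ n)) q)
        = (RtoC (PS (fun n => IZR (eZ c n)) q) * Pinf (RtoC q) ^ 24)%C).
      { unfold cubZ. rewrite !PS_conv by (auto using conv_abs_cv, E4Z_abs_cv; lra).
        rewrite !RtoC_mult, (PS_E4Z t q), (eZ_PS c Hc t q) by (auto; lra).
        rewrite j_E4_Disc by auto. unfold Disc. rewrite Hn'.
        assert ((Pinf (RtoC q) ^ 24 <> 0)%C) by now apply Cpow_nz.
        set (X := (Pinf (RtoC q) ^ 24)%C) in *. field. auto. }
      rewrite EP.
      replace (Pn q N ^ 24 * PS (fun n0 => IZR (eZ c n0)) q - PS (fun n0 => IZR (eZ c n0)) q * Pinf q ^ 24)%C
        with (RtoC (PS (fun n0 => IZR (eZ c n0)) q) * (Pn q N ^ 24 - Pinf q ^ 24))%C by ring.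
      rewrite Cmod_mult, Cmod_R.
      pose proof (PS_bound _ q He ltac:(lra)) as Hb. fold B in Hb.
      assert (Hpn : Cmod (Pn (RtoC q) N) <= exp 2).
      { eapply Rle_trans; [apply (Pn_mod_le _ q); [lra | rewrite Cmod_RtoC_pos; lra]|].
        apply exp_le. replace 2 with (/ / 2) by field. apply Rinv_le_contravar; lra. }
      pose proof (Cpow_lipschitz _ _ _ 24 Hpn (Pinf_mod q ltac:(lra))) as Hl.
      pose proof (Pinf_diff q N ltac:(lra)) as Hd.
      replace (INR 24) with 24 in Hl by (simpl; ring). change (24 - 1)%nat with 23%nat in Hl.
      apply Rle_trans with (K * q ^ S N).
      + unfold K. rewrite Rmult_assoc. apply Rmult_le_compat; auto using Rabs_pos, Cmod_ge_0.
        eapply Rle_trans; [apply Hl|]. rewrite (Rmult_assoc _ (exp 2 * 2)).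
        apply Rmult_le_compat_l; auto. apply Rmult_le_pos; [lra|]. apply pow_le. left; apply exp_pos.
      + apply Rmult_le_compat_r; [lra|]. assert (0 <= D) by (apply Rmult_le_pos; lra). lra.
    - eapply Rle_trans; [apply PS_bound; auto|].
      assert (H1 : 1 <= 64 ^ S N * q ^ S N).
      { rewrite <- Rpow_mult_distr. apply pow_R1_Rle. lra. }
      assert (0 <= K * q ^ S N) by (apply Rmult_le_pos; lra).
      unfold D. rewrite Rmult_plus_distr_r.
      assert (Series (fun n => Rabs (g n) * (/ 2) ^ n) * 1 <=
        Series (fun n => Rabs (g n) * (/ 2) ^ n) * (64 ^ S N * q ^ S N))
        by (apply Rmult_le_compat_l; auto). lra. }
  unfold g in G0. apply eq_IZR. lra.
Qed.
End Determination.

Lemma zsum_nonneg f n : (forall k, 0 <= f k)%Z -> (0 <= zsum f n)%Z.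
Proof. intros H. induction n; simpl; [lia|]. specialize (H n). lia. Qed.

Lemma conv_nonneg a b : (forall k, 0 <= a k)%Z -> (forall k, 0 <= b k)%Z ->
  forall n, (0 <= conv a b n)%Z.
Proof. intros Ha Hb n. apply zsum_nonneg. intros k. apply Z.mul_nonneg_nonneg; auto. Qed.

Lemma cubZ_nonneg n : (0 <= cubZ n)%Z.
Proof.
  assert (H : forall k, (0 <= E4Z k)%Z) by (intros [|k]; unfold E4Z; lia).
  apply conv_nonneg; auto. now apply conv_nonneg.
Qed.

(** Dividing by 1 - q^k means a n = ([mulk k a] n) + a (n - k), so nonnegativity propagates by
    strong induction. Starting from the cube of [E4], this gives the sign of the coefficients of
    j. *)
Lemma mulk_nonneg_inv k a N : (1 <= k)%nat ->
  (forall n, (n <= N)%nat -> 0 <= mulk k a n)%Z -> (forall n, (n <= N)%nat -> 0 <= a n)%Z.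
Proof.
  intros Hk H n. induction n as [n IH] using lt_wf_ind. intros Hn.
  specialize (H n Hn). unfold mulk in H. destruct (Nat.leb k n) eqn:E.
  - apply Nat.leb_le in E. specialize (IH (n - k)%nat ltac:(lia) ltac:(lia)). lia.
  - lia.
Qed.

Lemma mulks_nonneg_inv k j N : (1 <= k)%nat -> forall a,
  (forall n, (n <= N)%nat -> 0 <= mulks k j a n)%Z -> (forall n, (n <= N)%nat -> 0 <= a n)%Z.
Proof.
  intros Hk. induction j; intros a H; auto. apply IHj. now apply mulk_nonneg_inv with k.
Qed.

Lemma mulall_nonneg_inv e M N a :
  (forall n, (n <= N)%nat -> 0 <= mulall e M a n)%Z -> (forall n, (n <= N)%nat -> 0 <= a n)%Z.
Proof.
  induction M; intros H; auto. apply IHM. apply (mulks_nonneg_inv (S M) e); [lia | exact H].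
Qed.

Theorem coef_nonneg c : j_fourier_coefficients c -> forall n, (0 <= c n)%Z.
Proof.
  intros Hc n. change (0 <= eZ c (S n))%Z.
  apply (mulall_nonneg_inv 24 (S n) (S n)); auto.
  intros k Hk. rewrite mulall_eZ by auto. apply cubZ_nonneg.
Qed.

(** * Computing the coefficients *)

(* [geom_list k] divides a truncated power series by [1 - q ^ k]; the accumulator
   holds the output in reverse order. *)
Fixpoint geom_aux (k : nat) (l acc : list Z) : list Z :=
  match l with
  | nil => rev acc
  | x :: l' => geom_aux k l' ((x + nth (k - 1) acc 0)%Z :: acc)
  end.

Definition geom_list (k : nat) (l : list Z) : list Z := geom_aux k l nil.

Fixpoint geoms_list (k j : nat) (l : list Z) : list Z :=
  match j with O => l | S j' => geoms_list k j' (geom_list k l) end.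

Fixpoint geomall_list (e N : nat) (l : list Z) : list Z :=
  match N with O => l | S M => geomall_list e M (geoms_list (S M) e l) end.

Definition trunc (N : nat) (a : nat -> Z) : list Z := map a (seq 0 N).

(** Once [m] outputs have been produced, position k - 1 of the reversed accumulator is the output
    [k] places back, and the default 0 stands for negative indices. *)
Lemma nth_rev_trunc a m k : (1 <= k)%nat ->
  nth (k - 1) (rev (trunc m a)) 0%Z = if Nat.leb k m then a (m - k)%nat else 0%Z.
Proof.
  intros Hk. destruct (Nat.leb k m) eqn:E.
  - apply Nat.leb_le in E. unfold trunc.
    rewrite rev_nth by (rewrite length_map, length_seq; lia).
    rewrite length_map, length_seq. replace (m - S (k - 1))%nat with (m - k)%nat by lia.
    rewrite (nth_indep _ 0%Z (a 0%nat)) by (rewrite length_map, length_seq; lia).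
    rewrite map_nth, seq_nth by lia. reflexivity.
  - apply Nat.leb_gt in E. apply nth_overflow.
    unfold trunc. rewrite length_rev, length_map, length_seq. lia.
Qed.

Lemma geom_aux_spec k a : (1 <= k)%nat -> forall l m,
  l = map (mulk k a) (seq m (length l)) ->
  geom_aux k l (rev (trunc m a)) = trunc (m + length l) a.
Proof.
  intros Hk l. induction l as [|x l IH]; intros m H.
  - simpl. rewrite rev_involutive. now rewrite Nat.add_0_r.
  - simpl in H. injection H as Hx Hl. simpl geom_aux.
    rewrite nth_rev_trunc by auto.
    replace ((x + (if Nat.leb k m then a (m - k)%nat else 0))%Z :: rev (trunc m a))
      with (rev (trunc (S m) a)).
    + rewrite IH by exact Hl. f_equal. simpl. lia.
    + unfold trunc. rewrite seq_S, map_app, rev_app_distr. simpl. f_equal.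
      rewrite Hx. unfold mulk. lia.
Qed.

Lemma geom_list_spec k a N : (1 <= k)%nat -> geom_list k (trunc N (mulk k a)) = trunc N a.
Proof.
  intros Hk. pose proof (geom_aux_spec k a Hk (trunc N (mulk k a)) 0) as H.
  assert (E : length (trunc N (mulk k a)) = N)
    by (unfold trunc; now rewrite length_map, length_seq).
  rewrite E in H. exact (H eq_refl).
Qed.

Lemma geoms_list_spec k j a N : (1 <= k)%nat -> geoms_list k j (trunc N (mulks k j a)) = trunc N a.
Proof.
  intros Hk. induction j; simpl; auto. rewrite geom_list_spec by auto. exact IHj.
Qed.

Lemma geomall_list_spec e M a N : geomall_list e M (trunc N (mulall e M a)) = trunc N a.
Proof.
  induction M; simpl; auto. rewrite geoms_list_spec by lia. exact IHM.
Qed.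

Definition nthZ (l : list Z) (n : nat) : Z := nth n l 0%Z.

Lemma nthZ_trunc a N n : (n < N)%nat -> nthZ (trunc N a) n = a n.
Proof.
  intros H. unfold nthZ, trunc. rewrite (nth_indep _ 0%Z (a 0%nat)) by (rewrite length_map, length_seq; lia).
  rewrite map_nth, seq_nth by lia. reflexivity.
Qed.

Lemma zsum_ext f g n : (forall k, (k < n)%nat -> f k = g k) -> zsum f n = zsum g n.
Proof. induction n; intros H; auto. simpl. rewrite IHn, H; auto with arith. Qed.

Lemma trunc_ext a b N : (forall n, (n < N)%nat -> a n = b n) -> trunc N a = trunc N b.
Proof.
  intros H. unfold trunc. apply map_ext_in. intros n Hn. apply in_seq in Hn. apply H. lia.
Qed.

Lemma conv_trunc a b N : trunc N (conv (nthZ (trunc N a)) (nthZ (trunc N b))) = trunc N (conv a b).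
Proof.
  apply trunc_ext. intros n Hn. unfold conv. apply zsum_ext. intros k Hk.
  rewrite !nthZ_trunc by lia. reflexivity.
Qed.

(** The intermediate lists are named so that the divisor sums and the square of [E4] are evaluated
    once; convolving the functions directly would recompute them for every product. *)
Definition j_list (N : nat) : list Z :=
  let l := trunc N E4Z in
  let l2 := trunc N (conv (nthZ l) (nthZ l)) in
  geomall_list 24 N (trunc N (conv (nthZ l2) (nthZ l))).

Theorem j_list_correct c N n : j_fourier_coefficients c -> (S n < N)%nat ->
  c n = nthZ (j_list N) (S n).
Proof.
  intros Hc Hn. unfold j_list. cbv zeta. rewrite (conv_trunc E4Z E4Z), conv_trunc.
  change (conv (conv E4Z E4Z) E4Z) with cubZ.
  rewrite <- (trunc_ext (mulall 24 N (eZ c)) cubZ).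
  - rewrite geomall_list_spec, nthZ_trunc by auto. reflexivity.
  - intros k Hk. apply mulall_eZ; auto. lia.
Qed.

(** * The Bessel generating function *)

Definition bcoef (k : nat) : R := (2 * PI) ^ (2 * S k) / (INR (fact (S k)) * INR (fact k)).

(* [bessel x = 2 PI / sqrt x * I_1 (4 PI sqrt x)] for the modified Bessel function [I_1]. *)
Definition bessel (x : R) : R := Series (fun k => bcoef k * x ^ k).

Lemma bcoef_pos k : 0 < bcoef k.
Proof.
  unfold bcoef. pose proof PI_RGT_0. apply Rdiv_lt_0_compat; [apply pow_lt; lra|].
  apply Rmult_lt_0_compat; apply INR_fact_pos.
Qed.

Lemma bcoef_bound k x : 0 <= x ->
  bcoef k * x ^ k <= (2 * PI) ^ 2 * (((2 * PI) ^ 2 * x) ^ k / INR (fact k)).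
Proof.
  intros Hx. unfold bcoef. pose proof PI_RGT_0.
  pose proof (INR_fact_pos k). pose proof (INR_fact_pos (S k)).
  assert (1 <= INR (fact (S k))) by (apply (le_INR 1), lt_O_fact).
  replace (2 * S k)%nat with (2 + 2 * k)%nat by lia. rewrite pow_add, pow_mult.
  assert (Hw : 0 < (2 * PI) ^ 2) by (apply pow_lt; lra).
  set (w := (2 * PI) ^ 2) in *. rewrite (Rpow_mult_distr w).
  assert (0 <= w * w ^ k * x ^ k).
  { apply Rmult_le_pos; [apply Rmult_le_pos|]; try apply pow_le; lra. }
  replace (w * w ^ k / (INR (fact (S k)) * INR (fact k)) * x ^ k)
    with (w * w ^ k * x ^ k * / INR (fact k) * / INR (fact (S k))) by (field; lra).
  replace (w * (w ^ k * x ^ k / INR (fact k)))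
    with (w * w ^ k * x ^ k * / INR (fact k) * 1) by (field; lra).
  apply Rmult_le_compat_l.
  - apply Rmult_le_pos; auto. left; now apply Rinv_0_lt_compat.
  - rewrite <- Rinv_1. apply Rinv_le_contravar; lra.
Qed.

Lemma ex_series_bessel x : 0 <= x -> ex_series (fun k => bcoef k * x ^ k).
Proof.
  intros Hx.
  apply ex_series_pos_le with (fun k => (2 * PI) ^ 2 * (((2 * PI) ^ 2 * x) ^ k / INR (fact k))).
  - intros k. split; [|now apply bcoef_bound].
    apply Rmult_le_pos; [left; apply bcoef_pos | now apply pow_le].
  - exact (ex_series_scal_l ((2 * PI) ^ 2) _ (ex_series_exp _)).
Qed.

Definition bessel_gen (t : C) : C :=
  CS (fun n => RtoC (bessel (INR (S n))) * nome t ^ S n)%C.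

(** In the exchange of the sums over [n] and [k], one factor (2 pi)^k / k! of [bcoef k] pays for n^k
    through [pow_nome_bound]; the other makes the sum over [k] exponential. *)
Lemma bessel_gen_pisum t : 0 < Im t ->
  bessel_gen t = CS (fun k => RtoC (bcoef k) * pisum k (nome t))%C
  /\ asum (fun k => RtoC (bcoef k) * pisum k (nome t))%C
  /\ asum (fun n => RtoC (bessel (INR (S n))) * nome t ^ S n)%C.
Proof.
  intros H. pose proof PI_RGT_0 as HP. set (rho := exp (- (PI * Im t))).
  assert (Hrho : 0 <= rho < 1) by now apply exp_neg_PI_lt_1.
  set (f := fun n k => (RtoC (bcoef k) * (RtoC (INR (S n) ^ k) * nome t ^ S n))%C).
  set (v := fun k => (2 * PI) ^ 2 * ((2 * PI * (2 / Im t)) ^ k / INR (fact k))).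
  assert (Hbk : forall k, bcoef k <= (2 * PI) ^ 2 * ((2 * PI) ^ k / INR (fact k)) * ((2 * PI) ^ k / INR (fact k))).
  { intros k. unfold bcoef. pose proof (INR_fact_pos k). pose proof (INR_fact_pos (S k)).
    replace (2 * S k)%nat with (2 + k + k)%nat by lia. rewrite !pow_add.
    pose proof (fact_le_add k 1) as Hf. rewrite Nat.add_1_r in Hf.
    assert (0 < (2 * PI) ^ k) by (apply pow_lt; lra).
    assert (0 < (2 * PI) ^ 2) by (apply pow_lt; lra).
    replace ((2 * PI) ^ 2 * ((2 * PI) ^ k / INR (fact k)) * ((2 * PI) ^ k / INR (fact k)))
      with ((2 * PI) ^ 2 * (2 * PI) ^ k * (2 * PI) ^ k * / INR (fact k) * / INR (fact k)) by (field; lra).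
    replace ((2 * PI) ^ 2 * (2 * PI) ^ k * (2 * PI) ^ k / (INR (fact (S k)) * INR (fact k)))
      with ((2 * PI) ^ 2 * (2 * PI) ^ k * (2 * PI) ^ k * / INR (fact k) * / INR (fact (S k))) by (field; lra).
    apply Rmult_le_compat_l.
    - apply Rmult_le_pos; [|left; now apply Rinv_0_lt_compat]. left.
      apply Rmult_lt_0_compat; auto. now apply Rmult_lt_0_compat.
    - now apply Rinv_le_contravar. }
  assert (Hf : forall n k, Cmod (f n k) <= rho ^ S n * v k).
  { intros n k. unfold f. rewrite Cmod_mult, Cmod_RtoC_pos by (left; apply bcoef_pos).
    pose proof (pow_nome_bound t n k H) as Hb. fold rho in Hb.
    set (X := Cmod (RtoC (INR (S n) ^ k) * nome t ^ S n)) in *.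
    assert (HX : 0 <= X) by apply Cmod_ge_0.
    pose proof (INR_fact_pos k).
    assert (Hc : 0 < (2 * PI) ^ k / INR (fact k)).
    { apply Rdiv_lt_0_compat; auto. apply pow_lt; lra. }
    eapply Rle_trans; [apply Rmult_le_compat_r; [auto | apply Hbk]|].
    replace ((2 * PI) ^ 2 * ((2 * PI) ^ k / INR (fact k)) * ((2 * PI) ^ k / INR (fact k)) * X)
      with ((2 * PI) ^ 2 * ((2 * PI) ^ k / INR (fact k)) * (X * ((2 * PI) ^ k / INR (fact k)))) by ring.
    eapply Rle_trans; [apply Rmult_le_compat_l; [|apply Hb]|].
    - apply Rmult_le_pos; [apply pow2_ge_0 | lra].
    - right. unfold v. rewrite (Rpow_mult_distr (2 * PI) (2 / Im t)). unfold Rdiv. ring. }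
  assert (Hv : ex_series v) by exact (ex_series_scal_l ((2 * PI) ^ 2) _ (ex_series_exp _)).
  assert (Hv0 : forall k, 0 <= v k).
  { intros k. unfold v. apply Rmult_le_pos; [apply pow2_ge_0|].
    apply Rmult_le_pos; [|left; apply Rinv_0_lt_compat, INR_fact_pos].
    apply pow_le. apply Rmult_le_pos; [lra|]. left; apply Rdiv_lt_0_compat; lra. }
  assert (Hrow : forall n, CS (fun k => f n k) = (RtoC (bessel (INR (S n))) * nome t ^ S n)%C).
  { intros n.
    rewrite (CS_ext _ (fun k => nome t ^ S n * RtoC (bcoef k * INR (S n) ^ k))%C).
    2:{ intros k. unfold f. rewrite RtoC_mult. ring. }
    rewrite CS_scal, CS_RtoC; [apply Cmult_comm|].
    eapply ex_series_ext; [|apply (ex_series_bessel (INR (S n))), pos_INR].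
    intros k. cbv beta. rewrite Cmod_RtoC_pos; auto.
    apply Rmult_le_pos; [left; apply bcoef_pos | apply pow_le, pos_INR]. }
  assert (Hcol : forall k, CS (fun n => f n k) = (RtoC (bcoef k) * pisum k (nome t))%C).
  { intros k. unfold f, pisum. apply CS_scal. now apply asum_pisum. }
  split; [|split].
  - unfold bessel_gen. rewrite <- (CS_ext _ _ Hrow), (CS_fubini _ _ _ Hf); auto using ex_series_geom_S.
    + apply CS_ext, Hcol.
    + intros; apply pow_le; lra.
  - apply (asum_ext _ _ Hcol).
    apply asum_le with (fun k => Series (fun n => rho ^ S n) * v k).
    + intros k. rewrite Rmult_comm, <- Series_scal_l.
      apply CS_mod_le; [intros n; rewrite Rmult_comm; apply Hf|].
      exact (ex_series_scal_l (v k) _ (ex_series_geom_S _ Hrho)).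
    + exact (ex_series_scal_l _ _ Hv).
  - apply (asum_ext _ _ Hrow).
    apply asum_le with (fun n => Series v * rho ^ S n).
    + intros n. rewrite Rmult_comm, <- Series_scal_l. apply CS_mod_le; [intros k; apply Hf|].
      exact (ex_series_scal_l (rho ^ S n) _ Hv).
    + exact (ex_series_scal_l _ _ (ex_series_geom_S _ Hrho)).
Qed.

Definition twopii : C := (RtoC (2 * PI) * Ci)%C.

(** Lipschitz's formula read backwards. Summed over [k], the right side is the symmetric sum over m
    of e^(2 pi i / (t + m)) - 1, apart from the constant -2 pi^2, which comes from the -pi i in the
    Fourier series of the cotangent. *)
Lemma bcoef_pisum t k : 0 < Im t ->
  (RtoC (bcoef k) * pisum k (nome t)
   = twopii ^ S k / RtoC (INR (fact (S k))) * Sk (S k) t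
     + (if Nat.eqb k 0 then - RtoC (2 * PI ^ 2) else 0))%C.
Proof.
  intros H. pose proof two_pi_i_neq_0 as Hk. fold twopii in Hk.
  pose proof (RtoC_fact_neq k) as F1. pose proof (RtoC_fact_neq (S k)) as F2.
  assert (Esq : RtoC ((2 * PI) ^ 2) = (- (twopii * twopii))%C).
  { unfold twopii. rewrite RtoC_pow.
    replace (- (RtoC (2 * PI) * Ci * (RtoC (2 * PI) * Ci)))%C
      with (- (RtoC (2 * PI) ^ 2 * (Ci * Ci)))%C by ring.
    rewrite Ci2. ring. }
  assert (Eb : RtoC (bcoef k) = ((- (twopii * twopii)) ^ S k
     / (RtoC (INR (fact (S k))) * RtoC (INR (fact k))))%C).
  { unfold bcoef. rewrite RtoC_div, RtoC_mult.
    - f_equal. rewrite pow_mult, RtoC_pow, Esq. reflexivity.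
    - apply Rgt_not_eq, Rmult_lt_0_compat; apply INR_fact_pos. }
  rewrite Eb. destruct k.
  - simpl Nat.eqb. cbv iota. rewrite Sk_1, pi_cot_fourier by auto. rewrite !Cpow_1_r.
    unfold pisum. fold twopii.
    rewrite (CS_ext (fun n => RtoC (INR (S n) ^ 0) * nome t ^ S n)%C (fun n => nome t ^ S n)%C)
      by (intros; rewrite pow_O; ring).
    set (X := CS (fun n => nome t ^ S n)%C).
    simpl fact. simpl INR.
    replace (- RtoC (2 * PI ^ 2))%C with (twopii * (RtoC PI * Ci))%C.
    2:{ unfold twopii. rewrite !RtoC_mult, RtoC_pow.
        replace (2 * PI * Ci * (PI * Ci))%C with (2 * PI ^ 2 * (Ci * Ci))%C by ring.
        rewrite Ci2. ring. }
    field.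
  - simpl Nat.eqb. cbv iota. rewrite (lipschitz t (S k)) by (auto; lia).
    unfold lip_coef. fold twopii.
    rewrite Cplus_0_r.
    replace ((- (twopii * twopii)) ^ S (S k))%C with
      ((- (1)) * (- (1)) ^ S k * (twopii ^ S (S k) * (twopii * twopii ^ S k)))%C.
    2:{ replace (- (twopii * twopii))%C with ((- (1)) * (twopii * twopii))%C by ring.
        rewrite !Cpow_mult_l. simpl. ring. }
    field. auto.
Qed.

Lemma zeta_odd_bound : Series (fun i => / INR (2 * i + 1) ^ 2) <= 2.
Proof.
  pose proof (zeta_odd 2 (le_n 2)) as H. rewrite (proj1 zeta_2_4) in H.
  pose proof PI_bounds. assert (PI ^ 2 <= 10) by nra. lra.
Qed.

Definition strip (t : C) : Prop := 0 < Im t /\ Rabs (Re t) <= / 2 /\ Cmod t <= 1.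

Lemma strip_lower t i (x : R) : strip t -> Rabs x = INR (S i) ->
  INR (2 * i + 1) / 2 <= Cmod (t + RtoC x).
Proof.
  intros [_ [H _]] Hx. pose proof (re_le_Cmod (t + RtoC x)) as H1. simpl in H1. fold (Re t) in H1.
  pose proof (Rabs_triang (Re t + x) (- Re t)) as H2.
  replace (Re t + x + - Re t) with x in H2 by ring. rewrite Rabs_Ropp in H2.
  rewrite plus_INR, mult_INR. rewrite S_INR in Hx. simpl (INR 2). simpl (INR 1). lra.
Qed.

(** Since |Re t| <= 1/2, both translates have modulus at least (2i + 1)/2. For k = 0 the pair
    combines to 2t/(u v), and |t| <= 1 replaces the missing decay. *)
Lemma strip_pair t k i : strip t ->
  Cmod (pair_inv (S k) t i) <= 4 * 2 ^ S k * / INR (2 * i + 1) ^ 2.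
Proof.
  intros H. pose proof (strip_lower t i (INR (S i)) H (Rabs_INR_S i)) as Lp.
  assert (Hx : Rabs (- INR (S i)) = INR (S i)) by (rewrite Rabs_Ropp; apply Rabs_INR_S).
  pose proof (strip_lower t i _ H Hx) as Lm. rewrite RtoC_opp in Lm.
  destruct H as [_ [_ H1]]. unfold pair_inv.
  set (w := INR (2 * i + 1)) in *.
  assert (Hw : 1 <= w) by (unfold w; apply (le_INR 1); lia).
  replace (t - RtoC (INR (S i)))%C with (t + - RtoC (INR (S i)))%C by ring.
  set (u := (t + RtoC (INR (S i)))%C) in *. set (v := (t + - RtoC (INR (S i)))%C) in *.
  assert (Nu : u <> RtoC 0) by (apply Cmod_gt_0; lra).
  assert (Nv : v <> RtoC 0) by (apply Cmod_gt_0; lra).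
  assert (Iu : Cmod (/ u) <= 2 * / w).
  { rewrite Cmod_inv by auto. replace (2 * / w) with (/ (w / 2)) by (field; lra).
    apply Rinv_le_contravar; lra. }
  assert (Iv : Cmod (/ v) <= 2 * / w).
  { rewrite Cmod_inv by auto. replace (2 * / w) with (/ (w / 2)) by (field; lra).
    apply Rinv_le_contravar; lra. }
  assert (Hw2 : 0 < / w <= 1).
  { split; [apply Rinv_0_lt_compat; lra|]. rewrite <- Rinv_1. apply Rinv_le_contravar; lra. }
  destruct k.
  - rewrite !Cpow_1_r.
    replace (/ u + / v)%C with (2 * t * (/ u * / v))%C.
    2:{ replace (2 * t)%C with (u + v)%C by (unfold u, v; ring). field. auto. }
    rewrite !Cmod_mult, Cmod_RtoC_pos by lra. pose proof (Cmod_ge_0 t).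
    apply Rle_trans with (2 * 1 * ((2 * / w) * (2 * / w))).
    + apply Rmult_le_compat; try lra.
      * apply Rmult_le_pos; apply Cmod_ge_0.
      * apply Rmult_le_compat; auto using Cmod_ge_0.
    + right. field. lra.
  - assert (B : forall z, z <> RtoC 0 -> Cmod (/ z) <= 2 * / w ->
      Cmod (/ z ^ S (S k)) <= 2 ^ S (S k) * / w ^ 2).
    { intros z Hz Hb. rewrite inv_pow_mod by auto. rewrite <- Cmod_inv by auto.
      apply Rle_trans with ((2 * / w) ^ S (S k)); [apply pow_incr; split; auto using Cmod_ge_0|].
      rewrite Rpow_mult_distr. apply Rmult_le_compat_l; [apply pow_le; lra|].
      rewrite <- pow_inv. replace (S (S k)) with (2 + k)%nat by lia. rewrite pow_add.
      rewrite <- (Rmult_1_r ((/ w) ^ 2)) at 2. apply Rmult_le_compat_l; [apply pow_le; lra|].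
      rewrite <- (pow1 k). apply pow_incr; lra. }
    eapply Rle_trans; [apply Cmod_triangle|].
    pose proof (B u Nu Iu). pose proof (B v Nv Iv).
    assert (0 <= 2 ^ S (S k) * / w ^ 2).
    { apply Rmult_le_pos; [apply pow_le; lra|]. left; apply Rinv_0_lt_compat, pow_lt; lra. }
    lra.
Qed.

Lemma strip_pair_sum t k : strip t -> Cmod (CS (pair_inv (S k) t)) <= 8 * 2 ^ S k.
Proof.
  intros H. pose proof zeta_odd_bound as Hz. pose proof (ex_series_odd 2 (le_n 2)) as Ex.
  apply Rle_trans with (Series (fun i => 4 * 2 ^ S k * / INR (2 * i + 1) ^ 2)).
  - apply CS_mod_le; [intros; now apply strip_pair|].
    exact (ex_series_scal_l (4 * 2 ^ S k) _ Ex).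
  - rewrite Series_scal_l. assert (0 < 2 ^ S k) by (apply pow_lt; lra). nra.
Qed.

Lemma inv_nome_Sinv t : t <> RtoC 0 -> (/ nome (Sinv t))%C = Cexp (twopii * / t)%C.
Proof.
  intros H. unfold nome. rewrite <- Cexp_opp. f_equal. unfold Sinv, twopii. ring.
Qed.

(** The term m = 0 is e^(2 pi i / t) - 1, the inverse nome at -1/t less 1. All other translates
    together contribute at most the sum of 8 (4 pi)^(k+1) / (k+1)!, and the constant of
    [bcoef_pisum] adds 2 pi^2. *)
Theorem bessel_gen_strip t : strip t ->
  Cmod (bessel_gen t - / nome (Sinv t)) <= 8 * exp (4 * PI) + 1 + 2 * PI ^ 2.
Proof.
  intros Hs. pose proof Hs as [H [Hre Hm]]. pose proof PI_RGT_0 as HP.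
  destruct (bessel_gen_pisum t H) as [E [A _]]. pose proof (Im_pos_neq t H) as Ht.
  rewrite E.
  set (g := fun k => (twopii ^ S k / RtoC (INR (fact (S k))) * CS (pair_inv (S k) t))%C).
  set (s := fun k : nat => if Nat.eqb k 0 then (- RtoC (2 * PI ^ 2))%C else RtoC 0).
  assert (Ek : forall k, (RtoC (bcoef k) * pisum k (nome t)
     = exp_term (twopii * / t) (S k) + (g k + s k))%C).
  { intros k. rewrite bcoef_pisum by auto. unfold Sk, g, s, exp_term.
    rewrite Cpow_mult_l, Cpow_inv by auto. unfold Cdiv. ring. }
  assert (Hgb : forall k, Cmod (g k) <= 8 * ((4 * PI) ^ S k / INR (fact (S k)))).
  { intros k. unfold g. rewrite Cmod_mult, Cmod_div, Cmod_pow by apply RtoC_fact_neq.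
    unfold twopii. rewrite Cmod_two_pi_i, Cmod_RtoC_pos by (left; apply INR_fact_pos).
    pose proof (strip_pair_sum t k Hs) as Hp. pose proof (INR_fact_pos (S k)).
    assert (0 < (2 * PI) ^ S k / INR (fact (S k))).
    { apply Rdiv_lt_0_compat; auto. apply pow_lt; lra. }
    eapply Rle_trans; [apply Rmult_le_compat_l; [lra | apply Hp]|]. right.
    replace (4 * PI) with (2 * PI * 2) by ring. rewrite (Rpow_mult_distr (2 * PI)). field. lra. }
  pose proof (ex_series_exp (4 * PI)) as Ex.
  assert (Ex' : ex_series (fun k => (4 * PI) ^ S k / INR (fact (S k))))
    by now apply (ex_series_incr_1 (fun k => (4 * PI) ^ k / INR (fact k))) in Ex.
  assert (Ag : asum g).
  { apply asum_le with (1 := Hgb). exact (ex_series_scal_l 8 _ Ex'). }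
  destruct (CS_single (- RtoC (2 * PI ^ 2))%C) as [Es As]. fold s in Es, As.
  pose proof (asum_exp (twopii * / t)) as Ae.
  rewrite (CS_ext _ _ Ek), CS_plus, CS_plus; auto.
  2:{ now apply (proj1 (asum_S _)). } 2:{ now apply asum_plus. }
  pose proof (CS_S _ Ae) as E1. rewrite CS_exp, <- inv_nome_Sinv in E1 by auto.
  assert (E0 : exp_term (twopii * / t) 0 = RtoC 1) by (unfold exp_term; simpl; field).
  rewrite E0 in E1. rewrite E1, Es.
  match goal with |- Cmod ?x <= _ => replace x with (CS g + (- (1) + - RtoC (2 * PI ^ 2)))%C by ring end.
  eapply Rle_trans; [apply Cmod_triangle|].
  assert (B1 : Cmod (CS g) <= 8 * exp (4 * PI)).
  { apply Rle_trans with (8 * Series (fun k => (4 * PI) ^ S k / INR (fact (S k)))).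
    - rewrite <- Series_scal_l. apply CS_mod_le; auto. exact (ex_series_scal_l 8 _ Ex').
    - apply Rmult_le_compat_l; [lra|]. rewrite <- Series_exp, (Series_incr_1 _ Ex).
      simpl (_ ^ 0). simpl (fact 0). simpl (INR 1). lra. }
  assert (B2 : Cmod (- (1) + - RtoC (2 * PI ^ 2)) <= 1 + 2 * PI ^ 2).
  { eapply Rle_trans; [apply Cmod_triangle|]. rewrite Cmod_m1, Cmod_opp, Cmod_RtoC_pos; [lra|].
    pose proof (pow2_ge_0 PI). lra. }
  lra.
Qed.

(** * Cauchy's estimate for the coefficients *)

Lemma nome_RtoC x : nome (RtoC x) = (cos (2 * PI * x), sin (2 * PI * x)).
Proof.
  unfold nome, Cexp. simpl.
  match goal with |- (exp ?u * cos ?v, exp ?u * sin ?v) = _ =>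
    replace u with 0 by ring; replace v with (2 * PI * x) by ring end.
  rewrite exp_0. f_equal; ring.
Qed.

Lemma nome_real_neq_1 x : 0 < Rabs x < 1 -> nome (RtoC x) <> 1%C.
Proof.
  intros Hx E. rewrite nome_RtoC in E. injection E as Ec _.
  replace (2 * PI * x) with (2 * (PI * x)) in Ec by ring. rewrite cos_2a_sin in Ec.
  assert (Hs : sin (PI * x) = 0) by nra.
  pose proof PI_RGT_0.
  assert (Hp : 0 < sin (PI * Rabs x)) by (apply sin_gt_0; nra).
  unfold Rabs in *. destruct (Rcase_abs x).
  - replace (PI * - x) with (- (PI * x)) in Hp by ring. rewrite sin_neg in Hp. lra.
  - lra.
Qed.

Lemma csum_geom z n : z <> RtoC 1 -> csum (fun l => z ^ l)%C n = ((z ^ n - 1) / (z - 1))%C.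
Proof.
  intros Hz. assert (z - 1 <> 0)%C by now apply Cminus_neq_0.
  induction n; simpl csum; [simpl; field; auto|]. rewrite IHn, Cpow_S. field. auto.
Qed.

Lemma csum_const (z : C) n : csum (fun _ => z) n = (RtoC (INR n) * z)%C.
Proof. induction n; [simpl; ring|]. cbn [csum]. rewrite IHn, S_INR, RtoC_plus. ring. Qed.

Lemma csum_swap (f : nat -> nat -> C) m n :
  csum (fun i => csum (fun j => f i j) n) m = csum (fun j => csum (fun i => f i j) m) n.
Proof.
  induction m; simpl.
  - induction n; simpl; [reflexivity|]. rewrite <- IHn. ring.
  - rewrite IHm, csum_plus. reflexivity.
Qed.

Lemma csum_single (f : nat -> C) N n : (n < N)%nat ->
  (forall k, (k < N)%nat -> k <> n -> f k = RtoC 0) -> csum f N = f n.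
Proof.
  intros Hn H. induction N; [lia|]. simpl. destruct (Nat.eq_dec n N) as [->|Hne].
  - rewrite (csum_ext _ (fun _ => RtoC 0)), csum_const; [ring|].
    intros k Hk. apply H; lia.
  - rewrite (H N) by lia. rewrite IHN; [ring | lia|]. intros k Hk Hkn. apply H; lia.
Qed.

(** Equally spaced points of [-1/2, 1/2), centred so that they stay in the strip where the bounds
    hold. *)
Definition xpt (N l : nat) : R := INR l / INR N - / 2.

Lemma roots_orthogonal N m n : (m < N)%nat -> (n < N)%nat ->
  csum (fun l => nome (RtoC ((INR m - INR n) * xpt N l))) N
  = if Nat.eqb m n then RtoC (INR N) else RtoC 0.
Proof.
  intros Hm Hn. assert (HN : 0 < INR N) by (apply lt_0_INR; lia).
  set (z := nome (RtoC ((INR m - INR n) / INR N))).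
  set (w := nome (RtoC (- ((INR m - INR n) / 2)))).
  assert (E : forall l, nome (RtoC ((INR m - INR n) * xpt N l)) = (w * z ^ l)%C).
  { intros l. unfold z, w. rewrite nome_pow, <- nome_add, <- RtoC_mult, <- RtoC_plus. do 2 f_equal.
    unfold xpt. field. lra. }
  rewrite (csum_ext _ (fun l => w * z ^ l)%C) by (intros; apply E).
  rewrite csum_scal. destruct (Nat.eqb m n) eqn:Emn.
  - apply Nat.eqb_eq in Emn. subst m.
    assert (Hz : z = RtoC 1) by (unfold z; rewrite Rminus_diag, Rdiv_0_l; apply nome_0).
    assert (Hw : w = RtoC 1) by (unfold w; rewrite Rminus_diag, Rdiv_0_l, Ropp_0; apply nome_0).
    rewrite Hz, Hw, (csum_ext _ (fun _ => RtoC 1)) by (intros; apply Cpow_1_l).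
    rewrite csum_const. ring.
  - apply Nat.eqb_neq in Emn. rewrite csum_geom.
    + assert (Hz : (z ^ N = 1)%C).
      { unfold z. rewrite nome_pow, <- RtoC_mult.
        replace (INR N * ((INR m - INR n) / INR N)) with (IZR (Z.of_nat m - Z.of_nat n)).
        - apply nome_IZR.
        - rewrite minus_IZR, <- !INR_IZR_INZ. field. lra. }
      rewrite Hz. unfold Cdiv. ring.
    + apply nome_real_neq_1. unfold Rdiv. rewrite Rabs_mult, Rabs_inv, (Rabs_pos_eq (INR N)) by lra.
      pose proof (lt_INR _ _ Hm). pose proof (lt_INR _ _ Hn).
      pose proof (pos_INR m). pose proof (pos_INR n).
      assert (INR m <> INR n) by (intros e; apply Emn; now apply INR_eq).
      split.
      * apply Rmult_lt_0_compat; [apply Rabs_pos_lt; lra | now apply Rinv_0_lt_compat].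
      * apply Rmult_lt_reg_r with (INR N); auto. rewrite Rmult_assoc, Rinv_l, Rmult_1_r by lra.
        rewrite Rmult_1_l. apply Rabs_def1; lra.
Qed.

Definition line (y x : R) : C := (x, y).

Lemma nome_line y x : nome (line y x) = (RtoC (exp (- (2 * PI * y))) * nome (RtoC x))%C.
Proof.
  rewrite <- nome_imag, <- nome_add. f_equal. apply C_ext; simpl; ring.
Qed.

Lemma xpt_bound N l : (l < N)%nat -> Rabs (xpt N l) <= / 2.
Proof.
  intros H. assert (HN : 0 < INR N) by (apply lt_0_INR; lia). unfold xpt.
  pose proof (pos_INR l). pose proof (lt_INR _ _ H).
  assert (0 <= INR l / INR N) by (apply Rmult_le_pos; [auto | left; now apply Rinv_0_lt_compat]).
  assert (INR l / INR N <= 1) by (apply Rle_div_l; lra).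
  apply Rabs_le; lra.
Qed.

(* Cauchy's estimate, with the integral replaced by averages over finitely many points. *)
Lemma cauchy_estimate (g : nat -> R) y B n : 0 < y ->
  ex_series (fun m => Rabs (g m) * exp (- (2 * PI * y)) ^ m) ->
  (forall x, Rabs x <= / 2 -> Cmod (CS (fun m => RtoC (g m) * nome (line y x) ^ m))%C <= B) ->
  Rabs (g n) <= B * exp (2 * PI * y * INR n).
Proof.
  intros Hy Hex HB. set (r := exp (- (2 * PI * y))) in *.
  assert (Hr : 0 < r) by apply exp_pos.
  assert (Hnl : forall x m, (nome (line y x) ^ m = RtoC (r ^ m) * nome (RtoC (INR m * x)))%C).
  { intros x m. rewrite nome_line, Cpow_mult_l, <- RtoC_pow, nome_pow, <- RtoC_mult. reflexivity. }
  assert (Hn1 : forall x, Cmod (nome (RtoC x)) = 1).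
  { intros x. rewrite nome_mod. simpl. rewrite Rmult_0_r, Ropp_0. apply exp_0. }
  set (tail := fun N => Series (fun k => Rabs (g (N + k)%nat) * r ^ (N + k))).
  assert (Hterm : forall x m, Cmod (RtoC (g m) * nome (line y x) ^ m)%C = Rabs (g m) * r ^ m).
  { intros x m. rewrite Hnl, !Cmod_mult, Hn1, Cmod_R, Cmod_RtoC_pos; [ring|].
    apply pow_le; lra. }
  assert (Has : forall x, asum (fun m => RtoC (g m) * nome (line y x) ^ m)%C).
  { intros x. apply asum_le with (2 := Hex). intros m. rewrite Hterm. lra. }
  assert (Hpart : forall N x, Rabs x <= / 2 ->
    Cmod (csum (fun m => RtoC (g m) * nome (line y x) ^ m)%C N) <= B + tail N).
  { intros N x Hx. pose proof (CS_split _ N (Has x)) as E.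
    replace (csum (fun m => RtoC (g m) * nome (line y x) ^ m)%C N) with
      (CS (fun m => RtoC (g m) * nome (line y x) ^ m)%C +
       - CS (fun k => RtoC (g (N + k)%nat) * nome (line y x) ^ (N + k)))%C by (rewrite E; ring).
    eapply Rle_trans; [apply Cmod_triangle|]. apply Rplus_le_compat; [now apply HB|].
    rewrite Cmod_opp. unfold tail. apply CS_mod_le.
    - intros k. rewrite Hterm. lra.
    - apply (ex_series_tail (fun m => Rabs (g m) * r ^ m)), Hex. }
  (* Averaging over N points confuses indices that are congruent modulo N. The series is therefore
     truncated at N, which makes the orthogonality exact at the cost of [tail N]. *)
  assert (Hmain : forall N, (n < N)%nat -> Rabs (g n) * r ^ n <= B + tail N).
  { intros N HnN. assert (HN : 0 < INR N) by (apply lt_0_INR; lia).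
    set (h := fun l => (csum (fun m => RtoC (g m) * nome (line y (xpt N l)) ^ m)%C N
        * nome (RtoC (- (INR n * xpt N l))))%C).
    assert (Hh : csum h N = (RtoC (INR N) * RtoC (g n * r ^ n))%C).
    { unfold h.
      rewrite (csum_ext _ (fun l => csum (fun m => RtoC (g m * r ^ m)
        * nome (RtoC ((INR m - INR n) * xpt N l)))%C N)).
      - rewrite csum_swap.
        rewrite (csum_ext _ (fun m => RtoC (g m * r ^ m) * (if Nat.eqb m n then RtoC (INR N) else 0))%C).
        + rewrite (csum_single _ N n) by (auto; intros k Hk Hkn;
            rewrite (proj2 (Nat.eqb_neq k n)) by auto; ring).
          rewrite Nat.eqb_refl. ring.
        + intros m Hm. rewrite csum_scal, roots_orthogonal by auto. reflexivity.
      - intros l _. rewrite Cmult_comm, <- csum_scal. apply csum_ext. intros m _.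
        rewrite Hnl, (RtoC_mult (g m)).
        replace ((INR m - INR n) * xpt N l) with (INR m * xpt N l + - (INR n * xpt N l)) by ring.
        rewrite RtoC_plus, nome_add. ring. }
    assert (Hb : Cmod (csum h N) <= INR N * (B + tail N)).
    { rewrite <- rsum_const. eapply Rle_trans; [apply csum_mod|]. apply rsum_le.
      intros l Hl. unfold h. rewrite Cmod_mult, Hn1, Rmult_1_r.
      apply Hpart. now apply xpt_bound. }
    rewrite Hh, Cmod_mult, !Cmod_R, (Rabs_pos_eq (INR N)) in Hb by lra.
    apply Rmult_le_reg_l in Hb; auto.
    rewrite Rabs_mult, (Rabs_pos_eq (r ^ n)) in Hb by (apply pow_le; lra). exact Hb. }
  assert (Hlim : Rabs (g n) * r ^ n <= B).
  { pose proof (Series_tail_lim _ Hex) as L. fold tail in L. apply is_lim_seq_spec in L.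
    apply Rnot_lt_le. intros Hlt.
    assert (He : 0 < Rabs (g n) * r ^ n - B) by lra.
    destruct (L (mkposreal _ He)) as [N HN].
    specialize (HN (N + S n)%nat ltac:(lia)). specialize (Hmain (N + S n)%nat ltac:(lia)).
    change (Rabs (tail (N + S n)%nat - 0) < Rabs (g n) * r ^ n - B) in HN.
    rewrite Rminus_0_r in HN. apply Rabs_def2 in HN. lra. }
  assert (Er : exp (2 * PI * y * INR n) * r ^ n = 1).
  { unfold r. rewrite exp_pow, <- exp_plus, <- exp_0. f_equal. ring. }
  pose proof (exp_pos (2 * PI * y * INR n)) as Hp.
  replace (Rabs (g n)) with (Rabs (g n) * r ^ n * exp (2 * PI * y * INR n)).
  - apply Rmult_le_compat_r; lra.
  - rewrite Rmult_assoc, (Rmult_comm (r ^ n)), Er. ring.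
Qed.

Section Bound.
Variable c : nat -> Z.
Hypothesis Hc : j_fourier_coefficients c.

(** The value of j at i v less its polar term. As the coefficients are nonnegative it also dominates
    the same difference on the whole line of height [v]. *)
Definition jpos (v : R) : R := Series (fun n => IZR (c n) * exp (- (2 * PI * v)) ^ n).

Lemma exp_neg_lt_1 v : 0 < v -> 0 < exp (- (2 * PI * v)) < 1.
Proof.
  intros H. split; [apply exp_pos|]. rewrite <- exp_0. apply exp_increasing.
  pose proof PI_RGT_0. assert (0 < PI * v) by now apply Rmult_lt_0_compat. lra.
Qed.

Lemma ex_jpos v : 0 < v -> ex_series (fun n => IZR (c n) * exp (- (2 * PI * v)) ^ n).
Proof.
  intros H. apply (abs_cv_ex (fun n => IZR (c n))); [now apply coef_abs_cv | now apply exp_neg_lt_1].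
Qed.

Lemma coef_IZR_nonneg n : 0 <= IZR (c n).
Proof. apply (IZR_le 0). now apply coef_nonneg. Qed.

Lemma j_imag v : 0 < v -> j_invariant (imag v) = RtoC (exp (2 * PI * v) + jpos v).
Proof.
  intros H. rewrite (j_coef c Hc) by exact H. rewrite nome_imag.
  rewrite (CS_ext _ (fun n => RtoC (IZR (c n) * exp (- (2 * PI * v)) ^ n))).
  2:{ intros n. now rewrite RtoC_mult, RtoC_pow. }
  rewrite CS_RtoC, RtoC_plus. f_equal.
  rewrite <- RtoC_inv, exp_Ropp, Rinv_inv; auto. apply Rgt_not_eq, exp_pos.
Qed.

Lemma Sinv_imag v : 0 < v -> Sinv (imag v) = imag (/ v).
Proof.
  intros H. unfold Sinv, imag. apply C_ext; simpl; field; lra.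
Qed.

Lemma jpos_inv v : 0 < v -> exp (2 * PI * v) + jpos v = exp (2 * PI * / v) + jpos (/ v).
Proof.
  intros H. pose proof (j_Sinv (imag v) H) as E.
  rewrite Sinv_imag, !j_imag in E by (auto; now apply Rinv_0_lt_compat).
  injection E as E. lra.
Qed.

Lemma jpos_mono v w : 0 < v <= w -> jpos w <= jpos v.
Proof.
  intros H. unfold jpos. apply Series_le; [|apply ex_jpos; lra]. intros n.
  pose proof (coef_IZR_nonneg n). pose proof (exp_pos (- (2 * PI * w))).
  split; [apply Rmult_le_pos; auto; apply pow_le; lra|].
  apply Rmult_le_compat_l; auto. apply pow_incr. split; [lra|]. apply exp_le.
  pose proof PI_RGT_0. assert (PI * v <= PI * w) by (apply Rmult_le_compat_l; lra). lra.
Qed.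

(** For v < 1 invariance moves to 1/v > 1, where monotonicity gives [jpos 1]; the polar term at 1/v
    is the exponential. For v >= 1 monotonicity alone is enough. *)
Lemma jpos_bound v M : 0 < v -> / v <= M -> jpos v <= jpos 1 + exp (2 * PI * M).
Proof.
  intros H HM. pose proof PI_RGT_0. assert (Hv : 0 < / v) by now apply Rinv_0_lt_compat.
  pose proof (exp_pos (2 * PI * M)).
  destruct (Rle_lt_dec 1 v) as [Hv1|Hv1].
  - pose proof (jpos_mono 1 v ltac:(lra)). lra.
  - pose proof (jpos_inv v H) as E.
    assert (1 <= / v) by (rewrite <- Rinv_1; apply Rinv_le_contravar; lra).
    pose proof (jpos_mono 1 (/ v) ltac:(lra)). pose proof (exp_pos (2 * PI * v)).
    assert (exp (2 * PI * / v) <= exp (2 * PI * M)).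
    { apply exp_le. apply Rmult_le_compat_l; lra. }
    lra.
Qed.

Lemma j_minus_principal t : 0 < Im t ->
  Cmod (j_invariant t - / nome (Sinv t)) <= jpos (Im (Sinv t)).
Proof.
  intros H. pose proof (Im_Sinv_pos t H) as H'. rewrite <- (j_Sinv t H), (j_coef c Hc) by auto.
  match goal with |- Cmod ?x <= _ =>
    replace x with (CS (fun n => RtoC (IZR (c n)) * nome (Sinv t) ^ n))%C by ring end.
  unfold jpos. apply CS_mod_le; [|now apply ex_jpos].
  intros n. rewrite Cmod_mult, Cmod_pow, nome_mod, Cmod_RtoC_pos by apply coef_IZR_nonneg. lra.
Qed.

Theorem coef_bessel_bound y n : 0 < y <= / 2 -> (1 <= n)%nat ->
  Rabs (IZR (c n) - bessel (INR n)) <=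
  (jpos 1 + exp (2 * PI * (/ (4 * y) + y)) + exp (2 * PI * y) + 8 * exp (4 * PI) + 1 + 2 * PI ^ 2)
   * exp (2 * PI * y * INR n).
Proof.
  intros Hy Hn.
  (* The Bessel series starts at index 1, so index 0 keeps the whole of [c 0]. *)
  set (g := fun m => match m with O => IZR (c 0) | S k => IZR (c m) - bessel (INR m) end).
  replace (IZR (c n) - bessel (INR n)) with (g n) by (destruct n; [lia | reflexivity]).
  pose proof PI_RGT_0 as HP.
  set (b := fun m => match m with O => 0 | S k => bessel (INR m) end).
  assert (Hg : forall m, g m = IZR (c m) + - b m) by (intros [|m]; unfold g, b; ring).
  set (r := exp (- (2 * PI * y))).
  assert (Hr : 0 < r < 1) by (apply exp_neg_lt_1; lra).
  assert (Hbp : forall m, 0 <= bessel (INR (S m))).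
  { intros m. unfold bessel. apply Series_nonneg; [|apply ex_series_bessel, pos_INR].
    intros k. apply Rmult_le_pos; [left; apply bcoef_pos | apply pow_le, pos_INR]. }
  assert (Hstrip : forall x, Rabs x <= / 2 -> strip (line y x)).
  { intros x Hx. split; [simpl; lra|]. split; [exact Hx|].
    eapply Rle_trans; [apply Cmod_le_Re_Im|]. simpl. rewrite (Rabs_pos_eq y); lra. }
  assert (Exb : ex_series (fun m => b m * r ^ m)).
  { apply ex_series_incr_1. unfold b. 
    assert (H0 : Rabs 0 <= / 2) by (rewrite Rabs_R0; lra).
    destruct (bessel_gen_pisum (line y 0) ltac:(simpl; lra)) as [_ [_ A]].
    eapply ex_series_ext; [|exact A]. intros m. cbv beta.
    rewrite Cmod_mult, Cmod_pow, nome_mod, Cmod_RtoC_pos by auto. reflexivity. }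
  apply cauchy_estimate; [lra| |].
  - fold r. pose proof (coef_abs_cv c Hc r Hr) as E1.
    apply ex_series_pos_le with (2 := ex_series_plus _ _ E1 Exb).
    intros m. unfold plus; simpl. assert (0 <= r ^ m) by (apply pow_le; lra). split.
    + apply Rmult_le_pos; [apply Rabs_pos | auto].
    + rewrite <- Rmult_plus_distr_r. apply Rmult_le_compat_r; auto.
      rewrite Hg. eapply Rle_trans; [apply Rabs_triang|]. rewrite Rabs_Ropp.
      assert (0 <= b m) by (destruct m; simpl b; [lra | apply Hbp]).
      rewrite (Rabs_pos_eq (b m)); lra.
  - intros x Hx. set (t := line y x). pose proof (Hstrip x Hx) as Hs. fold t in Hs.
    pose proof Hs as [Ht _].
    assert (Eg : CS (fun m => RtoC (g m) * nome t ^ m)%C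
      = (j_invariant t - / nome t - bessel_gen t)%C).
    { destruct (bessel_gen_pisum t Ht) as [_ [_ A]].
      set (bb := fun m => (RtoC (b m) * nome t ^ m)%C).
      assert (Ab : asum bb).
      { apply asum_S. exact A. }
      assert (Eb : CS bb = bessel_gen t).
      { rewrite (CS_S _ Ab). unfold bb at 1, b at 1. unfold bessel_gen.
        rewrite Cmult_0_l, Cplus_0_l. reflexivity. }
      rewrite (j_coef c Hc t Ht), <- Eb.
      rewrite (CS_ext _ (fun m => RtoC (IZR (c m)) * nome t ^ m - bb m)%C).
      - rewrite CS_minus by (auto; now apply coef_asum). ring.
      - intros m. rewrite Hg, RtoC_plus, RtoC_opp. unfold bb. ring. }
    rewrite Eg.
    (* The inverse nome at -1/t is subtracted and added back: it is the large common part of j and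
       of the Bessel series. *)
    replace (j_invariant t - / nome t - bessel_gen t)%C
      with ((j_invariant t - / nome (Sinv t)) + (- / nome t + - (bessel_gen t - / nome (Sinv t))))%C by ring.
    eapply Rle_trans; [apply Cmod_triangle|].
    pose proof (Cmod_triangle (- / nome t) (- (bessel_gen t - / nome (Sinv t)))) as T2.
    rewrite !Cmod_opp in T2.
    pose proof (bessel_gen_strip t Hs) as B1. pose proof (j_minus_principal t Ht) as B2.
    assert (B3 : Cmod (/ nome t) <= exp (2 * PI * y)).
    { rewrite Cmod_inv by apply nome_neq_0. rewrite nome_mod. simpl.
      rewrite exp_Ropp, Rinv_inv. lra. }
    (* 1 / Im(-1/t) = (x^2 + y^2) / y with x^2 <= 1/4. *)
    assert (B4 : jpos (Im (Sinv t)) <= jpos 1 + exp (2 * PI * (/ (4 * y) + y))).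
    { apply jpos_bound; [now apply Im_Sinv_pos|]. rewrite Im_Sinv, Cmod_sq by auto. simpl.
      assert (Hx2 : x ^ 2 <= / 4).
      { rewrite <- pow2_abs. replace (/ 4) with ((/ 2) ^ 2) by field.
        apply pow_incr. split; [apply Rabs_pos | auto]. }
      unfold Rdiv. rewrite Rinv_mult, Rinv_inv.
      replace (/ (4 * y) + y) with (/ y * (/ 4 + y * y)) by (field; lra).
      apply Rmult_le_compat_l; [left; apply Rinv_0_lt_compat; lra|]. simpl in Hx2. lra. }
    lra.
Qed.

Lemma cube_le_pow3 n : INR (S n) ^ 3 <= 3 ^ S n.
Proof.
  assert (H : forall m, (m * m * m <= 3 ^ m)%nat).
  { intros m. destruct m as [|[|[|m]]]; [simpl; lia | simpl; lia | simpl; lia|].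
    induction m; [simpl; lia|].
    replace (3 ^ S (S (S (S m))))%nat with (3 * 3 ^ S (S (S m)))%nat by reflexivity. nia. }
  pose proof (le_INR _ _ (H (S n))) as HR. rewrite pow_INR, !mult_INR in HR.
  replace (INR 3) with 3 in HR by (simpl; ring).
  replace (INR (S n) ^ 3) with (INR (S n) * INR (S n) * INR (S n)) by ring. exact HR.
Qed.
End Bound.

(** * Wallis's product and the size of [I_1] *)

Definition wallis (n : nat) : R := RInt (fun x => sin x ^ n) 0 (PI / 2).

Lemma ex_RInt_sin_pow n a b : ex_RInt (fun x => sin x ^ n) a b.
Proof.
  apply (ex_RInt_continuous (V := R_CompleteNormedModule)). intros z _.
  apply (ex_derive_continuous (fun x => sin x ^ n)). auto_derive. exact I.
Qed.

(** The difference of the two sides is the integral of the derivative of sin^(n+1) cos, which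
    vanishes at both endpoints. *)
Lemma wallis_rec n : (INR n + 1) * wallis n = (INR n + 2) * wallis (S (S n)).
Proof.
  set (F := fun x => sin x ^ S n * cos x).
  set (f := fun x => (INR n + 1) * sin x ^ n - (INR n + 2) * sin x ^ S (S n)).
  assert (H1 : is_RInt f 0 (PI / 2) (F (PI / 2) - F 0)).
  { apply (is_RInt_derive F f).
    - intros x _. unfold F, f. auto_derive; auto.
      pose proof (sin2_cos2 x) as Hs. unfold Rsqr in Hs.
      change (Init.Nat.pred (S n)) with n. rewrite ?S_INR. simpl pow.
      replace (match n with 0%nat => 1 | S _ => INR n + 1 end) with (INR n + 1)
        by (destruct n; simpl; ring).
      assert (Ec : cos x * cos x = 1 - sin x * sin x) by lra.
      replace (1 * ((INR n + 1) * (cos x * sin x ^ n)) * cos x + sin x * sin x ^ n * (1 * - sin x))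
        with ((INR n + 1) * sin x ^ n * (cos x * cos x) - sin x * sin x * sin x ^ n) by ring.
      ring_simplify. replace (cos x ^ 2) with (1 - sin x * sin x) by (rewrite <- Ec; ring). ring.
    - intros x _. unfold f. apply (ex_derive_continuous (fun x => (INR n + 1) * sin x ^ n - (INR n + 2) * sin x ^ S (S n))).
      auto_derive. repeat split. }
  assert (H2 : is_RInt f 0 (PI / 2) ((INR n + 1) * wallis n - (INR n + 2) * wallis (S (S n)))).
  { apply (is_RInt_minus (V := R_NormedModule) (fun x => (INR n + 1) * sin x ^ n)
      (fun x => (INR n + 2) * sin x ^ S (S n))).
    - apply (is_RInt_scal (V := R_NormedModule) (fun x => sin x ^ n)).
      apply (RInt_correct (V := R_CompleteNormedModule)), ex_RInt_sin_pow.
    - apply (is_RInt_scal (V := R_NormedModule) (fun x => sin x ^ S (S n))).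
      apply (RInt_correct (V := R_CompleteNormedModule)), ex_RInt_sin_pow. }
  pose proof (is_RInt_unique (V := R_CompleteNormedModule) _ _ _ _ H1) as U1.
  pose proof (is_RInt_unique (V := R_CompleteNormedModule) _ _ _ _ H2) as U2.
  rewrite U1 in U2. clear H1 H2. rename U2 into H2.
  unfold F in H2. rewrite cos_PI2, sin_0 in H2. simpl pow in H2. lra.
Qed.

Lemma wallis_0 : wallis 0 = PI / 2.
Proof.
  unfold wallis. simpl pow. rewrite RInt_const. unfold scal; simpl; unfold mult; simpl. ring.
Qed.

Lemma wallis_1 : wallis 1 = 1.
Proof.
  assert (H : is_RInt (fun x => sin x ^ 1) 0 (PI / 2) (- cos (PI / 2) - - cos 0)).
  { apply (is_RInt_derive (fun x => - cos x) (fun x => sin x ^ 1)).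
    - intros x _. auto_derive; auto. ring.
    - intros x _. apply (ex_derive_continuous (fun x => sin x ^ 1)). auto_derive. exact I. }
  apply (is_RInt_unique (V := R_CompleteNormedModule)) in H. unfold wallis. rewrite H, cos_PI2, cos_0.
  ring.
Qed.

Lemma wallis_decr n : wallis (S n) <= wallis n.
Proof.
  pose proof PI_RGT_0. apply RInt_le; [lra | apply ex_RInt_sin_pow | apply ex_RInt_sin_pow|].
  intros x Hx. pose proof (sin_gt_0 x ltac:(lra) ltac:(lra)) as Hs. pose proof (SIN_bound x).
  simpl. assert (0 <= sin x ^ n) by (apply pow_le; lra). nra.
Qed.

(** The recursion makes the product independent of [n]. With monotonicity it brackets the square of
    each [wallis n], and this is how pi enters the size of [I_1]. *)
Lemma wallis_prod n : (INR n + 1) * (wallis n * wallis (S n)) = PI / 2.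
Proof.
  induction n.
  - rewrite wallis_0, wallis_1. simpl. ring.
  - pose proof (wallis_rec n) as H. rewrite S_INR.
    replace ((INR n + 1 + 1) * (wallis (S n) * wallis (S (S n))))
      with (wallis (S n) * ((INR n + 2) * wallis (S (S n)))) by ring.
    rewrite <- H, <- IHn. ring.
Qed.

Lemma wallis_nonneg n : 0 <= wallis n.
Proof.
  pose proof PI_RGT_0. apply RInt_ge_0; [lra | apply ex_RInt_sin_pow|].
  intros x Hx. apply pow_le. left. apply sin_gt_0; lra.
Qed.

(* [C (2 m + 1, m) / 2 ^ (2 m + 1)] *)
Definition kappa (m : nat) : R :=
  INR (fact (2 * m + 1)) / (INR (fact m) * INR (fact (S m)) * 2 ^ (2 * m + 1)).

Lemma kappa_wallis m : wallis (2 * m + 2) = PI / 2 * kappa m.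
Proof.
  induction m.
  - pose proof (wallis_rec 0) as H. rewrite wallis_0 in H. simpl INR in H.
    unfold kappa. simpl. lra.
  - pose proof (wallis_rec (2 * m + 2)) as H. rewrite IHm in H.
    replace (2 * S m + 2)%nat with (S (S (2 * m + 2))) by lia.
    assert (E : kappa (S m) * (INR (2 * m + 2) + 2) = kappa m * (INR (2 * m + 2) + 1)).
    { unfold kappa. replace (2 * S m + 1)%nat with (S (S (2 * m + 1))) by lia.
      rewrite !fact_simpl, !mult_INR. 
      replace (INR (S (S (2 * m + 1)))) with (2 * INR m + 3)
        by (rewrite !S_INR, plus_INR, mult_INR; simpl; ring).
      replace (INR (S (2 * m + 1))) with (2 * INR m + 2)
        by (rewrite !S_INR, plus_INR, mult_INR; simpl; ring).
      rewrite (plus_INR (2 * m) 2), (mult_INR 2 m), !S_INR. simpl (INR 2). simpl (INR 0).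
      pose proof (pos_INR m). pose proof (INR_fact_pos m). pose proof (INR_fact_pos (2 * m + 1)).
      assert (0 < 2 ^ (2 * m + 1)) by (apply pow_lt; lra).
      change (2 ^ S (S (2 * m + 1))) with (2 * (2 * 2 ^ (2 * m + 1))). field. repeat split; lra. }
    assert (Hp : 0 < INR (2 * m + 2) + 2) by (pose proof (pos_INR (2 * m + 2)); lra).
    apply (Rmult_eq_reg_l (INR (2 * m + 2) + 2)); [|lra].
    rewrite <- H. replace ((INR (2 * m + 2) + 2) * (PI / 2 * kappa (S m)))
      with (PI / 2 * (kappa (S m) * (INR (2 * m + 2) + 2))) by ring.
    rewrite E. ring.
Qed.

Lemma kappa_pos m : 0 < kappa m.
Proof.
  unfold kappa. apply Rdiv_lt_0_compat; [apply INR_fact_pos|].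
  apply Rmult_lt_0_compat; [apply Rmult_lt_0_compat; apply INR_fact_pos | apply pow_lt; lra].
Qed.

(** The square of the integral of index 2m + 2 is compared with its product by the larger preceding
    one. The lower bound below uses the following one instead. *)
Lemma kappa_sq_upper m : kappa m ^ 2 * (PI * (INR m + 1)) <= 1.
Proof.
  pose proof (wallis_prod (2 * m + 1)) as H. pose proof (wallis_decr (2 * m + 1)) as Hd.
  replace (S (2 * m + 1)) with (2 * m + 2)%nat in * by lia.
  pose proof (wallis_nonneg (2 * m + 2)) as Hn. rewrite kappa_wallis in *.
  rewrite plus_INR, mult_INR in H. simpl (INR 2) in H. simpl (INR 1) in H.
  pose proof PI_RGT_0. pose proof (pos_INR m).
  assert (E : (2 * INR m + 2) * (PI / 2 * kappa m * (PI / 2 * kappa m)) <= PI / 2).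
  { set (k := PI / 2 * kappa m) in *.
    apply Rle_trans with ((2 * INR m + 2) * (wallis (2 * m + 1) * k)); [|lra].
    apply Rmult_le_compat_l; [lra|]. apply Rmult_le_compat_r; auto. }
  apply (Rmult_le_reg_l (PI / 2)); [lra|].
  replace (PI / 2 * (kappa m ^ 2 * (PI * (INR m + 1))))
    with ((2 * INR m + 2) * (PI / 2 * kappa m * (PI / 2 * kappa m))) by field. lra.
Qed.

Lemma kappa_sq_lower m : 1 <= kappa m ^ 2 * (PI * (INR m + 3 / 2)).
Proof.
  pose proof (wallis_prod (2 * m + 2)) as H. pose proof (wallis_decr (2 * m + 2)) as Hd.
  pose proof (wallis_nonneg (2 * m + 2)) as Hn. rewrite kappa_wallis in *.
  rewrite plus_INR, mult_INR in H. simpl (INR 2) in H.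
  pose proof PI_RGT_0. pose proof (pos_INR m).
  assert (E : PI / 2 <= (2 * INR m + 3) * (PI / 2 * kappa m * (PI / 2 * kappa m))).
  { set (k := PI / 2 * kappa m) in *.
    apply Rle_trans with ((2 * INR m + 3) * (k * wallis (S (2 * m + 2)))); [lra|].
    apply Rmult_le_compat_l; [lra|]. apply Rmult_le_compat_l; auto. }
  apply (Rmult_le_reg_l (PI / 2)); [lra|].
  replace (PI / 2 * (kappa m ^ 2 * (PI * (INR m + 3 / 2))))
    with ((2 * INR m + 3) * (PI / 2 * kappa m * (PI / 2 * kappa m))) by field. lra.
Qed.

(* Both bounds are tangent lines at [x]: of [u -> u ^ (-1/2)] below, of the square root above. *)
Lemma kappa_bounds m x : 0 < x ->
  sqrt (2 / (PI * x)) * (3 / 2 - (2 * INR m + 3) / (2 * x)) <= kappa m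
  /\ kappa m <= sqrt (2 / (PI * x)) * (/ 2 * (x / (2 * INR m + 2) + 1)).
Proof.
  intros Hx. pose proof PI_RGT_0 as HP. pose proof (pos_INR m) as Hm.
  pose proof (kappa_pos m) as Hk. pose proof (kappa_sq_lower m) as L. pose proof (kappa_sq_upper m) as U.
  assert (Hpx : 0 < PI * x) by now apply Rmult_lt_0_compat.
  assert (H2 : 0 < 2 / (PI * x)) by (apply Rdiv_lt_0_compat; lra).
  pose proof (sqrt_lt_R0 _ H2) as Hs. set (s := sqrt (2 / (PI * x))) in *.
  assert (Es : s * s * (PI * x) = 2).
  { unfold s. rewrite sqrt_sqrt by lra. field. lra. }
  set (u := kappa m / s). assert (Hu : 0 < u) by (apply Rdiv_lt_0_compat; lra).
  assert (Eu : kappa m = s * u) by (unfold u; field; lra).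
  rewrite Eu in *. clear Hk.
  split; apply Rmult_le_compat_l; try lra.
  - set (r := (2 * INR m + 3) / (2 * x)).
    assert (Hr : 0 < r) by (apply Rdiv_lt_0_compat; lra).
    assert (Hur : 1 <= u * u * (2 * r)).
    { assert (E : (s * u) ^ 2 * (PI * (INR m + 3 / 2)) = (s * s * (PI * x)) * (u * u * r))
        by (unfold r; field; lra).
      rewrite E, Es in L. lra. }
    apply Rnot_lt_le. intros Hlt.
    assert (u * u < (3 / 2 - r) * (3 / 2 - r)) by nra.
    assert (0 <= (1 - 2 * r) * (1 - 2 * r) * (2 - r)).
    { apply Rmult_le_pos; [apply Rle_0_sqr | lra]. }
    nra.
  - set (v := x / (2 * INR m + 2)).
    assert (Huv : u * u <= v).
    { assert (E : (s * u) ^ 2 * (PI * (INR m + 1)) = (s * s * (PI * x)) * (u * u / (2 * v)))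
        by (unfold v; field; lra).
      assert (Hv : 0 < v) by (apply Rdiv_lt_0_compat; lra).
      rewrite E, Es in U. replace (2 * (u * u / (2 * v))) with (u * u / v) in U by (field; lra).
      apply Rle_div_l in U; lra. }
    pose proof (Rle_0_sqr (u - 1)) as Hsq. unfold Rsqr in Hsq. lra.
Qed.

Definition besselI1 (x : R) : R :=
  Series (fun m => (x / 2) ^ (2 * m + 1) / (INR (fact m) * INR (fact (S m)))).

(** This exhibits [I_1] as the series of sinh with weights [kappa m]. The terms concentrate near 2m
    = x, where the weight is close to sqrt(2/(pi x)). *)
Lemma besselI1_term x m :
  (x / 2) ^ (2 * m + 1) / (INR (fact m) * INR (fact (S m)))
  = x ^ (2 * m + 1) / INR (fact (2 * m + 1)) * kappa m.
Proof.
  unfold kappa.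
  assert (E : (x / 2) ^ (2 * m + 1) = x ^ (2 * m + 1) / 2 ^ (2 * m + 1))
    by (unfold Rdiv; now rewrite Rpow_mult_distr, pow_inv).
  rewrite E.
  pose proof (INR_fact_pos m). pose proof (INR_fact_pos (S m)). pose proof (INR_fact_pos (2 * m + 1)).
  assert (0 < 2 ^ (2 * m + 1)) by (apply pow_lt; lra). field. repeat split; lra.
Qed.

Lemma ex_series_exp_even x : 0 <= x -> ex_series (fun m => x ^ (2 * m) / INR (fact (2 * m))).
Proof.
  intros Hx. set (T := fun k => x ^ k / INR (fact k)).
  assert (Tp : forall k, 0 <= T k).
  { intros k. apply Rmult_le_pos; [now apply pow_le|]. left; apply Rinv_0_lt_compat, INR_fact_pos. }
  apply ex_series_bounded with (exp x); [intros; apply Tp|].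
  intros n. rewrite <- Series_exp.
  eapply Rle_trans; [|apply (rsum_le_Series T (2 * n) Tp), ex_series_exp].
  rewrite rsum_even_odd.
  assert (0 <= rsum (fun j => T (2 * j + 1)%nat) n).
  2:{ change (rsum (fun j => T (2 * j)%nat) n <= rsum (fun j => T (2 * j)%nat) n + rsum (fun j => T (2 * j + 1)%nat) n). lra. }
  replace 0 with (rsum (fun _ => 0) n) by (rewrite rsum_const; ring). apply rsum_le; auto.
Qed.

Lemma ex_series_exp_odd x : 0 <= x -> ex_series (fun m => x ^ (2 * m + 1) / INR (fact (2 * m + 1))).
Proof.
  intros Hx. set (T := fun k => x ^ k / INR (fact k)).
  assert (Tp : forall k, 0 <= T k).
  { intros k. apply Rmult_le_pos; [now apply pow_le|]. left; apply Rinv_0_lt_compat, INR_fact_pos. }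
  apply ex_series_bounded with (exp x); [intros; apply Tp|].
  intros n. rewrite <- Series_exp.
  eapply Rle_trans; [|apply (rsum_le_Series T (2 * n) Tp), ex_series_exp].
  rewrite rsum_even_odd.
  assert (0 <= rsum (fun j => T (2 * j)%nat) n).
  2:{ change (rsum (fun j => T (2 * j + 1)%nat) n <= rsum (fun j => T (2 * j)%nat) n + rsum (fun j => T (2 * j + 1)%nat) n). lra. }
  replace 0 with (rsum (fun _ => 0) n) by (rewrite rsum_const; ring). apply rsum_le; auto.
Qed.

Lemma exp_even_odd x : 0 <= x ->
  Series (fun m => x ^ (2 * m) / INR (fact (2 * m))) = (exp x + exp (- x)) / 2
  /\ Series (fun m => x ^ (2 * m + 1) / INR (fact (2 * m + 1))) = (exp x - exp (- x)) / 2.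
Proof.
  intros Hx. set (E := Series (fun m => x ^ (2 * m) / INR (fact (2 * m)))).
  set (O := Series (fun m => x ^ (2 * m + 1) / INR (fact (2 * m + 1)))).
  pose proof (is_lim_rsum _ (ex_series_exp_even x Hx)) as LE. fold E in LE.
  pose proof (is_lim_rsum _ (ex_series_exp_odd x Hx)) as LO. fold O in LO.
  assert (H : forall z (sg : R), (forall m, z ^ (2 * m) = x ^ (2 * m)) ->
     (forall m, z ^ (2 * m + 1) = sg * x ^ (2 * m + 1)) -> exp z = E + sg * O).
  { intros z sg H1 H2. pose proof (is_lim_rsum _ (ex_series_exp z)) as Lz. rewrite Series_exp in Lz.
    apply (is_lim_seq_subseq _ _ (fun n => (2 * n)%nat)) in Lz.
    2:{ apply eventually_subseq. intros; lia. }
    assert (L : is_lim_seq (fun n => rsum (fun m => x ^ (2 * m) / INR (fact (2 * m))) n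
       + sg * rsum (fun m => x ^ (2 * m + 1) / INR (fact (2 * m + 1))) n) (E + sg * O)).
    { apply is_lim_seq_plus'; auto. apply is_lim_seq_mult'; auto. apply is_lim_seq_const. }
    apply is_lim_seq_unique in L. apply is_lim_seq_unique in Lz.
    rewrite (Lim_seq_ext _ (fun n => rsum (fun k => z ^ k / INR (fact k)) (2 * n))) in L.
    - rewrite Lz in L. now injection L.
    - intros n. rewrite rsum_even_odd, <- rsum_scal. f_equal.
      + apply rsum_ext. intros k _. now rewrite H1.
      + apply rsum_ext. intros k _. rewrite H2. unfold Rdiv. ring. }
  assert (H1 : exp x = E + 1 * O) by (apply H; intros; ring).
  assert (H2 : exp (- x) = E + -1 * O).
  { assert (He : forall m, (- x) ^ (2 * m) = x ^ (2 * m)).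
    { intros m. rewrite !pow_mult. f_equal. ring. }
    apply H; auto. intros m. rewrite !pow_add, He. ring. }
  lra.
Qed.

Definition bessel_f (x : R) : R := sqrt (2 * PI * x) * exp (- x) * besselI1 x.

Lemma ex_besselI1 x : 0 <= x ->
  ex_series (fun m => (x / 2) ^ (2 * m + 1) / (INR (fact m) * INR (fact (S m)))).
Proof.
  intros Hx. apply ex_series_pos_le with (2 := ex_series_exp_odd (x / 2 * 2) ltac:(lra)).
  intros m. replace (x / 2 * 2) with x by field. rewrite besselI1_term.
  assert (0 <= x ^ (2 * m + 1) / INR (fact (2 * m + 1))).
  { apply Rmult_le_pos; [now apply pow_le|]. left; apply Rinv_0_lt_compat, INR_fact_pos. }
  pose proof (kappa_pos m).
  assert (kappa m <= 1).
  { pose proof (kappa_sq_upper m) as U. pose proof (pos_INR m). pose proof PI_bounds.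
    apply Rnot_lt_le. intros Hlt. assert (1 < kappa m ^ 2) by nra. 
    assert (1 <= PI * (INR m + 1)) by nra. nra. }
  split; [apply Rmult_le_pos; lra|]. rewrite <- (Rmult_1_r (_ / _)) at 2.
  apply Rmult_le_compat_l; lra.
Qed.

(** The tangent bounds of [kappa m] are affine in m and in 1/(m + 1), and against the terms of sinh
    these factors shift the index, so both bounds sum to combinations of sinh and cosh. The result
    fixes the limit 1 at infinity and a crude value at 4, the boundary data of the comparison
    below. *)
Theorem bessel_f_bounds x : 0 < x -> 1 - 2 / x <= bessel_f x <= 1.
Proof.
  intros Hx. pose proof PI_RGT_0 as HP.
  assert (Hpx : 0 < PI * x) by now apply Rmult_lt_0_compat.
  assert (H2 : 0 < 2 / (PI * x)) by (apply Rdiv_lt_0_compat; lra).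
  pose proof (sqrt_lt_R0 _ H2) as Hs. set (s := sqrt (2 / (PI * x))) in *.
  assert (Es : sqrt (2 * PI * x) * s = 2).
  { unfold s. rewrite <- sqrt_mult by lra.
    replace (2 * PI * x * (2 / (PI * x))) with (2 * 2) by (field; lra). apply sqrt_square; lra. }
  pose proof (ex_series_exp_odd x ltac:(lra)) as Xo. pose proof (ex_series_exp_even x ltac:(lra)) as Xe.
  destruct (exp_even_odd x ltac:(lra)) as [Ee Eo].
  set (To := fun m => x ^ (2 * m + 1) / INR (fact (2 * m + 1))) in *.
  set (Te := fun m => x ^ (2 * m) / INR (fact (2 * m))) in *.
  assert (Top : forall m, 0 <= To m).
  { intros m. apply Rmult_le_pos; [apply pow_le; lra|]. left; apply Rinv_0_lt_compat, INR_fact_pos. }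
  assert (EI : besselI1 x = Series (fun m => To m * kappa m)).
  { apply Series_ext. intros m. apply besselI1_term. }
  assert (Exk : ex_series (fun m => To m * kappa m)).
  { eapply ex_series_ext; [|apply (ex_besselI1 x); lra]. intros m. apply besselI1_term. }
  assert (E1 : forall m, To m * (2 * INR m + 1) = x * Te m).
  { intros m. unfold To, Te. rewrite Nat.add_1_r, fact_simpl, mult_INR.
    replace (INR (S (2 * m))) with (2 * INR m + 1) by (rewrite S_INR, mult_INR; simpl; ring).
    change (x ^ S (2 * m)) with (x * x ^ (2 * m)). pose proof (pos_INR m). pose proof (INR_fact_pos (2 * m)).
    field. split; lra. }
  assert (E3 : forall m, To m * (x / (2 * INR m + 2)) = Te (S m)).
  { intros m. unfold To, Te. replace (2 * S m)%nat with (S (2 * m + 1)) by lia.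
    rewrite fact_simpl, mult_INR.
    replace (INR (S (2 * m + 1))) with (2 * INR m + 2) by (rewrite S_INR, plus_INR, mult_INR; simpl; ring).
    change (x ^ S (2 * m + 1)) with (x * x ^ (2 * m + 1)). pose proof (pos_INR m). pose proof (INR_fact_pos (2 * m + 1)).
    field. split; lra. }
  assert (Te0 : Te 0%nat = 1) by (unfold Te; simpl; field).
  pose proof (exp_pos x) as Hex. pose proof (exp_pos (- x)) as Hexm.
  assert (Hxx : exp (- x) * exp x = 1) by (rewrite <- exp_plus, <- exp_0; f_equal; ring).
  assert (Hpre : 0 <= sqrt (2 * PI * x) * exp (- x)).
  { apply Rmult_le_pos; [apply sqrt_pos | lra]. }
  unfold bessel_f. split.
  - assert (L : s * ((3 / 2 - / x) * ((exp x - exp (- x)) / 2) - / 2 * ((exp x + exp (- x)) / 2))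
       <= besselI1 x).
    { rewrite EI.
      assert (E : forall m, To m * (s * (3 / 2 - (2 * INR m + 3) / (2 * x)))
        = s * (3 / 2 - / x) * To m - s * / 2 * Te m).
      { intros m. specialize (E1 m).
        replace (To m * (s * (3 / 2 - (2 * INR m + 3) / (2 * x)))) with
          (s * (3 / 2 - / x) * To m - s * / (2 * x) * (To m * (2 * INR m + 1))) by (field; lra).
        rewrite E1. field. lra. }
      assert (ExR : ex_series (fun m => s * (3 / 2 - / x) * To m - s * / 2 * Te m)).
      { apply (ex_series_minus (V := R_NormedModule) (fun m => s * (3 / 2 - / x) * To m)
          (fun m => s * / 2 * Te m)).
        - exact (ex_series_scal_l (s * (3 / 2 - / x)) _ Xo).
        - exact (ex_series_scal_l (s * / 2) _ Xe). }
      apply Rle_trans with (Series (fun m => s * (3 / 2 - / x) * To m - s * / 2 * Te m)).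
      - rewrite Series_minus, !Series_scal_l.
        + change (Series (fun n => To n)) with (Series To). change (Series (fun n => Te n)) with (Series Te).
          rewrite Ee, Eo. lra.
        + exact (ex_series_scal_l (s * (3 / 2 - / x)) _ Xo).
        + exact (ex_series_scal_l (s * / 2) _ Xe).
      - apply Rminus_le_0. rewrite <- Series_minus by auto. apply Series_nonneg.
        + intros m. rewrite <- E. 
          pose proof (proj1 (kappa_bounds m x Hx)) as Hk. fold s in Hk.
          pose proof (Rmult_le_compat_l _ _ _ (Top m) Hk). lra.
        + apply (ex_series_minus (V := R_NormedModule) (fun m => To m * kappa m)); auto. }
    apply Rmult_le_compat_l with (1 := Hpre) in L.
    apply Rle_trans with (2 := L).
    replace (sqrt (2 * PI * x) * exp (- x) *
      (s * ((3 / 2 - / x) * ((exp x - exp (- x)) / 2) - / 2 * ((exp x + exp (- x)) / 2))))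
      with ((sqrt (2 * PI * x) * s) * ((3 / 2 - / x) * ((exp (- x) * exp x - exp (- x) * exp (- x)) / 2)
        - / 2 * ((exp (- x) * exp x + exp (- x) * exp (- x)) / 2))) by (field; lra).
    rewrite Es, Hxx.
    set (w := exp (- x) * exp (- x)).
    assert (Hw : 0 < w) by now apply Rmult_lt_0_compat.
    assert (Hwx : w * (2 * x) <= 1).
    { unfold w. rewrite <- exp_plus. replace (- x + - x) with (- (2 * x)) by ring.
      pose proof (exp_ineq1_le (2 * x)). pose proof (exp_pos (- (2 * x))).
      assert (Ei : exp (- (2 * x)) * exp (2 * x) = 1) by (rewrite <- exp_plus, <- exp_0; f_equal; ring).
      nra. }
    assert (Hix : 0 < / x) by now apply Rinv_0_lt_compat.
    assert (Hw2 : 2 * w <= / x).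
    { apply (Rmult_le_reg_r x); auto. rewrite Rinv_l by lra. lra. }
    unfold Rdiv. assert (0 <= / x * w) by (apply Rmult_le_pos; lra). lra.
  - assert (U : besselI1 x <= s * (/ 2 * exp x)).
    { rewrite EI.
      assert (ExT : ex_series (fun m => Te (S m))) by now apply (ex_series_incr_1 Te) in Xe.
      assert (E : forall m, To m * (s * (/ 2 * (x / (2 * INR m + 2) + 1)))
        = s * / 2 * (Te (S m) + To m)).
      { intros m. rewrite <- E3. ring. }
      assert (ExS : ex_series (fun m => Te (S m) + To m)) by exact (ex_series_plus _ _ ExT Xo).
      apply Rle_trans with (Series (fun m => s * / 2 * (Te (S m) + To m))).
      - apply Series_le; [|exact (ex_series_scal_l (s * / 2) _ ExS)].
        intros m. pose proof (kappa_pos m). split; [apply Rmult_le_pos; auto; lra|].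
        rewrite <- E. apply Rmult_le_compat_l; auto.
        pose proof (proj2 (kappa_bounds m x Hx)) as Hk. exact Hk.
      - rewrite Series_scal_l, Series_plus by auto.
        pose proof (Series_incr_1 Te Xe) as Ei. rewrite Te0 in Ei.
        rewrite Ee in Ei. change (Series (fun n => To n)) with (Series To). rewrite Eo.
        rewrite Rmult_assoc. apply Rmult_le_compat_l; [lra|]. apply Rmult_le_compat_l; [lra|]. lra. }
    apply Rmult_le_compat_l with (1 := Hpre) in U.
    apply Rle_trans with (1 := U). right.
    replace (sqrt (2 * PI * x) * exp (- x) * (s * (/ 2 * exp x)))
      with ((sqrt (2 * PI * x) * s) * (exp (- x) * exp x) * / 2) by ring.
    rewrite Es, Hxx. field.
Qed.

(** * Asymptotic expansion of [I_1] *)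

Ltac eq_in_R := match goal with |- ?a = ?b => change (@eq R a b) end.

(* The operator annihilates [sqrt x * exp (- x) * I_1 x]; its zeroth order coefficient is
   negative, so a strict supersolution has no negative interior minimum. *)
Lemma max_principle (u u1 u2 : R -> R) X0 : 0 < X0 ->
  (forall x, X0 <= x -> is_derive u x (u1 x)) ->
  (forall x, X0 <= x -> is_derive u1 x (u2 x)) ->
  (forall x, X0 <= x -> u2 x + 2 * u1 x - 3 / (4 * x ^ 2) * u x < 0) ->
  0 < u X0 ->
  (forall eps, 0 < eps -> exists B, forall x, B <= x -> - eps < u x) ->
  forall x, X0 <= x -> 0 <= u x.
Proof.
  intros HX D1 D2 HL H0 Hlim x1 Hx1. apply Rnot_lt_le. intros Hneg.
  (* Beyond [B] the function exceeds half the negative value at [x1], and at [X0] it is positive; so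
     the minimum over [X0, M] is attained inside. *)
  destruct (Hlim (- u x1 / 2) ltac:(lra)) as [B HB].
  set (M := Rmax B x1 + 1).
  assert (HMB : B <= M /\ x1 < M) by (unfold M; pose proof (Rmax_l B x1); pose proof (Rmax_r B x1); lra).
  assert (HuM : u x1 / 2 < u M) by (specialize (HB M ltac:(lra)); lra).
  destruct (continuity_ab_min u X0 M) as [x2 [Hmin [Ha Hb]]]; [lra| |].
  { intros c Hc. apply derivable_continuous_pt. exists (u1 c). apply is_derive_Reals, D1. lra. }
  assert (Hx2 : u x2 <= u x1) by (apply Hmin; lra).
  assert (Hne1 : x2 <> X0) by (intros E; rewrite E in Hx2; lra).
  assert (Hne2 : x2 <> M) by (intros E; rewrite E in Hx2; lra).
  assert (U1 : u1 x2 = 0).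
  { assert (Hd : derivable_pt_lim u x2 (u1 x2)) by (apply is_derive_Reals, D1; lra).
    pose proof (deriv_minimum u X0 M x2 (exist _ (u1 x2) Hd) ltac:(lra) ltac:(lra)) as Hz.
    simpl in Hz. apply Hz. intros x Hxa Hxb. apply Hmin. lra. }
  assert (U2 : u2 x2 < 0).
  { specialize (HL x2 ltac:(lra)). rewrite U1 in HL.
    assert (0 < 3 / (4 * x2 ^ 2)).
    { apply Rdiv_lt_0_compat; [lra|]. assert (0 < x2 ^ 2) by (apply pow_lt; lra). lra. }
    nra. }
  assert (Hd2 : derivable_pt_lim u1 x2 (u2 x2)) by (apply is_derive_Reals, D2; lra).
  destruct (Hd2 (- u2 x2) ltac:(lra)) as [del Hdel].
  (* As u1 vanishes and u2 is negative at the minimum, u1 is negative just to its right; then u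
     strictly decreases there, against minimality. *)
  set (h := Rmin (del / 2) ((M - x2) / 2)).
  assert (Hh : 0 < h /\ h <= del / 2 /\ h <= (M - x2) / 2).
  { pose proof (cond_pos del). split; [apply Rmin_glb_lt; lra|].
    split; [apply Rmin_l | apply Rmin_r]. }
  assert (Hneg1 : forall k, 0 < k <= h -> u1 (x2 + k) < 0).
  { intros k Hk. pose proof (cond_pos del).
    specialize (Hdel k ltac:(lra) ltac:(rewrite Rabs_pos_eq; lra)).
    rewrite U1, Rminus_0_r in Hdel. apply Rabs_def2 in Hdel.
    assert (Hq : u1 (x2 + k) / k < 0) by lra.
    apply (Rmult_lt_compat_r k) in Hq; [|lra].
    replace (u1 (x2 + k) / k * k) with (u1 (x2 + k)) in Hq by (field; lra). lra. }
  destruct (MVT_gen u x2 (x2 + h) u1) as [z [Hz Ez]].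
  - intros y Hy. rewrite Rmin_left in Hy by lra. apply D1. lra.
  - intros y Hy. rewrite Rmin_left in Hy by lra.
    apply derivable_continuous_pt. exists (u1 y). apply is_derive_Reals, D1. lra.
  - rewrite Rmin_left, Rmax_right in Hz by lra.
    assert (Hle : u x2 <= u (x2 + h)) by (apply Hmin; lra).
    assert (Hz0 : u1 z <= 0).
    { destruct (Req_dec z x2) as [->|Hzn]; [lra|].
      replace z with (x2 + (z - x2)) by ring. left. apply Hneg1. lra. }
    assert (Hmid : u (x2 + h) - u (x2 + h / 2) < 0).
    { destruct (MVT_gen u (x2 + h / 2) (x2 + h) u1) as [w [Hw Ew]].
      - intros y Hy. rewrite Rmin_left in Hy by lra. apply D1. lra.
      - intros y Hy. rewrite Rmin_left in Hy by lra.
        apply derivable_continuous_pt. exists (u1 y). apply is_derive_Reals, D1. lra.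
      - rewrite Rmin_left, Rmax_right in Hw by lra.
        pose proof (Hneg1 (w - x2) ltac:(lra)) as Hw1.
        replace (x2 + (w - x2)) with w in Hw1 by ring. rewrite Ew.
        replace (x2 + h - (x2 + h / 2)) with (h / 2) by field. nra. }
    destruct (MVT_gen u x2 (x2 + h / 2) u1) as [w [Hw Ew]].
    + intros y Hy. rewrite Rmin_left in Hy by lra. apply D1. lra.
    + intros y Hy. rewrite Rmin_left in Hy by lra.
      apply derivable_continuous_pt. exists (u1 y). apply is_derive_Reals, D1. lra.
    + rewrite Rmin_left, Rmax_right in Hw by lra.
      assert (Hw0 : u1 w <= 0).
      { destruct (Req_dec w x2) as [->|Hwn]; [lra|].
        replace w with (x2 + (w - x2)) by ring. left. apply Hneg1. lra. }
      replace (x2 + h / 2 - x2) with (h / 2) in Ew by ring.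
      assert (u1 w * (h / 2) <= 0) by nra. lra.
Qed.

(** I_1(x) = (x/2) h(x^2/4) with an entire h having these coefficients. In the variable z = x^2/4
    Bessel's equation becomes z h'' + 2 h' = h, which is just the recursion of the coefficients. *)
Definition hcoef (m : nat) : R := / (INR (fact m) * INR (fact (S m))).

Lemma hcoef_S m : hcoef m = (INR m + 1) * (INR m + 2) * hcoef (S m).
Proof.
  unfold hcoef. rewrite (fact_simpl (S m)), (fact_simpl m), !mult_INR, !S_INR.
  pose proof (INR_fact_pos m). pose proof (pos_INR m). field. repeat split; lra.
Qed.

Lemma hcoef_pos m : 0 < hcoef m.
Proof. apply Rinv_0_lt_compat, Rmult_lt_0_compat; apply INR_fact_pos. Qed.

Lemma CV_hcoef : CV_radius hcoef = p_infty.
Proof.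
  apply CV_radius_infinite_DAlembert.
  - intros n. apply Rgt_not_eq, hcoef_pos.
  - apply is_lim_seq_le_le with (fun _ => 0) (fun n => 1 / INR (S n)).
    + intros n. pose proof (hcoef_pos (S n)). pose proof (hcoef_S n) as E. pose proof (pos_INR n).
      rewrite Rabs_pos_eq by (left; apply Rdiv_lt_0_compat; apply hcoef_pos).
      split; [left; apply Rdiv_lt_0_compat; apply hcoef_pos|].
      rewrite E, S_INR.
      replace (hcoef (S n) / ((INR n + 1) * (INR n + 2) * hcoef (S n)))
        with (1 / (INR n + 1) * / (INR n + 2)) by (field; lra).
      assert (0 < 1 / (INR n + 1)) by (apply Rdiv_lt_0_compat; lra).
      assert (/ (INR n + 2) <= 1) by (rewrite <- Rinv_1; apply Rinv_le_contravar; lra).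
      nra.
    + apply is_lim_seq_const.
    + apply is_lim_inv_INR.
Qed.

Definition h0 : R -> R := PSeries hcoef.
Definition h1 : R -> R := PSeries (PS_derive hcoef).
Definition h2 : R -> R := PSeries (PS_derive (PS_derive hcoef)).

Lemma is_derive_h0 z : is_derive h0 z (h1 z).
Proof. apply is_derive_PSeries. rewrite CV_hcoef. exact I. Qed.

Lemma is_derive_h1 z : is_derive h1 z (h2 z).
Proof. apply is_derive_PSeries. rewrite CV_radius_derive, CV_hcoef. exact I. Qed.

Lemma h_ode z : z * h2 z + 2 * h1 z = h0 z.
Proof.
  unfold h0, h1, h2.
  assert (E1 : ex_pseries (PS_derive hcoef) z).
  { apply CV_radius_inside. rewrite CV_radius_derive, CV_hcoef. exact I. }
  assert (E2 : ex_pseries (PS_derive (PS_derive hcoef)) z).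
  { apply CV_radius_inside. rewrite !CV_radius_derive, CV_hcoef. exact I. }
  rewrite <- PSeries_incr_1, <- PSeries_scal, <- PSeries_plus.
  - apply PSeries_ext. intros [|n].
    + change (0 + 2 * (INR 1 * hcoef 1) = hcoef 0). rewrite (hcoef_S 0).
      simpl INR. ring.
    + change (INR (S n) * (INR (S (S n)) * hcoef (S (S n))) + 2 * (INR (S (S n)) * hcoef (S (S n)))
        = hcoef (S n)).
      rewrite (hcoef_S (S n)), (S_INR (S n)). ring.
  - apply ex_pseries_incr_1. exact E2.
  - apply ex_pseries_scal; [apply Rmult_comm | exact E1].
Qed.

Lemma besselI1_h0 x : besselI1 x = x / 2 * h0 (x ^ 2 / 4).
Proof.
  unfold besselI1, h0, PSeries. rewrite <- Series_scal_l. apply Series_ext. intros m.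
  unfold hcoef. rewrite pow_add, pow_mult, pow_1.
  replace ((x / 2) ^ 2) with (x ^ 2 / 4) by field.
  pose proof (INR_fact_pos m). pose proof (INR_fact_pos (S m)).
  generalize ((x ^ 2 / 4) ^ m). intros w. field. split; lra.
Qed.

Definition Sx (x : R) : R := sqrt (2 * PI * x) * exp (- x).

Lemma is_derive_Sx x : 0 < x -> is_derive Sx x (Sx x * (/ (2 * x) - 1)).
Proof.
  intros Hx. pose proof PI_RGT_0. assert (H2 : 0 < 2 * PI * x) by (apply Rmult_lt_0_compat; lra).
  unfold Sx. auto_derive; [lra|].
  pose proof (sqrt_lt_R0 _ H2) as Hs. pose proof (sqrt_sqrt (2 * PI * x) ltac:(lra)) as Es.
  set (s := sqrt (2 * PI * x)) in *.
  field_simplify; try (split; lra); try lra.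
  replace PI with (s * s / (2 * x)) by (rewrite Es; field; lra). field. split; lra.
Qed.

Definition H0 (x : R) : R := h0 (x ^ 2 / 4).
Definition H1 (x : R) : R := h1 (x ^ 2 / 4).
Definition H2 (x : R) : R := h2 (x ^ 2 / 4).

Lemma is_derive_sq4 x : is_derive (fun x => x ^ 2 / 4) x (x / 2).
Proof. auto_derive; auto. field. Qed.

Lemma is_derive_H0 x : is_derive H0 x (x / 2 * H1 x).
Proof. apply (is_derive_comp h0 (fun x => x ^ 2 / 4) x _ _ (is_derive_h0 _) (is_derive_sq4 x)). Qed.

Lemma is_derive_H1 x : is_derive H1 x (x / 2 * H2 x).
Proof. apply (is_derive_comp h1 (fun x => x ^ 2 / 4) x _ _ (is_derive_h1 _) (is_derive_sq4 x)). Qed.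

Definition bf1 (x : R) : R := Sx x * ((3 / 4 - x / 2) * H0 x + x ^ 2 / 4 * H1 x).
Definition bf2 (x : R) : R :=
  Sx x * ((/ (2 * x) - 1) * ((3 / 4 - x / 2) * H0 x + x ^ 2 / 4 * H1 x)
    + (- / 2 * H0 x + (3 / 4 - x / 2) * (x / 2 * H1 x) + (x / 2 * H1 x + x ^ 2 / 4 * (x / 2 * H2 x)))).

Lemma is_derive_half x : is_derive (fun x => x / 2) x (/ 2).
Proof. auto_derive; auto. field. Qed.

Lemma is_derive_half' x : is_derive (fun x => 3 / 4 - x / 2) x (- / 2).
Proof. auto_derive; auto. field. Qed.

Lemma bf_h0 x : bessel_f x = Sx x * (x / 2 * H0 x).
Proof. unfold bessel_f, Sx, H0. now rewrite besselI1_h0. Qed.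

Lemma is_derive_bf x : 0 < x -> is_derive bessel_f x (bf1 x).
Proof.
  intros Hx. eapply is_derive_eq.
  - apply (is_derive_Rmult Sx (fun x => x / 2 * H0 x)); [now apply is_derive_Sx|].
    apply (is_derive_Rmult (fun x => x / 2) H0); [|apply is_derive_H0].
    apply is_derive_half.
  - intros s. now rewrite bf_h0.
  - unfold bf1. eq_in_R. field. lra.
Qed.

Lemma is_derive_bf1 x : 0 < x -> is_derive bf1 x (bf2 x).
Proof.
  intros Hx. eapply is_derive_eq.
  - apply (is_derive_Rmult Sx (fun x => (3 / 4 - x / 2) * H0 x + x ^ 2 / 4 * H1 x));
      [now apply is_derive_Sx|].
    apply (is_derive_plus (fun x => (3 / 4 - x / 2) * H0 x) (fun x => x ^ 2 / 4 * H1 x)).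
    + apply (is_derive_Rmult (fun x => 3 / 4 - x / 2) H0); [|apply is_derive_H0].
      apply is_derive_half'.
    + apply (is_derive_Rmult (fun x => x ^ 2 / 4) H1); [apply is_derive_sq4 | apply is_derive_H1].
  - reflexivity.
  - unfold bf2, plus; simpl. ring.
Qed.

Lemma bf_ode x : 0 < x -> bf2 x + 2 * bf1 x - 3 / (4 * x ^ 2) * bessel_f x = 0.
Proof.
  intros Hx. unfold bf2, bf1.
  pose proof (bf_h0 x) as E.
  rewrite E. pose proof (h_ode (x ^ 2 / 4)) as O. fold (H0 x) (H1 x) (H2 x) in O.
  replace (x ^ 2 / 4 * (x / 2 * H2 x)) with (x / 2 * (H0 x - 2 * H1 x)) by (rewrite <- O; eq_in_R; field).
  field. lra.
Qed.

(** Hankel's expansion of [bessel_f], truncated after x^(-4). *)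
Definition asy (x : R) : R :=
  1 - 3 / (8 * x) - 15 / (128 * x ^ 2) - 105 / (1024 * x ^ 3) - 4725 / (32768 * x ^ 4).
Definition asy1 (x : R) : R :=
  3 / (8 * x ^ 2) + 15 / (64 * x ^ 3) + 315 / (1024 * x ^ 4) + 4725 / (8192 * x ^ 5).
Definition asy2 (x : R) : R :=
  - 3 / (4 * x ^ 3) - 45 / (64 * x ^ 4) - 315 / (256 * x ^ 5) - 23625 / (8192 * x ^ 6).

Lemma is_derive_asy x : 0 < x -> is_derive asy x (asy1 x).
Proof.
  intros Hx. unfold asy, asy1. auto_derive.
  - repeat split; apply Rgt_not_eq; repeat apply Rmult_lt_0_compat; lra.
  - field. lra.
Qed.

Lemma is_derive_asy1 x : 0 < x -> is_derive asy1 x (asy2 x).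
Proof.
  intros Hx. unfold asy1, asy2. auto_derive.
  - repeat split; apply Rgt_not_eq; repeat apply Rmult_lt_0_compat; lra.
  - field. lra.
Qed.

(** The coefficients are those for which all powers through x^(-5) cancel. The residue is the effect
    of the first omitted term, of coefficient -72765/262144, on which 2 d/dx produces the factor
    -10. *)
Lemma asy_ode x : 0 < x ->
  asy2 x + 2 * asy1 x - 3 / (4 * x ^ 2) * asy x = - (363825 / 131072) / x ^ 6.
Proof. intros Hx. unfold asy, asy1, asy2. field. lra. Qed.

Lemma asy_near_1 x : 4 <= x -> 1 - / x <= asy x <= 1.
Proof.
  intros Hx. unfold asy.
  assert (Hi : 0 < / x <= / 4) by (split; [apply Rinv_0_lt_compat | apply Rinv_le_contravar]; lra).
  replace (3 / (8 * x)) with (3 / 8 * / x) by (field; lra).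
  replace (15 / (128 * x ^ 2)) with (15 / 128 * (/ x * / x)) by (field; lra).
  replace (105 / (1024 * x ^ 3)) with (105 / 1024 * (/ x * (/ x * / x))) by (field; lra).
  replace (4725 / (32768 * x ^ 4)) with (4725 / 32768 * (/ x * (/ x * (/ x * / x)))) by (field; lra).
  set (i := / x) in *.
  assert (0 <= i * i <= i * / 4) by nra.
  assert (0 <= i * (i * i) <= i * / 16) by nra.
  assert (0 <= i * (i * (i * i)) <= i * / 64) by nra.
  lra.
Qed.

(** The barrier has two tasks. For x >= 4 the operator sends 2/x^5 to at most (117/8 - 20)/x^6,
    which outweighs the residue 2.78/x^6 of [asy]. The exponential is itself a supersolution and
    equals 1 at x = 4, where the difference is only known to be at most 1/2. *)
Lemma bessel_asymptotic_one_sided (sg : R) : sg = 1 \/ sg = -1 -> forall x, 4 <= x ->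
  0 <= 2 / x ^ 5 + exp (4 - x) + sg * (bessel_f x - asy x).
Proof.
  intros Hsg.
  apply (max_principle (fun x => 2 / x ^ 5 + exp (4 - x) + sg * (bessel_f x - asy x))
    (fun x => - 10 / x ^ 6 - exp (4 - x) + sg * (bf1 x - asy1 x))
    (fun x => 60 / x ^ 7 + exp (4 - x) + sg * (bf2 x - asy2 x))); [lra| | | | |].
  - intros x Hx. apply (is_derive_plus (fun x => 2 / x ^ 5 + exp (4 - x))
      (fun x => sg * (bessel_f x - asy x))).
    + auto_derive; [repeat split; auto; apply Rgt_not_eq; repeat apply Rmult_lt_0_compat; lra|]. unfold Rminus. field. lra.
    + apply (is_derive_scal (fun x => bessel_f x - asy x)).
      apply (is_derive_minus bessel_f asy); [apply is_derive_bf | apply is_derive_asy]; lra.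
  - intros x Hx. apply (is_derive_plus (fun x => - 10 / x ^ 6 - exp (4 - x))
      (fun x => sg * (bf1 x - asy1 x))).
    + auto_derive; [repeat split; auto; apply Rgt_not_eq; repeat apply Rmult_lt_0_compat; lra|]. unfold Rminus. field. lra.
    + apply (is_derive_scal (fun x => bf1 x - asy1 x)).
      apply (is_derive_minus bf1 asy1); [apply is_derive_bf1 | apply is_derive_asy1]; lra.
  - intros x Hx. pose proof (bf_ode x ltac:(lra)) as O1. pose proof (asy_ode x ltac:(lra)) as O2.
    assert (H6 : 0 < / x ^ 6) by (apply Rinv_0_lt_compat, pow_lt; lra).
    pose proof (exp_pos (4 - x)) as He.
    assert (Hq : 0 < 3 / (4 * x ^ 2)).
    { apply Rdiv_lt_0_compat; [lra|]. assert (0 < x ^ 2) by (apply pow_lt; lra). lra. }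
    assert (Hi : 0 < / x <= / 4) by (split; [apply Rinv_0_lt_compat | apply Rinv_le_contravar]; lra).
    match goal with |- ?z < 0 => replace z with
      (/ x ^ 6 * (117 / 2 * / x - 20) - exp (4 - x) * (1 + 3 / (4 * x ^ 2))
       + sg * ((bf2 x + 2 * bf1 x - 3 / (4 * x ^ 2) * bessel_f x)
               - (asy2 x + 2 * asy1 x - 3 / (4 * x ^ 2) * asy x))) by (field; lra) end.
    rewrite O1, O2.
    assert (Hs : sg * (0 - - (363825 / 131072) / x ^ 6) <= / x ^ 6 * (363825 / 131072)).
    { replace (0 - - (363825 / 131072) / x ^ 6) with (/ x ^ 6 * (363825 / 131072)) by (field; lra).
      destruct Hsg; subst; nra. }
    assert (0 < exp (4 - x) * (1 + 3 / (4 * x ^ 2))) by (apply Rmult_lt_0_compat; lra).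
    assert (/ x ^ 6 * (117 / 2 * / x - 20) <= / x ^ 6 * (117 / 8 - 20))
      by (apply Rmult_le_compat_l; lra).
    lra.
  - pose proof (bessel_f_bounds 4 ltac:(lra)) as B. pose proof (asy_near_1 4 ltac:(lra)) as A.
    replace (4 - 4) with 0 by ring. rewrite exp_0. destruct Hsg; subst; lra.
  - intros eps He. exists (4 + 2 / eps). intros x Hx.
    assert (Hd : 0 < 2 / eps) by (apply Rdiv_lt_0_compat; lra).
    pose proof (bessel_f_bounds x ltac:(lra)) as B. pose proof (asy_near_1 x ltac:(lra)) as A.
    pose proof (exp_pos (4 - x)). assert (0 < 2 / x ^ 5) by (apply Rdiv_lt_0_compat; [lra | apply pow_lt; lra]).
    assert (Hb : 2 / x < eps).
    { apply Rlt_div_l; [lra|]. apply (Rmult_lt_reg_r (/ eps)); [now apply Rinv_0_lt_compat|].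
      replace (eps * x * / eps) with x by (field; lra). unfold Rdiv in *. lra. }
    assert (0 < / x) by (apply Rinv_0_lt_compat; lra).
    unfold Rdiv in *. destruct Hsg; subst; lra.
Qed.

Theorem bessel_asymptotic x : 4 <= x ->
  Rabs (bessel_f x - asy x) <= 2 / x ^ 5 + exp (4 - x).
Proof.
  intros Hx. pose proof (bessel_asymptotic_one_sided 1 (or_introl eq_refl) x Hx).
  pose proof (bessel_asymptotic_one_sided (-1) (or_intror eq_refl) x Hx).
  apply Rabs_le. lra.
Qed.

(** * The value of [j] at [i] *)

Lemma exp_taylor_ge x n : 0 <= x -> rsum (fun k => x ^ k / INR (fact k)) n <= exp x.
Proof.
  intros H. rewrite <- Series_exp. apply rsum_le_Series; [|apply ex_series_exp].
  intros k. apply Rmult_le_pos; [now apply pow_le|]. left. apply Rinv_0_lt_compat, INR_fact_pos.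
Qed.

Lemma exp_2PI_ge : 500 <= exp (2 * PI).
Proof.
  pose proof PI_bounds as HP.
  apply Rle_trans with (exp 1.57 ^ 4).
  - pose proof (exp_taylor_ge 1.57 6 ltac:(lra)) as H.
    assert (4.75 <= exp 1.57) by (simpl in H; lra).
    apply Rle_trans with (4.75 ^ 4); [lra | apply pow_incr; lra].
  - rewrite exp_pow. apply exp_le. simpl. lra.
Qed.

Lemma exp_INR_le x n : x <= INR n -> exp x <= 3 ^ n.
Proof.
  intros H. apply Rle_trans with (exp 1 ^ n).
  - rewrite exp_pow. apply exp_le. lra.
  - apply pow_incr. pose proof (exp_pos 1). pose proof exp_le_3. lra.
Qed.

(** n^3 <= 3^n dominates the Lambert series by a geometric series of ratio 3q, whose sum is at most
    0.00608. *)
Lemma E4_imag_le t q : 0 < Im t -> nome t = RtoC q -> 0 < q <= / 500 -> Cmod (E4 t) <= 2.46.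
Proof.
  intros Ht Hn Hq. unfold E4.
  assert (Hg : is_series (fun n => (3 * q) * / (1 - q) * (3 * q) ^ n) ((3 * q) * / (1 - q) * / (1 - 3 * q))).
  { apply (is_series_scal_l ((3 * q) * / (1 - q)) (fun n => (3 * q) ^ n)).
    apply is_series_geom. rewrite Rabs_pos_eq; lra. }
  destruct (sigma3_lambert t Ht) as [-> _].
  assert (B : Cmod (CS (lam 3 (nome t))) <= 0.00608).
  { eapply Rle_trans; [apply CS_mod_le with (g := fun n => (3 * q) * / (1 - q) * (3 * q) ^ n)|].
    - intros n. rewrite Hn. unfold lam. pose proof (cube_le_pow3 n) as H3.
      assert (Hp : q ^ S n <= q) by (apply pow_S_le_1; lra).
      assert (Hp0 : 0 < q ^ S n) by (apply pow_lt; lra).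
      replace (RtoC (INR (S n) ^ 3) * (RtoC q ^ S n / (1 - RtoC q ^ S n)))%C
        with (RtoC (INR (S n) ^ 3 * (q ^ S n / (1 - q ^ S n)))).
      2:{ rewrite RtoC_mult, RtoC_div by lra. rewrite RtoC_minus, !(RtoC_pow q). reflexivity. }
      assert (Hd : 0 < q ^ S n / (1 - q ^ S n)) by (apply Rdiv_lt_0_compat; lra).
      rewrite Cmod_RtoC_pos.
      2:{ apply Rmult_le_pos; [apply pow_le, pos_INR | lra]. }
      apply Rle_trans with (3 ^ S n * (q ^ S n / (1 - q ^ S n))).
      + apply Rmult_le_compat_r; lra.
      + replace ((3 * q) * / (1 - q) * (3 * q) ^ n) with (3 ^ S n * (q ^ S n * / (1 - q))).
        * apply Rmult_le_compat_l; [apply pow_le; lra|]. apply Rmult_le_compat_l; [lra|].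
          apply Rinv_le_contravar; lra.
        * rewrite Rpow_mult_distr. simpl. ring.
    - eexists; exact Hg.
    - rewrite (is_series_unique _ _ Hg).
      assert (/ (1 - q) <= 500 / 499).
      { replace (500 / 499) with (/ (499 / 500)) by field. apply Rinv_le_contravar; lra. }
      assert (/ (1 - 3 * q) <= 500 / 497).
      { replace (500 / 497) with (/ (497 / 500)) by field. apply Rinv_le_contravar; lra. }
      assert (0 < / (1 - q)) by (apply Rinv_0_lt_compat; lra).
      assert (0 < / (1 - 3 * q)) by (apply Rinv_0_lt_compat; lra).
      apply Rle_trans with (3 / 500 * (500 / 499) * (500 / 497)); [|lra].
      repeat apply Rmult_le_compat; try lra. apply Rmult_le_pos; lra. }
  eapply Rle_trans; [apply Cmod_triangle|]. rewrite Cmod_1, Cmod_mult, Cmod_RtoC_pos by lra. lra.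
Qed.

(** The true value is 1728 - e^(2 pi), about 1200. The crude estimate of the cube of [E4] over the
    discriminant at i is enough, since the result is added to the much larger bound used for 8 e^(4
    pi). *)
Lemma jpos_1_le c : j_fourier_coefficients c -> jpos c 1 <= 100000.
Proof.
  intros Hc. pose proof PI_bounds as HP. pose proof exp_2PI_ge as HE.
  assert (H3 : exp (2 * PI) <= 3 ^ 7) by (apply exp_INR_le; simpl; lra).
  set (q := exp (- (2 * PI))).
  assert (Hq : 0 < q <= / 500).
  { split; [apply exp_pos|]. unfold q. rewrite exp_Ropp. apply Rinv_le_contravar; lra. }
  assert (Hi : 0 < Im (imag 1)) by (simpl; lra).
  assert (Hn : nome (imag 1) = RtoC q) by (rewrite nome_imag; unfold q; do 3 f_equal; ring).
  pose proof (j_imag c Hc 1 ltac:(lra)) as E. rewrite j_E4_Disc in E by auto.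
  apply (f_equal Cmod) in E. unfold Disc in E. rewrite Hn in E.
  pose proof (E4_imag_le _ q Hi Hn Hq) as H4.
  pose proof (Pinf_diff q 0 ltac:(lra)) as Hp. cbn [Pn] in Hp. rewrite pow_1 in Hp.
  pose proof (Cmod_triangle_inv 1 (Pinf (RtoC q))) as H1. rewrite Cmod_1 in H1.
  assert (H2 : exp 2 <= 3 ^ 2) by (apply exp_INR_le; simpl; lra).
  assert (Hlow : 0.964 <= Cmod (Pinf (RtoC q))) by nra.
  assert (Hp24 : 0.41 <= Cmod (Pinf (RtoC q)) ^ 24).
  { apply Rle_trans with (0.964 ^ 24); [lra | apply pow_incr; lra]. }
  assert (HJ : 0 <= jpos c 1).
  { unfold jpos. apply Series_nonneg; [|apply ex_jpos; auto; lra]. intros n.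
    apply Rmult_le_pos; [now apply coef_IZR_nonneg | apply pow_le; left; apply exp_pos]. }
  pose proof (exp_pos (2 * PI * 1)).
  rewrite (Cmod_RtoC_pos (exp _ + _)) in E by lra.
  rewrite Cmod_div in E.
  2:{ apply Cmod_gt_0. rewrite Cmod_mult, Cmod_pow, Cmod_RtoC_pos by lra.
      apply Rmult_lt_0_compat; lra. }
  rewrite Cmod_mult, !Cmod_pow, (Cmod_RtoC_pos q) in E by lra.
  assert (Hqi : / q = exp (2 * PI)) by (unfold q; rewrite exp_Ropp; apply Rinv_inv).
  assert (Hb : Cmod (E4 (imag 1)) ^ 3 <= 2.46 ^ 3) by (apply pow_incr; split; [apply Cmod_ge_0 | auto]).
  assert (Hb0 : 0 <= Cmod (E4 (imag 1)) ^ 3) by apply pow_le, Cmod_ge_0.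
  set (p := Cmod (Pinf (RtoC q)) ^ 24) in *. set (e := Cmod (E4 (imag 1)) ^ 3) in *.
  assert (Hpi : / p <= / 0.41) by (apply Rinv_le_contravar; lra).
  assert (Hpi0 : 0 < / p) by (apply Rinv_0_lt_compat; lra).
  assert (e / (q * p) <= 2.46 ^ 3 * (3 ^ 7 * / 0.41)).
  { unfold Rdiv. rewrite Rinv_mult, Hqi. apply Rmult_le_compat; auto.
    - apply Rmult_le_pos; lra.
    - apply Rmult_le_compat; lra. }
  lra.
Qed.

(** * Large indices *)

Lemma Rpower_half_pow x m : 0 < x -> Rpower x (INR m / 2) = sqrt x ^ m.
Proof.
  intros H. replace (INR m / 2) with (/ 2 * INR m) by field.
  rewrite <- Rpower_mult, Rpower_sqrt by auto. apply Rpower_pow. now apply sqrt_lt_R0.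
Qed.

Lemma Rpower_3_2 x : 0 < x -> Rpower x (3 / 2) = sqrt x ^ 3.
Proof. intros H. rewrite <- Rpower_half_pow by auto. do 2 f_equal. simpl. ring. Qed.

Lemma Rpower_5_2 x : 0 < x -> Rpower x (5 / 2) = sqrt x ^ 5.
Proof. intros H. rewrite <- Rpower_half_pow by auto. do 2 f_equal. simpl. ring. Qed.

Lemma Rpower_3_4 x : 0 < x -> Rpower x (3 / 4) = sqrt x * sqrt (sqrt x).
Proof.
  intros H. assert (Hs : 0 < sqrt x) by now apply sqrt_lt_R0.
  replace (3 / 4) with (/ 2 * (3 / 2)) by field.
  rewrite <- Rpower_mult, Rpower_sqrt, Rpower_3_2 by auto.
  simpl. rewrite Rmult_1_r, sqrt_sqrt by lra. ring.
Qed.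

Definition amp (s : R) : R := exp (4 * PI * s) / (sqrt 2 * (s * sqrt s)).

Lemma amp_pos s : 0 < s -> 0 < amp s.
Proof.
  intros H. apply Rdiv_lt_0_compat; [apply exp_pos|].
  repeat apply Rmult_lt_0_compat; auto; apply sqrt_lt_R0; lra.
Qed.

Lemma d_asy n : (1 <= n)%nat -> d n = asy (4 * PI * sqrt (INR n)).
Proof.
  intros H. assert (Hn : 0 < INR n) by (apply lt_0_INR; lia).
  pose proof (sqrt_lt_R0 _ Hn) as Hs. pose proof PI_RGT_0.
  unfold d, asy. rewrite Rpower_3_2 by auto.
  assert (E : INR n = sqrt (INR n) * sqrt (INR n)) by (symmetry; apply sqrt_sqrt; lra).
  set (s := sqrt (INR n)) in *. rewrite E. field. split; lra.
Qed.

Lemma ab_of_close (n : nat) (x : R) : (1 <= n)%nat ->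
  Rabs (x - amp (sqrt (INR n)) * asy (4 * PI * sqrt (INR n)))
    <= amp (sqrt (INR n)) * (2.21073e-5 / sqrt (INR n) ^ 5) ->
  a n <= x <= b n.
Proof.
  intros H Hx. assert (Hn : 0 < INR n) by (apply lt_0_INR; lia).
  unfold a, b. rewrite (d_asy n H), (Rpower_3_4 _ Hn), (Rpower_5_2 _ Hn). fold (amp (sqrt (INR n))).
  apply Rabs_le_between in Hx. lra.
Qed.

Lemma bessel_amp s : 0 < s -> bessel (s ^ 2) = amp s * bessel_f (4 * PI * s).
Proof.
  intros H. pose proof PI_RGT_0.
  assert (E : bessel (s ^ 2) = 2 * PI / s * besselI1 (4 * PI * s)).
  { unfold bessel, besselI1. rewrite <- Series_scal_l. apply Series_ext. intros k.
    unfold bcoef. rewrite <- pow_mult.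
    replace (4 * PI * s / 2) with (2 * PI * s) by field.
    replace (2 * S k)%nat with (S (2 * k + 1)) by lia.
    rewrite (Rpow_mult_distr (2 * PI) s). rewrite (pow_add s (2 * k) 1), pow_1.
    rewrite <- (tech_pow_Rmult (2 * PI)).
    pose proof (INR_fact_pos k). pose proof (INR_fact_pos (S k)).
    generalize (s ^ (2 * k)) ((2 * PI) ^ (2 * k + 1)). intros u v. field. repeat split; lra. }
  rewrite E. unfold amp, bessel_f.
  replace (2 * PI * (4 * PI * s)) with ((2 * PI) ^ 2 * (2 * s)) by ring.
  rewrite sqrt_mult_alt by (apply pow_le; lra). rewrite sqrt_pow2 by lra.
  rewrite sqrt_mult_alt by lra. rewrite exp_Ropp.
  pose proof (exp_pos (4 * PI * s)). pose proof (sqrt_lt_R0 2 ltac:(lra)).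
  pose proof (sqrt_lt_R0 s H). field. repeat split; lra.
Qed.

(** Essentially the tangent at [n], with 2.7 for e. It compares an exponential with a linear
    function; taking seventh powers then handles s^7. *)
Lemma exp_tangent_pow x n : (1 <= n)%nat -> INR n - 1 <= x -> 2.7 ^ n * (1 + (x - INR n)) <= exp x.
Proof.
  intros Hn Hx. replace x with (INR n + (x - INR n)) at 2 by ring. rewrite exp_plus.
  assert (H1 : 2.7 <= exp 1).
  { pose proof (exp_taylor_ge 1 6 ltac:(lra)) as H. simpl in H. lra. }
  apply Rmult_le_compat; [apply pow_le; lra | lra | | apply exp_ineq1_le].
  replace (INR n) with (INR n * 1) by ring. rewrite <- exp_pow. apply pow_incr. lra.
Qed.

(** 3.87e12 is 2 times 1.29e7 times 1.5e5: the constant part of the coefficient error, the factor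
    needed to bring it under 1e-5, and 2 because it may use half of the room. Further, 64^7 exceeds
    3.87e12 and 7 times 0.8975 is below 2 pi. *)
Lemma circle_error_main s : 8 <= s -> 3.87e12 * s ^ 7 <= exp (2 * PI * s).
Proof.
  intros Hs. pose proof PI_bounds.
  apply Rle_trans with ((64 * s) ^ 7).
  - rewrite Rpow_mult_distr. apply Rmult_le_compat_r; [apply pow_le; lra | lra].
  - apply Rle_trans with (exp (0.8975 * s) ^ 7).
    + apply pow_incr. split; [lra|].
      eapply Rle_trans; [|apply (exp_tangent_pow _ 7); [lia | simpl; lra]]. simpl. lra.
    + rewrite exp_pow. apply exp_le. simpl. nra.
Qed.

(** The other half of the room: 3e5 is 2 times 1.5e5, and 6.1^7 exceeds it. The exponents leave 3/2
    pi s - 2 pi / s, and 0.6731 s - 0.1123 lies below one seventh of this for s >= 8. *)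
Lemma circle_error_secondary s : 8 <= s ->
  3e5 * s ^ 7 * exp (2 * PI * (s / 4 + / s)) <= exp (2 * PI * s).
Proof.
  intros Hs. pose proof PI_bounds.
  assert (Hi : / s <= / 8) by (apply Rinv_le_contravar; lra).
  assert (Hi0 : 0 < / s) by (apply Rinv_0_lt_compat; lra).
  apply Rle_trans with (exp (0.6731 * s - 0.1123) ^ 7 * exp (2 * PI * (s / 4 + / s))).
  - apply Rmult_le_compat_r; [left; apply exp_pos|].
    apply Rle_trans with ((6.1 * s) ^ 7).
    + rewrite Rpow_mult_distr. apply Rmult_le_compat_r; [apply pow_le; lra | lra].
    + apply pow_incr. split; [lra|].
      eapply Rle_trans; [|apply (exp_tangent_pow _ 5); [lia | simpl; lra]]. simpl. lra.
  - rewrite exp_pow, <- exp_plus. apply exp_le. simpl.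
    assert (PI * / s <= 3.1416 * / 8) by (apply Rmult_le_compat; lra). nra.
Qed.

(** The exponential is absorbed as one more 1/x^5, and x >= 12.5 s turns 3/x^5 into less than 1e-5 /
    s^5. *)
Lemma bessel_f_close s : 8 <= s ->
  Rabs (bessel_f (4 * PI * s) - asy (4 * PI * s)) <= 1e-5 / s ^ 5.
Proof.
  intros Hs. pose proof PI_bounds. set (x := 4 * PI * s).
  assert (Hx : 12.5 * s <= x) by (unfold x; nra).
  eapply Rle_trans; [apply bessel_asymptotic; lra|].
  assert (He : exp (4 - x) <= / x ^ 5).
  { replace (4 - x) with (- (5 * ((x - 4) / 5))) by field. rewrite exp_Ropp.
    apply Rinv_le_contravar; [apply pow_lt; lra|].
    replace 5 with (INR 5) at 1 by (simpl; ring). rewrite <- exp_pow. apply pow_incr.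
    split; [lra|]. eapply Rle_trans; [|apply (exp_taylor_ge _ 3); lra]. simpl. nra. }
  assert (Hp : (12.5 * s) ^ 5 <= x ^ 5) by (apply pow_incr; lra).
  rewrite Rpow_mult_distr in Hp.
  assert (H5 : 0 < s ^ 5) by (apply pow_lt; lra).
  assert (Hinv : / x ^ 5 <= / (12.5 ^ 5 * s ^ 5)).
  { apply Rinv_le_contravar; auto. apply Rmult_lt_0_compat; lra. }
  rewrite Rinv_mult in Hinv. assert (0 < / s ^ 5) by now apply Rinv_0_lt_compat.
  unfold Rdiv. lra.
Qed.

(** The tolerance is shared: 1e-5 for [c n] against the Bessel function, 1e-5 for the Bessel
    function against its expansion. The threshold 64, that is s >= 8, is where these constants
    already work. *)
Lemma lemma2p2_large c n : j_fourier_coefficients c -> (64 <= n)%nat -> a n <= IZR (c n) <= b n.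
Proof.
  intros Hc Hn. apply ab_of_close; [lia|]. pose proof PI_bounds as HP.
  assert (Hn64 : 64 <= INR n) by (replace 64 with (INR 64) by (simpl; ring); now apply le_INR).
  set (s := sqrt (INR n)).
  assert (Es : s ^ 2 = INR n) by (apply pow2_sqrt; lra).
  assert (Hs : 8 <= s).
  { replace 8 with (sqrt (8 ^ 2)) by (apply sqrt_pow2; lra). apply sqrt_le_1_alt. lra. }
  assert (Hi : / s <= / 8) by (apply Rinv_le_contravar; lra).
  assert (Hi0 : 0 < / s) by (apply Rinv_0_lt_compat; lra).
  pose proof (coef_bessel_bound c Hc (/ s) n ltac:(lra) ltac:(lia)) as HB.
  replace (/ (4 * / s)) with (s / 4) in HB by (field; lra).
  rewrite <- Es in HB. replace (2 * PI * / s * s ^ 2) with (2 * PI * s) in HB by (field; lra).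
  rewrite bessel_amp in HB by lra.
  pose proof (amp_pos s ltac:(lra)) as HA.
  assert (H5 : 0 < / s ^ 5) by (apply Rinv_0_lt_compat, pow_lt; lra).
  pose proof (bessel_f_close s Hs) as HF.
  assert (HC : Rabs (IZR (c n) - amp s * bessel_f (4 * PI * s)) <= amp s * (1e-5 / s ^ 5)).
  { eapply Rle_trans; [exact HB|]. clear HB HF.
    pose proof (jpos_1_le c Hc) as J.
    assert (G1 : exp (2 * PI * / s) <= 3 ^ 1) by (apply exp_INR_le; simpl; nra).
    assert (G2 : exp (4 * PI) <= 3 ^ 13) by (apply exp_INR_le; simpl; lra).
    assert (G3 : PI ^ 2 <= 10) by nra.
    pose proof (circle_error_main s Hs) as M1. pose proof (circle_error_secondary s Hs) as M2.
    pose proof (exp_pos (2 * PI * s)) as He.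
    set (w := exp (2 * PI * s)) in *. set (v := exp (2 * PI * (s / 4 + / s))) in *.
    assert (S7 : 0 < s ^ 7) by (apply pow_lt; lra).
    apply Rle_trans with ((1.29e7 + v) * w); [apply Rmult_le_compat_r; lra|].
    (* A deliberate loss of sqrt s, so that only integral powers of [s] remain to be compared with
       the exponential. *)
    assert (Hden : sqrt 2 * (s * sqrt s) <= 1.5 * s ^ 2).
    { assert (sqrt 2 <= 1.5) by (apply Rsqr_incr_0_var; [rewrite Rsqr_sqrt; unfold Rsqr|]; lra).
      assert (sqrt s <= s) by (apply Rsqr_incr_0_var; [rewrite Rsqr_sqrt; unfold Rsqr; nra|lra]).
      pose proof (sqrt_pos 2). pose proof (sqrt_pos s).
      apply Rmult_le_compat; auto; [nra|]. simpl. nra. }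
    assert (Hden0 : 0 < sqrt 2 * (s * sqrt s)).
    { repeat apply Rmult_lt_0_compat; try apply sqrt_lt_R0; lra. }
    assert (Ew : exp (4 * PI * s) = w * w) by (unfold w; rewrite <- exp_plus; f_equal; ring).
    apply Rle_trans with (w * w * / (1.5 * s ^ 2) * (1e-5 / s ^ 5)).
    (* What remains is (1.29e7 + v) 1.5e5 s^7 <= w, the half-sum of [M1] and [M2]. *)
    - replace (w * w * / (1.5 * s ^ 2) * (1e-5 / s ^ 5)) with (w / (1.5e5 * s ^ 7) * w) by (field; lra).
      apply Rmult_le_compat_r; [lra|]. apply Rle_div_r; [lra|]. nra.
    - unfold amp, Rdiv. rewrite Ew. apply Rmult_le_compat_r; [lra|].
      apply Rmult_le_compat_l; [nra|]. now apply Rinv_le_contravar. }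
  replace (IZR (c n) - amp s * asy (4 * PI * s)) with
    ((IZR (c n) - amp s * bessel_f (4 * PI * s))
     + amp s * (bessel_f (4 * PI * s) - asy (4 * PI * s))) by ring.
  eapply Rle_trans; [apply Rabs_triang|]. rewrite Rabs_mult, (Rabs_pos_eq (amp s)) by lra.
  apply (Rmult_le_compat_l (amp s)) in HF; [|lra]. unfold Rdiv in *.
  assert (0 < amp s * / s ^ 5) by now apply Rmult_lt_0_compat. lra.
Qed.

(** * Small indices *)

(** The Taylor tail of e^y from order [k] on, divided by y^k / k!. These satisfy the Horner
    recursion tail k = 1 + y/(k+1) tail (k+1) exactly, so an enclosure of one late tail yields an
    enclosure of e^y. *)
Definition exp_tail (y : R) (k : nat) : R :=
  Series (fun i => y ^ i * (INR (fact k) / INR (fact (k + i)))).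

Lemma fact_ratio_le k i : 0 < INR (fact k) / INR (fact (k + i)) <= 1.
Proof.
  pose proof (INR_fact_pos k). pose proof (INR_fact_pos (k + i)).
  split; [now apply Rdiv_lt_0_compat|]. apply Rle_div_l; auto. rewrite Rmult_1_l.
  apply le_INR, fact_le. lia.
Qed.

Lemma ex_exp_tail y k : 0 <= y <= / 2 ->
  ex_series (fun i => y ^ i * (INR (fact k) / INR (fact (k + i)))).
Proof.
  intros H. apply (ex_series_pos_le _ (fun i => y ^ i)).
  - intros i. pose proof (fact_ratio_le k i). assert (0 <= y ^ i) by (apply pow_le; lra).
    split; [apply Rmult_le_pos|]; nra.
  - apply ex_series_geom. rewrite Rabs_pos_eq; lra.
Qed.

Lemma exp_tail_0 y : exp_tail y 0 = exp y.
Proof.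
  rewrite <- Series_exp. apply Series_ext. intros i. simpl. unfold Rdiv. now rewrite Rmult_1_l.
Qed.

Lemma exp_tail_step y k : 0 <= y <= / 2 ->
  exp_tail y k = 1 + y * / INR (S k) * exp_tail y (S k).
Proof.
  intros H. unfold exp_tail at 1. rewrite Series_incr_1 by now apply ex_exp_tail.
  rewrite Nat.add_0_r, pow_O. rewrite Rdiv_diag by apply Rgt_not_eq, INR_fact_pos.
  rewrite Rmult_1_l. f_equal. unfold exp_tail. rewrite <- Series_scal_l. apply Series_ext.
  intros i. replace (k + S i)%nat with (S k + i)%nat by lia. simpl pow.
  rewrite (fact_simpl k), mult_INR.
  pose proof (INR_S_ge_1 k). pose proof (INR_fact_pos (S k + i)). field. split; lra.
Qed.

Lemma exp_tail_bounds y k : 0 <= y <= / 2 -> 1 <= exp_tail y k <= 2.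
Proof.
  intros H. pose proof (ex_exp_tail y k H) as Ex.
  assert (Hp : forall i, 0 <= y ^ i * (INR (fact k) / INR (fact (k + i))) <= y ^ i).
  { intros i. pose proof (fact_ratio_le k i). assert (0 <= y ^ i) by (apply pow_le; lra).
    split; [apply Rmult_le_pos|]; nra. }
  split.
  - rewrite exp_tail_step by auto. assert (0 <= exp_tail y (S k)).
    { apply Series_nonneg; [|now apply ex_exp_tail]. intros i. pose proof (fact_ratio_le (S k) i).
      apply Rmult_le_pos; [apply pow_le|]; lra. }
    assert (0 <= y * / INR (S k)).
    { apply Rmult_le_pos; [lra|]. left. apply Rinv_0_lt_compat. pose proof (INR_S_ge_1 k). lra. }
    assert (0 <= y * / INR (S k) * exp_tail y (S k)) by now apply Rmult_le_pos. lra.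
  - apply Rle_trans with (Series (fun i => y ^ i)).
    + apply Series_le; auto. apply ex_series_geom. rewrite Rabs_pos_eq; lra.
    + rewrite Series_geom by (rewrite Rabs_pos_eq; lra).
      replace 2 with (/ / 2) by field. apply Rinv_le_contravar; lra.
Qed.

Definition scale : Z := (10 ^ 20)%Z.

(** Fixed-point enclosure with 20 decimals. Lower ends are kept nonnegative, so products, inverses
    and roots are monotone in each end and no case distinction on signs arises. *)
Definition encl (i : Z * Z) (x : R) : Prop :=
  0 <= IZR (fst i) <= x * IZR scale /\ x * IZR scale <= IZR (snd i).

Definition iconst (m : Z) : Z * Z := (m * scale, m * scale)%Z.
Definition iadd (i j : Z * Z) : Z * Z := (fst i + fst j, snd i + snd j)%Z.
Definition imul (i j : Z * Z) : Z * Z := (fst i * fst j / scale, snd i * snd j / scale + 1)%Z.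
Definition iinv (i : Z * Z) : Z * Z := (scale * scale / snd i, scale * scale / fst i + 1)%Z.
Definition isqrt (i : Z * Z) : Z * Z := (Z.sqrt (fst i * scale), Z.sqrt (snd i * scale) + 1)%Z.

Lemma IZR_scale_pos : 0 < IZR scale.
Proof. now apply (IZR_lt 0). Qed.

Lemma Zdiv_bounds m n : (0 < n)%Z -> IZR (m / n) <= IZR m / IZR n <= IZR (m / n + 1).
Proof.
  intros H. assert (Hn : 0 < IZR n) by now apply (IZR_lt 0).
  pose proof (Z.div_mod m n ltac:(lia)) as E. pose proof (Z.mod_pos_bound m n H) as B.
  split.
  - apply Rle_div_r; auto. rewrite <- mult_IZR. apply IZR_le. lia.
  - apply Rle_div_l; auto. rewrite <- mult_IZR. apply IZR_le. lia.
Qed.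

Lemma encl_nonneg i x : encl i x -> 0 <= x.
Proof. unfold encl. pose proof IZR_scale_pos. intros [[? ?] ?]. nra. Qed.

Lemma encl_const m : (0 <= m)%Z -> encl (iconst m) (IZR m).
Proof.
  intros H. unfold encl, iconst; cbn [fst snd]. rewrite mult_IZR. pose proof IZR_scale_pos.
  apply (IZR_le 0) in H. repeat split; try lra. apply Rmult_le_pos; lra.
Qed.

Lemma encl_pos m : encl (iconst (Zpos m)) (IZR (Zpos m)).
Proof. now apply encl_const. Qed.

Lemma encl_add i j x y : encl i x -> encl j y -> encl (iadd i j) (x + y).
Proof. unfold encl, iadd; cbn [fst snd]. rewrite !plus_IZR. lra. Qed.

Lemma encl_mul i j x y : encl i x -> encl j y -> encl (imul i j) (x * y).
Proof.
  unfold encl, imul; cbn [fst snd]. intros [[A1 A2] A3] [[B1 B2] B3].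
  pose proof IZR_scale_pos as HD.
  pose proof (Zdiv_bounds (fst i * fst j) scale eq_refl) as [L _].
  pose proof (Zdiv_bounds (snd i * snd j) scale eq_refl) as [_ U].
  rewrite mult_IZR in L, U. set (D := IZR scale) in *.
  replace (x * y * D) with (x * D * (y * D) / D) by (field; lra).
  assert (Hinv : 0 < / D) by now apply Rinv_0_lt_compat.
  repeat split.
  - apply (IZR_le 0), Z.div_pos; [|reflexivity].
    apply le_IZR in A1, B1. now apply Z.mul_nonneg_nonneg.
  - eapply Rle_trans; [exact L|]. apply Rmult_le_compat_r; [lra|]. now apply Rmult_le_compat.
  - eapply Rle_trans; [|exact U]. apply Rmult_le_compat_r; [lra|]. apply Rmult_le_compat; lra.
Qed.

Lemma encl_inv i x : (0 < fst i)%Z -> encl i x -> encl (iinv i) (/ x).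
Proof.
  unfold encl, iinv; cbn [fst snd]. intros H [[A1 A2] A3].
  pose proof IZR_scale_pos as HD. pose proof (IZR_lt 0 _ H) as Hl.
  assert (Hs : (0 < snd i)%Z) by (apply lt_IZR; lra).
  assert (Hx : 0 < x) by nra.
  pose proof (Zdiv_bounds (scale * scale) (snd i) Hs) as [L _].
  pose proof (Zdiv_bounds (scale * scale) (fst i) H) as [_ U].
  rewrite mult_IZR in L, U. set (D := IZR scale) in *.
  replace (/ x * D) with (D * D * / (x * D)) by (field; lra).
  assert (HDD : 0 < D * D) by now apply Rmult_lt_0_compat.
  repeat split.
  - apply (IZR_le 0), Z.div_pos; auto. discriminate.
  - eapply Rle_trans; [exact L|]. apply Rmult_le_compat_l; [lra|]. apply Rinv_le_contravar; nra.
  - eapply Rle_trans; [|exact U]. apply Rmult_le_compat_l; [lra|]. apply Rinv_le_contravar; lra.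
Qed.

Lemma encl_sqrt i x : encl i x -> encl (isqrt i) (sqrt x).
Proof.
  intros H. pose proof (encl_nonneg _ _ H) as Hx. revert H.
  unfold encl, isqrt; cbn [fst snd]. intros [[A1 A2] A3].
  pose proof IZR_scale_pos as HD.
  assert (E : sqrt x * IZR scale = sqrt (x * IZR scale * IZR scale)).
  { rewrite Rmult_assoc, sqrt_mult_alt by auto. now rewrite sqrt_square by lra. }
  rewrite E. apply le_IZR in A1 as Z1.
  assert (Z2 : (0 <= snd i)%Z) by (apply le_IZR; nra).
  pose proof (Z.sqrt_spec (fst i * scale) ltac:(unfold scale; lia)) as [S1 _].
  pose proof (Z.sqrt_spec (snd i * scale) ltac:(unfold scale; lia)) as [_ S2].
  pose proof (Z.sqrt_nonneg (fst i * scale)) as N1. pose proof (Z.sqrt_nonneg (snd i * scale)) as N2.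
  apply IZR_le in S1, N1, N2. apply IZR_lt in S2.
  rewrite !mult_IZR in S1, S2. rewrite succ_IZR in S2. rewrite plus_IZR.
  set (a1 := IZR (Z.sqrt (fst i * scale))) in *. set (a2 := IZR (Z.sqrt (snd i * scale))) in *.
  repeat split; auto.
  - apply sqrt_le_1_alt in S1. rewrite sqrt_square in S1 by auto.
    eapply Rle_trans; [exact S1|]. apply sqrt_le_1_alt. nra.
  - rewrite <- (sqrt_square (a2 + 1)) by lra. apply sqrt_le_1_alt. nra.
Qed.

(* Every tail [exp_tail y k] lies in [1, 2], which starts the Horner scheme. *)
Fixpoint ihorner (y : Z * Z) (k m : nat) : Z * Z :=
  match m with
  | O => (scale, 2 * scale)%Z
  | S m => iadd (iconst 1) (imul (imul y (iinv (iconst (Z.of_nat (S k))))) (ihorner y (S k) m))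
  end.

Fixpoint isquare (i : Z * Z) (m : nat) : Z * Z :=
  match m with O => i | S m => isquare (imul i i) m end.

(** Eight halvings bring every x <= 128 into [0, 1/2], and eight squarings undo them. With 18 Horner
    steps the truncation is of size y^18 / 18!, below the resolution. *)
Definition ihalf8 (i : Z * Z) : Z * Z := (fst i / 256, snd i / 256 + 1)%Z.

Definition iexp (i : Z * Z) : Z * Z := isquare (ihorner (ihalf8 i) 0 18) 8.

Lemma encl_horner i y m : 0 <= y <= / 2 -> encl i y -> forall k, encl (ihorner i k m) (exp_tail y k).
Proof.
  intros Hy Hi. induction m; intros k.
  - pose proof (exp_tail_bounds y k Hy). pose proof IZR_scale_pos.
    unfold encl; cbn [ihorner fst snd]. rewrite mult_IZR. nra.
  - cbn [ihorner]. rewrite exp_tail_step by auto. apply encl_add; [now apply encl_const|].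
    apply encl_mul; [|apply IHm]. apply encl_mul; auto.
    rewrite INR_IZR_INZ. apply encl_inv; [|apply encl_const; lia].
    unfold iconst; cbn [fst]. unfold scale. lia.
Qed.

Lemma encl_square m : forall i x, encl i x -> encl (isquare i m) (x ^ (2 ^ m)).
Proof.
  induction m; intros i x H.
  - simpl. now rewrite Rmult_1_r.
  - cbn [isquare]. replace (2 ^ S m)%nat with (2 * 2 ^ m)%nat by reflexivity.
    rewrite pow_mult. apply IHm. simpl. rewrite Rmult_1_r. now apply encl_mul.
Qed.

Lemma encl_exp i x : (snd i <= 128 * scale - 256)%Z -> encl i x -> encl (iexp i) (exp x).
Proof.
  intros Hs H. pose proof (encl_nonneg _ _ H) as Hx. pose proof IZR_scale_pos as HD.
  assert (H8 : encl (ihalf8 i) (x / 256)).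
  { revert H. unfold encl, ihalf8; cbn [fst snd]. intros [[A1 A2] A3].
    pose proof (Zdiv_bounds (fst i) 256 eq_refl) as [L _].
    pose proof (Zdiv_bounds (snd i) 256 eq_refl) as [_ U].
    repeat split; try lra. apply (IZR_le 0), Z.div_pos; [now apply le_IZR | reflexivity]. }
  assert (Hy : 0 <= x / 256 <= / 2).
  { split; [lra|]. destruct H as [_ H]. apply IZR_le in Hs. rewrite minus_IZR, mult_IZR in Hs.
    assert (x * IZR scale <= 128 * IZR scale) by lra.
    assert (x <= 128) by (eapply Rmult_le_reg_r; [exact HD | lra]). lra. }
  replace (exp x) with (exp (x / 256) ^ (2 ^ 8)).
  - apply encl_square. rewrite <- exp_tail_0. now apply encl_horner.
  - rewrite exp_pow. f_equal. replace (INR (2 ^ 8)) with 256; [field|].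
    rewrite INR_IZR_INZ. reflexivity.
Qed.

Definition iPI : Z * Z := (314159265358970000000, 314159265358980000000)%Z.

Lemma encl_PI : encl iPI PI.
Proof.
  pose proof PI_bounds. unfold encl, iPI, scale; cbn [fst snd]. change (10 ^ 20)%Z with 100000000000000000000%Z. lra.
Qed.

Definition ifrac (p q : Z) : Z * Z := imul (iconst p) (iinv (iconst q)).

Lemma encl_frac p q : encl (ifrac (Zpos p) (Zpos q)) (IZR (Zpos p) / IZR (Zpos q)).
Proof. apply encl_mul; [apply encl_pos | now apply encl_inv, encl_pos]. Qed.

(** With p = 1 - [asy] x, e = e^x and t = sqrt 2 n^(3/4), the two inequalities become c t + e p <= e
    + tol and e <= c t + e p + tol. Subtractions are moved across so that only nonnegative
    quantities are enclosed, and there is no division by t. *)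
Definition check (n c : Z) : bool :=
  let s := isqrt (iconst n) in
  let x := imul (imul (iconst 4) iPI) s in
  let w := iinv x in
  let e := iexp x in
  let p := imul w (iadd (ifrac 3 8) (imul w (iadd (ifrac 15 128)
             (imul w (iadd (ifrac 105 1024) (imul w (ifrac 4725 32768))))))) in
  let v := iinv s in
  let v5 := imul v (imul v (imul v (imul v v))) in
  let t := imul (isqrt (iconst 2)) (imul s (isqrt s)) in
  let lhs := iadd (imul (iconst c) t) (imul e p) in
  let tol := imul e (imul (ifrac 221073 10000000000) v5) in
  ((0 <=? c) && (0 <? n) && (0 <? fst s) && (0 <? fst x) && (snd x <=? 128 * scale - 256)
   && (snd lhs <=? fst e + fst tol) && (snd e <=? fst lhs + fst tol))%Z%bool.

Lemma check_correct n c : check (Z.of_nat n) c = true -> a n <= IZR c <= b n.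
Proof.
  unfold check. cbv zeta. rewrite !Bool.andb_true_iff, !Z.leb_le, !Z.ltb_lt.
  intros [[[[[[Hc Hn] Hs0] Hx0] Hx1] HU] HL].
  apply ab_of_close; [lia|].
  assert (Es : encl (isqrt (iconst (Z.of_nat n))) (sqrt (INR n))).
  { apply encl_sqrt. rewrite INR_IZR_INZ. apply encl_const, Zle_0_nat. }
  set (s := sqrt (INR n)) in *.
  set (si := isqrt (iconst (Z.of_nat n))) in *.
  assert (Ex : encl (imul (imul (iconst 4) iPI) si) (4 * PI * s)).
  { apply encl_mul; auto. apply encl_mul; [apply encl_pos | apply encl_PI]. }
  set (x := 4 * PI * s) in *. set (xi := imul (imul (iconst 4) iPI) si) in *.
  pose proof (encl_exp _ _ Hx1 Ex) as Ee.
  pose proof (encl_inv _ _ Hx0 Ex) as Ew. pose proof (encl_inv _ _ Hs0 Es) as Ev.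
  pose proof IZR_scale_pos as HD.
  assert (Hs : 0 < s) by (apply sqrt_lt_R0, lt_0_INR; lia).
  assert (Hx : 0 < x) by (apply Rmult_lt_0_compat; [pose proof PI_RGT_0; lra | exact Hs]).
  set (lhsi := iadd _ _) in HU, HL. set (toli := imul (iexp xi) (imul _ _)) in HU, HL.
  set (p := / x * (3 / 8 + / x * (15 / 128 + / x * (105 / 1024 + / x * (4725 / 32768))))).
  assert (Ep : 1 - p = asy x) by (unfold p, asy; field; lra).
  assert (El : encl lhsi (IZR c * (sqrt 2 * (s * sqrt s)) + exp x * p)).
  { apply encl_add; apply encl_mul; auto.
    - apply encl_const, Hc.
    - apply encl_mul; [apply encl_sqrt, encl_pos|].
      apply encl_mul; [|apply encl_sqrt]; exact Es.
    - unfold p. do 3 (apply encl_mul; [exact Ew|]; apply encl_add; [apply encl_frac|]).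
      apply encl_mul; [exact Ew | apply encl_frac]. }
  assert (Et : encl toli (exp x * (221073 / 10000000000 * (/ s * (/ s * (/ s * (/ s * / s))))))).
  { apply encl_mul; [exact Ee|]. apply encl_mul; [apply encl_frac|]. do 4 (apply encl_mul; [exact Ev|]). exact Ev. }
  apply IZR_le in HU, HL. rewrite plus_IZR in HU, HL.
  destruct Ee as [[_ E1] E2], El as [[_ L1] L2], Et as [[_ T1] _].
  assert (Hamp : amp s * (sqrt 2 * (s * sqrt s)) = exp x).
  { unfold amp. fold x. field. pose proof (sqrt_lt_R0 2 ltac:(lra)). pose proof (sqrt_lt_R0 s Hs).
    repeat split; lra. }
  set (t := sqrt 2 * (s * sqrt s)) in *. set (D := IZR scale) in *.
  set (tol := 221073 / 10000000000 * (/ s * (/ s * (/ s * (/ s * / s))))) in *.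
  assert (Etol : 2.21073e-5 / s ^ 5 = tol).
  { replace 2.21073e-5 with (221073 / 10000000000) by lra. unfold tol. field. lra. }
  rewrite Etol, <- Ep.
  assert (B1 : IZR c * t + exp x * p <= exp x + exp x * tol)
    by (apply (Rmult_le_reg_r D); lra).
  assert (B2 : exp x <= IZR c * t + exp x * p + exp x * tol)
    by (apply (Rmult_le_reg_r D); lra).
  assert (Ht : 0 < t).
  { unfold t. repeat apply Rmult_lt_0_compat; auto; apply sqrt_lt_R0; lra. }
  rewrite <- Hamp in B1, B2. apply Rabs_le. split; apply (Rmult_le_reg_r t); lra.
Qed.

(** The range is 6 to 63. Because of the index shift, [c 63] is entry 64 of the list, which 66
    entries cover. *)
Lemma check_small :
  let l := j_list 66 in forallb (fun n => check (Z.of_nat n) (nthZ l (S n))) (seq 6 58) = true.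
Proof. vm_compute. reflexivity. Qed.

Theorem lemma2p2 :
  forall c : nat -> Z, j_fourier_coefficients c ->
  forall n : nat, (6 <= n)%nat ->
    a n <= IZR (c n) <= b n.
Proof.
  intros c Hc n Hn. destruct (Nat.le_gt_cases 64 n) as [H|H].
  - now apply lemma2p2_large.
  - apply check_correct. rewrite (j_list_correct c 66 n Hc) by lia.
    pose proof check_small as HS. cbv zeta in HS. rewrite forallb_forall in HS.
    apply (HS n), in_seq. lia.
Qed.
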